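(* For any given $n\ge1$, $s\in[\frac12,1)$, and constants $0<\lambda\le\Lambda$, $\theta\in(0,\pi/2)$, $\omega>0$, $t_\circ>0$, $\gamma_\circ\in(0,2s)$ and $C_\circ>0$, there exist positive constants $R$, $\varepsilon$, $\alpha\in(0,1)$ and $C$ such that the following holds. Let $\mathcal L$ be an operator of the form described in the context, put $Q_1:=B_1\times(-t_\circ,0)$, and let $A\subset\mathbb R^n\times[-2t_\circ,0]$ be a closed set such that $A^c$ satisfies the interior cone condition in $Q_1$ with opening $\theta$ and speed $\omega$. Let $v_i$, $i=1,2$, be two viscosity solutions of $$\big|(\partial_t-\mathcal L)v_i\big|\le\varepsilon\ \text{ in }A^c\cap(B_R\times(-2t_\circ,0)),\qquad v_i\equiv0\ \text{ in }A\cap(B_R\times(-2t_\circ,0)),$$ satisfying $$v_i\ge-\varepsilon\ \text{ in }B_R\times(-2t_\circ,0),\qquad |v_i(x,t)|\le C_\circ(1+|x|)^{2s-\gamma_\circ}\ \text{ in }\mathbb R^n\times(-2t_\circ,0),\qquad v_i(e_n,0)=1.$$ Then $$v_i>0\ \text{ in }A^c\cap Q_1,\qquad \Big[\frac{v_1}{v_2}\Big]_{C^\alpha(A^c\cap Q_1)}+\Big[\frac{v_2}{v_1}\Big]_{C^\alpha(A^c\cap Q_1)}\le C .$$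
   Context: Operators: $\mathcal L u(x)=\mathrm{p.v.}\int_{\mathbb R^n}(u(x+y)-u(x))K(y)\,dy$ (in the $x$ variable) with $K(y)=K(-y)$ and $\lambda|y|^{-n-2s}\le K(y)\le\Lambda|y|^{-n-2s}$. Interior cone condition: a set $\Omega\subset\mathbb R^n\times\mathbb R$ satisfies the interior cone condition at $(0,0)$ with opening $\theta\in(0,\pi/2)$ and speed $\omega>0$ if for some direction $e\in\mathbb S^{n-1}$ the traveling cone $\Sigma_t=\{x: x\cdot e>\cos\theta\,|x|\}-\omega t e$ satisfies $(\Sigma_t\cap B_1)\times\{t\}\subset\Omega$ for all $t<0$ (i.e. for all $t\in(-1/\omega,0)$). $\Omega$ satisfies the interior cone condition with opening $\theta$ and speed $\omega$ in $Q\subset\mathbb R^n\times\mathbb R$ if for all $(x_\circ,t_\circ)\in\Omega\cap Q$ the translate $\Omega-(x_\circ,t_\circ)$ satisfies the previous condition. $e_n$ is the $n$-th coordinate vector, $A^c$ is the complement of $A$, and $[\cdot]_{C^\alpha}$ is the Hölder seminorm. *)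

(* Defs.v *)
From HB Require Import structures.
From mathcomp Require Import all_boot all_order all_algebra.
From mathcomp Require Import all_classical all_reals all_analysis.

Set Implicit Arguments.
Unset Strict Implicit.
Unset Printing Implicit Defensive.

Import Order.TTheory GRing.Theory Num.Theory.
Import numFieldNormedType.Exports.

Local Open Scope classical_set_scope.
Local Open Scope ring_scope.

(* Borel sigma-algebra of 'rV[R]_n, generated by the coordinates. *)
Section rV_measurable.
Context (R : realType) (n : nat).

Let coord (i : 'I_n) (x : 'rV[R]_n) : measurableTypeR R := x ord0 i.

Definition rV_measurable_sets : set (set 'rV[R]_n) := g_sigma_preimage coord.

Let rV_set0 : rV_measurable_sets set0.
Proof. exact: sigma_algebra0. Qed.

Let rV_setC A : rV_measurable_sets A -> rV_measurable_sets (~` A).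
Proof. exact: sigma_algebraC. Qed.

Let rV_bigcup (F : (set 'rV[R]_n)^nat) :
  (forall i, rV_measurable_sets (F i)) -> rV_measurable_sets (\bigcup_i F i).
Proof. exact: sigma_algebra_bigcup. Qed.

HB.instance Definition _ := @isMeasurable.Build
  (measure_tuple_display default_measure_display) 'rV[R]_n
  rV_measurable_sets rV_set0 rV_setC rV_bigcup.

Lemma measurable_rV_coord (i : 'I_n) :
  measurable_fun [set: 'rV[R]_n] (fun x : 'rV[R]_n => x ord0 i).
Proof.
move=> _ Y mY; rewrite setTI; apply: sub_sigma_algebra => /=.
rewrite -bigcup_seq/=; exists i => /=; first by rewrite mem_index_enum.
by exists Y => //; rewrite setTI.
Qed.

Lemma measurable_fun_rV d (T : measurableType d) (f : T -> 'rV[R]_n) :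
  (forall i, measurable_fun [set: T] (fun x => f x ord0 i)) ->
  measurable_fun [set: T] f.
Proof.
move=> mf.
have mfs : g_sigma_preimage (fun i => coord i \o f) `<=` measurable.
  apply: smallest_sub; first exact: sigma_algebra_measurable.
  rewrite -bigcup_seq; apply: bigcup_sub => i _.
  by move=> A [B mB <-]; exact: mf.
by move: mfs; rewrite g_sigma_preimage_comp => h _ A mA; apply: h; exists A.
Qed.

End rV_measurable.

Section lebesgue_measure_rV.
Local Open Scope ereal_scope.
Context (R : realType).

Definition rV_cons (n : nat) (p : measurableTypeR R * 'rV[R]_n) : 'rV[R]_n.+1 :=
  \row_(i < n.+1) (if unlift ord0 i is Some j then p.2 ord0 j else p.1).

Lemma measurable_rV_cons (n : nat) :
  measurable_fun [set: measurableTypeR R * 'rV[R]_n] (@rV_cons n).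
Proof.
apply: measurable_fun_rV => i; case: (unliftP ord0 i) => [j|] ->.
  rewrite (_ : (fun _ => _) = (fun x : 'rV[R]_n => x ord0 j) \o snd).
    exact: measurableT_comp (measurable_rV_coord j) measurable_snd.
  by apply/funext => p; rewrite mxE liftK.
rewrite (_ : (fun _ => _) = fst); first exact: measurable_fst.
by apply/funext => p; rewrite mxE unlift_none.
Qed.

Section step.
Context (n : nat) (m : {sigma_finite_measure set 'rV[R]_n -> \bar R}).

Let mu : {measure set _ -> \bar R} :=
  (@lebesgue_measure R \x m)%E.

Definition leb_step : set 'rV[R]_n.+1 -> \bar R := pushforward mu (@rV_cons n).

HB.instance Definition _ := Measure.copy leb_step
  (measure_function_pushforward__canonical__measure_function_Measure mu
    (@measurable_rV_cons n)).

Let leb_step_sigma_finite : sigma_finite setT leb_step.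
Proof.
have /sigma_finiteP[F [TF ndF Foo]] := sigma_finiteT (@lebesgue_measure R).
have /sigma_finiteP[G [TG ndG Goo]] := sigma_finiteT m.
pose g (x : 'rV[R]_n.+1) : measurableTypeR R * 'rV[R]_n :=
  (x ord0 ord0, \row_j x ord0 (lift ord0 j)).
have mg : measurable_fun setT g.
  apply/measurable_fun_pairP; split; first exact: measurable_rV_coord.
  apply: measurable_fun_rV => j.
  rewrite (_ : (fun _ => _) = fun x : 'rV[R]_n.+1 => x ord0 (lift ord0 j)).
    exact: measurable_rV_coord.
  by apply/funext => x; rewrite !mxE.
have gK : cancel (@rV_cons n) g.
  case=> a y; rewrite /g /rV_cons mxE unlift_none; congr pair.
  by apply/rowP => j; rewrite !mxE liftK.
exists (fun k => g @^-1` (F k `*` G k)).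
  apply/seteqP; split => // x _.
  have [i _ Fi] : (\bigcup_i F i) (g x).1 by rewrite -TF.
  have [j _ Gj] : (\bigcup_i G i) (g x).2 by rewrite -TG.
  exists (maxn i j) => //; split.
    by move: Fi; exact/subsetPset/ndF/leq_maxl.
  by move: Gj; exact/subsetPset/ndG/leq_maxr.
move=> k; have [mFk Fk] := Foo k; have [mGk Gk] := Goo k; split.
  by rewrite -[X in measurable X]setTI; apply: mg => //; exact: measurableX.
rewrite /leb_step /pushforward -comp_preimage.
rewrite (_ : g \o _ = id) ?preimage_id; last by apply/funext => p; exact: gK.
by rewrite [ltLHS]product_measure1E// lte_mul_pinfty// ge0_fin_numE.
Qed.

HB.instance Definition _ := Measure_isSigmaFinite.Build _ _ _ leb_step
  leb_step_sigma_finite.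

End step.

Fixpoint lebesgue_rV (n : nat) : {sigma_finite_measure set 'rV[R]_n -> \bar R} :=
  match n with
  | 0 => \d_ (0%R : 'rV[R]_0)
  | k.+1 => leb_step (lebesgue_rV k)
  end.

End lebesgue_measure_rV.

(* The library norm on 'rV[R]_n is the sup norm; Euclidean quantities are
   therefore spelled out. *)
Section euclidean.
Context (R : realType) (n : nat).
Implicit Types (x y : 'rV[R]_n) (z w : 'rV[R]_n * R).

Definition dotv x y : R := \sum_(i < n) x ord0 i * y ord0 i.

Definition enorm x : R := Num.sqrt (dotv x x).

Definition eball (r : R) : set 'rV[R]_n := [set x | enorm x < r].

Definition st_dist z w : R :=
  Num.sqrt (enorm (z.1 - w.1) ^+ 2 + (z.2 - w.2) ^+ 2).

Definition holder_seminorm (a : R) (D : set ('rV[R]_n * R))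
    (f : 'rV[R]_n * R -> R) : \bar R :=
  maxe 0%E (ereal_sup [set q | exists z w,
    [/\ D z, D w, z != w & q = (`|f z - f w| / st_dist z w `^ a)%:E]]).

(* Lebesgue measurable = a.e. equal to a Borel function. *)
Definition lebesgue_measurable (f : 'rV[R]_n -> R) : Prop :=
  exists2 g : 'rV[R]_n -> R, measurable_fun [set: 'rV[R]_n] g &
    {ae lebesgue_rV R n, forall x, f x = g x}.

End euclidean.

Definition last_vec (R : realType) (n : nat) : 'rV[R]_n :=
  \row_(i < n) (i.+1 == n)%:R.

Section operator.
Context (R : realType) (n : nat).
Implicit Types (K u : 'rV[R]_n -> R).

Definition kernel_class (s lam Lam : R) K : Prop :=
  [/\ lebesgue_measurable K,
      forall y, K y = K (- y) &
      forall y, y != 0 ->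
        lam * enorm y `^ (- n%:R - 2 * s) <= K y /\
        K y <= Lam * enorm y `^ (- n%:R - 2 * s)].

Definition nonlocal_op K u (x : 'rV[R]_n) : R :=
  lim ((fun e : R => \int[lebesgue_rV R n]_(y in [set y | e < enorm y])
          ((u (x + y) - u x) * K y)) @ 0^'+).

End operator.

Section cone.
Context (R : realType) (n : nat).

Definition traveling_cone (theta omega : R) (e : 'rV[R]_n) (t : R) :
    set 'rV[R]_n :=
  [set x - (omega * t) *: e | x in [set x | cos theta * enorm x < dotv x e]].

Definition interior_cone_at0 (theta omega : R) (Om : set ('rV[R]_n * R)) : Prop :=
  exists2 e : 'rV[R]_n, enorm e = 1 &
    forall t, t < 0 ->
      (traveling_cone theta omega e t `&` eball 1) `*` [set t] `<=` Om.

Definition interior_cone (theta omega : R) (Om Q : set ('rV[R]_n * R)) : Prop :=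
  forall z, (Om `&` Q) z ->
    interior_cone_at0 theta omega [set w | Om (w + z)].

End cone.

Section viscosity.
Context (R : realType) (n : nat).
Implicit Types (phi v : 'rV[R]_n * R -> R) (z : 'rV[R]_n * R).

Definition Dt phi z : R := derive1 (fun tau : R => phi (z.1, tau)) z.2.

Definition Dx (h : 'rV[R]_n) phi z : R := 'D_h (fun y => phi (y, z.2)) z.1.

(* C^2 in space, C^1 in time. *)
Definition C21 phi : Prop :=
  [/\ continuous phi,
      (forall z, derivable (fun tau : R => phi (z.1, tau)) z.2 1) /\
        continuous (Dt phi),
      (forall h, (forall z, derivable (fun y => phi (y, z.2)) z.1 h) /\
        continuous (Dx h phi)) &
      (forall h k, (forall z, derivable (fun y => Dx h phi (y, z.2)) z.1 k) /\
        continuous (Dx k (Dx h phi)))].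

Definition cylinder (r : R) z : set ('rV[R]_n * R) :=
  [set w | enorm (w.1 - z.1) < r /\ `|w.2 - z.2| < r].

(* Time slice at the contact time, with v replaced by the test function near
   the contact point; L is evaluated on this function. *)
Definition glue (r : R) z phi v (x : 'rV[R]_n) : R :=
  if enorm (x - z.1) < r then phi (x, z.2) else v (x, z.2).

(* d_t v - L v <= c in Om *)
Definition visc_le (K : 'rV[R]_n -> R) (c : R) (Om : set ('rV[R]_n * R)) v : Prop :=
  forall z r phi, 0 < r -> cylinder r z `<=` Om -> C21 phi ->
    phi z = v z -> (forall w, cylinder r z w -> v w <= phi w) ->
    Dt phi z - nonlocal_op K (glue r z phi v) z.1 <= c.

(* d_t v - L v >= c in Om *)
Definition visc_ge (K : 'rV[R]_n -> R) (c : R) (Om : set ('rV[R]_n * R)) v : Prop :=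
  forall z r phi, 0 < r -> cylinder r z `<=` Om -> C21 phi ->
    phi z = v z -> (forall w, cylinder r z w -> phi w <= v w) ->
    c <= Dt phi z - nonlocal_op K (glue r z phi v) z.1.

(* |d_t v - L v| <= c in Om *)
Definition visc_abs_le (K : 'rV[R]_n -> R) (c : R) (Om : set ('rV[R]_n * R)) v :
    Prop :=
  visc_le K c Om v /\ visc_ge K (- c) Om v.

End viscosity.

(* Main.v *)
(** The operator is put in symmetrised form, [L w (x) = 1/2 int (w (x + y) + w (x - y) - 2 w (x)) k (y) dy], for uniformly continuous bounded [w]; doubling of variables shows that sums of viscosity subsolutions are subsolutions, so that combinations [v1 - m v2] of the two solutions can be tested against explicit barriers. Let [Mt (t)] be the weighted mass of the positive part of [w] seen at scale [r]. A blow-up barrier bounds subsolutions from above by [int Mt], a bump barrier bounds supersolutions from below by [int Mt], and a third barrier propagates positivity from a small ball in the domain to a large ball meeting the complement. Since [s >= 1/2], the scale [r^(2s)] of time is at most of order [r], so the moving cone contains balls of radius [b r] during times of order [r^(2s)].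

At a point of the domain, the normalisation [v (e_n, 0) = 1] forces a positive mass, hence a lower bound of [v] inside the cone at a fixed scale, and positivity and comparability of [v1] and [v2] around the point. Going down the scales [8^-j], upper and lower bounds chained by a Gronwall argument show that [v2] at scale [j] decays strictly more slowly than [8^(-2sj)]. Hence, if [m v2 <= v1 <= M v2] at one scale, the tails of [v1 - m v2] and [M v2 - v1] are negligible, and one of these functions, being large in the cone, absorbs a fraction of [(M - m) v2] at the next scale. The oscillation of [v1 / v2] therefore decays geometrically. *)

Require Import Defs.
From HB Require Import structures.
From mathcomp Require Import all_boot all_order all_algebra.
From mathcomp Require Import all_classical all_reals all_analysis.
From mathcomp Require Import measurable_realfun.
From mathcomp Require Import ring lra zify.

Set Implicit Arguments.
Unset Strict Implicit.
Unset Printing Implicit Defensive.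

Import Order.TTheory GRing.Theory Num.Theory.
Import numFieldNormedType.Exports.

Local Open Scope classical_set_scope.
Local Open Scope ring_scope.

(** The cone condition looks only backward in time and the axis of the cone depends on the base
    point. Hence the estimates around (x0, T) use times t < T, values at T come from left
    continuity, and two points are compared from the later one. The mass [Mt] is merely continuous
    in time while barriers must be C^1 in time, so barriers contain a primitive [mu] of it and the
    estimates speak of increments of [mu]. A fixed right-hand side is harmless at all scales because
    the mass at every scale stays above a fixed constant: the error is compared with the mass, never
    with the values of the solution, which may tend to zero. The gap q < 1 between consecutive
    scales serves twice. It makes the tails of the combinations of v1 and v2 summable, with a sum
    proportional to the fraction th gained at each scale, so that th can be taken small enough to
    absorb them. And as the oscillation shrinks only by 1 - th >= q, the product of oscillation and
    profile does not decay, so the equation error and the growth at infinity never dominate. *)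

Section EuclideanNorm.
Context (R : realType) (n : nat).
Implicit Types x y z : 'rV[R]_n.

Lemma dotvC x y : dotv x y = dotv y x.
Proof. by apply: eq_bigr => i _; rewrite mulrC. Qed.

Lemma dotvDl x y z : dotv (x + y) z = dotv x z + dotv y z.
Proof. by rewrite -big_split; apply: eq_bigr => i _; rewrite mxE mulrDl. Qed.

Lemma dotvZl (a : R) x y : dotv (a *: x) y = a * dotv x y.
Proof. by rewrite big_distrr; apply: eq_bigr => i _ /=; rewrite mxE mulrA. Qed.

Lemma dotvNl x y : dotv (- x) y = - dotv x y.
Proof. by rewrite -scaleN1r dotvZl mulN1r. Qed.

Lemma dotvDr x y z : dotv x (y + z) = dotv x y + dotv x z.
Proof. by rewrite dotvC dotvDl !(dotvC x). Qed.

Lemma dotvZr (a : R) x y : dotv x (a *: y) = a * dotv x y.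
Proof. by rewrite dotvC dotvZl dotvC. Qed.

Lemma dotvNr x y : dotv x (- y) = - dotv x y.
Proof. by rewrite dotvC dotvNl dotvC. Qed.

Lemma dotv_ge0 x : 0 <= dotv x x.
Proof. by apply: sumr_ge0 => i _; rewrite -expr2 sqr_ge0. Qed.

Lemma enorm_ge0 x : 0 <= enorm x.
Proof. exact: sqrtr_ge0. Qed.

Lemma sqr_enorm x : enorm x ^+ 2 = dotv x x.
Proof. by rewrite sqr_sqrtr ?dotv_ge0. Qed.

Lemma enormN x : enorm (- x) = enorm x.
Proof. by rewrite /enorm dotvNl dotvNr opprK. Qed.

Lemma enormZ (a : R) x : enorm (a *: x) = `|a| * enorm x.
Proof.
by rewrite /enorm dotvZl dotvZr mulrA -expr2 sqrtrM ?sqr_ge0// sqrtr_sqr.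
Qed.

Lemma enorm0 : enorm (0 : 'rV[R]_n) = 0.
Proof. by rewrite -(scale0r 0) enormZ normr0 mul0r. Qed.

Lemma enormB x y : enorm (x - y) = enorm (y - x).
Proof. by rewrite -enormN opprB. Qed.

Lemma coord_le_enorm x (i : 'I_n) : `|x ord0 i| <= enorm x.
Proof.
rewrite -sqrtr_sqr ler_sqrt ?dotv_ge0// /dotv (bigD1 i)//= -expr2 lerDl.
by apply: sumr_ge0 => j _; rewrite -expr2 sqr_ge0.
Qed.

Lemma enorm_eq0 x : (enorm x == 0) = (x == 0).
Proof.
apply/idP/idP => [/eqP x0|/eqP->]; last by rewrite enorm0.
apply/eqP/rowP => i; rewrite mxE; apply/eqP; rewrite -normr_le0 -x0.
exact: coord_le_enorm.
Qed.

Lemma enorm_gt0 x : (0 < enorm x) = (x != 0).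
Proof. by rewrite lt_neqAle enorm_ge0 andbT eq_sym enorm_eq0. Qed.

Lemma sqr_enormD x y : enorm (x + y) ^+ 2 =
  enorm x ^+ 2 + 2 * dotv x y + enorm y ^+ 2.
Proof. by rewrite !sqr_enorm dotvDl !dotvDr (dotvC y x); ring. Qed.

Lemma CauchySchwarz x y : `|dotv x y| <= enorm x * enorm y.
Proof.
have [->|y0] := eqVneq y 0.
  by rewrite -(scale0r 0) dotvZr mul0r normr0 mulr_ge0 ?enorm_ge0.
have yy : 0 < dotv y y by rewrite -sqr_enorm exprn_gt0// enorm_gt0.
rewrite -(@ler_pXn2r _ 2)// ?nnegrE ?mulr_ge0 ?enorm_ge0// exprMn !sqr_enorm.
rewrite -normrX ger0_norm ?sqr_ge0//.
(* The square of this vector is [c * (a * c - b ^+ 2)] in the notation set below, so no division by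
   [dotv y y] is needed. *)
have := dotv_ge0 (dotv y y *: x - dotv x y *: y).
rewrite dotvDl !dotvDr !dotvNl !dotvNr !dotvZl !dotvZr (dotvC y x).
set a := dotv x x; set b := dotv x y; set c := dotv y y => h.
rewrite -subr_ge0 -(pmulr_rge0 _ yy); apply: le_trans h _.
rewrite le_eqVlt; apply/orP; left; apply/eqP; rewrite -/c; ring.
Qed.

Lemma ler_enormD x y : enorm (x + y) <= enorm x + enorm y.
Proof.
rewrite -(@ler_pXn2r _ 2)// ?nnegrE ?addr_ge0 ?enorm_ge0// sqr_enormD.
have := le_trans (ler_norm _) (CauchySchwarz x y); nra.
Qed.

Lemma ler_enormB x y : enorm (x - y) <= enorm x + enorm y.
Proof. by rewrite (le_trans (ler_enormD _ _))// enormN. Qed.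

Lemma ler_dist_enorm x y : `|enorm x - enorm y| <= enorm (x - y).
Proof.
have h (a b : 'rV[R]_n) : enorm a - enorm b <= enorm (a - b).
  by rewrite lerBlDr -{1}(subrK b a); exact: ler_enormD.
by rewrite ler_norml h lerNl opprB enormB h.
Qed.

Lemma le_norm_enorm x : `|x| <= enorm x.
Proof.
rewrite [leLHS]mx_normrE; apply: bigmax_le; first exact: enorm_ge0.
by move=> [i j] _ /=; rewrite (ord1 i) coord_le_enorm.
Qed.

Lemma coord_le_norm x (i : 'I_n) : `|x ord0 i| <= `|x|.
Proof. by rewrite [leRHS]mx_normrE (le_bigmax _ (fun ij => `|x ij.1 ij.2|) (ord0, i)). Qed.

Lemma enorm_le_norm x : enorm x <= n%:R * `|x|.
Proof.
have [n0|n0] := posnP n.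
  rewrite (_ : x = 0) ?enorm0 ?mulr_ge0//.
  by apply/rowP => i; have := ltn_ord i; rewrite [X in (_ < X)%N]n0.
rewrite -(@ler_pXn2r _ 2)// ?nnegrE ?mulr_ge0 ?enorm_ge0// sqr_enorm exprMn.
apply: (@le_trans _ _ (\sum_(i < n) `|x| ^+ 2)).
  apply: ler_sum => i _; rewrite -expr2 -real_normK ?num_real//.
  by rewrite ler_pXn2r ?nnegrE ?normr_ge0 ?coord_le_norm.
rewrite sumr_const card_ord -[X in X <= _]mulr_natl ler_wpM2r ?sqr_ge0//.
by rewrite -natrX ler_nat expnS expn1 leq_pmulr.
Qed.

Lemma lt_enorm_ball x e : 0 < e -> \forall y \near x, enorm (x - y) < e.
Proof.
move=> e0; have n0 : 0 < n%:R + 1 :> R by rewrite ltr_wpDl.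
have : \forall y \near nbhs x, `|x - y| < e / (n%:R + 1).
  apply/nbhs_ballP; exists (e / (n%:R + 1)); first by rewrite /= divr_gt0.
  by move=> y; rewrite -ball_normE.
apply: filterS => y; rewrite ltr_pdivlMr// => /(le_lt_trans _); apply.
by rewrite (le_trans (enorm_le_norm _))// mulrC ler_wpM2l// lerDl.
Qed.

Lemma nbhs_enormP x (A : set 'rV[R]_n) :
  nbhs x A <-> exists2 e, 0 < e & forall y, enorm (x - y) < e -> A y.
Proof.
split=> [/nbhs_ballP[e /= e0 eA]|[e e0 eA]].
  exists e => // y xy; apply: eA; rewrite -ball_normE /=.
  exact: le_lt_trans (le_norm_enorm _) xy.
by apply: filterS eA _; exact: lt_enorm_ball.
Qed.

Lemma continuous_at_enormP x (f : 'rV[R]_n -> R) :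
  {for x, continuous f} <-> forall e, 0 < e ->
  exists2 d, 0 < d & forall y, enorm (x - y) < d -> `|f x - f y| < e.
Proof.
split=> [fx e e0|h].
  have /nbhs_enormP[d d0 dA] : nbhs x [set y | `|f x - f y| < e].
    by have /cvgrPdist_lt/(_ _ e0) := fx.
  by exists d.
move=> A /nbhs_ballP[e /= e0 eA]; apply/nbhs_enormP.
by have [d d0 dA] := h _ e0; exists d => // y /dA; exact: eA.
Qed.

Lemma lipschitz_continuous_enorm (L : R) (f : 'rV[R]_n -> R) :
  (forall x y, `|f x - f y| <= L * enorm (x - y)) -> continuous f.
Proof.
move=> fL x; apply/continuous_at_enormP => e e0.
have L0 : 0 < `|L| + 1 by rewrite ltr_wpDl.
exists (e / (`|L| + 1)); first by rewrite divr_gt0.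
move=> y; rewrite ltr_pdivlMr// => /(le_lt_trans _); apply.
apply: le_trans (fL _ _) _; rewrite mulrC ler_wpM2l ?enorm_ge0//.
by rewrite (le_trans (ler_norm _))// lerDl.
Qed.

Lemma continuous_dotv x : continuous (fun y => dotv x y).
Proof.
apply: (@lipschitz_continuous_enorm (enorm x)) => y z.
by rewrite -dotvNr -dotvDr; exact: CauchySchwarz.
Qed.

Lemma continuous_enorm : continuous (@enorm R n).
Proof.
apply: (@lipschitz_continuous_enorm 1) => y z.
by rewrite mul1r; exact: ler_dist_enorm.
Qed.

End EuclideanNorm.

(** * Integration on R^n and bounds on the kernels *)

Section MeasureRV.
Context (R : realType).

(** The sigma-algebra is generated by the coordinates, so an open set has to be exhausted by
    countably many boxes: rational centres, radii [1 / (k + 1)], and the empty set in place of the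
    boxes that leave [U]. *)
Lemma measurable_preimage_open (n : nat) (U : set 'rV[R]_n) : open U -> measurable U.
Proof.
move=> oU.
pose box (q : 'rV[rat]_n * nat) : set 'rV[R]_n :=
  \bigcap_(i in [set: 'I_n]) [set x : 'rV[R]_n | `|x ord0 i - ratr (q.1 ord0 i)| < q.2.+1%:R^-1].
have mbox q : measurable (box q).
  apply: fin_bigcap_measurable => // i _.
  rewrite (_ : [set _ | _] = (fun x : 'rV[R]_n => x ord0 i) @^-1`
      ball (ratr (q.1 ord0 i) : R) q.2.+1%:R^-1).
    rewrite -[X in measurable X]setTI; apply: measurable_rV_coord => //.
    exact: measurable_ball.
  by apply/seteqP; split => x /=; rewrite -ball_normE /= distrC.
rewrite (_ : U = \bigcup_(q : 'rV[rat]_n * nat) (if `[< box q `<=` U >] then box q else set0)).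
  apply: countable_bigcupT_measurable; first exact: countableP.
  by move=> q; case: ifP.
apply/seteqP; split=> [x Ux|x [q _]]; last by case: ifPn => // /asboolP; apply.
have /nbhs_ballP[e /= e0 eU] : nbhs x U by exact: open_nbhs_nbhs.
pose k := Num.truncn (2 / e).
have ke : k.+1%:R^-1 < e / 2.
  rewrite -[e / 2]invrK invf_div ltf_pV2 ?posrE ?divr_gt0//.
  by rewrite truncnS_gt.
have hq i : exists q : rat, `|x ord0 i - ratr q| < k.+1%:R^-1 :> R.
  have : x ord0 i - k.+1%:R^-1 < x ord0 i by rewrite ltrBlDr ltrDl.
  move=> /rat_in_itvoo[q]; rewrite in_itv/= => /andP[q1 q2]; exists q.
  by rewrite gtr0_norm ?subr_gt0// ltrBlDr addrC -ltrBlDr.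
have [q hq'] := choice hq.
exists (\row_i q i, k) => //; case: ifPn => [_ i _/=|/asboolP]; first by rewrite mxE.
case=> y yb; apply: eU; rewrite -ball_normE /=.
rewrite [ltLHS]mx_normrE; apply: bigmax_lt => // -[i j] _ /=; rewrite (ord1 i) !mxE.
have := yb j I; rewrite /= mxE => h1; have := hq' j => h2.
rewrite (_ : _ - _ = (x ord0 j - ratr (q j)) - (y ord0 j - ratr (q j))); last by ring.
by apply: le_lt_trans (ler_normB _ _) _; rewrite (splitr e) ltrD// (lt_trans _ ke).
Qed.

Lemma continuous_measurable_rV (n : nat) (f : 'rV[R]_n -> R) :
  continuous f -> measurable_fun setT f.
Proof.
move=> cf; apply: (@measurability _ _ _ _ setT f (@RGenOInfty.G R)) => [|A [B [x ->] <-]].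
  exact: RGenOInfty.measurableE.
rewrite setTI; apply: measurable_preimage_open.
by have /continuousP := cf; apply; exact: interval_open.
Qed.

(** Uniqueness of the measure that gives half-open intervals their length, applied to the image of
    Lebesgue measure under the translation. *)
Lemma lebesgue_measureD (a : R) (A : set R) : measurable A ->
  lebesgue_measure ((fun x => x + a) @^-1` A) = lebesgue_measure A.
Proof.
have ma : measurable_fun [set: measurableTypeR R] (fun x => x + a : measurableTypeR R).
  exact: measurable_funD.
pose m : {measure set _ -> \bar R} := pushforward lebesgue_measure (fun x : measurableTypeR R => x + a : measurableTypeR R).
pose m' := [the measure _ _ of measure_function_pushforward__canonical__measure_function_Measure (@lebesgue_measure R) ma].
move=> mA; symmetry; apply: (@lebesgue_measure_unique R m') => // X [[u v] /= uv <-].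
rewrite /m' /= /pushforward /= (_ : _ @^-1` _ = `]u - a, v - a]%classic); last first.
  by apply/seteqP; split => x /=; rewrite !in_itv/= => /andP[h1 h2]; apply/andP; split; lra.
rewrite !lebesgue_measure_itv /= !lte_fin.
rewrite ltrD2r; case: ifP => // _; rewrite -!EFinD; congr EFin; ring.
Qed.

(** The section at [x] of the preimage is the preimage under [f2] of the section of [A] at [f1 x];
    preservation by [f2] handles the inner measure and preservation by [f1] the outer integral. *)
Lemma product_preserves (n : nat) (f1 : measurableTypeR R -> measurableTypeR R) (f2 : 'rV[R]_n -> 'rV[R]_n) (m : {sigma_finite_measure set 'rV[R]_n -> \bar R}) :
  measurable_fun setT f1 -> measurable_fun setT f2 ->
  (forall A, measurable A -> lebesgue_measure (f1 @^-1` A) = lebesgue_measure A) ->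
  (forall A, measurable A -> m (f2 @^-1` A) = m A) ->
  forall A, measurable A ->
  (@lebesgue_measure R \x m)%E ((fun p => (f1 p.1, f2 p.2)) @^-1` A) =
  (@lebesgue_measure R \x m)%E A.
Proof.
move=> mf1 mf2 pf1 pf2 A mA; rewrite /product_measure1 /=.
pose h : measurableTypeR R -> \bar R := m \o xsection A.
have mh : measurable_fun [set: measurableTypeR R] h by exact: measurable_fun_xsection.
transitivity (\int[@lebesgue_measure R]_x (h \o f1) x)%E.
  apply: eq_integral => x _; rewrite /= /h /= -[RHS]pf2; last exact: measurable_xsection.
  by congr (m _); apply/seteqP; split => y; rewrite /xsection /= !inE /= ?inE.
rewrite -(preimage_setT f1) -ge0_integral_pushforward//.
by apply: eq_measure_integral => B mB _; exact: pf1.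
Qed.

Lemma lebesgue_rV_stepE (n : nat) (A : set 'rV[R]_n.+1) :
  lebesgue_rV R n.+1 A = (@lebesgue_measure R \x lebesgue_rV R n)%E (@rV_cons R n @^-1` A).
Proof. by []. Qed.

Lemma measurable_shift_rV (n : nat) (a : 'rV[R]_n) :
  measurable_fun setT (fun x : 'rV[R]_n => x + a).
Proof.
apply: measurable_fun_rV => i; under eq_fun do rewrite mxE.
by apply: measurable_funD => //; exact: measurable_rV_coord.
Qed.

Lemma measurable_opp_rV (n : nat) : measurable_fun setT (fun x : 'rV[R]_n => - x).
Proof.
apply: measurable_fun_rV => i; under eq_fun do rewrite mxE.
by apply: measurableT_comp => //; exact: measurable_rV_coord.
Qed.

(** Induction on the dimension: [rV_cons] turns a translation into a product of translations. *)
Lemma lebesgue_rV_shift (n : nat) (a : 'rV[R]_n) (A : set 'rV[R]_n) : measurable A ->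
  lebesgue_rV R n ((fun x => x + a) @^-1` A) = lebesgue_rV R n A.
Proof.
elim: n a A => [|n IH] a A mA.
  by rewrite (_ : _ @^-1` _ = A)//; apply/seteqP; split => x /=; rewrite (thinmx0 a) addr0.
rewrite !lebesgue_rV_stepE.
rewrite -[RHS](@product_preserves n (fun x => x + a ord0 ord0) (fun x => x + \row_j a ord0 (lift ord0 j)) (lebesgue_rV R n)); first last.
- by rewrite -[X in measurable X]setTI; exact: measurable_rV_cons.
- by move=> B mB; exact: IH.
- by move=> B mB; exact: lebesgue_measureD.
- exact: measurable_shift_rV.
- exact: measurable_funD.
have E x y : rV_cons (x, y) + a = rV_cons (x + a ord0 ord0, y + \row_j a ord0 (lift ord0 j)).
  by apply/rowP => i; rewrite !mxE; case: (unliftP ord0 i) => [j ->|->] /=; rewrite ?mxE ?liftK ?unlift_none ?mxE.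
rewrite -comp_preimage; congr (_ _); apply/funext => -[x y] /=.
by rewrite E.
Qed.

Lemma lebesgue_rV_opp (n : nat) (A : set 'rV[R]_n) : measurable A ->
  lebesgue_rV R n ((fun x => - x) @^-1` A) = lebesgue_rV R n A.
Proof.
elim: n A => [|n IH] A mA.
  by rewrite (_ : _ @^-1` _ = A)//; apply/seteqP; split => x /=; rewrite (thinmx0 x) oppr0.
rewrite !lebesgue_rV_stepE.
rewrite -[RHS](@product_preserves n (fun x => - x) (fun x => - x) (lebesgue_rV R n)); first last.
- by rewrite -[X in measurable X]setTI; exact: measurable_rV_cons.
- by move=> B mB; exact: IH.
- by move=> B mB; exact: lebesgue_measureN.
- exact: measurable_opp_rV.
- exact: measurableT_comp.
have E x (y : 'rV[R]_n) : - rV_cons (x, y) = rV_cons (- x, - y).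
  by apply/rowP => i; rewrite !mxE; case: (unlift ord0 i) => [j|] /=; rewrite ?mxE.
rewrite -comp_preimage; congr (_ _); apply/funext => -[x y] /=.
by rewrite E.
Qed.

(** The sets whose measure the product construction gives exactly. Euclidean balls are only compared
    with them, so the volume of the unit ball never enters. *)
Definition cube (n : nat) (r : R) : set 'rV[R]_n := [set x | forall i, `|x ord0 i| <= r].

Arguments cube n r : clear implicits.

Lemma measurable_cube (n : nat) r : measurable (cube n r).
Proof.
rewrite (_ : cube n r = \bigcap_(i in [set: 'I_n]) [set x : 'rV[R]_n | `|x ord0 i| <= r]).
  apply: fin_bigcap_measurable => // i _.
  rewrite (_ : [set _ | _] = (fun x : 'rV[R]_n => x ord0 i) @^-1` `[- r, r]%classic).
    by rewrite -[X in measurable X]setTI; apply: measurable_rV_coord.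
  by apply/seteqP; split => x /=; rewrite in_itv/= ler_norml.
by apply/seteqP; split => [x h i _|x h i]; apply: h.
Qed.

Lemma lebesgue_rV_cube (n : nat) r : 0 <= r -> lebesgue_rV R n (cube n r) = ((2 * r) ^+ n)%:E.
Proof.
move=> r0; elim: n => [|n IH].
  rewrite /= diracE expr0 mem_set//.
  by move=> i; case: i.
rewrite lebesgue_rV_stepE (_ : _ @^-1` _ = `[- r, r]%classic `*` cube n r).
  rewrite product_measure1E//; last exact: measurable_cube.
  rewrite IH [X in (X * _)%E](lebesgue_measure_itv `[- r, r])/= lte_fin -EFinD.
  case: ltP => h; first by rewrite -EFinM exprS; congr (_ * _)%:E; ring.
  have -> : r = 0 by lra.
  by rewrite mul0e mulr0 exprS mul0r.
apply/seteqP; split => -[x y] /=.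
  move=> h; split; first by have := h ord0; rewrite mxE unlift_none /= in_itv/= ler_norml.
  by move=> i; have := h (lift ord0 i); rewrite mxE liftK.
move=> [hx hy] i; case: (unliftP ord0 i) => [j ->|->]; rewrite mxE ?liftK ?unlift_none /=; first exact: hy.
by move: hx; rewrite in_itv/= ler_norml.
Qed.

End MeasureRV.

(** Truncations are written as real factors [ind (...)], so that integrals range over the whole
    space and linearity applies directly. *)
Definition ind (R : realType) (b : bool) : R := b%:R.
Arguments ind {R} b.

Lemma ind_ge0 (R : realType) b : 0 <= ind b :> R.
Proof. exact: ler0n. Qed.
#[local] Hint Resolve ind_ge0 : core.

Lemma ind_le1 (R : realType) b : ind b <= 1 :> R.
Proof. by case: b; rewrite /ind. Qed.

Lemma indT (R : realType) (b : bool) : b -> ind b = 1 :> R.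
Proof. by rewrite /ind => ->. Qed.

Lemma indF (R : realType) (b : bool) : ~~ b -> ind b = 0 :> R.
Proof. by rewrite /ind => /negbTE ->. Qed.

Section MeasurePreserving.
Context (R : realType) (n : nat).
Local Notation mu := (lebesgue_rV R n).
Implicit Types (f g : 'rV[R]_n -> R) (a x y z : 'rV[R]_n).

Definition intg f := mu.-integrable setT (EFin \o f).
Definition INT f : R := \int[mu]_y f y.

Lemma intg_meas f : intg f -> measurable_fun setT f.
Proof. by move=> /integrableP[/measurable_EFinP]. Qed.

Lemma intg_le f g : measurable_fun setT f -> (forall y, `|f y| <= g y) ->
  intg g -> intg f.
Proof.
move=> mf fg; apply: le_integrable => //; first exact/measurable_EFinP.
move=> y _ /=; rewrite lee_fin (le_trans (fg y))//; exact: ler_norm.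
Qed.

Lemma intgD f g : intg f -> intg g -> intg (fun y => f y + g y).
Proof. exact: integrableD. Qed.

Lemma intgB f g : intg f -> intg g -> intg (fun y => f y - g y).
Proof. exact: integrableB. Qed.

Lemma intgZ c f : intg f -> intg (fun y => c * f y).
Proof. exact: integrableZl. Qed.

Lemma intg0 : intg (fun=> 0).
Proof. exact: integrable0. Qed.

Lemma intg_norm f : intg f -> intg (fun y => `|f y|).
Proof. exact: integrable_norm. Qed.

Lemma INT_le f g : intg f -> intg g -> (forall y, f y <= g y) -> INT f <= INT g.
Proof. by move=> ? ? fg; apply: le_Rintegral. Qed.

Lemma INT_ge0 f : (forall y, 0 <= f y) -> 0 <= INT f.
Proof. by move=> f0; apply: Rintegral_ge0. Qed.

Lemma INTD f g : intg f -> intg g -> INT (fun y => f y + g y) = INT f + INT g.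
Proof. exact: RintegralD. Qed.

Lemma INTB f g : intg f -> intg g -> INT (fun y => f y - g y) = INT f - INT g.
Proof. exact: RintegralB. Qed.

Lemma INTZ c f : intg f -> INT (fun y => c * f y) = c * INT f.
Proof. by move=> ?; rewrite /INT RintegralZl. Qed.

Lemma INTN f : intg f -> INT (fun y => - f y) = - INT f.
Proof.
move=> fi; rewrite -mulN1r -INTZ//; congr INT; apply/funext => y; by rewrite mulN1r.
Qed.

Lemma INT0 : INT (fun=> 0) = 0.
Proof. rewrite -[RHS](mul0r (INT (fun=> 0))) -INTZ; last exact: intg0.
by congr INT; apply/funext => y; rewrite mul0r. Qed.

Lemma le_norm_INT f : intg f -> `|INT f| <= INT (fun y => `|f y|).
Proof. by move=> ?; apply: le_normr_Rintegral. Qed.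

Lemma EFin_INT f : intg f -> (INT f)%:E = (\int[mu]_y (f y)%:E)%E.
Proof. by move=> fi; rewrite /INT /Rintegral fineK//; apply: integrable_fin_num. Qed.

Section preserving.
Context (p : 'rV[R]_n -> 'rV[R]_n) (mp : measurable_fun setT p)
  (pp : forall A, measurable A -> mu (p @^-1` A) = mu A).

Lemma ge0_integral_preserving (f : 'rV[R]_n -> \bar R) : measurable_fun setT f ->
  (forall y, 0 <= f y)%E -> (\int[mu]_y f (p y) = \int[mu]_y f y)%E.
Proof.
move=> mf f0; transitivity (\int[pushforward mu p]_y f y)%E.
  rewrite ge0_integral_pushforward// preimage_setT //.
by apply: eq_measure_integral => A mA _; exact: pp.
Qed.

Lemma intg_preserving f : intg f -> intg (f \o p).
Proof.
move=> /integrableP[mf fi]; apply/integrableP; split.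
  exact: (measurableT_comp mf mp).
rewrite (ge0_integral_preserving (f := fun y => `|(f y)%:E|%E))//.
exact: measurableT_comp.
Qed.

Lemma INT_preserving f : intg f -> INT (f \o p) = INT f.
Proof.
move=> fi; rewrite /INT /Rintegral; congr fine.
transitivity (\int[pushforward mu p]_y (f y)%:E)%E.
  rewrite integral_pushforward//.
    apply/measurable_EFinP; exact: intg_meas.
  by rewrite preimage_setT; exact: intg_preserving.
by apply: eq_measure_integral => A mA _; exact: pp.
Qed.

End preserving.

Lemma intg_shift a f : intg f -> intg (fun y => f (y + a)).
Proof.
apply: (@intg_preserving (fun y => y + a)); first exact: measurable_shift_rV.
by move=> A; exact: lebesgue_rV_shift.
Qed.

Lemma INT_shift a f : intg f -> INT (fun y => f (y + a)) = INT f.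
Proof.
apply: (@INT_preserving (fun y => y + a)); first exact: measurable_shift_rV.
by move=> A; exact: lebesgue_rV_shift.
Qed.

Lemma intg_opp f : intg f -> intg (fun y => f (- y)).
Proof.
apply: (@intg_preserving (fun y => - y)); first exact: measurable_opp_rV.
by move=> A; exact: lebesgue_rV_opp.
Qed.

Lemma INT_opp f : intg f -> INT (fun y => f (- y)) = INT f.
Proof.
apply: (@INT_preserving (fun y => - y)); first exact: measurable_opp_rV.
by move=> A; exact: lebesgue_rV_opp.
Qed.

Lemma meas_ind (P : 'rV[R]_n -> bool) : measurable [set y | P y] ->
  measurable_fun setT (fun y => ind (P y) : R).
Proof.
move=> mP; rewrite (_ : (fun y => _) = \1_[set y | P y]).
  exact: measurable_indic.
by apply/funext => y; rewrite indicE mem_setE.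
Qed.

Lemma meas_le (f g : 'rV[R]_n -> R) : measurable_fun setT f -> measurable_fun setT g ->
  measurable [set y | f y <= g y].
Proof.
move=> mf mg; have := measurable_fun_ler mf mg.
move=> /(_ measurableT [set true] I).
by rewrite setTI.
Qed.

Lemma meas_lt (f g : 'rV[R]_n -> R) : measurable_fun setT f -> measurable_fun setT g ->
  measurable [set y | f y < g y].
Proof.
move=> mf mg; have := measurable_fun_ltr mf mg.
move=> /(_ measurableT [set true] I).
by rewrite setTI.
Qed.

Lemma meas_enorm : measurable_fun setT (@enorm R n).
Proof. by apply: continuous_measurable_rV; exact: continuous_enorm. Qed.

Lemma meas_enorm_shift a : measurable_fun setT (fun y : 'rV[R]_n => enorm (y + a)).
Proof. by apply: (measurableT_comp meas_enorm); exact: measurable_shift_rV. Qed.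

Lemma measurable_eball a r : measurable [set y : 'rV[R]_n | enorm (y - a) < r].
Proof. by apply: meas_lt => //; exact: meas_enorm_shift. Qed.

Lemma measurable_eball0 r : measurable [set y : 'rV[R]_n | enorm y < r].
Proof. by apply: meas_lt => //; exact: meas_enorm. Qed.

Lemma lebesgue_eball a r : mu [set y | enorm (y - a) < r] = mu [set y | enorm y < r].
Proof.
rewrite -[RHS](lebesgue_rV_shift (- a))//; exact: measurable_eball0.
Qed.

Lemma lebesgue_eball_le r : 0 <= r -> (mu [set y | (enorm y < r)%R] <= ((2 * r) ^+ n)%:E)%E.
Proof.
move=> r0; rewrite -lebesgue_rV_cube//; apply: le_measure; rewrite ?inE.
- exact: measurable_eball0.
- exact: measurable_cube.
- by move=> y /= yr i; rewrite (le_trans (coord_le_enorm _ _))// ltW.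
Qed.

Lemma lebesgue_eball_ge r : (0 < n)%N -> 0 < r ->
  (((r / n%:R) ^+ n)%:E <= mu [set y | (enorm y < r)%R])%E.
Proof.
move=> n0 r0; have nn : 0 < n%:R :> R by rewrite ltr0n.
rewrite (_ : r / n%:R = 2 * (r / (2 * n%:R))); last by field; rewrite gt_eqF.
have r1 : 0 <= r / (2 * n%:R) by rewrite divr_ge0 ?mulr_ge0 ?ltW.
rewrite -lebesgue_rV_cube//; apply: le_measure; rewrite ?inE.
- exact: measurable_cube.
- exact: measurable_eball0.
- move=> y /= yr; apply: le_lt_trans (enorm_le_norm _) _.
  apply: (@le_lt_trans _ _ (r / 2)); last by lra.
  rewrite -ler_pdivlMl// (_ : _ * (r / 2) = r / (2 * n%:R)); last by field; rewrite gt_eqF.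
  rewrite [leLHS]mx_normrE; apply: bigmax_le; first by rewrite divr_ge0 ?mulr_ge0 ?ltW.
  by move=> [i j] _ /=; rewrite (ord1 i).
Qed.

Lemma intg_ball a r : intg (fun y => ind (enorm (y - a) < r)).
Proof.
apply/integrableP; split.
  by apply/measurable_EFinP; apply: meas_ind; exact: measurable_eball.
have [r0|r0] := leP r 0.
  rewrite (_ : (fun y => _) = cst 0%E) ?integral0//.
  by apply/funext => y /=; rewrite indF ?normr0// -leNgt (le_trans r0)// enorm_ge0.
rewrite (_ : (fun y => _) = (fun y => (\1_[set y | enorm (y - a) < r] y)%:E)); last first.
  by apply/funext => y; rewrite indicE mem_setE /= ger0_norm.
rewrite integral_indic ?setIT//; last exact: (measurable_eball a r).
apply: (@le_lt_trans _ _ ((2 * r) ^+ n)%:E); last exact: ltry.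
by have := lebesgue_eball_le (ltW r0); rewrite -(lebesgue_eball a r).
Qed.

Lemma INT_ball_EFin a r : (INT (fun y => ind (enorm (y - a) < r)))%:E = mu [set y | enorm y < r].
Proof.
rewrite EFin_INT; last exact: intg_ball.
rewrite (_ : (fun y => _) = (fun y => (\1_[set y | enorm (y - a) < r] y)%:E)); last first.
  by apply/funext => y; rewrite indicE mem_setE.
rewrite integral_indic ?setIT//; last exact: (measurable_eball a r).
exact: lebesgue_eball.
Qed.

Lemma INT_ball_le a r : 0 <= r -> INT (fun y => ind (enorm (y - a) < r)) <= (2 * r) ^+ n.
Proof. by move=> r0; rewrite -lee_fin INT_ball_EFin lebesgue_eball_le. Qed.

Lemma INT_ball_ge a r : (0 < n)%N -> 0 < r ->
  (r / n%:R) ^+ n <= INT (fun y => ind (enorm (y - a) < r)).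
Proof. by move=> n0 r0; rewrite -lee_fin INT_ball_EFin lebesgue_eball_ge. Qed.

(** [F] lies below the sum over [k] of [c k] on the ball of radius [rho k], whose measure is at most
    [(2 * rho k) ^+ n]; the series of these products is geometric. *)
Lemma dyadic_intg (F : 'rV[R]_n -> R) (c rho : nat -> R) (M q : R) :
  measurable_fun setT F -> (forall y, 0 <= F y) -> 0 <= q < 1 -> 0 <= M ->
  (forall k, 0 <= c k) -> (forall k, 0 <= rho k) ->
  (forall y, F y != 0 -> exists k, enorm y < rho k /\ F y <= c k) ->
  (forall k, c k * (2 * rho k) ^+ n <= M * q ^+ k) ->
  intg F /\ INT F <= M / (1 - q).
Proof.
move=> mF F0 /andP[q0 q1] M0 c0 rho0 Fc cM.
pose G (k : nat) (y : 'rV[R]_n) : \bar R := (c k * ind (enorm (y - 0) < rho k))%:E.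
have G0 k y : (0 <= G k y)%E by rewrite lee_fin mulr_ge0.
have mG k : measurable_fun setT (G k).
  apply/measurable_EFinP; apply: measurable_funM => //.
  by apply: meas_ind; exact: measurable_eball.
have le1 : (\int[mu]_y (F y)%:E <= (M / (1 - q))%:E)%E.
  apply: (@le_trans _ _ (\int[mu]_y (\sum_(0 <= k <oo) G k y))%E).
    apply: ge0_le_integral => //.
    - by move=> y _; rewrite lee_fin.
    - exact/measurable_EFinP.
    - by apply: ge0_emeasurable_sum => // k y _ _; exact: G0.
    - move=> y _; have [->|/Fc[k [yk Fk]]] := eqVneq (F y) 0.
        by apply: nneseries_ge0 => k _ _; exact: G0.
      apply: (@le_trans _ _ (G k y)).
        by rewrite /G subr0 indT ?mulr1 ?lee_fin.
      apply: le_trans (nneseries_lim_ge k.+1 _); last by move=> j _ _; exact: G0.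
      by rewrite big_nat_recr//= leeDr// sume_ge0.
  rewrite integral_nneseries//.
  apply: lime_le; first by apply: is_cvg_nneseries => j _ _; apply: integral_ge0.
  apply: nearW => N.
  apply: (@le_trans _ _ (\sum_(0 <= k < N) (M * q ^+ k)%:E)%E).
    apply: lee_sum => k _; rewrite /G -EFin_INT; last by apply: intgZ; exact: intg_ball.
    rewrite INTZ ?lee_fin; last exact: intg_ball.
    by rewrite (le_trans _ (cM k))// ler_wpM2l// INT_ball_le.
  rewrite sumEFin lee_fin -big_distrr/= ler_wpM2l//.
  rewrite -div1r ler_pdivlMr ?subr_gt0//.
  have -> : (\sum_(0 <= k < N) q ^+ k) * (1 - q) = 1 - q ^+ N.
    by rewrite big_mkord -[RHS]opprB subrX1 -mulNr opprB mulrC.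
  by rewrite lerBlDr lerDl exprn_ge0.
have le2 : intg F.
  apply/integrableP; split; first exact/measurable_EFinP.
  under eq_integral do rewrite abse_EFin ger0_norm//.
  exact: le_lt_trans le1 (ltry _).
by split=> //; rewrite -lee_fin EFin_INT.
Qed.

End MeasurePreserving.

(** * Integrals of powers of the norm and moments of the model kernel *)

Section PowerIntegrals.
Context (R : realType) (n : nat) (hn : (0 < n)%N).
Implicit Types (a x y z : 'rV[R]_n).

Lemma meas_powenorm (b : R) : measurable_fun setT (fun y : 'rV[R]_n => enorm y `^ b).
Proof. rewrite (_ : (fun y => _) = (@powR R ^~ b) \o @enorm R n)//.
apply: measurableT_comp; [exact: measurable_powR|exact: meas_enorm]. Qed.

Lemma meas_ind_le (f g : 'rV[R]_n -> R) : measurable_fun setT f -> measurable_fun setT g ->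
  measurable_fun setT (fun y => ind (f y <= g y) : R).
Proof. by move=> mf mg; apply: meas_ind; exact: meas_le. Qed.

Lemma meas_ind_lt (f g : 'rV[R]_n -> R) : measurable_fun setT f -> measurable_fun setT g ->
  measurable_fun setT (fun y => ind (f y < g y) : R).
Proof. by move=> mf mg; apply: meas_ind; exact: meas_lt. Qed.

Lemma ler_powRN (u v b : R) : 0 < u -> u <= v -> 0 <= b -> v `^ (- b) <= u `^ (- b).
Proof.
move=> u0 uv b0; rewrite !powRN lef_pV2 ?posrE ?powR_gt0 ?(lt_le_trans u0)//.
by apply: ge0_ler_powR; rewrite // nnegrE ?(ltW u0) ?(le_trans (ltW u0)).
Qed.

Lemma powR2N_lt1 (b : R) : 0 < b -> 2 `^ (- b) < 1 :> R.
Proof.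
move=> b0; rewrite powRN invf_lt1 ?powR_gt0//.
have := @gt0_ltr_powR R b b0 1 2; rewrite powR1; apply; rewrite ?nnegrE ?ler0n//.
by rewrite ltr1n.
Qed.

Lemma powR2X (k : nat) (b : R) : (2 ^+ k) `^ b = (2 `^ b) ^+ k :> R.
Proof. by rewrite -powR_mulrn// -powRrM mulrC powRrM powR_mulrn// powR_ge0. Qed.

Lemma dyadic_far (r t : R) : 0 < r -> r <= t -> exists k : nat, 2 ^+ k * r <= t < 2 ^+ k.+1 * r.
Proof.
move=> r0 rt.
have [N hN] : exists N : nat, t < 2 ^+ N * r.
  exists (Num.truncn (t / r)).+1; rewrite -ltr_pdivrMr//.
  apply: lt_trans (truncnS_gt (t / r)) _; rewrite -natrX ltr_nat; exact: ltn_expl.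
have : exists N : nat, t < 2 ^+ N * r by exists N.
move=> /ex_minnP[[|m]]; first by rewrite expr0 mul1r ltNge rt.
move=> tm hm; exists m; rewrite tm andbT leNgt; apply/negP => /hm.
by rewrite ltnn.
Qed.

(** On the shell from [2 ^+ k * r] to [2 ^+ k.+1 * r] the power is at most its value at the inner
    radius; multiplied by the volume this leaves [r^(-b)] times the [k]-th power of [2^(-b) < 1]. *)
Lemma intg_far (b : R) : 0 < b -> exists2 C, 0 < C & forall r, 0 < r ->
  intg (fun y => ind (r <= enorm y) * enorm y `^ (- n%:R - b)) /\
  INT (fun y => ind (r <= enorm y) * enorm y `^ (- n%:R - b)) <= C * r `^ (- b).
Proof.
move=> b0.
have q1 := powR2N_lt1 b0.
exists (4 ^+ n / (1 - 2 `^ (- b))); first by rewrite divr_gt0 ?subr_gt0// exprn_gt0.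
move=> r r0; rewrite mulrAC.
apply: (@dyadic_intg _ _ _ (fun k => (2 ^+ k * r) `^ (- n%:R - b)) (fun k => 2 ^+ k.+1 * r)) => //.
- apply: measurable_funM; last exact: meas_powenorm.
  by apply: meas_ind_le => //; exact: meas_enorm.
- by move=> y; rewrite mulr_ge0// ?powR_ge0//; case: (r <= _); rewrite /ind.
- by rewrite powR_ge0 q1.
- by rewrite mulr_ge0 ?powR_ge0// exprn_ge0.
- by move=> k; rewrite powR_ge0.
- by move=> k; rewrite mulr_ge0// ?exprn_ge0// ltW.
- move=> y; case: (leP r (enorm y)) => [ry _|]; last by rewrite /ind mul0r eqxx.
  have [k /andP[k1 k2]] := dyadic_far r0 ry; exists k; split => //.
  rewrite /ind mul1r -opprD; apply: ler_powRN => //; first by rewrite mulr_gt0// exprn_gt0.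
  by rewrite addr_ge0// ltW.
- move=> k; set u := 2 ^+ k * r; have u0 : 0 < u by rewrite mulr_gt0// exprn_gt0.
  rewrite (_ : 2 * (2 ^+ k.+1 * r) = 4 * u); last by rewrite /u exprS; ring.
  have hu : u `^ (- n%:R - b) * u ^+ n = u `^ (- b).
    rewrite -powR_mulrn ?(ltW u0)// -powRD ?(gt_eqF u0) ?implybT//.
    by congr (_ `^ _); ring.
  rewrite exprMn mulrCA hu /u powRM ?exprn_ge0 ?(ltW r0)// powR2X.
  by rewrite le_eqVlt; apply/orP; left; apply/eqP; ring.
Qed.

(** The origin lies in no dyadic shell, which is why it is discarded. As [b - n] has no definite
    sign, on a shell [|y|^b] is bounded by the outer radius and [|y|^(-n)] by the inner one. *)
Lemma intg_near (b : R) : 0 < b -> exists2 C, 0 < C & forall r, 0 < r ->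
  intg (fun y => ind (enorm y < r) * (ind (0 < enorm y) * enorm y `^ (b - n%:R))) /\
  INT (fun y => ind (enorm y < r) * (ind (0 < enorm y) * enorm y `^ (b - n%:R))) <= C * r `^ b.
Proof.
move=> b0.
have q1 := powR2N_lt1 b0.
exists (8 ^+ n / (1 - 2 `^ (- b))); first by rewrite divr_gt0 ?subr_gt0// exprn_gt0.
move=> r r0; rewrite mulrAC.
apply: (@dyadic_intg _ _ _ (fun k => (r / 2 ^+ k) `^ b * (r / 2 ^+ k / 2) `^ (- n%:R))
   (fun k => 2 * (r / 2 ^+ k))) => //.
- apply: measurable_funM; first by apply: meas_ind_lt => //; exact: meas_enorm.
  apply: measurable_funM; last exact: meas_powenorm.
  by apply: meas_ind_lt => //; exact: meas_enorm.
- by move=> y; rewrite mulr_ge0 ?ind_ge0// mulr_ge0 ?ind_ge0 ?powR_ge0.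
- by rewrite powR_ge0 q1.
- by rewrite mulr_ge0 ?powR_ge0// exprn_ge0.
- by move=> k; rewrite mulr_ge0 ?powR_ge0.
- by move=> k; rewrite mulr_ge0// divr_ge0 ?exprn_ge0// ltW.
- move=> y; case: (ltP (enorm y) r) => [yr|]; last by rewrite /ind mul0r eqxx.
  case: (ltP 0 (enorm y)) => [y0 _|]; last by rewrite /ind mul0r mulr0 eqxx.
  have [k /andP[k1 k2]] := dyadic_far y0 (ltW yr); exists k.
  have p2 : 0 < 2 ^+ k :> R by rewrite exprn_gt0.
  have h1 : enorm y <= r / 2 ^+ k by rewrite ler_pdivlMr// mulrC.
  have h2 : r / 2 ^+ k / 2 <= enorm y.
    by rewrite ler_pdivrMr// ler_pdivrMr// (le_trans (ltW k2))// exprS; lra.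
  have h3 : 0 < r / 2 ^+ k by rewrite divr_gt0.
  split; first by apply: le_lt_trans h1 _; lra.
  rewrite /ind !mul1r powRD ?(gt_eqF y0) ?implybT//; apply: ler_pM; rewrite ?powR_ge0//.
    by apply: ge0_ler_powR; rewrite ?nnegrE ?(ltW y0) ?(ltW b0) ?(ltW h3).
  by apply: ler_powRN => //; lra.
- move=> k; set u := r / 2 ^+ k.
  have p2 : 0 < 2 ^+ k :> R by rewrite exprn_gt0.
  have u0 : 0 < u by rewrite divr_gt0.
  rewrite (_ : 2 * (2 * u) = 8 * (u / 2)); last by field.
  have h0 : 0 < u / 2 by rewrite divr_gt0.
  have hu : (u / 2) `^ (- n%:R) * (u / 2) ^+ n = 1.
    rewrite -powR_mulrn ?(ltW h0)// -powRD ?(gt_eqF h0) ?implybT//.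
    by rewrite addNr powRr0.
  rewrite exprMn -mulrA (mulrCA _ (8 ^+ n)) hu mulr1 /u powRM ?(ltW r0) ?invr_ge0 ?(ltW p2)//.
  rewrite -powR_inv1 ?(ltW p2)// -powRrM mulN1r powR2X.
  by rewrite le_eqVlt; apply/orP; left; apply/eqP; ring.
Qed.

End PowerIntegrals.

Section KernelIntegrals.
Context (R : realType) (n : nat) (hn : (0 < n)%N) (s : R) (s0 : 0 < s) (s1 : s < 1).
Implicit Types (a x y z : 'rV[R]_n).

Definition jker y : R := enorm y `^ (- n%:R - 2 * s).

Lemma jker_ge0 y : 0 <= jker y. Proof. exact: powR_ge0. Qed.

Lemma jker0 : jker 0 = 0.
Proof.
rewrite /jker enorm0 powR0//; apply/eqP => h.
have n0 : 0 < n%:R :> R by rewrite ltr0n.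
have : 0 < n%:R + 2 * s by rewrite addr_gt0// mulr_gt0.
by rewrite -oppr_lt0 opprD h ltxx.
Qed.

Lemma meas_jker : measurable_fun setT jker.
Proof. exact: meas_powenorm. Qed.

Lemma powR_jker y b : y != 0 -> enorm y `^ b * jker y = enorm y `^ (b - n%:R - 2 * s).
Proof.
move=> y0; rewrite -powRD ?(gt_eqF (_ : 0 < enorm y)) ?enorm_gt0 ?implybT//.
by congr (_ `^ _); ring.
Qed.

Lemma jker_far : exists2 C, 0 < C & forall r, 0 < r ->
  intg (fun y => ind (r <= enorm y) * jker y) /\
  INT (fun y => ind (r <= enorm y) * jker y) <= C * r `^ (- (2 * s)).
Proof. by apply: intg_far => //; rewrite mulr_gt0. Qed.

Lemma jker_far_growth (g : R) : 0 < g -> exists2 C, 0 < C & forall r, 0 < r ->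
  intg (fun y => ind (r <= enorm y) * (enorm y `^ (2 * s - g) * jker y)) /\
  INT (fun y => ind (r <= enorm y) * (enorm y `^ (2 * s - g) * jker y)) <= C * r `^ (- g).
Proof.
move=> g0; have [C C0 h] := intg_far n g0; exists C => // r r0.
rewrite (_ : (fun y => _) = (fun y => ind (r <= enorm y) * enorm y `^ (- n%:R - g))); first exact: h.
apply/funext => y; case: (leP r (enorm y)) => [ry|]; last by rewrite /ind !mul0r.
rewrite powR_jker -?enorm_gt0 ?(lt_le_trans r0)//; congr (_ * _ `^ _); ring.
Qed.

Lemma jker_near : exists2 C, 0 < C & forall r, 0 < r ->
  intg (fun y => ind (enorm y < r) * (enorm y ^+ 2 * jker y)) /\
  INT (fun y => ind (enorm y < r) * (enorm y ^+ 2 * jker y)) <= C * r `^ (2 - 2 * s).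
Proof.
have b0 : 0 < 2 - 2 * s by rewrite subr_gt0 gtr_pMr.
have [C C0 h] := intg_near n b0; exists C; first exact: C0.
move=> r r0; have -> : (fun y : 'rV[R]_n => ind (enorm y < r) * (enorm y ^+ 2 * jker y)) =
    (fun y => ind (enorm y < r) * (ind (0 < enorm y) * enorm y `^ (2 - 2 * s - n%:R))).
  apply/funext => y; congr (_ * _); have [->|y0] := eqVneq y 0.
    by rewrite jker0 enorm0 ltxx /ind mulr0 mul0r.
  rewrite -powR_mulrn ?enorm_ge0// powR_jker// enorm_gt0 y0 /ind mul1r.
  by congr (_ `^ _); ring.
exact: h r r0.
Qed.

Lemma powR_sub2 (r : R) : 0 < r -> r `^ (2 - 2 * s) = r `^ (- (2 * s)) * r ^+ 2.
Proof.
move=> r0; rewrite -powR_mulrn ?(ltW r0)// -powRD ?(gt_eqF r0) ?implybT//.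
by congr (_ `^ _); ring.
Qed.

Lemma jker_min : exists2 C, 0 < C & forall r, 0 < r ->
  intg (fun y => Num.min 1 (enorm y ^+ 2 / r ^+ 2) * jker y) /\
  INT (fun y => Num.min 1 (enorm y ^+ 2 / r ^+ 2) * jker y) <= C * r `^ (- (2 * s)).
Proof.
have [C1 C10 h1] := jker_far; have [C2 C20 h2] := jker_near.
exists (C1 + C2); first by rewrite addr_gt0.
move=> r r0; have [i1 H1] := h1 _ r0; have [i2 H2] := h2 _ r0.
have r2 : 0 < r ^+ 2 by rewrite exprn_gt0.
pose g (y : 'rV[R]_n) : R := ind (r <= enorm y) * jker y + (r ^+ 2)^-1 * (ind (enorm y < r) * (enorm y ^+ 2 * jker y)).
have ig : intg g by apply: intgD => //; apply: intgZ.
have le y : Num.min 1 (enorm y ^+ 2 / r ^+ 2) * jker y <= g y.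
  rewrite /g; case: (leP r (enorm y)) => ry; rewrite /ind ?mul1r ?mul0r ?mulr0 ?addr0 ?add0r.
    by rewrite ler_piMl ?jker_ge0// ge_min lexx.
  by rewrite mulrA [_^-1 * _]mulrC ler_wpM2r ?jker_ge0// ge_min lexx orbT.
have ge y : 0 <= Num.min 1 (enorm y ^+ 2 / r ^+ 2) * jker y.
  by rewrite mulr_ge0 ?jker_ge0// le_min ler01 divr_ge0 ?sqr_ge0.
have ii : intg (fun y => Num.min 1 (enorm y ^+ 2 / r ^+ 2) * jker y).
  apply: intg_le ig.
    apply: measurable_funM; last exact: meas_jker.
    apply: measurable_minr => //; apply: measurable_funM => //.
    by apply: measurable_funX; exact: meas_enorm.
  by move=> y; rewrite ger0_norm.
split => //; apply: le_trans (INT_le ii ig le) _.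
rewrite INTD//; last exact: intgZ.
rewrite INTZ// mulrDl lerD// ler_pdivrMl// (le_trans H2)// powR_sub2//.
by rewrite le_eqVlt; apply/orP; left; apply/eqP; ring.
Qed.

Lemma jker_far_ge : exists2 c, 0 < c & forall r, 0 < r ->
  c * r `^ (- (2 * s)) <= INT (fun y => ind (r <= enorm y) * jker y).
Proof.
have nn : 0 < n%:R :> R by rewrite ltr0n.
have n1 : 1 <= n%:R :> R by rewrite (ler_nat _ 1 n).
(* The volume bounds lose a dimensional factor: the ball of radius [A * r] has measure at least
   [(4 * r) ^+ n], the one of radius [r] at most [(2 * r) ^+ n], so the annulus between them has a
   definite measure. *)
pose A : R := 4 * n%:R.
have A0 : 0 < A by rewrite mulr_gt0.
exists (A `^ (- n%:R - 2 * s) * (4 ^+ n - 2 ^+ n)).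
  rewrite mulr_gt0 ?powR_gt0// subr_gt0 ltr_pXn2r ?nnegrE// ?ltr_nat//.
move=> r r0; have [C1 C10 h1] := jker_far; have [i1 _] := h1 _ r0.
pose c := (A * r) `^ (- n%:R - 2 * s).
have c0 : 0 <= c by exact: powR_ge0.
have rA : r <= A * r by rewrite ler_peMl ?(ltW r0)// /A; lra.
pose g (y : 'rV[R]_n) : R := c * (ind (enorm (y - 0) < A * r) - ind (enorm (y - 0) < r)).
have ig : intg g by apply: intgZ; apply: intgB; exact: intg_ball.
apply: (@le_trans _ _ (INT g)); last first.
  apply: INT_le => // y; rewrite /g subr0.
  case: (leP r (enorm y)) => ry; last first.
    by rewrite (lt_le_trans ry rA) /ind subrr mulr0 mul0r.
  rewrite /ind mul1r subr0; case: (ltP (enorm y) (A * r)) => yA; last by rewrite mulr0 jker_ge0.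
  rewrite mulr1 /c /jker -opprD; apply: ler_powRN; rewrite ?(lt_le_trans r0)// ?(ltW yA)//.
  by rewrite addr_ge0// mulr_ge0// ltW.
rewrite INTZ; last by apply: intgB; exact: intg_ball.
rewrite INTB; [|exact: intg_ball|exact: intg_ball].
apply: (@le_trans _ _ (c * ((A * r / n%:R) ^+ n - (2 * r) ^+ n))).
  rewrite /c powRM ?(ltW A0) ?(ltW r0)// (_ : A * r / n%:R = 4 * r); last by rewrite /A; field; rewrite gt_eqF.
  rewrite !exprMn -mulrBl [r `^ (_ - _)](_ : _ = r `^ (- (2 * s)) * (r ^+ n)^-1); last first.
    rewrite -powR_mulrn ?(ltW r0)// -powRN -powRD ?(gt_eqF r0) ?implybT//.
    by congr (_ `^ _); ring.
  rewrite le_eqVlt; apply/orP; left; apply/eqP; field.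
  by rewrite expf_neq0// gt_eqF.
rewrite ler_wpM2l// lerB// ?INT_ball_ge// ?mulr_gt0//.
exact/INT_ball_le/ltW.
Qed.

End KernelIntegrals.

Ltac nneg := repeat first [by [] | exact: sqr_ge0 | exact: enorm_ge0 | exact: powR_ge0 |
  by apply: ltW | apply: mulr_ge0 | apply: addr_ge0 | apply: exprn_ge0 | rewrite invr_ge0].

(** * Test functions and viscosity subsolutions *)

Section TestFunctions.
Context (R : realType).

(** The derivative is part of the data, so that the rules of calculus produce explicit formulas for
    the barriers. *)
Definition C1fun (q dq : R -> R) := (forall t : R, is_derive t 1 q (dq t)) /\ continuous dq.

Definition C2fun (f f1 f2 : R -> R) := C1fun f f1 /\ C1fun f1 f2.

Lemma C1fun_continuous q dq : C1fun q dq -> continuous q.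
Proof.
move=> [h _] t; have := h t => /@ex_derive/derivable1_diffP/differentiable_continuous; exact.
Qed.

Lemma mean_value (f df : R -> R) (u h : R) : (forall t : R, is_derive t 1 f (df t)) ->
  exists2 v, `|v - u| <= `|h| & f (u + h) - f u = df v * h.
Proof.
move=> fd.
have cf (a b : R) : {within `[a, b], continuous f}.
  apply: continuous_subspaceT => t.
  by have := fd t => /@ex_derive/derivable1_diffP/differentiable_continuous.
have [h0|h0|->] := ltgtP h 0; last by exists u; rewrite ?subrr ?normr0// addr0 subrr mulr0.
- have hu : u + h < u by rewrite gtrDl.
  have [c + e] := MVT hu (fun t _ => fd t) (cf _ _).
  rewrite in_itv/= => /andP[c1 c2]; exists c; last first.
    by rewrite -[LHS]opprB e; ring.
  by rewrite !ler0_norm; lra.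
- have hu : u < u + h by rewrite ltrDl.
  have [c + e] := MVT hu (fun t _ => fd t) (cf _ _).
  rewrite in_itv/= => /andP[c1 c2]; exists c; last by rewrite e; ring.
  by rewrite !ger0_norm; lra.
Qed.

(** Two applications of the mean value theorem, for increments of either sign; the factor 1/2 of the
    Taylor formula is given up. *)
Lemma taylor2 (f f1 f2 : R -> R) (u h B : R) : C2fun f f1 f2 ->
  (forall v, `|v - u| <= `|h| -> `|f2 v| <= B) ->
  `|f (u + h) - f u - f1 u * h| <= B * h ^+ 2.
Proof.
move=> [[df _] [df1 _]] hB.
have [v vu ->] := mean_value u h df.
have [v' vu' e] := mean_value u (v - u) df1.
rewrite -mulrBl -{1}(subrKC u v) e normrM normrM -(real_normK (num_real h)) expr2 mulrA ler_wpM2r//.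
rewrite ler_pM//; exact/hB/(le_trans vu').
Qed.

Lemma continuous_bounded_itv (f : R -> R) (U : R) : continuous f ->
  exists2 B, 0 <= B & forall v, `|v| <= U -> `|f v| <= B.
Proof.
move=> cf; have [U0|U0] := leP 0 U; last first.
  by exists 0 => // v vU; have := le_lt_trans (le_trans (normr_ge0 v) vU) U0; rewrite ltxx.
have UU : - U <= U by lra.
have cn : {within `[- U, U], continuous (fun v => `|f v|)}.
  by apply: continuous_subspaceT => t; apply: continuous_comp; [exact: cf|exact: norm_continuous].
have [c _ hc] := EVT_max UU cn.
exists `|f c| => // v; rewrite ler_norml => /andP[h1 h2]; apply: hc.
by rewrite in_itv/= h1.
Qed.

Context (n : nat).
Implicit Types (x y p h k : 'rV[R]_n) (z w : 'rV[R]_n * R).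

Definition dlt (f : 'rV[R]_n -> R) x y := f (x + y) + f (x - y) - 2 * f x.

Lemma dlt_quad x p y : dlt (fun x => enorm (x - p) ^+ 2) x y = 2 * enorm y ^+ 2.
Proof.
rewrite /dlt (addrAC x y) (addrAC x (- y)) (sqr_enormD (x - p) y) (sqr_enormD (x - p) (- y)) enormN dotvNr; ring.
Qed.

(** Moving [x] by [y] and [- y] changes the argument of [f] by [h1] and [h2], whose sum is
    [2 * a * enorm y ^+ 2] because the scalar products cancel. The first-order Taylor terms add up
    to the first summand, and each remainder is at most [B * eta ^+ 2]. *)
Lemma dlt_base (f f1 f2 : R -> R) (a c B : R) x p y : 0 <= a -> C2fun f f1 f2 ->
  let u := a * enorm (x - p) ^+ 2 + c in
  let eta := a * (2 * enorm (x - p) * enorm y + enorm y ^+ 2) in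
  (forall v, `|v - u| <= eta -> `|f2 v| <= B) ->
  `|dlt (fun x => f (a * enorm (x - p) ^+ 2 + c)) x y| <=
  `|f1 u| * (2 * a * enorm y ^+ 2) + 2 * B * eta ^+ 2.
Proof.
move=> a0 cf u eta hB.
have eta0 : 0 <= eta.
  by rewrite mulr_ge0// addr_ge0 ?sqr_ge0// mulr_ge0 ?enorm_ge0// mulr_ge0 ?enorm_ge0.
have B0 : 0 <= B by apply: le_trans (normr_ge0 _) (hB u _); rewrite subrr normr0.
pose h1 := a * (2 * dotv (x - p) y + enorm y ^+ 2).
pose h2 := a * (- (2 * dotv (x - p) y) + enorm y ^+ 2).
have CS := CauchySchwarz (x - p) y.
have e1 : a * enorm (x + y - p) ^+ 2 + c = u + h1.
  by rewrite addrAC (sqr_enormD (x - p) y) /u /h1; ring.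
have e2 : a * enorm (x - y - p) ^+ 2 + c = u + h2.
  by rewrite addrAC (sqr_enormD (x - p) (- y)) dotvNr enormN /u /h2; ring.
have sq := sqr_ge0 (enorm y).
have l1 : `|h1| <= eta.
  rewrite normrM (ger0_norm a0) ler_wpM2l// (le_trans (ler_normD _ _))//.
  by rewrite normrM (ger0_norm sq) ger0_norm// lerD2r -mulrA ler_wpM2l.
have l2 : `|h2| <= eta.
  rewrite normrM (ger0_norm a0) ler_wpM2l// (le_trans (ler_normD _ _))//.
  by rewrite normrN normrM (ger0_norm sq) ger0_norm// lerD2r -mulrA ler_wpM2l.
have t1 := @taylor2 _ _ _ u h1 B cf (fun v hv => hB v (le_trans hv l1)).
have t2 := @taylor2 _ _ _ u h2 B cf (fun v hv => hB v (le_trans hv l2)).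
have s1 : B * h1 ^+ 2 <= B * eta ^+ 2.
  by rewrite ler_wpM2l// -(real_normK (num_real h1)) ler_pXn2r ?nnegrE.
have s2 : B * h2 ^+ 2 <= B * eta ^+ 2.
  by rewrite ler_wpM2l// -(real_normK (num_real h2)) ler_pXn2r ?nnegrE.
rewrite /dlt e1 e2.
rewrite (_ : _ - _ = (f (u + h1) - f u - f1 u * h1) + (f (u + h2) - f u - f1 u * h2) + f1 u * (2 * a * enorm y ^+ 2)); last first.
  by rewrite /h1 /h2 -/u; ring.
apply: le_trans (ler_normD _ _) _; rewrite addrC lerD//.
  rewrite normrM (@ger0_norm _ (2 * a * _))//; apply: mulr_ge0 => //.
  exact: mulr_ge0.
by apply: le_trans (ler_normD _ _) _; lra.
Qed.

Lemma is_derive_line (F : 'rV[R]_n -> R) x h (d : R) :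
  is_derive (0 : R) 1 (fun tau : R => F (tau *: h + x)) d -> is_derive x h F d.
Proof.
move=> [dF <-].
have e : (fun tau : R => tau^-1 *: ((F \o shift x) (tau *: h) - F x)) =
    (fun tau : R => tau^-1 *: (((fun tau : R => F (tau *: h + x)) \o shift 0) (tau *: (1 : R)) - (fun tau : R => F (tau *: h + x)) 0)).
  by apply/funext => tau /=; rewrite addr0 scale0r add0r /GRing.scale /= mulr1.
by split; [rewrite /derivable e; exact: dF|rewrite /derive e].
Qed.

(** Common shape of the pieces of all barriers: [f] is a radial profile around [p], [m] its height
    in time, and [q] a shift of the argument that moves the level sets of the profile in time. *)
Definition basefun (m f : R -> R) (a : R) p (q : R -> R) z : R :=
  m z.2 * f (a * enorm (z.1 - p) ^+ 2 + q z.2).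

Lemma sqr_enorm_line x h p (tau : R) :
  enorm (tau *: h + x - p) ^+ 2 = enorm (x - p) ^+ 2 + tau * (2 * dotv (x - p) h) + tau ^+ 2 * enorm h ^+ 2.
Proof.
rewrite -addrA addrC (sqr_enormD (x - p) (tau *: h)) dotvZr enormZ exprMn real_normK ?num_real//; ring.
Qed.

Lemma is_derive_base_x (c b : R) (f f1 : R -> R) (a : R) x h p :
  (forall t : R, is_derive t 1 f (f1 t)) ->
  is_derive x h (fun x => c * f (a * enorm (x - p) ^+ 2 + b))
    (c * (f1 (a * enorm (x - p) ^+ 2 + b) * (2 * a * dotv (x - p) h))).
Proof.
move=> df; apply: is_derive_line.
pose g (tau : R) := a * (enorm (x - p) ^+ 2 + tau * (2 * dotv (x - p) h) + tau ^+ 2 * enorm h ^+ 2) + b.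
rewrite (_ : (fun tau : R => _) = (fun tau => c * f (g tau))); last first.
  by apply/funext => tau; rewrite sqr_enorm_line.
have dg : is_derive (0 : R) 1 g (2 * a * dotv (x - p) h).
  apply: is_derive_eq; rewrite /GRing.scale /=; ring.
have g0 : g 0 = a * enorm (x - p) ^+ 2 + b by rewrite /g; ring.
have dfg : is_derive (0 : R) 1 (f \o g) (f1 (a * enorm (x - p) ^+ 2 + b) * (2 * a * dotv (x - p) h)).
  have := df (g 0); rewrite g0 => hf.
  by apply: is_derive1_comp; rewrite g0.
exact: (is_deriveZ c dfg).
Qed.

Lemma is_derive_base_xx (c b : R) (f f1 : R -> R) (a : R) x h k p :
  (forall t : R, is_derive t 1 f (f1 t)) ->
  is_derive x k (fun x => c * (f (a * enorm (x - p) ^+ 2 + b) * (2 * a * dotv (x - p) h)))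
    (c * (f1 (a * enorm (x - p) ^+ 2 + b) * (2 * a * dotv (x - p) k) * (2 * a * dotv (x - p) h)
       + f (a * enorm (x - p) ^+ 2 + b) * (2 * a * dotv k h))).
Proof.
move=> df; apply: is_derive_line.
pose g (tau : R) := a * (enorm (x - p) ^+ 2 + tau * (2 * dotv (x - p) k) + tau ^+ 2 * enorm k ^+ 2) + b.
pose l (tau : R) := 2 * a * (dotv (x - p) h + tau * dotv k h).
rewrite (_ : (fun tau : R => _) = (fun tau => c * (f (g tau) * l tau))); last first.
  apply/funext => tau; rewrite sqr_enorm_line /l (_ : tau *: k + x - p = x - p + tau *: k) ?(dotvDl (x - p)) ?dotvZl//.
  by rewrite -addrA addrC.
have dg : is_derive (0 : R) 1 g (2 * a * dotv (x - p) k).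
  apply: is_derive_eq; rewrite /GRing.scale /=; ring.
have dl : is_derive (0 : R) 1 l (2 * a * dotv k h).
  apply: is_derive_eq; rewrite /GRing.scale /=; ring.
have g0 : g 0 = a * enorm (x - p) ^+ 2 + b by rewrite /g; ring.
have l0 : l 0 = 2 * a * dotv (x - p) h by rewrite /l; ring.
have dfg : is_derive (0 : R) 1 (f \o g) (f1 (a * enorm (x - p) ^+ 2 + b) * (2 * a * dotv (x - p) k)).
  have := df (g 0); rewrite g0 => hf.
  by apply: is_derive1_comp; rewrite g0.
have dm := is_deriveZ c (is_deriveM dfg dl).
apply: is_derive_eq; rewrite /GRing.scale /= g0 l0; ring.
Qed.

Lemma dltZ (c : R) (f : 'rV[R]_n -> R) x y : dlt (fun x => c * f x) x y = c * dlt f x y.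
Proof. by rewrite /dlt; ring. Qed.

Lemma dltD (f g : 'rV[R]_n -> R) x y : dlt (fun x => f x + g x) x y = dlt f x y + dlt g x y.
Proof. by rewrite /dlt; ring. Qed.

Lemma dltN (f : 'rV[R]_n -> R) x y : dlt (fun x => - f x) x y = - dlt f x y.
Proof. by rewrite /dlt; ring. Qed.

(* [C21] only gives directional second derivatives; the quadratic bound on second differences is what makes the near part of the operator converge. *)
Definition tst (phi : 'rV[R]_n * R -> R) := C21 phi /\
  forall z, exists r C, [/\ 0 < r, 0 <= C & forall w y, cylinder r z w -> enorm y < r ->
    `|dlt (fun x => phi (x, w.2)) w.1 y| <= C * enorm y ^+ 2].

Lemma continuous_fst_enorm p : continuous (fun z : 'rV[R]_n * R => enorm (z.1 - p) ^+ 2).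
Proof.
have ce : continuous (fun z : 'rV[R]_n * R => enorm (z.1 - p)).
  move=> z; apply: (@continuous_comp _ _ _ (fun z : 'rV[R]_n * R => z.1 - p) (@enorm R n)); last exact: continuous_enorm.
  by apply: cvgB; [exact: cvg_fst|exact: cvg_cst].
by move=> z; under [X in continuous_at _ X]eq_fun do rewrite expr2; apply: cvgM; exact: ce.
Qed.

Lemma continuous_fst_dotv p h : continuous (fun z : 'rV[R]_n * R => dotv (z.1 - p) h).
Proof.
rewrite (_ : (fun z => _) = (fun z : 'rV[R]_n * R => dotv h (z.1 - p))); last first.
  by apply/funext => z; rewrite dotvC.
move=> z.
apply: (@continuous_comp _ _ _ (fun z : 'rV[R]_n * R => z.1 - p) (dotv h)); last exact: continuous_dotv.
by apply: cvgB; [exact: cvg_fst|exact: cvg_cst].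
Qed.

Lemma continuous_snd_comp (q : R -> R) : continuous q -> continuous (fun z : 'rV[R]_n * R => q z.2).
Proof.
by move=> cq z; apply: (@continuous_comp _ _ _ (@snd _ _) q); [exact: cvg_snd|exact: cq].
Qed.

Lemma continuous_base (m f q : R -> R) (a : R) p : continuous m -> continuous f -> continuous q ->
  continuous (basefun m f a p q).
Proof.
move=> cy cf cq z; apply: cvgM; first exact: continuous_snd_comp.
apply: (@continuous_comp _ _ _ (fun z : 'rV[R]_n * R => a * enorm (z.1 - p) ^+ 2 + q z.2) f); last exact: cf.
apply: cvgD; last exact: continuous_snd_comp.
by apply: cvgM; [exact: cvg_cst|exact: continuous_fst_enorm].
Qed.

Lemma is_derive_base_t (m dm f f1 q dq : R -> R) (a : R) p z : C1fun m dm -> (forall t : R, is_derive t 1 f (f1 t)) ->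
  C1fun q dq -> is_derive z.2 1 (fun tau => basefun m f a p q (z.1, tau))
    (basefun dm f a p q z + basefun (fun t => m t * dq t) f1 a p q z).
Proof.
move=> [hm _] hf [hq _]; rewrite /basefun /=.
pose g (tau : R) := a * enorm (z.1 - p) ^+ 2 + q tau.
have dg : is_derive z.2 1 g (dq z.2).
  have := hq z.2 => hqz.
  have := is_deriveD (is_derive_cst (a * enorm (z.1 - p) ^+ 2) z.2 1) hqz.
  by rewrite add0r.
have dfg : is_derive z.2 1 (f \o g) (f1 (g z.2) * dq z.2).
  have := hf (g z.2) => hfz; exact: is_derive1_comp.
have hmz := hm z.2.
have hM := is_deriveM hmz dfg.
apply: is_derive_eq; rewrite /GRing.scale /=; rewrite /g; ring.
Qed.

Lemma Dt_base (m dm f f1 q dq : R -> R) (a : R) p : C1fun m dm -> (forall t : R, is_derive t 1 f (f1 t)) ->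
  C1fun q dq -> Dt (basefun m f a p q) =
  (fun z => basefun dm f a p q z + basefun (fun t => m t * dq t) f1 a p q z).
Proof.
move=> hm hf hq; apply/funext => z; rewrite /Dt derive1E.
by have := is_derive_base_t a p z hm hf hq => /@derive_val.
Qed.

Lemma Dx_base (m f f1 q : R -> R) (a : R) p h : (forall t : R, is_derive t 1 f (f1 t)) ->
  Dx h (basefun m f a p q) = (fun z => m z.2 * (f1 (a * enorm (z.1 - p) ^+ 2 + q z.2) * (2 * a * dotv (z.1 - p) h))).
Proof.
move=> hf; apply/funext => z; rewrite /Dx /basefun /=.
by have := is_derive_base_x (m z.2) (q z.2) a z.1 h p hf => /@derive_val.
Qed.

Lemma C21_base (m dm f f1 f2 q dq : R -> R) (a : R) p : C1fun m dm -> C2fun f f1 f2 -> C1fun q dq ->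
  C21 (basefun m f a p q).
Proof.
move=> hm [hf hf1] hq.
have cy := C1fun_continuous hm; have cq := C1fun_continuous hq.
have cf := C1fun_continuous hf; have cf1 := C1fun_continuous hf1.
have cdot h : continuous (fun z : 'rV[R]_n * R => 2 * a * dotv (z.1 - p) h).
  by move=> z; apply: cvgM; [exact: cvg_cst|exact: continuous_fst_dotv].
split.
- exact: continuous_base.
- split; first by move=> z; have := is_derive_base_t a p z hm (proj1 hf) hq => /@ex_derive.
  rewrite (Dt_base _ _ hm (proj1 hf) hq) => z; apply: cvgD.
    by apply: continuous_base => //; exact: (proj2 hm).
  apply: continuous_base => // t; apply: cvgM; first exact: cy.
  exact: (proj2 hq).
- move=> h; split; first by move=> z; have := is_derive_base_x (m z.2) (q z.2) a z.1 h p (proj1 hf) => /@ex_derive.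
  rewrite (Dx_base _ _ _ _ h (proj1 hf)) => z.
  rewrite (_ : (fun z => _) = (fun z => basefun m f1 a p q z * (2 * a * dotv (z.1 - p) h))); last first.
    by apply/funext => w; rewrite /basefun mulrA.
  by apply: cvgM; [exact: continuous_base|exact: cdot].
- move=> h k; rewrite (Dx_base _ _ _ _ h (proj1 hf)).
  have dd z := is_derive_base_xx (m z.2) (q z.2) a z.1 h k p (proj1 hf1).
  split; first by move=> z; have := dd z => /@ex_derive.
  rewrite (_ : Dx k _ = (fun z => basefun m f2 a p q z * (2 * a * dotv (z.1 - p) k) * (2 * a * dotv (z.1 - p) h)
       + basefun m f1 a p q z * (2 * a * dotv k h))); last first.
    apply/funext => z; rewrite /Dx /=; have := dd z => /@derive_val ->; rewrite /basefun; ring.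
  move=> z; apply: cvgD.
    apply: cvgM; last exact: cdot.
    by apply: cvgM; [apply: continuous_base => //; exact: (proj2 hf1)|exact: cdot].
  by apply: cvgM; [exact: continuous_base|exact: cvg_cst].
Qed.

End TestFunctions.

(** * Powers of the positive part *)

Section PositivePowers.
Context (R : realType).

(** For positive exponents these truncated powers are closed under differentiation up to a factor
    and gain one order of smoothness per power, so barriers glued from them have explicit
    derivatives. *)
Definition ppow (k : nat) (u : R) : R := Num.max 0 u ^+ k.

Lemma ppow_ge0 k u : 0 <= ppow k u.
Proof. by rewrite exprn_ge0// le_max lexx. Qed.

Lemma ppow_pos k u : 0 <= u -> ppow k u = u ^+ k.
Proof. by move=> u0; rewrite /ppow max_r. Qed.

Lemma ppow_neg k u : u <= 0 -> ppow k.+1 u = 0.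
Proof. by move=> u0; rewrite /ppow max_l// expr0n. Qed.

Lemma continuous_ppow k : continuous (ppow k).
Proof.
move=> u; apply: (@continuous_comp _ _ _ (fun u : R => Num.max 0 u) (fun v : R => v ^+ k)); last exact: exprn_continuous.
by apply: continuous_max; [exact: cvg_cst|exact: cvg_id].
Qed.

Lemma C1fun_comp (f f1 q dq : R -> R) : C1fun f f1 -> C1fun q dq ->
  C1fun (f \o q) (fun t => f1 (q t) * dq t).
Proof.
move=> cf cq; split=> t.
  have := (proj1 cf) (q t) => hf; have := (proj1 cq) t => hq.
  exact: is_derive1_comp.
apply: cvgM; last exact: (proj2 cq).
by apply: (@continuous_comp _ _ _ q f1); [exact: (C1fun_continuous cq)|exact: (proj2 cf)].
Qed.

Lemma C1funD (f f1 q dq : R -> R) : C1fun f f1 -> C1fun q dq ->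
  C1fun (fun t => f t + q t) (fun t => f1 t + dq t).
Proof.
move=> cf cq; split=> t.
  have := (proj1 cf) t => hf; have := (proj1 cq) t => hq; exact: is_deriveD.
by apply: cvgD; [exact: (proj2 cf)|exact: (proj2 cq)].
Qed.

Lemma C1funM (f f1 q dq : R -> R) : C1fun f f1 -> C1fun q dq ->
  C1fun (fun t => f t * q t) (fun t => f1 t * q t + f t * dq t).
Proof.
move=> cf cq; split=> t.
  have := (proj1 cf) t => hf; have := (proj1 cq) t => hq.
  have h := is_deriveM hf hq; apply: is_derive_eq; rewrite /GRing.scale /=; ring.
apply: cvgD; apply: cvgM.
- exact: (proj2 cf).
- exact: (C1fun_continuous cq).
- exact: (C1fun_continuous cf).
- exact: (proj2 cq).
Qed.

Lemma C1fun_cst (c : R) : C1fun (fun=> c) (fun=> 0).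
Proof. by split=> t; [exact: is_derive_cst|exact: cvg_cst]. Qed.

Lemma C1fun_affine (a b : R) : C1fun (fun t => a * t + b) (fun=> a).
Proof.
split=> t; last exact: cvg_cst.
by apply: is_derive_eq; rewrite /GRing.scale /= addr0 mulr1.
Qed.

Lemma C2fun_id : C2fun (fun t : R => t) (fun=> 1) (fun=> 0).
Proof.
split; last exact: C1fun_cst.
by split=> t; [exact: is_derive_id|exact: cvg_cst].
Qed.

Lemma C2fun_cst (c : R) : C2fun (fun=> c) (fun=> 0) (fun=> 0).
Proof. by split; exact: C1fun_cst. Qed.

Lemma C1fun_exprn k : C1fun (fun t : R => t ^+ k.+1) (fun t => k.+1%:R * t ^+ k).
Proof.
elim: k => [|k IH]; have [h1 h2] := C2fun_id.
  rewrite (_ : (fun t => _) = (fun t : R => t)); last by apply/funext => t; rewrite expr1.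
  by rewrite (_ : (fun t => _ * _) = (fun=> 1))//; apply/funext => t; rewrite expr0 mulr1.
have := C1funM h1 IH; rewrite (_ : (fun t => t * t ^+ k.+1) = (fun t : R => t ^+ k.+2)); last first.
  by apply/funext => t; rewrite -exprS.
rewrite (_ : (fun t => _ + _) = (fun t : R => k.+2%:R * t ^+ k.+1))//.
by apply/funext => t; rewrite mul1r mulrCA -exprS -(natr1 k.+1); ring.
Qed.

Lemma is_derive_ppow k (u : R) : is_derive u 1 (ppow k.+2) (k.+2%:R * ppow k.+1 u).
Proof.
have [u0|u0|->] := ltgtP u 0.
- rewrite ppow_neg ?ltW// mulr0.
  apply: (@near_eq_is_derive _ _ _ (cst 0)); rewrite ?oner_eq0//.
  near=> v; rewrite ppow_neg// ltW//; near: v; exact: lt_nbhsl.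
- rewrite ppow_pos ?ltW//.
  apply: (@near_eq_is_derive _ _ _ (fun v : R => v ^+ k.+2)); rewrite ?oner_eq0//.
    near=> v; rewrite ppow_pos// ltW//; near: v; exact: lt_nbhsr.
  exact: (proj1 (C1fun_exprn k.+1)).
(* At the junction [u = 0] the difference quotient is at most [|h| ^+ k.+1 <= |h|] as soon as
   [|h| < 1]. *)
- rewrite ppow_neg// mulr0.
  have h : (fun h : R => h^-1 *: ((ppow k.+2 \o shift 0) (h *: (1 : R)) - ppow k.+2 0)) @ 0^' --> (0 : R).
    apply/cvgr0Pnorm_lt => e e0; near=> h.
    rewrite /= addr0 (ppow_neg k.+1 (lexx 0)) subr0 /GRing.scale /= mulr1.
    have h0 : h != 0 by near: h; exact: nbhs_dnbhs_neq.
    have he : `|h| < Num.min e 1.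
      near: h; apply: dnbhs0_lt; by rewrite lt_min e0 ltr01.
    move: he; rewrite lt_min => /andP[he h1].
    apply: le_lt_trans he; rewrite normrM normfV ler_pdivrMl ?normr_gt0// -expr2.
    rewrite (ger0_norm (ppow_ge0 _ _)).
    apply: (@le_trans _ _ (`|h| ^+ k.+2)).
      by rewrite lerXn2r// ?nnegrE ?le_max ?lexx// ge_max normr_ge0 ler_norm.
    by apply: ler_wiXn2l => //; exact: ltW.
  split; last exact: cvg_lim h.
  by apply/cvg_ex; exists 0.
Unshelve. all: by end_near. Qed.

Lemma C1fun_ppow k : C1fun (ppow k.+2) (fun u => k.+2%:R * ppow k.+1 u).
Proof.
split=> [u|u]; first exact: is_derive_ppow.
by apply: cvgM; [exact: cvg_cst|exact: continuous_ppow].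
Qed.

Lemma eq_C1fun (f f1 g g1 : R -> R) : C1fun f f1 -> f =1 g -> f1 =1 g1 -> C1fun g g1.
Proof. by move=> h /funext <- /funext <-. Qed.

End PositivePowers.

Section Viscosity.
Context (R : realType) (n : nat).
Implicit Types (x y p h : 'rV[R]_n) (z : 'rV[R]_n * R) (phi psi w : 'rV[R]_n * R -> R).

Lemma continuous_epsR (q : R -> R) (t : R) : {for t, continuous q} -> forall e : R, 0 < e ->
  exists2 d, 0 < d & forall u, `|u - t| < d -> `|q u - q t| < e.
Proof.
move=> cq e e0; have /cvgrPdist_lt/(_ _ e0)/nbhs_ballP[d /= d0 hd] := cq.
by exists d => // u ud; rewrite distrC; apply: hd; rewrite -ball_normE /= distrC.
Qed.

Lemma continuous_epsXP phi z : {for z, continuous phi} <-> (forall e : R, 0 < e ->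
  exists2 d, 0 < d & forall v, cylinder d z v -> `|phi v - phi z| < e).
Proof.
split=> [cq e e0|h].
  have /cvgrPdist_lt/(_ _ e0)/nbhs_ballP[d /= d0 hd] := cq.
  exists d => // -[u t] [/= ud td]; rewrite distrC; apply: hd; split; rewrite /= -ball_normE /= distrC//.
  exact: le_lt_trans (le_norm_enorm _) ud.
apply/cvgrPdist_lt => e e0; have [d d0 hd] := h _ e0.
exists ([set u | enorm (z.1 - u) < d], [set t | `|z.2 - t| < d]) => /=.
  split; first exact: lt_enorm_ball.
  by apply/nbhs_ballP; exists d.
move=> [u t] [/= ud td]; rewrite distrC; apply: hd; split => /=; first by rewrite enormB.
by rewrite distrC.
Qed.

(** The local quadratic bound comes from [dlt_base], with [f1] and [f2] bounded on compact intervals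
    that contain all values of the argument near [z] and, for [f2], its variation [eta0] for
    [|y| < 1]. *)
Lemma tst_base (m dm f f1 f2 q dq : R -> R) (a : R) p : 0 <= a ->
  C1fun m dm -> C2fun f f1 f2 -> C1fun q dq -> tst (basefun m f a p q).
Proof.
move=> a0 hm hf hq; split; first exact: C21_base hm hf hq.
move=> z.
have cq : {for z.2, continuous q} by exact: (C1fun_continuous hq).
have cm : {for z.2, continuous m} by exact: (C1fun_continuous hm).
have [d d0 hd] : exists2 d, 0 < d & forall t, `|t - z.2| < d -> `|q t - q z.2| < 1 /\ `|m t - m z.2| < 1.
  have [d1 d10 h1] := continuous_epsR cq ltr01; have [d2 d20 h2] := continuous_epsR cm ltr01.
  exists (Num.min d1 d2) => [|t]; first by rewrite lt_min d10.
  by rewrite lt_min => /andP[/h1 ? /h2].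
pose E0 := enorm (z.1 - p) + 1; have E00 : 0 <= E0 by rewrite addr_ge0 ?enorm_ge0.
pose U := a * E0 ^+ 2 + `|q z.2| + 1.
pose eta0 := a * (2 * E0 + 1).
have eta00 : 0 <= eta0 by rewrite mulr_ge0// addr_ge0// mulr_ge0.
have [B1 B10 hB1] := continuous_bounded_itv U (proj2 (proj1 hf)).
have [B2 B20 hB2] := continuous_bounded_itv (U + eta0) (proj2 (proj2 hf)).
exists (Num.min d 1), ((`|m z.2| + 1) * (B1 * (2 * a) + 2 * B2 * eta0 ^+ 2)); split.
- by rewrite lt_min d0 ltr01.
- nneg.
move=> v y [v1 v2] y1; have [q1 m1] : `|q v.2 - q z.2| < 1 /\ `|m v.2 - m z.2| < 1.
  by apply: hd; rewrite (lt_le_trans v2)// ge_min lexx.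
have {}y1 : enorm y < 1 by rewrite (lt_le_trans y1)// ge_min lexx orbT.
have {}v1 : enorm (v.1 - z.1) < 1 by rewrite (lt_le_trans v1)// ge_min lexx orbT.
have vp : enorm (v.1 - p) <= E0.
  rewrite -(subrKA z.1 v.1 (- p)) addrC.
  by rewrite (le_trans (ler_enormD _ _))// lerD2l ltW.
rewrite /basefun /= dltZ normrM.
have mv : `|m v.2| <= `|m z.2| + 1.
  rewrite -{1}(subrK (m z.2) (m v.2)) (le_trans (ler_normD _ _))// addrC lerD2l ltW//.
have qv : `|q v.2| <= `|q z.2| + 1.
  rewrite -{1}(subrK (q z.2) (q v.2)) (le_trans (ler_normD _ _))// addrC lerD2l ltW//.
have y0 := enorm_ge0 y; have x0 := enorm_ge0 (v.1 - p).
have etale : a * (2 * enorm (v.1 - p) * enorm y + enorm y ^+ 2) <= eta0 * enorm y.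
  rewrite /eta0 -[leRHS]mulrA ler_wpM2l// mulrDl mul1r; nra.
have ule : `|a * enorm (v.1 - p) ^+ 2 + q v.2| <= U.
  rewrite /U -addrA (le_trans (ler_normD _ _))// lerD// normrM (ger0_norm a0) ler_wpM2l//.
  by rewrite normrX (ger0_norm x0) ler_pXn2r ?nnegrE.
rewrite -[leRHS]mulrA ler_pM//.
apply: le_trans (@dlt_base _ _ _ _ _ a (q v.2) B2 v.1 p y a0 hf _) _.
  move=> u /= uu; apply: hB2; rewrite -{1}(subrK (a * enorm (v.1 - p) ^+ 2 + q v.2) u).
  rewrite (le_trans (ler_normD _ _))// addrC lerD// (le_trans uu)// (le_trans etale)//.
  by rewrite ler_piMr// ltW.
rewrite [leRHS]mulrDl; apply: lerD.
  by rewrite mulrA ler_wpM2r ?sqr_ge0// ler_wpM2r ?hB1// mulr_ge0.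
rewrite -[leRHS]mulrA -exprMn ler_wpM2l ?mulr_ge0// ler_pXn2r// ?nnegrE ?mulr_ge0//.
  by rewrite addr_ge0 ?sqr_ge0// mulr_ge0// mulr_ge0.
by rewrite addr_ge0// mulr_ge0.
Qed.

Lemma C21_Dt_is_derive phi z : C21 phi -> is_derive z.2 1 (fun tau : R => phi (z.1, tau)) (Dt phi z).
Proof.
move=> [_ [d _] _ _]; rewrite /Dt derive1E; exact: DeriveDef.
Qed.

Lemma tst_DtD phi psi z : tst phi -> tst psi -> Dt (fun z => phi z + psi z) z = Dt phi z + Dt psi z.
Proof.
move=> [hphi _] [hpsi _].
have h1 := C21_Dt_is_derive z hphi; have h2 := C21_Dt_is_derive z hpsi.
by rewrite /Dt derive1E /=; have := is_deriveD h1 h2 => /@derive_val.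
Qed.

Lemma tstD phi psi : tst phi -> tst psi -> tst (fun z => phi z + psi z).
Proof.
move=> tphi tpsi; have [cphi lphi] := tphi; have [cpsi lpsi] := tpsi.
split; last first.
  move=> z; have [r1 [C1 [r10 C10 h1]]] := lphi z; have [r2 [C2 [r20 C20 h2]]] := lpsi z.
  exists (Num.min r1 r2), (C1 + C2); split; rewrite ?lt_min ?r10 ?addr_ge0//.
  move=> v y [v1 v2] yr; rewrite dltD (le_trans (ler_normD _ _))// mulrDl lerD//.
    by apply: h1; [split|]; rewrite (lt_le_trans v1, lt_le_trans v2, lt_le_trans yr) // ge_min lexx.
  by apply: h2; [split|]; rewrite (lt_le_trans v1, lt_le_trans v2, lt_le_trans yr) // ge_min lexx orbT.
have [c1 [d1 e1] f1 g1] := cphi; have [c2 [d2 e2] f2 g2] := cpsi.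
have DxD h : Dx h (fun z => phi z + psi z) = (fun z => Dx h phi z + Dx h psi z).
  apply/funext => z; rewrite /Dx.
  by have := deriveD ((f1 h).1 z) ((f2 h).1 z).
split.
- by move=> z; apply: cvgD; [exact: c1|exact: c2].
- split; first by move=> z; have := derivableD (d1 z) (d2 z).
  rewrite (_ : Dt _ = (fun z => Dt phi z + Dt psi z)).
    by move=> z; apply: cvgD; [exact: e1|exact: e2].
  by apply/funext => z; exact: tst_DtD.
- move=> h; split; first by move=> z; have := derivableD ((f1 h).1 z) ((f2 h).1 z).
  by rewrite DxD => z; apply: cvgD; [exact: (f1 h).2|exact: (f2 h).2].
- move=> h k; rewrite DxD; split; first by move=> z; have := derivableD ((g1 h k).1 z) ((g2 h k).1 z).
  rewrite (_ : Dx k _ = (fun z => Dx k (Dx h phi) z + Dx k (Dx h psi) z)).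
    by move=> z; apply: cvgD; [exact: (g1 h k).2|exact: (g2 h k).2].
  apply/funext => z; rewrite {1}/Dx.
  by have := deriveD ((g1 h k).1 z) ((g2 h k).1 z).
Qed.

End Viscosity.

(** * Subsolutions and comparison with a barrier *)

Section ViscositySub.
Context (R : realType) (n : nat).
Implicit Types (x y p : 'rV[R]_n) (z : 'rV[R]_n * R) (phi psi w h : 'rV[R]_n * R -> R)
  (k : 'rV[R]_n -> R).

(** Near the contact point the test function is seen, further away the subsolution. Each second
    difference uses its own central value, so adding a constant to [f] or to [g] leaves the operator
    unchanged; a barrier can therefore be inserted without the constant that lifts it to contact. *)
Definition gop k (r : R) (f g : 'rV[R]_n -> R) x : R :=
  2^-1 * INT (fun y => (if enorm y < r then dlt f x y else dlt g x y) * k y).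

(* Subsolutions of [d_t w - L w <= c], without principal value; supersolutions are described as functions [w] whose opposite is a subsolution. *)
Definition vsub k (c : R) (Om : set ('rV[R]_n * R)) w := forall z r phi,
  0 < r -> cylinder r z `<=` Om -> tst phi -> phi z = w z ->
  (forall v, cylinder r z v -> w v <= phi v) ->
  Dt phi z <= c + gop k r (fun x => phi (x, z.2)) (fun x => w (x, z.2)) z.1.

Lemma Dt_time (q dq : R -> R) z : C1fun q dq -> Dt (fun w : 'rV[R]_n * R => q w.2) z = dq z.2.
Proof.
by move=> [h _]; rewrite /Dt derive1E /=; have := h z.2 => /@derive_val.
Qed.

Lemma tst_time (q dq : R -> R) : C1fun q dq -> tst (fun w : 'rV[R]_n * R => q w.2).
Proof.
move=> hq; rewrite (_ : (fun w : 'rV[R]_n * R => q w.2) = basefun q (fun=> 1) 0 0 (fun=> 0)).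
  exact: (tst_base _ (lexx 0) hq (C2fun_cst 1) (C1fun_cst 0)).
by apply/funext => w; rewrite /basefun mulr1.
Qed.

Lemma tst_continuous phi : tst phi -> continuous phi.
Proof. by move=> [[]]. Qed.

Lemma compact_cyl p r1 (ta tb : R) :
  compact ([set x : 'rV[R]_n | enorm (x - p) <= r1] `*` `[ta, tb]%classic).
Proof.
apply: compact_setX; last exact: segment_compact.
apply: bounded_closed_compact.
  rewrite /bounded_set /bounded_near; near=> M => x /= xr.
  apply: le_trans (le_norm_enorm _) _.
  rewrite -(subrK p x) (le_trans (ler_enormD _ _))//.
  apply: (@le_trans _ _ (r1 + enorm p)); first by rewrite lerD2r.
  near: M; apply: nbhs_pinfty_ge; exact: num_real.
apply: (@closed_comp _ _ (fun x : 'rV[R]_n => enorm (x - p)) [set u : R | u <= r1]); last exact: closed_le.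
move=> x _; apply: (@lipschitz_continuous_enorm _ _ 1) => u v.
by rewrite mul1r (le_trans (ler_dist_enorm _ _))// opprB addrA subrK.
Unshelve. all: by end_near. Qed.

Lemma cyl_max (F : 'rV[R]_n * R -> R) p r1 ta tb z0 : continuous F ->
  enorm (z0.1 - p) <= r1 -> ta <= z0.2 <= tb ->
  exists z, [/\ enorm (z.1 - p) <= r1, ta <= z.2 <= tb &
    forall z', enorm (z'.1 - p) <= r1 -> ta <= z'.2 <= tb -> F z' <= F z].
Proof.
move=> cF h1 h2.
have [||z] := @compact_EVT_max _ _ F _ _ (@compact_cyl p r1 ta tb).
- by exists z0; split => //=; rewrite in_itv.
- exact: continuous_subspaceT.
rewrite inE => -[/= z1]; rewrite in_itv/= => z2 hz; exists z; split => // z' z'1 z'2.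
by apply: hz; rewrite inE; split => //=; rewrite in_itv.
Qed.

(** A maximum at the final time would not be interior to any cylinder. A nondecreasing penalty that
    is active only after [tb'] excludes it, and its derivative has the favourable sign. *)
Lemma time_penalty (tb' tb M : R) : tb' < tb -> 0 <= M -> exists P dP : R -> R,
  [/\ C1fun P dP, (forall t, 0 <= P t), (forall t, 0 <= dP t),
    (forall t, t <= tb' -> P t = 0) & P tb = M].
Proof.
move=> tt M0; have d0 : 0 < tb - tb' by rewrite subr_gt0.
pose N := M / (tb - tb') ^+ 2.
have N0 : 0 <= N by rewrite divr_ge0 ?sqr_ge0.
exists (fun t => N * ppow 2 (1 * t + - tb')), (fun t => 0 * ppow 2 (1 * t + - tb') + N * (2%:R * ppow 1 (1 * t + - tb') * 1)).
split.
- exact: eq_C1fun (C1funM (C1fun_cst N) (C1fun_comp (C1fun_ppow R 0) (C1fun_affine 1 (- tb')))) (fun=> erefl) (fun=> erefl).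
- by move=> t; rewrite mulr_ge0 ?ppow_ge0.
- by move=> t; rewrite mul0r add0r mulr1 mulr_ge0// mulr_ge0 ?ppow_ge0.
- by move=> t tt'; rewrite ppow_neg ?mulr0// mul1r subr_le0.
- by rewrite mul1r ppow_pos ?(ltW d0)// mulfVK// expf_neq0// gt_eqF.
Qed.

(** If [w] exceeds [h] somewhere before [tb'], maximise [w - h - P] on the closed cylinder, with [P]
    the time penalty. The lateral and initial conditions and the penalty force an interior maximum,
    where [h + P] plus a constant touches [w] from above, against the strict inequality of the
    barrier. That inequality is thus only requested where [h < w], and it may use the maximality of
    [w - h] in the time slice. *)
Lemma barrier_le k c Om w h p (r1 ta tb' tb : R) :
  continuous w -> vsub k c Om w -> tst h -> tb' < tb ->
  (forall x t, enorm (x - p) = r1 -> ta <= t <= tb -> w (x, t) <= h (x, t)) ->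
  (forall x, enorm (x - p) <= r1 -> w (x, ta) <= h (x, ta)) ->
  (forall x t, enorm (x - p) < r1 -> ta < t < tb -> h (x, t) < w (x, t) ->
     (forall x', enorm (x' - p) <= r1 -> w (x', t) - w (x, t) <= h (x', t) - h (x, t)) ->
     (exists2 rho, 0 < rho & cylinder rho (x, t) `<=` Om) /\
     (exists2 rs, 0 < rs & forall r, 0 < r -> r < rs ->
        c + gop k r (fun x => h (x, t)) (fun x => w (x, t)) x < Dt h (x, t))) ->
  forall x t, enorm (x - p) <= r1 -> ta <= t <= tb' -> w (x, t) <= h (x, t).
Proof.
move=> cw vw th tt hlat hini hop x0 t0 hx0 ht0.
rewrite leNgt; apply/negP => hlt.
have ch := tst_continuous th.
have cwh : continuous (fun z => w z - h z).
  by move=> z; apply: cvgB; [exact: cw|exact: ch].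
have t0b : ta <= t0 <= tb by case/andP: ht0 => -> /= /le_trans; apply; exact: ltW.
have [zm [_ _ zmax]] := @cyl_max _ p r1 ta tb (x0, t0) cwh hx0 t0b.
(* The maximum without penalty; a penalty of [|M0| + 1] at [tb] makes the penalised difference
   negative there. *)
pose M0 := w zm - h zm.
have d0 : 0 < tb - tb' by rewrite subr_gt0.
have M1 : 0 <= `|M0| + 1 by rewrite addr_ge0.
have [P [dP [CP P0 dP0 Pz Pb]]] := time_penalty tt M1.
have tP := tst_time CP.
have cF : continuous (fun z => (w z - h z) - P z.2).
  move=> z; apply: cvgB; first exact: cwh.
  exact: (tst_continuous tP).
have [[x t] [/= hx ht hmax]] := @cyl_max _ p r1 ta tb (x0, t0) cF hx0 t0b.
pose m := w (x, t) - h (x, t) - P t.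
have m0 : 0 < m.
  have := hmax (x0, t0) hx0 t0b; rewrite /= -/m => /(lt_le_trans _); apply.
  by rewrite Pz ?subr0 ?subr_gt0//; case/andP: ht0.
have hw : h (x, t) < w (x, t).
  by rewrite -subr_gt0 (lt_le_trans m0)// /m lerBlDr lerDl P0.
have xr : enorm (x - p) < r1.
  rewrite lt_neqAle hx andbT; apply/eqP => e.
  by have := hlat x t e ht; rewrite leNgt hw.
have tta : ta < t.
  case/andP: ht => h1 _; rewrite lt_neqAle h1 andbT; apply/eqP => e.
  by have := hini x hx; rewrite e leNgt hw.
have ttb : t < tb.
  case/andP: ht => h1 h2; rewrite lt_neqAle h2 andbT; apply/eqP => e.
  have : m <= M0 - (`|M0| + 1).
    rewrite /m e lerB//.
      have := zmax (x, tb); rewrite -e /= -/M0; apply => //; exact/andP.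
    by rewrite Pb.
  have := ler_norm M0 => h3 h4; have : m < 0 by apply: le_lt_trans h4 _; lra.
  by rewrite ltNge (ltW m0).
have [||[rho rho0 cyl] [rs rs0 hrs]] := hop x t xr _ hw _.
- by rewrite tta ttb.
- move=> x' hx'; have := hmax (x', t) hx' ht; rewrite /= => hm; lra.
(* Half of the minimum, so that the cylinder of radius [e] stays strictly inside the region of
   maximisation and inside [Om], and [e] is an admissible radius for the barrier. *)
pose e := Num.min (Num.min rho rs) (Num.min (r1 - enorm (x - p)) (Num.min (t - ta) (tb - t))) / 2.
have e0 : 0 < e.
  by rewrite divr_gt0// !lt_min rho0 rs0 !subr_gt0 xr tta ttb.
have ee : e < Num.min (Num.min rho rs) (Num.min (r1 - enorm (x - p)) (Num.min (t - ta) (tb - t))).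
  by rewrite /e; set E := Num.min _ _ in e0 *; have : 0 < E / 2 := e0; lra.
move: ee; rewrite !lt_min => /andP[/andP[e1 e2] /andP[e3 /andP[e4 e5]]].
have [Pm [dPm [CPm Pme dPme]]] : exists Pm dPm : R -> R, [/\ C1fun Pm dPm, (forall t, Pm t = P t + m) & forall t, dPm t = dP t + 0].
  by exists (fun t => P t + m), (fun t => dP t + 0); split => //; exact: (C1funD CP (C1fun_cst m)).
have tPm := tst_time CPm.
pose phi z := h z + Pm z.2.
have tphi : tst phi by exact: (tstD th tPm).
have := vw (x, t) e phi e0 _ tphi _ _.
have -> : Dt phi (x, t) = Dt h (x, t) + (dP t + 0).
  by rewrite (tst_DtD _ th tPm) (Dt_time _ CPm) dPme.
have -> : gop k e (fun x1 => phi (x1, (x, t).2)) (fun x1 => w (x1, (x, t).2)) (x, t).1 =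
    gop k e (fun x => h (x, t)) (fun x => w (x, t)) x.
  rewrite /gop /=; congr (_ * INT _); apply/funext => y; congr (_ * _); case: ifP => // _; rewrite /dlt /phi /=; ring.
have hh := hrs e e0 e2.
move=> H; have {}H : Dt h (x, t) + (dP t + 0) <= c + gop k e (fun x => h (x, t)) (fun x => w (x, t)) x.
  apply: H.
  - move=> v [v1 v2]; apply: cyl; split; [exact: lt_trans v1 e1|exact: lt_trans v2 e1].
  - by rewrite /phi /= Pme /m; ring.
  - move=> [x' t'] [/= v1 v2]; have := hmax (x', t'); rewrite /= => hm.
    have : w (x', t') - h (x', t') - P t' <= m.
      apply: hm.
        rewrite -(subrKA x x' (- p)) (le_trans (ler_enormD _ _))//; lra.
      by move: v2; rewrite ltr_norml => /andP[? ?]; apply/andP; split; lra.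
    rewrite /phi /= Pme; lra.
have := dP0 t; lra.
Qed.

End ViscositySub.

Ltac clrP := repeat match goal with H : ?P |- _ => match type of P with Prop => clear H end end.
Ltac lr := clrP; lra.

(** * Uniform bounds over the class of kernels *)

Section Kernels.
Context (R : realType) (n : nat).
Implicit Types (x y p : 'rV[R]_n) (z : 'rV[R]_n * R) (f g h w : 'rV[R]_n -> R) (k : 'rV[R]_n -> R) (s lam Lam r M C : R).
Local Notation bmeas f := (measurable_fun [set: 'rV[R]_n] f).

Definition par s lam Lam : Prop := [/\ (0 < n)%N, 0 < s, s < 1, 0 < lam & 0 < Lam].

(* Unlike [kernel_class], this requires a Borel kernel; at the origin [jker s 0 = 0] forces [k 0 = 0]. *)
Definition kern s lam Lam k := [/\ bmeas k, (forall y, k (- y) = k y) &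
  forall y, lam * jker s y <= k y <= Lam * jker s y].

(** Typical size of the second difference of a bounded function that varies at scale [r]; integrated
    against a kernel of the class it gives a quantity of order [r^(-2s)]. *)
Definition tr r y : R := Num.min 1 (enorm y ^+ 2 / r ^+ 2).

Lemma tr_ge0 r y : 0 <= tr r y.
Proof. by rewrite le_min ler01 divr_ge0 ?sqr_ge0. Qed.

Lemma tr_near r y : 0 < r -> enorm y <= r -> tr r y = enorm y ^+ 2 / r ^+ 2.
Proof.
move=> r0 yr; rewrite /tr min_r// ler_pdivrMr ?exprn_gt0// mul1r ler_pXn2r// ?nnegrE ?enorm_ge0//.
exact: ltW.
Qed.

Lemma tr_far r y : 0 < r -> r <= enorm y -> tr r y = 1.
Proof.
move=> r0 yr; rewrite /tr min_l// ler_pdivlMr ?exprn_gt0// mul1r ler_pXn2r// ?nnegrE ?enorm_ge0//.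
exact: ltW.
Qed.

Lemma meas_tr r : bmeas (tr r).
Proof.
apply: measurable_minr; first exact: measurable_cst.
by apply: measurable_funM; [apply: measurable_funX; exact: meas_enorm|exact: measurable_cst].
Qed.

Lemma meas_shift f x : bmeas f -> bmeas (fun y => f (x + y)).
Proof.
move=> mf; rewrite (_ : (fun y => _) = f \o (fun y => y + x)); last first.
  by apply/funext => y /=; rewrite addrC.
exact: measurableT_comp mf (measurable_shift_rV x).
Qed.

Lemma meas_opp f : bmeas f -> bmeas (fun y => f (- y)).
Proof. by move=> mf; exact: measurableT_comp mf (@measurable_opp_rV _ _). Qed.

Lemma meas_dlt f x : bmeas f -> bmeas (dlt f x).
Proof.
move=> mf; apply: measurable_funB; last exact: measurable_cst.
by apply: measurable_funD; [exact: meas_shift|apply: (meas_opp (f := fun y => f (x + y))); exact: meas_shift].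
Qed.

Lemma meas_if_near r f g : bmeas f -> bmeas g -> bmeas (fun y => if enorm y < r then f y else g y).
Proof.
move=> mf mg; rewrite (_ : (fun y => _) = (fun y => ind (enorm y < r) * f y + ind (r <= enorm y) * g y)).
  by apply: measurable_funD; apply: measurable_funM => //; [apply: meas_ind_lt|apply: meas_ind_le];
    try exact: meas_enorm; exact: measurable_cst.
by apply/funext => y; case: ltP => _; rewrite /ind /= ?mul1r ?mul0r ?addr0 ?add0r.
Qed.

Lemma le_norm_dlt f x y M : (forall x, `|f x| <= M) -> `|dlt f x y| <= 4 * M.
Proof.
move=> fM; have := fM (x + y); have := fM (x - y); have := fM x.
rewrite !ler_norml => /andP[? ?] /andP[? ?] /andP[? ?]; rewrite /dlt; apply/andP; split; lra.
Qed.

Section Bounds.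
Variables (s lam Lam : R).
Hypothesis pp : par s lam Lam.
Let hn : (0 < n)%N. Proof. by case: pp. Qed.
Let s0 : 0 < s. Proof. by case: pp. Qed.
Let s1 : s < 1. Proof. by case: pp. Qed.
Let lam0 : 0 < lam. Proof. by case: pp. Qed.
Let Lam0 : 0 < Lam. Proof. by case: pp. Qed.

Lemma kern_ge0 k y : kern s lam Lam k -> 0 <= k y.
Proof.
move=> [_ _ /(_ y)/andP[h _]]; apply: le_trans h; by rewrite mulr_ge0 ?jker_ge0// ltW.
Qed.

Lemma kern_intg k f g : kern s lam Lam k -> bmeas f -> (forall y, `|f y| <= g y) ->
  intg (fun y => g y * jker s y) -> intg (fun y => f y * k y).
Proof.
move=> kk mf fg ig; have [mk _ kb] := kk.
apply: (intg_le _ _ (intgZ Lam ig)); first exact: measurable_funM.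
move=> y; rewrite normrM (ger0_norm (kern_ge0 y kk)) mulrCA ler_pM ?normr_ge0 ?(kern_ge0 y kk)//.
by case/andP: (kb y).
Qed.

Lemma kern_INT_le k g : kern s lam Lam k -> bmeas g -> (forall y, 0 <= g y) ->
  intg (fun y => g y * jker s y) -> INT (fun y => g y * k y) <= Lam * INT (fun y => g y * jker s y).
Proof.
move=> kk mg g0 ig; have [_ _ kb] := kk; rewrite -INTZ//; apply: INT_le.
- by apply: kern_intg ig => // y; rewrite ger0_norm.
- exact: intgZ.
- by move=> y; rewrite mulrCA ler_wpM2l//; case/andP: (kb y).
Qed.

Lemma kern_INT_ge k g : kern s lam Lam k -> bmeas g -> (forall y, 0 <= g y) ->
  intg (fun y => g y * jker s y) -> lam * INT (fun y => g y * jker s y) <= INT (fun y => g y * k y).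
Proof.
move=> kk mg g0 ig; have [_ _ kb] := kk; rewrite -INTZ//; apply: INT_le.
- exact: intgZ.
- by apply: kern_intg ig => // y; rewrite ger0_norm.
- by move=> y; rewrite mulrCA ler_wpM2l//; case/andP: (kb y).
Qed.

Lemma meas_ind_far r : bmeas (fun y => ind (r <= enorm y) : R).
Proof. by apply: meas_ind_le; [exact: measurable_cst|exact: meas_enorm]. Qed.

Lemma meas_ind_near r : bmeas (fun y => ind (enorm y < r) : R).
Proof. by apply: meas_ind_lt; [exact: meas_enorm|exact: measurable_cst]. Qed.

(** The kernel is quantified after the constants: every threshold of the proof is fixed before the
    operator is known. The lower bound on the far mass is the source of absorption in the blow-up
    barrier. *)
Lemma kern_bounds : exists Cm cf, [/\ 0 < Cm, 0 < cf & forall k, kern s lam Lam k -> forall r, 0 < r ->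
  [/\ intg (fun y => tr r y * k y), INT (fun y => tr r y * k y) <= Cm / r `^ (2 * s),
    intg (fun y => ind (r <= enorm y) * k y), INT (fun y => ind (r <= enorm y) * k y) <= Cm / r `^ (2 * s) &
    cf / r `^ (2 * s) <= INT (fun y => ind (r <= enorm y) * k y)]].
Proof.
have [C1 C10 h1] := jker_min hn s0 s1.
have [C2 C20 h2] := jker_far n s0.
have [c c0 h3] := jker_far_ge hn s0.
exists (Lam * (C1 + C2)), (lam * c); split; [by rewrite mulr_gt0 ?addr_gt0|exact: mulr_gt0|].
move=> k kk r r0; have [i1 I1] := h1 r r0; have [i2 I2] := h2 r r0; have I3 := h3 r r0.
rewrite -!powRN -!(mulrA Lam) -!(mulrA lam).
have p0 : 0 <= r `^ (- (2 * s)) by exact: powR_ge0.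
have mi := meas_ind_far r.
have i3 : intg (fun y => ind (r <= enorm y) * k y).
  by apply: kern_intg i2 => // y; rewrite ger0_norm ?ind_ge0.
split => //.
- by apply: (kern_intg kk _ _ i1) => [|y]; [exact: meas_tr|rewrite ger0_norm ?tr_ge0].
- apply: le_trans (kern_INT_le kk (meas_tr r) (tr_ge0 r) i1) _; rewrite ler_wpM2l ?(ltW Lam0)//.
  by rewrite (le_trans I1)// ler_wpM2r// lerDl ltW.
- apply: le_trans (kern_INT_le kk mi (fun=> ind_ge0 _ _) i2) _; rewrite ler_wpM2l ?(ltW Lam0)//.
  by rewrite (le_trans I2)// ler_wpM2r// lerDr ltW.
- apply: le_trans (kern_INT_ge kk mi (fun=> ind_ge0 _ _) i2); rewrite ler_wpM2l ?(ltW lam0)//.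
Qed.

Lemma kern_near : exists2 C, 0 < C & forall k, kern s lam Lam k -> forall r, 0 < r ->
  intg (fun y => ind (enorm y < r) * enorm y ^+ 2 * k y) /\
  INT (fun y => ind (enorm y < r) * enorm y ^+ 2 * k y) <= C * r `^ (2 - 2 * s).
Proof.
have [C C0 h] := jker_near hn s0 s1; exists (Lam * C); first exact: mulr_gt0.
move=> k kk r r0; have [] := h r r0.
rewrite (_ : (fun y => _) = (fun y => ind (enorm y < r) * enorm y ^+ 2 * jker s y)); last first.
  by apply/funext => y; rewrite mulrA.
move=> i I; have m : bmeas (fun y => ind (enorm y < r) * enorm y ^+ 2 : R).
  by apply: measurable_funM; [exact: meas_ind_near|apply: measurable_funX; exact: meas_enorm].
have p y : 0 <= ind (enorm y < r) * enorm y ^+ 2 by rewrite mulr_ge0 ?ind_ge0 ?sqr_ge0.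
split; first by apply: (kern_intg kk m _ i) => y; rewrite ger0_norm.
by rewrite (le_trans (kern_INT_le kk m p i))// -mulrA ler_wpM2l// ltW.
Qed.

Lemma intg_tr_le k f r C : kern s lam Lam k -> 0 < r -> bmeas f -> (forall y, `|f y| <= C * tr r y) ->
  intg (fun y => f y * k y).
Proof.
move=> kk r0 mf fb; have [C1 C10 h1] := jker_min hn s0 s1; have [i1 _] := h1 r r0.
apply: (kern_intg kk mf fb).
by rewrite (_ : (fun y => _) = (fun y => C * (tr r y * jker s y))); [exact: intgZ|apply/funext => y; rewrite mulrA].
Qed.

Lemma intg_far_le k f r C : kern s lam Lam k -> 0 < r -> bmeas f -> (forall y, `|f y| <= C) ->
  intg (fun y => ind (r <= enorm y) * f y * k y).
Proof.
move=> kk r0 mf fb; apply: (@intg_tr_le _ _ r C) => //.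
  by apply: measurable_funM => //; exact: meas_ind_far.
move=> y; have C0 := le_trans (normr_ge0 _) (fb y).
case: (leP r (enorm y)) => ry; last by rewrite /ind mul0r normr0 mulr_ge0 ?tr_ge0.
by rewrite tr_far// mulr1 /ind mul1r.
Qed.

Lemma glue_bound h w x y r C M : 0 < r -> 0 <= C -> (forall x, `|w x| <= M) ->
  (enorm y < r -> `|dlt h x y| <= C * enorm y ^+ 2) ->
  `|if enorm y < r then dlt h x y else dlt w x y| <= (C * r ^+ 2 + 4 * M) * tr r y.
Proof.
move=> r0 C0 wM hb; have M0 : 0 <= M := le_trans (normr_ge0 _) (wM 0).
have r2 : 0 < r ^+ 2 by exact: exprn_gt0.
have Cr : 0 <= C * r ^+ 2 by rewrite mulr_ge0// ltW.
case: ltP => [yr|yr].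
  rewrite tr_near// ?(ltW yr)//; apply: le_trans (hb yr) _.
  rewrite mulrDl (_ : C * r ^+ 2 * _ = C * enorm y ^+ 2); last by field; rewrite gt_eqF.
  by rewrite lerDl mulr_ge0 ?divr_ge0 ?sqr_ge0 ?mulr_ge0.
by rewrite tr_far// mulr1; apply: le_trans (le_norm_dlt _ _ wM) _; lra.
Qed.

Lemma intg_gop k h w x r C M : kern s lam Lam k -> 0 < r -> 0 <= C -> bmeas h -> bmeas w ->
  (forall x, `|w x| <= M) -> (forall y, enorm y < r -> `|dlt h x y| <= C * enorm y ^+ 2) ->
  intg (fun y => (if enorm y < r then dlt h x y else dlt w x y) * k y).
Proof.
move=> kk r0 C0 mh mw wM hb; apply: (@intg_tr_le _ _ r (C * r ^+ 2 + 4 * M)) => //.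
  by apply: meas_if_near; exact: meas_dlt.
by move=> y; apply: glue_bound => //; exact: hb.
Qed.

(* The principal value enters only through [S]; [G] collects one-sided contributions, symmetrised using that [k] is even. *)
Lemma gop_le k h w x r C M (S G : 'rV[R]_n -> R) : kern s lam Lam k -> 0 < r -> 0 <= C -> bmeas h -> bmeas w ->
  (forall x, `|w x| <= M) -> (forall y, enorm y < r -> `|dlt h x y| <= C * enorm y ^+ 2) ->
  intg (fun y => S y * k y) -> intg (fun y => G y * k y) ->
  (forall y, (if enorm y < r then dlt h x y else dlt w x y) <= S y + (G y + G (- y))) ->
  gop k r h w x <= 2^-1 * INT (fun y => S y * k y) + INT (fun y => G y * k y).
Proof.
move=> kk r0 C0 mh mw wM hb iS iG hle; have [_ ke _] := kk.
have iG' : intg (fun y => G (- y) * k y).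
  by have := intg_opp iG; rewrite /intg; under eq_fun do rewrite /= ke.
have eG : INT (fun y => G (- y) * k y) = INT (fun y => G y * k y).
  by rewrite -(INT_opp iG); congr INT; apply/funext => y; rewrite ke.
have iGG := intgD iG iG'.
have : INT (fun y => (if enorm y < r then dlt h x y else dlt w x y) * k y) <=
   INT (fun y => S y * k y + (G y * k y + G (- y) * k y)).
  apply: INT_le; [exact: (intg_gop kk r0 C0 mh mw wM hb)|exact: intgD|].
  move=> y; rewrite -!mulrDl ler_wpM2r ?(kern_ge0 y kk)//.
rewrite INTD// INTD// eG /gop => h1; lra.
Qed.

End Bounds.

Lemma powR_small (b C e : R) : 0 < b -> 0 < e -> exists2 r0, 0 < r0 & forall r, 0 < r -> r <= r0 -> C * r `^ b <= e.
Proof.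
move=> b0 e0; have C1 : 0 < `|C| + 1 by rewrite ltr_wpDl.
exists ((e / (`|C| + 1)) `^ b^-1); first by rewrite powR_gt0// divr_gt0.
move=> r r0 rr; have : r `^ b <= e / (`|C| + 1).
  rewrite -[leRHS](_ : ((e / (`|C| + 1)) `^ b^-1) `^ b = _); last first.
    by rewrite -powRrM mulVf ?gt_eqF// powRr1// ltW// divr_gt0.
  by apply: ge0_ler_powR; rewrite ?nnegrE ?powR_ge0// ltW.
rewrite ler_pdivlMr// mulrC; apply: le_trans; rewrite ler_wpM2r ?powR_ge0//.
by rewrite (le_trans (ler_norm _))// lerDl.
Qed.

End Kernels.

(** * Doubling of variables *)

Section Superposition.
Context (R : realType) (n : nat) (s lam Lam : R).
Implicit Types (x y p : 'rV[R]_n) (z v : 'rV[R]_n * R) (phi psi w h : 'rV[R]_n * R -> R)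
  (k : 'rV[R]_n -> R) (a c t e d r : R).

(** Uniformity is what the doubling argument needs, since translated points are compared
    simultaneously for all displacements; it also makes the weighted mass continuous in time. *)
Definition UC w := forall e, 0 < e -> exists2 d, 0 < d & forall z v,
  enorm (z.1 - v.1) < d -> `|z.2 - v.2| < d -> `|w z - w v| < e.

Lemma UC_continuous w : UC w -> continuous w.
Proof.
move=> ucw z; apply/continuous_epsXP => e e0; have [d d0 h] := ucw e e0.
by exists d => // v [v1 v2]; exact: h.
Qed.

Lemma UC_slice w t : UC w -> continuous (fun x => w (x, t)).
Proof.
move=> ucw x; apply/continuous_at_enormP => e e0; have [d d0 h] := ucw e e0.
by exists d => // y xy; apply: h => //=; rewrite subrr normr0.
Qed.

Lemma tst_slice phi t : tst phi -> continuous (fun x => phi (x, t)).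
Proof.
move=> /tst_continuous c x; apply/continuous_at_enormP => e e0.
have [d d0 h] := (continuous_epsXP phi (x, t)).1 (c _) e e0.
by exists d => // y xy; rewrite distrC; apply: h; split => /=; rewrite ?subrr ?normr0// enormB.
Qed.

(** It serves as the penalty that ties two points together and, one point being frozen, as a test
    function in the other; its second differences do not depend on the centre. *)
Definition quad a p t c z := a * (enorm (z.1 - p) ^+ 2 + (z.2 - t) ^+ 2) + c.

Lemma quad_diag a c z : quad a z.1 z.2 c z = c.
Proof. by rewrite /quad !subrr enorm0 expr0n /= addr0 mulr0 add0r. Qed.

Lemma quad_base a p t c : quad a p t c = basefun (fun=> 1) id a p (fun u => a * ((1 * u + - t) * (1 * u + - t)) + c).
Proof. by apply/funext => z; rewrite /quad /basefun /=; ring. Qed.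

Lemma C1fun_sqr a t c : C1fun (fun u => a * ((1 * u + - t) * (1 * u + - t)) + c)
  (fun u : R => 2 * a * (u - t)).
Proof.
have A := C1fun_affine 1 (- t).
have B := C1funD (C1funM (C1fun_cst a) (C1funM A A)) (C1fun_cst c).
by apply: (eq_C1fun B) => u //; ring.
Qed.

Lemma tst_quad a p t c : 0 <= a -> tst (quad a p t c).
Proof.
by move=> a0; rewrite quad_base; apply: tst_base (C1fun_cst 1) (C2fun_id R) (C1fun_sqr a t c).
Qed.

Lemma Dt_quad a p t c z : Dt (quad a p t c) z = 2 * a * (z.2 - t).
Proof.
rewrite quad_base (Dt_base _ _ (C1fun_cst 1) (proj1 (proj1 (C2fun_id R))) (C1fun_sqr a t c)) /basefun /=; ring.
Qed.

Lemma dlt_quadf a p t c u x y : dlt (fun x => quad a p t c (x, u)) x y = 2 * a * enorm y ^+ 2.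
Proof.
rewrite /quad /=.
have := dlt_quad x p y; rewrite /dlt => h.
by rewrite (_ : _ - _ = a * (enorm (x + y - p) ^+ 2 + enorm (x - y - p) ^+ 2 - 2 * enorm (x - p) ^+ 2)); [rewrite h; ring|ring].
Qed.

Lemma doubling_max (F : ('rV[R]_n * R) * ('rV[R]_n * R) -> R) z0 r : 0 <= r -> continuous F ->
  let Q z := enorm (z.1 - z0.1) <= r /\ z0.2 - r <= z.2 <= z0.2 + r in
  exists z v, [/\ Q z, Q v & forall z' v', Q z' -> Q v' -> F (z', v') <= F (z, v)].
Proof.
move=> r0 cF Q; pose B := [set x : 'rV[R]_n | enorm (x - z0.1) <= r] `*` `[z0.2 - r, z0.2 + r]%classic.
have QB z : Q z <-> B z.
  by rewrite /B /Q /=; split=> -[h1 h2]; split => //; move: h2; rewrite in_itv.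
have cB := @compact_cyl R n z0.1 r (z0.2 - r) (z0.2 + r).
have [||[z v]] := @compact_EVT_max _ _ F (B `*` B) _ (compact_setX cB cB).
- have : B z0 by apply: (QB z0).1; split; [rewrite subrr enorm0|rewrite gerBl lerDl r0].
  by move=> h; exists (z0, z0).
- exact: continuous_subspaceT.
rewrite inE => -[/= Bz Bv] hm; exists z, v; split; [exact/QB|exact/QB|].
by move=> z' v' /QB h1 /QB h2; apply: hm; rewrite inE.
Qed.

Lemma sqr_lt (a b : R) : 0 <= a -> 0 <= b -> a ^+ 2 < b ^+ 2 -> a < b.
Proof. by move=> a0 b0; rewrite ltr_pXn2r// nnegrE. Qed.

Lemma abs_sqr_lt (a b : R) : 0 <= b -> a ^+ 2 < b ^+ 2 -> `|a| < b.
Proof. by move=> b0; rewrite -(real_normK (num_real a)); exact: sqr_lt. Qed.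

Definition pen w1 w2 phi (N : R) z v := w1 z + w2 v - phi z - quad N v.1 v.2 0 z.

Lemma quad_sym a c c' z v : quad a z.1 z.2 c v = quad a v.1 v.2 c' z - c' + c.
Proof. by rewrite /quad enormB (_ : (v.2 - z.2) ^+ 2 = (z.2 - v.2) ^+ 2); ring. Qed.

Lemma quad_cst a p t c z : quad a p t c z = quad a p t 0 z + c.
Proof. by rewrite /quad addr0. Qed.

Lemma continuous_pen w1 w2 phi (N : R) : continuous w1 -> continuous w2 -> continuous phi ->
  continuous (fun u : ('rV[R]_n * R) * ('rV[R]_n * R) => pen w1 w2 phi N u.1 u.2).
Proof.
move=> cw1 cw2 cp.
have c1' (f : 'rV[R]_n * R -> R) : continuous f -> continuous (fun u : ('rV[R]_n * R) * ('rV[R]_n * R) => f u.1).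
  by move=> cf u; apply: (@continuous_comp _ _ _ fst f); [exact: cvg_fst|exact: cf].
have c2' (f : 'rV[R]_n * R -> R) : continuous f -> continuous (fun u : ('rV[R]_n * R) * ('rV[R]_n * R) => f u.2).
  by move=> cf u; apply: (@continuous_comp _ _ _ snd f); [exact: cvg_snd|exact: cf].
have cdx : continuous (fun u : ('rV[R]_n * R) * ('rV[R]_n * R) => enorm (u.1.1 - u.2.1)).
  move=> u; apply: (@continuous_comp _ _ _ (fun u : ('rV[R]_n * R) * ('rV[R]_n * R) => u.1.1 - u.2.1) (@enorm R n)); last exact: continuous_enorm.
  apply: cvgB.
    by apply: (@continuous_comp _ _ _ fst fst); exact: cvg_fst.
  by apply: (@continuous_comp _ _ _ snd fst); [exact: cvg_snd|exact: cvg_fst].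
have cdt : continuous (fun u : ('rV[R]_n * R) * ('rV[R]_n * R) => u.1.2 - u.2.2).
  move=> u; apply: cvgB.
    by apply: (@continuous_comp _ _ _ fst snd); [exact: cvg_fst|exact: cvg_snd].
  by apply: (@continuous_comp _ _ _ snd snd); exact: cvg_snd.
move=> u; apply: cvgB; first apply: cvgB; first apply: cvgD.
- exact: (c1' w1 cw1).
- exact: (c2' w2 cw2).
- exact: (c1' phi cp).
- apply: cvgD; last exact: cvg_cst.
  apply: cvgM; first exact: cvg_cst.
  apply: cvgD.
    by under [X in X @ _ --> _]eq_fun do rewrite expr2; apply: cvgM; exact: cdx.
  by under [X in X @ _ --> _]eq_fun do rewrite expr2; apply: cvgM; exact: cdt.
Qed.

Lemma quad_lt a p t z (d : R) : 0 < a -> 0 < d -> quad a p t 0 z < a * d ^+ 2 ->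
  enorm (z.1 - p) < d /\ `|z.2 - t| < d.
Proof.
move=> a0 d0; rewrite /quad addr0 ltr_pM2l// => h.
have q1 := sqr_ge0 (enorm (z.1 - p)); have q2 := sqr_ge0 (z.2 - t).
split; first by apply: sqr_lt; rewrite ?enorm_ge0 ?(ltW d0)//; move: h q2; lr.
by apply: abs_sqr_lt; [exact: ltW|move: h q1; lr].
Qed.

Lemma quad_ge0 a p t z : 0 <= a -> 0 <= quad a p t 0 z.
Proof. by move=> a0; rewrite /quad addr0 mulr_ge0// addr_ge0 ?sqr_ge0. Qed.

(** The added [quad 1] makes the contact at [z0] strict. Comparing the maximum with the pair
    [(z0, z0)] bounds both penalties by [w2 vm - w2 zm]. Boundedness of [w2] and the size of [N]
    first bring [zm] and [vm] within [d5]; uniform continuity then makes the right-hand side smaller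
    than [(d / 2) ^+ 2], which brings [zm] near [z0]. *)
Lemma doubling_points w1 w2 phi z0 r (M2 d : R) : continuous w1 -> UC w2 -> continuous phi ->
  (forall z, `|w2 z| <= M2) -> 0 < r -> 0 < d -> phi z0 = w1 z0 + w2 z0 ->
  (forall v, cylinder r z0 v -> w1 v + w2 v <= phi v) ->
  exists N zm vm, [/\ 0 < N, cylinder d z0 zm, cylinder d z0 vm &
    forall z v, enorm (z.1 - z0.1) <= r / 2 /\ z0.2 - r / 2 <= z.2 <= z0.2 + r / 2 ->
      enorm (v.1 - z0.1) <= r / 2 /\ z0.2 - r / 2 <= v.2 <= z0.2 + r / 2 ->
      pen w1 w2 (fun z => phi z + quad 1 z0.1 z0.2 0 z) N z v <=
      pen w1 w2 (fun z => phi z + quad 1 z0.1 z0.2 0 z) N zm vm].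
Proof.
move=> cw1 uc2 cphi b2 r0 d0 phi0 phile.
have M20 : 0 <= M2 := le_trans (normr_ge0 _) (b2 z0).
have M21 : 0 < 2 * M2 + 1 by rewrite ltr_wpDl// mulr_ge0.
have d20 : 0 < d / 2 by rewrite divr_gt0.
have [d4 d40 hd4] := uc2 _ (exprn_gt0 2 d20).
pose d5 := Num.min d4 (d / 2).
have d50 : 0 < d5 by rewrite lt_min d40.
have [d54 d5d] : d5 <= d4 /\ d5 <= d / 2 by split; rewrite ge_min lexx ?orbT.
pose N := (2 * M2 + 1) / d5 ^+ 2.
have N0 : 0 < N by rewrite divr_gt0 ?exprn_gt0.
have cphi1 : continuous (fun z => phi z + quad 1 z0.1 z0.2 0 z).
  by move=> z; apply: cvgD; [exact: cphi|apply: tst_continuous; exact: tst_quad].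
have cF := @continuous_pen _ _ _ N cw1 (UC_continuous uc2) cphi1.
have r20 : 0 <= r / 2 by rewrite divr_ge0// ltW.
have [zm [vm [Qz Qv hmax]]] := doubling_max z0 r20 cF.
exists N, zm, vm.
have Q0 : enorm (z0.1 - z0.1) <= r / 2 /\ z0.2 - r / 2 <= z0.2 <= z0.2 + r / 2.
  by rewrite subrr enorm0 lerBlDr !lerDl r20.
have key : quad 1 z0.1 z0.2 0 zm + quad N vm.1 vm.2 0 zm <= w2 vm - w2 zm.
  have := hmax z0 z0 Q0 Q0; rewrite /pen /= !quad_diag phi0.
  suff : w1 zm + w2 zm <= phi zm by lr.
  apply: phile; case: Qz => h1 h2; split.
    by apply: le_lt_trans h1 _; move: r0; lr.
  by rewrite ltr_norml; apply/andP; move: h2 r0; clrP => /andP[h1 h2] r0; split; lra.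
have hw2 := b2 vm; have hw2' := b2 zm.
have quad1 := quad_ge0 z0.1 z0.2 zm ler01.
have quadN := quad_ge0 vm.1 vm.2 zm (ltW N0).
have [dx dt] : enorm (zm.1 - vm.1) < d5 /\ `|zm.2 - vm.2| < d5.
  apply: (quad_lt N0 d50); rewrite /N mulfVK ?gt_eqF ?exprn_gt0// -/N.
  by move: hw2 hw2' key quad1; rewrite !ler_norml; clrP => /andP[? ?] /andP[? ?]; lra.
have [dz dzt] : enorm (zm.1 - z0.1) < d / 2 /\ `|zm.2 - z0.2| < d / 2.
  apply: (quad_lt ltr01 d20); rewrite mul1r.
  have := hd4 zm vm (lt_le_trans dx d54) (lt_le_trans dt d54).
  by rewrite ltr_norml => /andP[h _]; move: h key quadN; lr.
split => //.
- by split; [move: dz d0|move: dzt d0]; lr.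
- split.
    rewrite -(subrKA zm.1 vm.1 (- z0.1)) (le_lt_trans (ler_enormD _ _))// enormB.
    by move: dx dz d5d; lr.
  move: dzt dt d5d; rewrite !ltr_norml; clrP => /andP[? ?] /andP[? ?] ?; apply/andP; split; lra.
Qed.

(** At a maximum of [pen] each variable separately gives a contact from above. The time derivatives
    of the coupling penalty, [2 * N * (z.2 - v.2)] and its opposite, cancel when the two
    inequalities are added. *)
Lemma doubling_touch k c1 c2 Om w1 w2 phi (N : R) z v rho : vsub k c1 Om w1 -> vsub k c2 Om w2 -> tst phi ->
  0 < N -> 0 < rho -> cylinder rho z `<=` Om -> cylinder rho v `<=` Om ->
  (forall z', cylinder rho z z' -> pen w1 w2 phi N z' v <= pen w1 w2 phi N z v) ->
  (forall v', cylinder rho v v' -> pen w1 w2 phi N z v' <= pen w1 w2 phi N z v) ->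
  Dt phi z <= c1 + c2 +
    2^-1 * (INT (fun y => (if enorm y < rho then dlt (fun x => phi (x, z.2)) z.1 y + 2 * N * enorm y ^+ 2 else dlt (fun x => w1 (x, z.2)) z.1 y) * k y) +
            INT (fun y => (if enorm y < rho then 2 * N * enorm y ^+ 2 else dlt (fun x => w2 (x, v.2)) v.1 y) * k y)).
Proof.
move=> v1 v2 tphi N0 rho0 cz cv mz mv.
pose psi1 z' := phi z' + quad N v.1 v.2 (w1 z - phi z - quad N v.1 v.2 0 z) z'.
pose psi2 v' := quad N z.1 z.2 (w2 v - quad N v.1 v.2 0 z) v'.
have tN c p t : tst (quad N p t c) by apply: tst_quad; exact: ltW.
have H1 : Dt phi z + 2 * N * (z.2 - v.2) <= c1 + gop k rho (fun x => psi1 (x, z.2)) (fun x => w1 (x, z.2)) z.1.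
  rewrite -(Dt_quad N v.1 v.2 (w1 z - phi z - quad N v.1 v.2 0 z)) -(tst_DtD _ tphi (tN _ _ _)); apply: (v1 z rho psi1) => //.
  - exact: tstD.
  - by rewrite /psi1 quad_cst; ring.
  - by move=> z' /mz; rewrite /pen /psi1 (quad_cst _ _ _ (_ - _ - _)); lr.
have H2 : 2 * N * (v.2 - z.2) <= c2 + gop k rho (fun x => psi2 (x, v.2)) (fun x => w2 (x, v.2)) v.1.
  rewrite -(Dt_quad N z.1 z.2 (w2 v - quad N v.1 v.2 0 z)); apply: (v2 v rho psi2) => //.
  - exact: tN.
  - by rewrite /psi2 (quad_sym _ _ 0); ring.
  - by move=> v' /mv; rewrite /pen /psi2 (quad_sym _ _ 0 z v'); lr.
have e1 : gop k rho (fun x => psi1 (x, z.2)) (fun x => w1 (x, z.2)) z.1 =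
  2^-1 * INT (fun y => (if enorm y < rho then dlt (fun x => phi (x, z.2)) z.1 y + 2 * N * enorm y ^+ 2 else dlt (fun x => w1 (x, z.2)) z.1 y) * k y).
  by congr (_ * INT _); apply/funext => y; congr (_ * _); case: ifP => // _; rewrite dltD dlt_quadf.
have e2 : gop k rho (fun x => psi2 (x, v.2)) (fun x => w2 (x, v.2)) v.1 =
  2^-1 * INT (fun y => (if enorm y < rho then 2 * N * enorm y ^+ 2 else dlt (fun x => w2 (x, v.2)) v.1 y) * k y).
  by congr (_ * INT _); apply/funext => y; congr (_ * _); case: ifP => // _; rewrite dlt_quadf.
by move: H1 H2; rewrite e1 e2 mulrDr; lr.
Qed.

Lemma intg_glue_fun k (g w : 'rV[R]_n -> R) x r (C M : R) : par n s lam Lam -> kern s lam Lam k -> 0 < r -> 0 <= C ->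
  measurable_fun setT g -> measurable_fun setT w -> (forall x, `|w x| <= M) ->
  (forall y, enorm y < r -> `|g y| <= C * enorm y ^+ 2) ->
  intg (fun y => (if enorm y < r then g y else dlt w x y) * k y).
Proof.
move=> pp kk r0 C0 mg mw wM gb; have M0 : 0 <= M := le_trans (normr_ge0 _) (wM 0).
have Cr : 0 <= C * r ^+ 2 by rewrite mulr_ge0 ?sqr_ge0.
apply: (@intg_tr_le _ _ _ _ _ pp k _ r (C * r ^+ 2 + 4 * M) kk r0).
  by apply: meas_if_near => //; exact: meas_dlt.
move=> y; case: ltP => [yr|yr].
  rewrite tr_near// ?(ltW yr)//; apply: le_trans (gb y yr) _.
  rewrite mulrDl (_ : C * r ^+ 2 * _ = C * enorm y ^+ 2); last by field; rewrite gt_eqF.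
  by rewrite lerDl mulr_ge0 ?divr_ge0 ?sqr_ge0 ?mulr_ge0.
by rewrite tr_far// mulr1; apply: le_trans (le_norm_dlt _ _ wM) _; rewrite lerDr.
Qed.

(* Doubling of variables: the quadratic penalty cancels in the sum because both points are translated by the same vector. *)
Lemma vsub_doubling k c1 c2 Om w1 w2 (M1 M2 : R) z0 r phi rt Ct : par n s lam Lam -> kern s lam Lam k -> UC w1 -> UC w2 ->
  (forall z, `|w1 z| <= M1) -> (forall z, `|w2 z| <= M2) -> vsub k c1 Om w1 -> vsub k c2 Om w2 ->
  0 < r -> cylinder r z0 `<=` Om -> tst phi -> phi z0 = w1 z0 + w2 z0 ->
  (forall v, cylinder r z0 v -> w1 v + w2 v <= phi v) ->
  0 < rt -> 0 <= Ct -> (forall v y, cylinder rt z0 v -> enorm y < rt ->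
    `|dlt (fun x => phi (x, v.2)) v.1 y| <= Ct * enorm y ^+ 2) ->
  forall sg e, 0 < sg -> sg <= r / 4 -> sg <= rt -> 0 < e ->
  Dt phi z0 - 2 * e <= c1 + c2 + 2^-1 * INT (fun y => (if enorm y < sg then (Ct + 2) * enorm y ^+ 2 else
     dlt (fun x => w1 (x, z0.2) + w2 (x, z0.2)) z0.1 y + 8 * e) * k y).
Proof.
move=> pp kk uc1 uc2 b1 b2 v1 v2 r0 cyl tphi phi0 phile rt0 Ct0 hphi sg e sg0 sgr sgt e0.
pose phi1 z := phi z + quad 1 z0.1 z0.2 0 z.
have tphi1 : tst phi1 by apply: tstD => //; exact: tst_quad.
have Dphi1 z : Dt phi1 z = Dt phi z + 2 * (z.2 - z0.2).
  by rewrite (tst_DtD _ tphi (tst_quad _ _ _ ler01)) Dt_quad mulr1.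
have [d1 d10 hd1] : exists2 d, 0 < d & forall v, cylinder d z0 v -> `|Dt phi1 v - Dt phi1 z0| < e.
  by apply: (continuous_epsXP _ _).1 e0; case: tphi1 => -[_ [_ h] _ _] _; exact: h.
have [d2 d20 hd2] := uc1 e e0; have [d3 d30 hd3] := uc2 e e0.
pose d := Num.min (Num.min d1 d2) (Num.min d3 (Num.min rt (r / 4))).
have : d <= Num.min (Num.min d1 d2) (Num.min d3 (Num.min rt (r / 4))) by [].
rewrite !le_min => /andP[/andP[dd1 dd2] /and3P[dd3 ddt ddr]].
have d0 : 0 < d by rewrite !lt_min d10 d20 d30 rt0 divr_gt0.
have [N [zm [vm [N0 [zd ztd] [vd vtd] hmax]]]] := doubling_points (UC_continuous uc1) uc2 (tst_continuous tphi) b2 r0 d0 phi0 phile.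
have near2 y z t : enorm (z.1 - z0.1) < d -> `|z.2 - z0.2| < d -> enorm y <= sg -> `|t - z.2| <= sg ->
    enorm ((z.1 + y) - z0.1) <= r / 2 /\ z0.2 - r / 2 <= t <= z0.2 + r / 2.
  move=> h1 h2 h3 h4; split.
    by rewrite addrAC (le_trans (ler_enormD _ _))//; move: h1 h3 ddr sgr; lr.
  by move: h2 h4 ddr sgr; rewrite ltr_norml ler_norml; clrP => /andP[? ?] /andP[? ?] ? ?; apply/andP; split; lra.
have cylin rho z v : rho < sg -> enorm (z.1 - z0.1) < d -> `|z.2 - z0.2| < d -> cylinder rho z v ->
    enorm (v.1 - z0.1) <= r / 2 /\ z0.2 - r / 2 <= v.2 <= z0.2 + r / 2.
  move=> rr h1 h2 [h3 h4]; rewrite -(subrK z.1 v.1) (addrC _ z.1).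
  by apply: near2 => //; apply: ltW; exact: lt_trans rr.
have Qcyl z : enorm (z.1 - z0.1) <= r / 2 /\ z0.2 - r / 2 <= z.2 <= z0.2 + r / 2 -> cylinder r z0 z.
  move=> [h1 h]; split; first by apply: le_lt_trans h1 _; move: r0; lr.
  by rewrite ltr_norml; apply/andP; move: h r0; clrP => /andP[h2 h3]; split; lra.
have inQ z : enorm (z.1 - z0.1) < d -> `|z.2 - z0.2| < d ->
    enorm (z.1 - z0.1) <= r / 2 /\ z0.2 - r / 2 <= z.2 <= z0.2 + r / 2.
  move=> h1 h2; rewrite -{1}(addr0 z.1); apply: near2 => //; first by rewrite enorm0 ltW.
  by rewrite subrr normr0 ltW.
have Qz := inQ zm zd ztd; have Qv := inQ vm vd vtd.
have step rho (a : 0 < rho) (b : rho < sg) := doubling_touch v1 v2 tphi1 N0 a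
  (fun v hh => cyl _ (Qcyl _ (cylin _ _ _ b zd ztd hh))) (fun v hh => cyl _ (Qcyl _ (cylin _ _ _ b vd vtd hh)))
  (fun v hh => hmax v vm (cylin _ _ _ b zd ztd hh) Qv) (fun v hh => hmax zm v Qz (cylin _ _ _ b vd vtd hh)).
have [Cn Cn0 hCn] := kern_near pp.
have b20 : 0 < 2 - 2 * s by case: pp => _ _ h _ _; move: h; lr.
(* [rho] is chosen after [N]: the penalty is visible in the operators only for [|y| < rho], where it
   contributes at most [e]. *)
have [rho1 rho10 hrho] := powR_small (2 * N * Cn) b20 e0.
pose rho := Num.min rho1 (sg / 2).
have rho0 : 0 < rho by rewrite lt_min rho10 divr_gt0.
have rhosg : rho < sg by rewrite gt_min ltr_pdivrMr// ltr_pMr// ltr1n orbT.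
have rholt : rho <= rho1 by rewrite ge_min lexx.
have := step rho rho0 rhosg.
have [iN IN] := hCn k kk rho rho0.
have hdphi y : enorm y < sg -> `|dlt (fun x => phi (x, zm.2)) zm.1 y| <= Ct * enorm y ^+ 2.
  by move=> ysg; apply: hphi; [split; apply: lt_le_trans ddt|exact: lt_le_trans sgt].
have hdphi1 y : dlt (fun x => phi1 (x, zm.2)) zm.1 y = dlt (fun x => phi (x, zm.2)) zm.1 y + 2 * enorm y ^+ 2.
  by rewrite dltD dlt_quadf mulr1.
pose g1 y := if enorm y < rho then dlt (fun x => phi1 (x, zm.2)) zm.1 y + 2 * N * enorm y ^+ 2 else dlt (fun x => w1 (x, zm.2)) zm.1 y.
pose g2 y := if enorm y < rho then 2 * N * enorm y ^+ 2 else dlt (fun x => w2 (x, vm.2)) vm.1 y.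
pose g y := if enorm y < sg then (Ct + 2) * enorm y ^+ 2 else dlt (fun x => w1 (x, z0.2) + w2 (x, z0.2)) z0.1 y + 8 * e.
have mphi : measurable_fun setT (fun x => phi1 (x, zm.2)) by apply: continuous_measurable_rV; exact: tst_slice.
have mw1 t : measurable_fun setT (fun x => w1 (x, t)) by apply: continuous_measurable_rV; exact: UC_slice.
have mw2 t : measurable_fun setT (fun x => w2 (x, t)) by apply: continuous_measurable_rV; exact: UC_slice.
have m2 a : measurable_fun setT (fun y : 'rV[R]_n => a * enorm y ^+ 2).
  by apply: measurable_funM; [exact: measurable_cst|apply: measurable_funX; exact: meas_enorm].
have C20 : 0 <= Ct + 2 by rewrite addr_ge0.
have CN0 : 0 <= Ct + 2 + 2 * N by rewrite addr_ge0// mulr_ge0// ltW.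
have N20 : 0 <= 2 * N by rewrite mulr_ge0// ltW.
have i1 : intg (fun y => g1 y * k y).
  apply: (intg_glue_fun _ pp kk rho0 CN0 _ (mw1 zm.2) (fun=> b1 _)).
    by apply: measurable_funD => //; exact: meas_dlt.
  move=> y yr; rewrite hdphi1; have := hdphi y (lt_trans yr rhosg).
  rewrite !mulrDl; have := mulr_ge0 Ct0 (sqr_ge0 (enorm y)); have := mulr_ge0 N20 (sqr_ge0 (enorm y)).
  have := sqr_ge0 (enorm y); rewrite !ler_norml; clrP => ? ? ? /andP[? ?]; apply/andP; split; lra.
have i2 : intg (fun y => g2 y * k y).
  apply: (intg_glue_fun _ pp kk rho0 N20 _ (mw2 vm.2) (fun=> b2 _)) => //.
  by move=> y yr; rewrite ger0_norm// mulr_ge0 ?sqr_ge0.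
have i3 : intg (fun y => g y * k y).
  have -> : (fun y => g y * k y) = (fun y => (if enorm y < sg then (Ct + 2) * enorm y ^+ 2 else dlt (fun x => w1 (x, z0.2) + w2 (x, z0.2)) z0.1 y) * k y + 8 * e * (ind (sg <= enorm y) * k y)).
    by apply/funext => y; rewrite /g; case: ltP => _; rewrite /ind /=; ring.
  apply: intgD.
    apply: (intg_glue_fun _ pp kk sg0 C20 (m2 _) _ (fun=> le_trans (ler_normD _ _) (lerD (b1 _) (b2 _)))).
      exact: measurable_funD.
    by move=> y yr; rewrite ger0_norm// mulr_ge0 ?sqr_ge0.
  have [Cm [cf [_ _ /(_ k kk sg sg0)[_ _ ? _ _]]]] := kern_bounds pp.
  exact: intgZ.
rewrite -/g1 -INTD//.
have pt y : g1 y * k y + g2 y * k y <= 2 * (2 * N) * (ind (enorm y < rho) * enorm y ^+ 2 * k y) + g y * k y.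
  rewrite -mulrDl (mulrA (2 * (2 * N)) (_ * _)) -mulrDl ler_wpM2r ?(kern_ge0 pp y kk)//.
  have q0 := sqr_ge0 (enorm y).
  rewrite /g1 /g2 /g; case: (ltP (enorm y) rho) => yr.
    have ysg : enorm y < sg by exact: lt_trans yr rhosg.
    rewrite ysg /ind /= !mul1r hdphi1.
    by have := hdphi y ysg; rewrite ler_norml => /andP[_]; rewrite !mulrDl; lr.
  rewrite {1}/ind /= mul0r mulr0 add0r.
  case: (ltP (enorm y) sg) => ysg.
    have := hdphi y ysg; rewrite ler_norml => /andP[_].
    have yN : enorm (- y) <= sg by rewrite enormN ltW.
    have tt t : `|t - t| <= sg by rewrite subrr normr0 ltW.
    have h1 := hmax (zm.1 + y, zm.2) (vm.1 + y, vm.2) (near2 y zm _ zd ztd (ltW ysg) (tt _)) (near2 y vm _ vd vtd (ltW ysg) (tt _)).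
    have h2 := hmax (zm.1 - y, zm.2) (vm.1 - y, vm.2) (near2 (- y) zm _ zd ztd yN (tt _)) (near2 (- y) vm _ vd vtd yN (tt _)).
    have := hdphi1 y; move: h1 h2; rewrite /pen /= -/(phi1 _).
    have eq1 (a : 'rV[R]_n) : quad N (vm.1 + a) vm.2 0 (zm.1 + a, zm.2) = quad N vm.1 vm.2 0 zm.
      by rewrite /quad /= opprD addrACA subrr !addr0.
    rewrite !eq1 /dlt -!surjective_pairing.
    by rewrite mulrDl; clrP; rewrite /phi1; lra.
  (* Beyond [sg] both points are replaced by [z0]. A second difference involves four values counted
     with multiplicity, each moving by less than [e]; two functions give [8 * e]. *)
  have q1 w z (a : 'rV[R]_n) : (forall z v, enorm (z.1 - v.1) < d -> `|z.2 - v.2| < d -> `|w z - w v| < e) ->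
      enorm (z.1 - z0.1) < d -> `|z.2 - z0.2| < d -> `|w (z.1 + a, z.2) - w (z0.1 + a, z0.2)| < e.
    by move=> h h1 h2; apply: h => //=; rewrite opprD addrACA subrr addr0.
  have u1 z v : enorm (z.1 - v.1) < d -> `|z.2 - v.2| < d -> `|w1 z - w1 v| < e.
    by move=> h1 h2; apply: hd2; exact: lt_le_trans dd2.
  have u2 z v : enorm (z.1 - v.1) < d -> `|z.2 - v.2| < d -> `|w2 z - w2 v| < e.
    by move=> h1 h2; apply: hd3; exact: lt_le_trans dd3.
  have := q1 w1 zm y u1 zd ztd; have := q1 w1 zm (- y) u1 zd ztd; have := q1 w1 zm 0 u1 zd ztd.
  have := q1 w2 vm y u2 vd vtd; have := q1 w2 vm (- y) u2 vd vtd; have := q1 w2 vm 0 u2 vd vtd.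
  by rewrite !addr0 /dlt !ltr_norml; clrP => /andP[? ?] /andP[? ?] /andP[? ?] /andP[? ?] /andP[? ?] /andP[? ?]; lra.
have := INT_le (intgD i1 i2) (intgD (intgZ (2 * (2 * N)) iN) i3) pt.
rewrite (INTD (intgZ (2 * (2 * N)) iN) i3) (INTZ (2 * (2 * N)) iN) /g1 /g2 /g.
have := hrho rho rho0 rholt; have := hd1 zm (conj (lt_le_trans zd dd1) (lt_le_trans ztd dd1)).
have -> : Dt phi1 z0 = Dt phi z0 by rewrite Dphi1 subrr mulr0 addr0.
have : 2 * N * INT (fun y => ind (enorm y < rho) * enorm y ^+ 2 * k y) <= 2 * N * Cn * rho `^ (2 - 2 * s).
  by rewrite -(mulrA _ Cn) ler_wpM2l.
by rewrite ltr_norml; clrP => ? /andP[? _]; lra.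
Qed.

(** Passage to the limit in the doubled inequality: the region [|y| < sg] contributes little because
    of the quadratic bound, and between [sg] and [r] the sum of the subsolutions lies below the test
    function and agrees with it at [z0]. *)
Lemma vsubD k c1 c2 Om w1 w2 (M1 M2 : R) : par n s lam Lam -> kern s lam Lam k -> UC w1 -> UC w2 ->
  (forall z, `|w1 z| <= M1) -> (forall z, `|w2 z| <= M2) -> vsub k c1 Om w1 -> vsub k c2 Om w2 ->
  vsub k (c1 + c2) Om (fun z => w1 z + w2 z).
Proof.
move=> pp kk uc1 uc2 b1 b2 v1 v2 z0 r phi r0 cyl tphi phi0 phile.
have [rt [Ct [rt0 Ct0 hphi]]] := (proj2 tphi) z0.
have [Cm [cf [Cm0 cf0 kb]]] := kern_bounds pp.
have [Cn Cn0 hCn] := kern_near pp.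
apply/ler_addgt0Pr => e e0.
have b20 : 0 < 2 - 2 * s by case: pp => _ _ h _ _; move: h; lr.
have e20 : 0 < e / 2 by rewrite divr_gt0.
have [sg1 sg10 hsg] := powR_small ((Ct + 1) * Cn) b20 e20.
pose sg := Num.min sg1 (Num.min (r / 4) rt).
have sg0 : 0 < sg by rewrite !lt_min sg10 divr_gt0.
have : sg <= Num.min sg1 (Num.min (r / 4) rt) by [].
rewrite !le_min => /and3P[sgsg1 sgr sgt].
have [iN IN] := hCn k kk sg sg0.
have [_ _ iF _ _] := kb k kk sg sg0.
pose I := INT (fun y => ind (sg <= enorm y) * k y).
have I0 : 0 <= I by apply: INT_ge0 => y; rewrite mulr_ge0 ?ind_ge0 ?(kern_ge0 pp y kk).
(* Chosen after [sg], since the error [8 * e1] is multiplied by the kernel mass [I] outside the ball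
   of radius [sg]. *)
pose e1 := e / (2 * (2 + 4 * I)).
have I1 : 0 < 2 + 4 * I by rewrite ltr_pwDl// mulr_ge0.
have e10 : 0 < e1 by rewrite divr_gt0// mulr_gt0.
have := vsub_doubling pp kk uc1 uc2 b1 b2 v1 v2 r0 cyl tphi phi0 phile rt0 Ct0 hphi sg0 sgr sgt e10.
set W := (fun x => w1 (x, z0.2) + w2 (x, z0.2)).
have bW x : `|W x| <= M1 + M2 by exact: le_trans (ler_normD _ _) (lerD (b1 _) (b2 _)).
have mW : measurable_fun setT W by apply: measurable_funD; apply: continuous_measurable_rV; exact: UC_slice.
have mp : measurable_fun setT (fun x => phi (x, z0.2)) by apply: continuous_measurable_rV; exact: tst_slice.
have sgrr : sg < r by move: r0 sgr; lr.
have c00 : cylinder rt z0 z0 by split; rewrite subrr ?enorm0 ?normr0.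
have dphi y : enorm y < sg -> `|dlt (fun x => phi (x, z0.2)) z0.1 y| <= Ct * enorm y ^+ 2.
  by move=> h; apply: hphi => //; exact: lt_le_trans sgt.
have dW y : enorm y < r -> dlt W z0.1 y <= dlt (fun x => phi (x, z0.2)) z0.1 y.
  have cy (a : 'rV[R]_n) : enorm a < r -> cylinder r z0 (z0.1 + a, z0.2).
    by move=> h; split => /=; [rewrite addrC addKr|rewrite subrr normr0].
  move=> yr; have yN : enorm (- y) < r by rewrite enormN.
  have := phile _ (cy y yr); have := phile _ (cy (- y) yN); have := phi0.
  rewrite /dlt /W -!surjective_pairing; lr.
have mG : measurable_fun setT (fun y => if enorm y < r then dlt (fun x => phi (x, z0.2)) z0.1 y else dlt W z0.1 y).
  by apply: meas_if_near; exact: meas_dlt.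
have cnphi : continuous (fun z => `|phi z|).
  by move=> z; apply: (@continuous_comp _ _ _ phi (fun u : R => `|u|)); [exact: tst_continuous|exact: norm_continuous].
have ezz : enorm (z0.1 - z0.1) <= r by rewrite subrr enorm0 ltW.
have ett : z0.2 <= z0.2 <= z0.2 by rewrite lexx.
have [zM [_ _ hM]] := cyl_max cnphi ezz ett.
have hB y : enorm y < r -> `|dlt (fun x => phi (x, z0.2)) z0.1 y| <= 4 * `|phi zM|.
  move=> yr; have yN : enorm (- y) < r by rewrite enormN.
  have h (a : 'rV[R]_n) : enorm a < r -> `|phi (z0.1 + a, z0.2)| <= `|phi zM|.
    by move=> ar; apply: hM => //=; rewrite (addrC z0.1) addrK ltW.
  have := h y yr; have := h _ yN; have := h 0; rewrite enorm0 addr0 => /(_ r0).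
  by rewrite !ler_norml /dlt; clrP => /andP[? ?] /andP[? ?] /andP[? ?]; apply/andP; split; lra.
have i0 : intg (fun y => (if enorm y < r then dlt (fun x => phi (x, z0.2)) z0.1 y else dlt W z0.1 y) * k y).
  apply: (@intg_tr_le _ _ _ _ _ pp k _ sg (Ct * sg ^+ 2 + (4 * `|phi zM| + 4 * (M1 + M2))) kk sg0 mG) => y.
  have M0 : 0 <= M1 + M2 := le_trans (normr_ge0 _) (bW 0).
  have P0 : 0 <= 4 * `|phi zM| + 4 * (M1 + M2) by rewrite addr_ge0 ?mulr_ge0.
  have Cs : 0 <= Ct * sg ^+ 2 by rewrite mulr_ge0 ?sqr_ge0.
  case: (ltP (enorm y) sg) => ysg.
    rewrite (lt_trans ysg sgrr) tr_near// ?(ltW ysg)//; apply: le_trans (dphi y ysg) _.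
    rewrite mulrDl (_ : Ct * sg ^+ 2 * _ = Ct * enorm y ^+ 2); last by field; rewrite gt_eqF.
    by rewrite lerDl mulr_ge0// divr_ge0 ?sqr_ge0.
  rewrite tr_far// mulr1; case: ltP => yr.
    by apply: le_trans (hB y yr) _; move: P0 Cs M0; lr.
  apply: le_trans (le_norm_dlt _ _ bW) _; move: Cs (normr_ge0 (phi zM)); lr.
have i1 : intg (fun y => (if enorm y < sg then (Ct + 2) * enorm y ^+ 2 else dlt W z0.1 y + 8 * e1) * k y).
  have C20 : 0 <= Ct + 2 by rewrite addr_ge0.
  have -> : (fun y => (if enorm y < sg then (Ct + 2) * enorm y ^+ 2 else dlt W z0.1 y + 8 * e1) * k y) = (fun y => (if enorm y < sg then (Ct + 2) * enorm y ^+ 2 else dlt W z0.1 y) * k y + 8 * e1 * (ind (sg <= enorm y) * k y)).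
    by apply/funext => y; case: ltP => _; rewrite /ind /=; ring.
  apply: intgD; last exact: intgZ.
  apply: (intg_glue_fun _ pp kk sg0 C20 _ mW bW).
    by apply: measurable_funM; [exact: measurable_cst|apply: measurable_funX; exact: meas_enorm].
  by move=> y yr; rewrite ger0_norm// mulr_ge0 ?sqr_ge0.
have pt y : (if enorm y < sg then (Ct + 2) * enorm y ^+ 2 else dlt W z0.1 y + 8 * e1) * k y <=
    (2 * (Ct + 1) * (ind (enorm y < sg) * enorm y ^+ 2 * k y) + 8 * e1 * (ind (sg <= enorm y) * k y)) +
    (if enorm y < r then dlt (fun x => phi (x, z0.2)) z0.1 y else dlt W z0.1 y) * k y.
  rewrite !mulrA -!mulrDl ler_wpM2r ?(kern_ge0 pp y kk)//.
  case: (ltP (enorm y) sg) => ysg; rewrite /ind /= ?mulr1 ?mulr0 ?mul0r ?addr0 ?add0r.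
    rewrite (lt_trans ysg sgrr); have := dphi y ysg; rewrite ler_norml => /andP[+ _].
    by rewrite !mulrDr !mulrDl; lr.
  rewrite addrC lerD2l; case: ltP => // yr; exact: dW.
have := INT_le i1 (intgD (intgD (intgZ (2 * (Ct + 1)) iN) (intgZ (8 * e1) iF)) i0) pt.
rewrite INTD//; last by apply: intgD; exact: intgZ.
rewrite INTD ?INTZ//; [|exact: intgZ|exact: intgZ].
rewrite -/I /gop -/W; have := hsg sg sg0 sgsg1.
have : (Ct + 1) * INT (fun y => ind (enorm y < sg) * enorm y ^+ 2 * k y) <= (Ct + 1) * Cn * sg `^ (2 - 2 * s).
  by rewrite -(mulrA _ Cn) ler_wpM2l// addr_ge0.
have : e1 * (2 + 4 * I) = e / 2 by rewrite /e1; field; rewrite gt_eqF.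
by set I1' := INT _; set I2' := INT _; set I3' := INT _; lr.
Qed.

End Superposition.

(** * Reduction to Borel kernels and bounded uniformly continuous functions *)

Section OffNull.
Local Open Scope ereal_scope.
Context d (T : measurableType d) (R : realType) (mu : {measure set T -> \bar R}).
Import HBNNSimple.

(** Neither function is assumed measurable, so the argument works with the supremum over simple
    functions: a simple function below [f], multiplied by the indicator of the complement of [N],
    keeps its integral and lies below [g]. *)
Lemma ge0_le_integral_offnull (f g : T -> \bar R) N : (forall x, 0 <= f x) -> (forall x, 0 <= g x) ->
  measurable N -> mu N = 0 -> (forall x, ~ N x -> f x = g x) ->
  \int[mu]_x f x <= \int[mu]_x g x.
Proof.
move=> f0 g0 mN N0 fg; rewrite (ge0_integralTE mu f0); apply: ge_ereal_sup => _ [h hf <-].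
have mNc : measurable (~` N) by exact: measurableC.
have hp x : (proj_nnsfun h mNc x = h x * (x \in ~` N)%:R)%R by rewrite /= mindicE.
rewrite -integralT_nnsfun (_ : \int[mu]_x (h x)%:E = \int[mu]_x (proj_nnsfun h mNc x)%:E); last first.
  apply: ge0_ae_eq_integral => //.
  - exact/measurable_EFinP.
  - exact/measurable_EFinP.
  - by move=> x _; rewrite lee_fin.
  - by move=> x _; rewrite lee_fin.
  - exists N; split => // x /= /not_implyP[_ h1]; apply: contrapT => Nx; apply: h1.
    by rewrite mindicE mem_set// mulr1.
rewrite integralT_nnsfun (ge0_integralTE mu g0); apply: ereal_sup_ubound; exists (proj_nnsfun h mNc) => // x.
rewrite hp; have [xN|xN] := pselect (N x).
  by rewrite memNset ?mulr0//; apply.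
by rewrite mem_set// mulr1 -fg.
Qed.

Lemma integral_offnull (D : set T) (f g : T -> \bar R) N : measurable N -> mu N = 0 ->
  (forall x, ~ N x -> f x = g x) -> \int[mu]_(x in D) f x = \int[mu]_(x in D) g x.
Proof.
move=> mN N0 fg; rewrite integral_mkcond [RHS]integral_mkcond integralE [RHS]integralE.
have fgD x : ~ N x -> (f \_ D) x = (g \_ D) x by move=> /fg h; rewrite !patchE h.
have p x : ~ N x -> (f \_ D)^\+ x = (g \_ D)^\+ x by move=> /fgD h; rewrite !funeposE h.
have q x : ~ N x -> (f \_ D)^\- x = (g \_ D)^\- x by move=> /fgD h; rewrite !funenegE h.
congr (_ - _); apply/eqP; rewrite eq_le; apply/andP; split;
  by apply: ge0_le_integral_offnull mN N0 _ => // x Nx; rewrite ?p ?q.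
Qed.

End OffNull.

Section KernelRepresentative.
Context (R : realType) (n : nat) (s lam Lam : R).
Implicit Types (x y p : 'rV[R]_n) (z v : 'rV[R]_n * R) (phi w : 'rV[R]_n * R -> R)
  (K k u : 'rV[R]_n -> R) (t e r C M : R).
Local Notation mu := (lebesgue_rV R n).

(** Averaging a Borel representative with its reflection makes it even, and clipping it between the
    two power bounds makes them hold everywhere. Off [N], its reflection and the origin neither
    operation changes the value. *)
Lemma kernel_rep K : par n s lam Lam -> kernel_class s lam Lam K -> lam <= Lam ->
  exists k N, [/\ kern s lam Lam k, measurable N, mu N = 0%E & forall y, ~ N y -> K y = k y].
Proof.
move=> pp [[g mg [N [mN N0 gN]]] Ke Kb] lL; have [hn s0 s1 lam0 Lam0] := pp.
pose k y := Num.max (lam * jker s y) (Num.min (Lam * jker s y) (2^-1 * (g y + g (- y)))).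
have m0 : measurable [set 0 : 'rV[R]_n].
  rewrite (_ : [set 0] = [set y : 'rV[R]_n | enorm y <= 0]); last first.
    apply/seteqP; split => y /=; first by move=> ->; rewrite enorm0.
    by rewrite le_eqVlt ltNge enorm_ge0 orbF enorm_eq0 => /eqP.
  apply: meas_le; [exact: meas_enorm|exact: measurable_cst].
have mu0 : mu [set 0 : 'rV[R]_n] = 0%E.
  apply/eqP; rewrite eq_le measure_ge0 andbT; apply/lee_addgt0Pr => e e0; rewrite add0e.
  have e1 : 0 < Num.min 1 e by rewrite lt_min ltr01.
  have e2 : 0 < Num.min 1 e / 2 by rewrite divr_gt0.
  apply: (@le_trans _ _ (mu [set y : 'rV[R]_n | enorm y < Num.min 1 e / 2])).
    apply: le_measure; rewrite ?inE//; first exact: measurable_eball0.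
    by move=> y /= ->; rewrite enorm0.
  apply: le_trans (lebesgue_eball_le n (ltW e2)) _; rewrite lee_fin mulrC mulfVK//.
  apply: (@le_trans _ _ (Num.min 1 e)); last by rewrite ge_min lexx orbT.
  rewrite -[leRHS]expr1; apply: ler_wiXn2l => //; first exact: ltW.
  by rewrite ge_min lexx.
have mNN : measurable (-%R @^-1` N) by rewrite -[X in measurable X]setTI; exact: measurable_opp_rV.
have NN0 : mu (-%R @^-1` N) = 0%E by have := lebesgue_rV_opp mN; rewrite N0.
exists k, ((N `|` (-%R @^-1` N)) `|` [set 0]); split.
- split.
  + have mj a : measurable_fun setT (fun y : 'rV[R]_n => a * jker s y).
      by apply: measurable_funM; [exact: measurable_cst|exact: meas_jker].
    apply: measurable_maxr => //; apply: measurable_minr => //.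
    apply: measurable_funM; [exact: measurable_cst|apply: measurable_funD => //].
    exact: meas_opp.
  + by move=> y; rewrite /k /jker enormN opprK (addrC (g (- y))).
  + move=> y; rewrite le_max lexx/= ge_max ge_min lexx/= andbT.
    by rewrite ler_wpM2r ?jker_ge0.
- by apply: measurableU => //; exact: measurableU.
- by rewrite measureU0// ?measureU0//; exact: measurableU.
- move=> y /= /not_orP[/not_orP[y1 y2] /eqP y3].
  have gy : g y = K y by apply: contrapT => h; apply: y1; apply: gN => /= h2; apply: h.
  have gNy : g (- y) = K y by rewrite Ke; apply: contrapT => h; apply: y2; apply: gN => /= h2; apply: h.
  have [h1 h2] := Kb y y3.
  rewrite /k gy gNy (_ : 2^-1 * _ = K y); last by field.
  by rewrite min_r// max_r.
Qed.

(* The operator is a limit of truncated integrals of functions that need not be Borel; replacing them by Borel representatives and symmetrising gives an absolutely convergent integral. *)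
Lemma nonlocal_opE K k N (u uh : 'rV[R]_n -> R) N' x C r0 : par n s lam Lam -> kern s lam Lam k ->
  measurable N -> mu N = 0%E -> (forall y, ~ N y -> K y = k y) ->
  measurable N' -> mu N' = 0%E -> (forall y, ~ N' y -> u y = uh y) ->
  measurable_fun setT uh -> 0 < r0 -> 0 <= C ->
  (forall y, enorm y < r0 -> `|uh (x + y) + uh (x - y) - 2 * u x| <= C * enorm y ^+ 2) ->
  (forall e, 0 < e -> intg (fun y => ind (e < enorm y) * ((uh (x + y) - u x) * k y))) ->
  intg (fun y => (uh (x + y) + uh (x - y) - 2 * u x) * k y) ->
  nonlocal_op K u x = 2^-1 * INT (fun y => (uh (x + y) + uh (x - y) - 2 * u x) * k y).
Proof.
move=> pp kk mN N0 Kk mN' N'0 uuh muh r00 C0 hC ie id.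
have [mk ke kb] := kk.
pose D y := uh (x + y) + uh (x - y) - 2 * u x.
have mxN' : measurable ((fun y => y + x) @^-1` N').
  by rewrite -[X in measurable X]setTI; exact: measurable_shift_rV.
have xN'0 : mu ((fun y => y + x) @^-1` N') = 0%E by have := lebesgue_rV_shift x mN'; rewrite N'0.
have mNN : measurable (N `|` ((fun y => y + x) @^-1` N')) by exact: measurableU.
have NN0 : mu (N `|` ((fun y => y + x) @^-1` N')) = 0%E.
  by rewrite measureU0.
have step e : 0 < e -> \int[mu]_(y in [set y | e < enorm y]) ((u (x + y) - u x) * K y) =
    2^-1 * INT (fun y => ind (e < enorm y) * (D y * k y)).
  move=> e0; transitivity (INT (fun y => ind (e < enorm y) * ((uh (x + y) - u x) * k y))).
    rewrite /INT /Rintegral; congr fine.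
    rewrite (@integral_offnull _ _ _ _ _ _ (fun y => ((uh (x + y) - u x) * k y)%:E) _ mNN NN0); last first.
      by move=> y /= /not_orP[y1 y2]; rewrite Kk// uuh// addrC.
    rewrite integral_mkcond; apply: eq_integral => y _; rewrite patchE.
    case: ifPn => [/set_mem /= h|/negP h]; first by rewrite /ind h mul1r.
    by rewrite indF ?mul0r//; apply/negP => h2; apply: h; exact/mem_set.
  have h := ie e e0; have hN := intg_opp h.
  have : INT (fun y => ind (e < enorm y) * (D y * k y)) =
      INT (fun y => ind (e < enorm y) * ((uh (x + y) - u x) * k y)) +
      INT (fun y => ind (e < enorm (- y)) * ((uh (x + (- y)) - u x) * k (- y))).
    rewrite -(INTD h hN); congr INT; apply/funext => y; rewrite enormN ke /D; ring.
  rewrite (INT_opp h) => ->; by field.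
have [Cn Cn0 hCn] := kern_near pp.
have b20 : 0 < 2 - 2 * s by case: pp => _ _ h _ _; move: h; lr.
apply: cvg_lim => //; apply/cvgrPdist_le => e e0.
have [r1 r10 hr1] := powR_small (C * Cn) b20 e0.
near=> d.
have d0 : 0 < d by near: d; exact: nbhs_right_gt.
(* The truncated and the full integral differ on the closed ball [|y| <= d], contained in the open
   ball of radius [2 * d] for which the second moment is known. *)
have d1 : 2 * d <= r1.
  rewrite -ler_pdivlMl// mulrC; apply: ltW; near: d; apply: nbhs_right_lt.
  by rewrite divr_gt0.
have d2 : 2 * d <= r0.
  rewrite -ler_pdivlMl// mulrC; apply: ltW; near: d; apply: nbhs_right_lt.
  by rewrite divr_gt0.
rewrite step// -mulrBr.
have m2 : measurable_fun setT D.
  apply: measurable_funB; last exact: measurable_cst.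
  apply: measurable_funD; first exact: meas_shift.
  by apply: (meas_opp (f := fun y => uh (x + y))); exact: meas_shift.
have i2 : intg (fun y => ind (d < enorm y) * (D y * k y)).
  apply: intg_le (intg_norm id).
    apply: measurable_funM; last exact: measurable_funM.
    by apply: meas_ind_lt; [exact: measurable_cst|exact: meas_enorm].
  move=> y; rewrite normrM ler_piMl// ger0_norm ?ind_ge0//; exact: ind_le1.
have dd0 : 0 < 2 * d by rewrite mulr_gt0.
have [iN IN] := hCn k kk (2 * d) dd0.
rewrite -(INTB id i2); apply: le_trans (_ : `|INT (fun y => D y * k y - ind (d < enorm y) * (D y * k y))| <= e).
  rewrite normrM ger0_norm ?invr_ge0//; apply: ler_piMl => //.
  by rewrite invf_le1// ler1n.
apply: le_trans (le_norm_INT (intgB id i2)) _.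
apply: (@le_trans _ _ (INT (fun y => C * (ind (enorm y < 2 * d) * enorm y ^+ 2 * k y)))).
  apply: INT_le; [exact: intg_norm (intgB id i2)|exact: intgZ|].
  move=> y; rewrite -{1}(mul1r (D y * k y)) -mulrBl normrM normrM (ger0_norm (kern_ge0 pp y kk)) (mulrA C) (mulrA `|_|).
  rewrite ler_wpM2r ?(kern_ge0 pp y kk)//.
  case: (ltP d (enorm y)) => yd.
    by rewrite {1}/ind subrr normr0 mul0r mulr_ge0// mulr_ge0 ?sqr_ge0 ?ind_ge0.
  have y2d : enorm y < 2 * d by apply: le_lt_trans yd _; move: d0; lr.
  rewrite y2d /ind /= subr0 normr1 !mul1r; apply: hC; exact: lt_le_trans y2d d2.
rewrite INTZ//; apply: le_trans (hr1 _ dd0 d1).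
by rewrite -mulrA ler_wpM2l.
Unshelve. all: by end_near. Qed.

(** Beyond the radius [rt] supplied by [tst] the quotient [enorm y ^+ 2 / rt ^+ 2] is at least 1,
    and [phi] is bounded on a compact ball. *)
Lemma tst_dlt_bound phi z r : tst phi -> 0 < r -> exists2 C, 0 <= C &
  forall y, enorm y < r -> `|dlt (fun x => phi (x, z.2)) z.1 y| <= C * enorm y ^+ 2.
Proof.
move=> tphi r0; have [rt [Ct [rt0 Ct0 hphi]]] := (proj2 tphi) z.
have cn : continuous (fun z => `|phi z|).
  by move=> v; apply: (@continuous_comp _ _ _ phi (fun u : R => `|u|)); [exact: tst_continuous|exact: norm_continuous].
have ezz : enorm (z.1 - z.1) <= r by rewrite subrr enorm0 ltW.
have ett : z.2 <= z.2 <= z.2 by rewrite lexx.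
have [zM [_ _ hM]] := cyl_max cn ezz ett.
have B0 : 0 <= 4 * `|phi zM| / rt ^+ 2 by rewrite divr_ge0 ?sqr_ge0// mulr_ge0.
exists (Ct + 4 * `|phi zM| / rt ^+ 2); first exact: addr_ge0.
move=> y yr; rewrite mulrDl; have [yt|yt] := ltP (enorm y) rt.
  apply: (@le_trans _ _ (Ct * enorm y ^+ 2)); last by rewrite lerDl mulr_ge0 ?sqr_ge0.
  by apply: hphi => //; split; rewrite subrr ?enorm0 ?normr0.
apply: (@le_trans _ _ (4 * `|phi zM|)).
  have yN : enorm (- y) < r by rewrite enormN.
  have h (a : 'rV[R]_n) : enorm a < r -> `|phi (z.1 + a, z.2)| <= `|phi zM|.
    by move=> ar; apply: hM => //=; rewrite (addrC z.1) addrK ltW.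
  have := h y yr; have := h _ yN; have := h 0; rewrite enorm0 addr0 => /(_ r0).
  by rewrite !ler_norml /dlt; clrP => /andP[? ?] /andP[? ?] /andP[? ?]; apply/andP; split; lra.
apply: (@le_trans _ _ (4 * `|phi zM| / rt ^+ 2 * enorm y ^+ 2)); last first.
  by rewrite lerDr mulr_ge0 ?sqr_ge0.
rewrite -mulrA ler_peMr// ?mulr_ge0// mulrC ler_pdivlMr ?exprn_gt0// mul1r.
by rewrite ler_pXn2r ?nnegrE ?enorm_ge0// ltW.
Qed.

End KernelRepresentative.

Section Truncation.
Context (R : realType) (n : nat) (s lam Lam : R).
Implicit Types (x y p : 'rV[R]_n) (z v : 'rV[R]_n * R) (phi w : 'rV[R]_n * R -> R)
  (K k u : 'rV[R]_n -> R) (t e r C M : R).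
Local Notation mu := (lebesgue_rV R n).

(** Both [1] and [enorm x] are at most [enorm y], whence the factor 3. *)
Lemma growth_far (C0 g rad : R) x y : 0 < C0 -> 0 < g -> g < 2 * s -> 4 <= rad ->
  enorm x < rad / 4 -> rad / 4 <= enorm y ->
  C0 * (1 + enorm (x + y)) `^ (2 * s - g) <= C0 * 3 `^ (2 * s - g) * enorm y `^ (2 * s - g).
Proof.
move=> C00 g0 gs r4 xr yr; rewrite -mulrA ler_pM2l// -powRM ?enorm_ge0//.
have b0 : 0 <= 2 * s - g by rewrite subr_ge0 ltW.
apply: ge0_ler_powR => //; rewrite ?nnegrE ?addr_ge0 ?mulr_ge0 ?enorm_ge0//.
by have := ler_enormD x y; move: r4 xr yr; lr.
Qed.

(** The function and its truncation are compared through second differences, which agree for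
    [|y| < rad / 4]. Further out the growth exponent [2 * s - g] makes the difference integrable
    against the kernel, with a tail of order [rad^(-g)]; this is the cost of truncation that a large
    [rad] makes negligible. *)
Lemma nonlocal_red (g C0 : R) : par n s lam Lam -> 0 < g -> g < 2 * s -> 0 < C0 ->
  exists2 Cg, 0 < Cg & forall rad : R, 4 <= rad -> forall K k N u (ub phi : 'rV[R]_n -> R) x r C M, kern s lam Lam k ->
  measurable N -> mu N = 0%E -> (forall y, ~ N y -> K y = k y) -> lebesgue_measurable u ->
  measurable_fun setT ub -> (forall y, `|ub y| <= M) -> (forall y, enorm y < rad / 2 -> ub y = u y) ->
  (forall y, `|ub y| <= C0 * (1 + enorm y) `^ (2 * s - g)) ->
  (forall y, `|u y| <= C0 * (1 + enorm y) `^ (2 * s - g)) ->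
  enorm x < rad / 4 -> 0 < r -> 0 <= C -> continuous phi ->
  (forall y, enorm y < r -> `|dlt phi x y| <= C * enorm y ^+ 2) ->
  (forall y, enorm y < r -> `|phi (x + y)| <= M) ->
  phi x = u x ->
  `|nonlocal_op K (fun y => if enorm (y - x) < r then phi y else u y) x - gop k r phi ub x| <= Cg * rad `^ (- g).
Proof.
move=> pp g0 gs C00; have [hn s0 s1 lam0 Lam0] := pp.
have [Cj Cj0 hCj] := jker_far_growth n s g0.
pose P : R := C0 * 3 `^ (2 * s - g).
have P0 : 0 < P by rewrite mulr_gt0 ?powR_gt0.
exists (2 * P * (Lam * (Cj * 4 `^ g))); first by rewrite !mulr_gt0 ?powR_gt0.
move=> rad r4 K k N u ub phi x r C M kk mN N0 Kk [v mv [N' [mN' N'0 uv]]] mub ubM ubu ubg ug xr r0 C0' cphi hphi phiM phix.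
have [mk ke kb] := kk.
have rad0 : 0 < rad / 4 by move: r4; lr.
pose gr y := C0 * (1 + enorm y) `^ (2 * s - g).
have mgr : measurable_fun setT gr.
  apply: measurable_funM; first exact: measurable_cst.
  have m1 : measurable_fun setT (fun y : 'rV[R]_n => 1 + enorm y).
    by apply: measurable_funD; [exact: measurable_cst|exact: meas_enorm].
  exact: (@measurableT_comp _ _ _ _ _ _ (@powR R ^~ (2 * s - g)) _ (fun y : 'rV[R]_n => 1 + enorm y) (measurable_powR _) m1).
have gr0 y : 0 <= gr y by rewrite mulr_ge0 ?powR_ge0// ltW.
(* The Borel representative [v] satisfies no growth bound on the null set; clipping restores the
   bound and changes nothing where [v] equals [u]. *)
pose vc y := Num.max (- gr y) (Num.min (gr y) (v y)).
pose uh y := if enorm (y - x) < r then phi y else if enorm y < rad / 2 then ub y else vc y.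
pose uu y := if enorm (y - x) < r then phi y else u y.
have mvc : measurable_fun setT vc.
  apply: measurable_maxr; last exact: measurable_minr.
  exact: measurableT_comp.
have vcg y : `|vc y| <= gr y.
  by rewrite ler_norml /vc le_max lexx/= ge_max ge_min lexx/= andbT; have := gr0 y; lr.
have mphi := continuous_measurable_rV cphi.
have mif a b (f1 f2 : 'rV[R]_n -> R) : measurable_fun setT f1 -> measurable_fun setT f2 ->
    measurable_fun setT (fun y => if enorm (y - a) < b then f1 y else f2 y).
  move=> m1 m2; rewrite (_ : (fun y => _) = (fun y => ind (enorm (y - a) < b) * f1 y + ind (b <= enorm (y - a)) * f2 y)).
    by apply: measurable_funD; apply: measurable_funM => //; [apply: meas_ind_lt|apply: meas_ind_le];
      try exact: meas_enorm_shift; exact: measurable_cst.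
  by apply/funext => y; case: ltP => _; rewrite /ind /= ?mul1r ?mul0r ?addr0 ?add0r.
have muh : measurable_fun setT uh.
  apply: mif => //; apply: (meas_if_near (rad / 2)) => //.
have uuh y : ~ N' y -> uu y = uh y.
  move=> yN; rewrite /uu /uh; case: ifP => // _; case: ifP => [/ubu//|_].
  have uv' : u y = v y by apply: contrapT => h; apply: yN; apply: uv => /= h2; apply: h.
  rewrite /vc -uv'; have := ug y; rewrite -/(gr y) ler_norml => /andP[h1 h2].
  by rewrite min_r// max_r.
have uux : uu x = phi x by rewrite /uu subrr enorm0 r0.
have uhx y : enorm y < r -> uh (x + y) = phi (x + y) by move=> yr; rewrite /uh addrAC subrr add0r yr.
have Mub : 0 <= M := le_trans (normr_ge0 _) (ubM 0).
have uhn y : enorm y < rad / 4 -> ~~ (enorm y < r) -> uh (x + y) = ub (x + y).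
  move=> yr ynr; rewrite /uh addrAC subrr add0r (negbTE ynr) ifT//.
  by apply: le_lt_trans (ler_enormD _ _) _; move: yr xr; lr.
have uhle y : `|uh (x + y)| <= M + ind (rad / 4 <= enorm y) * (P * enorm y `^ (2 * s - g)).
  have I0 : 0 <= ind (rad / 4 <= enorm y) * (P * enorm y `^ (2 * s - g)).
    by rewrite mulr_ge0 ?ind_ge0// mulr_ge0 ?powR_ge0// ltW.
  case: (ltP (enorm y) r) => yr; first by rewrite uhx// (le_trans (phiM y yr))// lerDl.
  case: (ltP (enorm y) (rad / 4)) => yR.
    by rewrite uhn// -?leNgt// (le_trans (ubM _))// /ind mul0r addr0.
  apply: (@le_trans _ _ (gr (x + y))); last first.
    by rewrite /ind mul1r (le_trans (growth_far C00 g0 gs r4 xr yR))// lerDr.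
  rewrite /uh addrAC subrr add0r ltNge yr /=; case: ifP => _ //; exact: ubg.
pose D y := uh (x + y) + uh (x - y) - 2 * uu x.
have mD : measurable_fun setT D.
  apply: measurable_funB; last exact: measurable_cst.
  apply: measurable_funD; first exact: meas_shift.
  by apply: (meas_opp (f := fun y => uh (x + y))); exact: meas_shift.
pose G y := if enorm y < r then dlt phi x y else dlt ub x y.
have mG : measurable_fun setT G by apply: meas_if_near; exact: meas_dlt.
have [iF IF] := hCj _ rad0.
pose F y := 4 * P * (ind (rad / 4 <= enorm y) * enorm y `^ (2 * s - g)).
have F0 y : 0 <= F y by rewrite !mulr_ge0 ?ind_ge0 ?powR_ge0// ltW.
have mF : measurable_fun setT F.
  apply: measurable_funM; first exact: measurable_cst.
  by apply: measurable_funM; [exact: meas_ind_far|exact: meas_powenorm].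
have iFj : intg (fun y => F y * jker s y).
  rewrite (_ : (fun y => _) = (fun y => 4 * P * (ind (rad / 4 <= enorm y) * (enorm y `^ (2 * s - g) * jker s y)))); last first.
    by apply/funext => y; rewrite /F !mulrA.
  exact: intgZ.
have DG y : `|D y - G y| <= F y.
  rewrite /D /G uux; case: ifPn => yr.
    by rewrite uhx// uhx ?enormN// /dlt subrr normr0.
  have h (a : 'rV[R]_n) : ~~ (enorm a < r) -> `|uh (x + a) - ub (x + a)| <= ind (rad / 4 <= enorm a) * (2 * P * enorm a `^ (2 * s - g)).
    move=> ar; case: (ltP (enorm a) (rad / 4)) => aR.
      by rewrite uhn// subrr normr0 /ind mul0r.
    rewrite /ind mul1r; apply: (@le_trans _ _ (gr (x + a) + gr (x + a))).
      rewrite (le_trans (ler_normB _ _))// lerD ?ubg//.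
      by rewrite /uh addrAC subrr add0r (negbTE ar); case: ifP => _ //; exact: ubg.
    by have := growth_far C00 g0 gs r4 xr aR; rewrite -/(gr _) -/P; lr.
  have rN : ~~ (enorm (- y) < r) by rewrite enormN.
  have ubx : ub x = phi x.
    by rewrite phix ubu//; move: xr rad0; lr.
  have -> : uh (x + y) + uh (x - y) - 2 * phi x - dlt ub x y = (uh (x + y) - ub (x + y)) + (uh (x - y) - ub (x - y)).
    by rewrite /dlt ubx; move: (uh _) (uh _) (ub _) (ub _) (phi _) => a1 a2 a3 a4 a5; ring.
  rewrite (le_trans (ler_normD _ _))//; have := h y yr; have := h _ rN; rewrite enormN /F.
  set i := ind _; set q := _ `^ _; lr.
have iG : intg (fun y => G y * k y).
  apply: (intg_gop pp kk r0 C0' mphi mub ubM hphi).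
have iDG : intg (fun y => (D y - G y) * k y).
  by apply: (kern_intg pp kk _ DG) => //; exact: measurable_funB.
have iD : intg (fun y => D y * k y).
  have := intgD iG iDG; rewrite /intg; under eq_fun do rewrite /= -mulrDl addrC subrK.
  by [].
have hC y : enorm y < r -> `|uh (x + y) + uh (x - y) - 2 * uu x| <= C * enorm y ^+ 2.
  by move=> yr; rewrite uux uhx// uhx ?enormN//; exact: hphi.
have ie e : 0 < e -> intg (fun y => ind (e < enorm y) * ((uh (x + y) - uu x) * k y)).
  move=> e0; have [Cm [cf [_ _ kbd]]] := kern_bounds pp.
  have i1 : intg (fun y => (M + `|phi x|) * (ind (e <= enorm y) * jker s y) + P * (ind (rad / 4 <= enorm y) * (enorm y `^ (2 * s - g) * jker s y))).
    apply: intgD; apply: intgZ => //.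
    by have [C1 _ h] := jker_far n s0; have [] := h e e0.
  rewrite (_ : (fun y => _) = (fun y => (ind (e < enorm y) * (uh (x + y) - uu x)) * k y)); last first.
    by apply/funext => y; rewrite mulrA.
  apply: (@kern_intg _ _ _ _ _ pp k _ (fun y => (M + `|phi x|) * ind (e <= enorm y) + P * (ind (rad / 4 <= enorm y) * enorm y `^ (2 * s - g)))) => //.
  - apply: measurable_funM; first by apply: meas_ind_lt; [exact: measurable_cst|exact: meas_enorm].
    by apply: measurable_funB; [exact: meas_shift|exact: measurable_cst].
  - move=> y; have I0 : 0 <= ind (rad / 4 <= enorm y) * (P * enorm y `^ (2 * s - g)).
      by rewrite mulr_ge0 ?ind_ge0// mulr_ge0 ?powR_ge0// ltW.
    case: (ltP e (enorm y)) => ye; last first.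
      by rewrite {1}/ind mul0r normr0 addr_ge0 ?mulr_ge0 ?addr_ge0 ?ind_ge0 ?powR_ge0// ltW.
    rewrite (ltW ye) /ind mul1r mulr1 uux (le_trans (ler_normB _ _))//.
    by have := uhle y; rewrite mulrCA /ind; lr.
  - move: i1; rewrite /intg; congr (_.-integrable _ _); apply/funext => y /=; congr EFin; ring.
rewrite -/uu (nonlocal_opE pp kk mN N0 Kk mN' N'0 uuh muh r0 C0' hC ie iD) /gop -mulrBr.
rewrite -(INTB iD iG).
have -> : INT (fun y => D y * k y - G y * k y) = INT (fun y => (D y - G y) * k y).
  by congr INT; apply/funext => y; rewrite (mulrBl (k y) (D y) (G y)).
rewrite normrM ger0_norm ?invr_ge0//.
have iFk : intg (fun y => F y * k y) by apply: (kern_intg pp kk mF _ iFj) => y; rewrite ger0_norm.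
have h1 : `|INT (fun y => (D y - G y) * k y)| <= INT (fun y => F y * k y).
  apply: le_trans (le_norm_INT iDG) _; apply: INT_le => //; first exact: intg_norm.
  by move=> y; rewrite normrM (ger0_norm (kern_ge0 pp y kk)) ler_wpM2r ?(kern_ge0 pp y kk).
have h2 := kern_INT_le pp kk mF F0 iFj.
have h3 : INT (fun y => F y * jker s y) = 4 * P * INT (fun y => ind (rad / 4 <= enorm y) * (enorm y `^ (2 * s - g) * jker s y)).
  by rewrite -INTZ//; congr INT; apply/funext => y; rewrite /F !mulrA.
have h4 : Cj * (rad / 4) `^ (- g) = Cj * 4 `^ g * rad `^ (- g).
  rewrite powRM ?invr_ge0//; last by move: r4; lr.
  by rewrite -powR_inv1// -powRrM mulN1r opprK mulrAC mulrA.
rewrite h4 in IF.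
rewrite -ler_pdivlMl ?invr_gt0// invrK; apply: le_trans h1 (le_trans h2 _); rewrite h3.
rewrite [leRHS](_ : _ = Lam * (4 * P * (Cj * 4 `^ g * rad `^ (- g)))); last by ring.
by rewrite ler_pM2l// ler_pM2l// mulr_gt0.
Qed.

End Truncation.

Section CutOff.
Context (R : realType) (n : nat) (s lam Lam : R).
Implicit Types (x y p : 'rV[R]_n) (z : 'rV[R]_n * R) (phi v w : 'rV[R]_n * R -> R)
  (K k u : 'rV[R]_n -> R) (t e r C M rad ta : R).
Local Notation mu := (lebesgue_rV R n).

Lemma C21N phi : C21 phi -> C21 (fun z => - phi z).
Proof.
move=> [c1 [d1 e1] f1 g1].
have DtN : Dt (fun z => - phi z) = (fun z => - Dt phi z).
  by apply/funext => z; rewrite /Dt !derive1E; have := deriveN (d1 z).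
have DxN h : Dx h (fun z => - phi z) = (fun z => - Dx h phi z).
  by apply/funext => z; rewrite /Dx; have := deriveN ((f1 h).1 z).
split.
- by move=> z; apply: cvgN; exact: c1.
- by split; [move=> z; have := derivableN (d1 z)|rewrite DtN => z; apply: cvgN; exact: e1].
- by move=> h; split; [move=> z; have := derivableN ((f1 h).1 z)|rewrite DxN => z; apply: cvgN; exact: (f1 h).2].
- move=> h k; rewrite DxN; split; first by move=> z; have := derivableN ((g1 h k).1 z).
  rewrite (_ : Dx k _ = (fun z => - Dx k (Dx h phi) z)); first by move=> z; apply: cvgN; exact: (g1 h k).2.
  by apply/funext => z; rewrite {1}/Dx; have := deriveN ((g1 h k).1 z).
Qed.

Lemma Dt_opp phi z : C21 phi -> Dt (fun z => - phi z) z = - Dt phi z.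
Proof. by move=> [_ [d1 _] _ _]; rewrite /Dt !derive1E; have := deriveN (d1 z). Qed.

Lemma tstN phi : tst phi -> tst (fun z => - phi z).
Proof.
move=> [h1 h2]; split; first exact: C21N.
move=> z; have [r [C [r0 C0 h]]] := h2 z; exists r, C; split => // w y cw yr.
by rewrite (dltN (fun x => phi (x, w.2))) normrN; exact: h.
Qed.

Definition clampt ta t := Num.max (- ta) (Num.min t 0).

Lemma clampt_id ta t : - ta <= t <= 0 -> clampt ta t = t.
Proof. by move=> /andP[h1 h2]; rewrite /clampt min_l// max_r. Qed.

Lemma clampt_bounds ta t : 0 <= ta -> - ta <= clampt ta t <= 0.
Proof. by move=> ta0; rewrite /clampt le_max lexx ge_max ge_min lexx orbT andbT oppr_le0. Qed.

Lemma clampt_idem ta t : 0 <= ta -> clampt ta (clampt ta t) = clampt ta t.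
Proof. by move=> ta0; rewrite clampt_id// clampt_bounds. Qed.

Lemma clampt_lip ta t t' : `|clampt ta t - clampt ta t'| <= `|t - t'|.
Proof.
wlog tt : t t' / t <= t'.
  by move=> H; case: (leP t t') => [|/ltW] h; [exact: H|rewrite distrC (distrC t); exact: H].
have h1 : clampt ta t <= clampt ta t' by rewrite /clampt; apply: le_max2 => //; exact: le_min2.
rewrite distrC (distrC t) !ger0_norm ?subr_ge0//.
have mx (a x y : R) : x <= y -> Num.max a y - Num.max a x <= y - x.
  by move=> xy; case: (leP a x) => h2; case: (leP a y) => h3; move: xy h2 h3; lr.
have mn (x y : R) : x <= y -> Num.min y 0 - Num.min x 0 <= y - x.
  by move=> xy; case: (leP x 0) => h2; case: (leP y 0) => h3; move: xy h2 h3; lr.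
by apply: le_trans (mn _ _ tt); apply: mx; exact: le_min2.
Qed.

(** The pairs of points, taken in a compact set, at which [F] differs by at least [e] form a compact
    set off the diagonal, on which the squared distance has a positive minimum. Clamping brings all
    times into a compact interval, and points far out in space contribute nothing. *)
Lemma UC_of_compact (F : 'rV[R]_n * R -> R) ta rho : continuous F -> 0 <= ta -> 0 <= rho ->
  (forall x t, F (x, t) = F (x, clampt ta t)) -> (forall x t, rho <= enorm x -> F (x, t) = 0) ->
  UC F /\ exists M, forall z, `|F z| <= M.
Proof.
move=> cF ta0 rho0 Ft F0.
pose B := [set x : 'rV[R]_n | enorm (x - 0) <= rho + 1] `*` `[- ta, 0]%classic.
have cB := @compact_cyl R n 0 (rho + 1) (- ta) 0.
have Bin x t : enorm x <= rho + 1 -> B (x, clampt ta t).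
  by move=> xr; split => /=; [rewrite subr0|rewrite in_itv/=; exact: clampt_bounds].
split; last first.
  have [||zM zMB hM] := @compact_EVT_max _ _ (fun z => `|F z|) B _ cB.
  - by exists (0, 0); split => /=; [rewrite subr0 enorm0 addr_ge0|rewrite in_itv/= oppr_le0 ta0 lexx].
  - apply: continuous_subspaceT => z; apply: (@continuous_comp _ _ _ F (fun u : R => `|u|)); [exact: cF|exact: norm_continuous].
  exists `|F zM| => -[x t]; rewrite Ft; have [xr|xr] := leP (enorm x) (rho + 1).
    by apply: hM; rewrite inE; exact: Bin.
  by rewrite F0 ?normr0// ltW// (le_lt_trans _ xr)// lerDl.
move=> e e0.
pose E := (B `*` B) `&` [set u : ('rV[R]_n * R) * ('rV[R]_n * R) | e <= `|F u.1 - F u.2|].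
have cE : compact E.
  apply: (@subclosed_compact _ _ (B `*` B)); last by move=> ? [].
    apply: closedI.
      apply: compact_closed; first exact: norm_hausdorff.
      exact: compact_setX.
    apply: (@closed_comp _ _ (fun u : ('rV[R]_n * R) * ('rV[R]_n * R) => `|F u.1 - F u.2|) [set a : R | e <= a]); last exact: closed_ge.
    move=> u _; apply: (@continuous_comp _ _ _ (fun u : ('rV[R]_n * R) * ('rV[R]_n * R) => F u.1 - F u.2) (fun u : R => `|u|)); last exact: norm_continuous.
    apply: cvgB.
      by apply: (@continuous_comp _ _ _ fst F); [exact: cvg_fst|exact: cF].
    by apply: (@continuous_comp _ _ _ snd F); [exact: cvg_snd|exact: cF].
  exact: compact_setX.
have q0 z z' : z != z' -> 0 < quad 1 z'.1 z'.2 0 z.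
  move=> zz; rewrite lt_neqAle quad_ge0 ?ler01// andbT eq_sym; apply: contra_neq zz.
  rewrite /quad addr0 mul1r => /eqP; rewrite paddr_eq0 ?sqr_ge0// !expf_eq0/= enorm_eq0 !subr_eq0 => /andP[/eqP h1 /eqP h2].
  by rewrite (surjective_pairing z) (surjective_pairing z') h1 h2.
have [m m0 hm] : exists2 m, 0 < m & forall q, E q -> m <= quad 1 q.2.1 q.2.2 0 q.1.
  have [E0|/set0P Ene] := eqVneq E set0; first by exists 1 => // q; rewrite E0.
  have cq : continuous (fun q : ('rV[R]_n * R) * ('rV[R]_n * R) => pen (fun=> 0) (fun=> 0) (fun=> 0) 1 q.1 q.2 : R).
    by apply: continuous_pen => z; exact: cvg_cst.
  have [q qE hq] := @compact_EVT_max _ _ (fun q : ('rV[R]_n * R) * ('rV[R]_n * R) => pen (fun=> 0) (fun=> 0) (fun=> 0) 1 q.1 q.2 : R) E Ene cE (continuous_subspaceT cq).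
  exists (quad 1 q.2.1 q.2.2 0 q.1); last first.
    by move=> q' /mem_set/hq; rewrite /pen !addr0 !subr0 !sub0r lerN2.
  apply: q0; move: qE; rewrite inE => -[_ /=]; case: eqVneq => // ->.
  by rewrite subrr normr0 leNgt e0.
(* With [d <= 1] one has [d ^+ 2 <= d <= m / 2], so the two squares together stay below [m]. *)
exists (Num.min 1 (m / 2)); first by rewrite lt_min ltr01 divr_gt0.
move=> [x t] [x' t'] /= xx tt; rewrite (Ft x) (Ft x').
rewrite ltNge; apply/negP => eF.
have xx1 : enorm (x - x') < 1 by apply: lt_le_trans xx _; rewrite ge_min lexx.
have small (a b : 'rV[R]_n) (tb tc : R) : enorm (a - b) < 1 -> rho + 1 < enorm a -> F (a, clampt ta tb) - F (b, clampt ta tc) = 0.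
  move=> ab ar; rewrite !F0 ?subrr//.
    by have := ler_enormD (a - b) b; rewrite subrK; move: ab ar; lr.
  by move: ar; lr.
have [xr|xr] := leP (enorm x) (rho + 1); last by move: eF; rewrite small// normr0 leNgt e0.
have [xr'|xr'] := leP (enorm x') (rho + 1); last by move: eF; rewrite distrC small ?normr0 1?leNgt ?e0// enormB.
have := hm ((x, clampt ta t), (x', clampt ta t')); rewrite /quad /= addr0 mul1r => /(_ _)/le_lt_trans => h.
have : m < m; last by rewrite ltxx.
apply: h; first by split => //; split; exact: Bin.
have lt := le_lt_trans (clampt_lip ta t t') tt.
set d := Num.min 1 _ in xx lt *.
have [d1 dm] : d <= 1 /\ d <= m / 2 by rewrite /d; split; rewrite ge_min lexx ?orbT.
have d0 : 0 <= d by exact: le_trans (enorm_ge0 _) (ltW xx).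
have h1 : enorm (x - x') ^+ 2 < d ^+ 2 by rewrite ltr_pXn2r ?nnegrE ?enorm_ge0.
have h2 : (clampt ta t - clampt ta t') ^+ 2 < d ^+ 2.
  by rewrite -(real_normK (num_real (_ - _))) ltr_pXn2r ?nnegrE.
by have : d ^+ 2 <= d; [rewrite expr2 ler_piMl|move: h1 h2 dm; lr].
Qed.

Lemma within_epsXP (S : set ('rV[R]_n * R)) v : {within S, continuous v} -> forall z, S z ->
  forall e, 0 < e -> exists2 d, 0 < d & forall z', S z' -> cylinder d z z' -> `|v z' - v z| < e.
Proof.
move=> /subspace_continuousP cv z Sz e e0.
have /cvgrPdist_lt/(_ _ e0) := cv z Sz.
rewrite near_withinE => /nbhs_ballP[d /= d0 hd]; exists d => // -[u t] Su [/= ud td].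
rewrite distrC; apply: hd => //; split; rewrite /= -ball_normE /= distrC//.
exact: le_lt_trans (le_norm_enorm _) ud.
Qed.

(** It equals 1 up to [rad / 2] and vanishes from [3 / 4 * rad] on, strictly inside the ball where
    the solutions are known to be continuous. *)
Definition cutoff rad x := Num.max 0 (Num.min 1 (3 - 4 * enorm x / rad)).

Lemma cutoff_in rad x : 0 < rad -> enorm x <= rad / 2 -> cutoff rad x = 1.
Proof.
move=> r0 xr; rewrite /cutoff min_l ?max_r//.
have : enorm x / rad <= 2^-1 by rewrite ler_pdivrMr// mulrC.
by rewrite -mulrA; lra.
Qed.

Lemma cutoff_out rad x : 0 < rad -> 3 / 4 * rad <= enorm x -> cutoff rad x = 0.
Proof.
move=> r0 xr; rewrite /cutoff max_l// ge_min; apply/orP; right.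
have : 3 / 4 <= enorm x / rad by rewrite ler_pdivlMr.
by rewrite -mulrA; lra.
Qed.

Lemma cutoff_bounds rad x : 0 <= cutoff rad x <= 1.
Proof. by rewrite /cutoff le_max lexx/= ge_max ler01 ge_min lexx. Qed.

Lemma continuous_cutoff rad : continuous (@cutoff rad).
Proof.
have h : continuous (fun x => Num.max 0 (Num.min 1 (3 - 4 * enorm x / rad))).
  have h1 : continuous (fun x => 3 - 4 * enorm x / rad).
    apply: (@lipschitz_continuous_enorm _ _ `|4 / rad|) => x y.
    rewrite (_ : _ - _ = 4 / rad * (enorm y - enorm x)); last by ring.
    by rewrite normrM ler_wpM2l// distrC ler_dist_enorm.
  have h2 (a : R) : continuous (fun x : 'rV[R]_n => a) by exact: cst_continuous.
  move=> x; apply: (continuous_max (h2 0 x)); exact: (continuous_min (h2 1 x) (h1 x)).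
exact: h.
Qed.

Definition vbar rad ta v z := cutoff rad z.1 * v (z.1, clampt ta z.2).

Lemma vbar_id rad ta v z : 0 < rad -> enorm z.1 <= rad / 2 -> - ta <= z.2 <= 0 -> vbar rad ta v z = v z.
Proof. by move=> r0 zr zt; rewrite /vbar cutoff_in// mul1r clampt_id// -surjective_pairing. Qed.

Lemma continuous_vbar rad ta tb v : 0 < rad -> 0 <= ta -> ta < tb ->
  {within eball rad `*` `]- tb, 0]%classic, continuous v} -> continuous (vbar rad ta v).
Proof.
move=> r0 ta0 tab cv z; apply/continuous_epsXP => e e0.
have Sin x t : enorm x < rad -> (eball rad `*` `]- tb, 0]%classic) (x, clampt ta t).
  move=> xr; split => //=; rewrite in_itv/=; have /andP[h1 h2] := clampt_bounds t ta0; rewrite h2 andbT.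
  by apply: lt_le_trans h1; rewrite ltrN2.
have [zr|zr] := ltP (enorm z.1) rad; last first.
  exists (rad / 4); first by rewrite divr_gt0.
  move=> z' [h1 h2]; rewrite /vbar !cutoff_out// ?mul0r ?subrr ?normr0//.
    by move: zr r0; lr.
  have := ler_enormD (z.1 - z'.1) z'.1; rewrite subrK enormB; move: zr h1; lr.
have e20 : 0 < e / 2 by rewrite divr_gt0.
have V0 : 0 < `|v (z.1, clampt ta z.2)| + 1 by rewrite ltr_wpDl.
have [d1 d10 hd1] := within_epsXP cv (Sin z.1 z.2 zr) e20.
have [d2 d20 hd2] := (continuous_at_enormP z.1 (@cutoff rad)).1 (@continuous_cutoff rad z.1) _ (divr_gt0 e20 V0).
exists (Num.min (rad - enorm z.1) (Num.min d1 d2)); first by rewrite !lt_min subr_gt0 zr d10.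
move=> z' [h1 h2]; move: h1 h2; rewrite !lt_min => /and3P[h1 h2 h3] /and3P[h4 h5 h6].
have zr' : enorm z'.1 < rad.
  by have := ler_enormD (z'.1 - z.1) z.1; rewrite subrK; move: h1; lr.
have a1 := hd1 (z'.1, clampt ta z'.2) (Sin _ _ zr') (conj h2 (le_lt_trans (clampt_lip _ _ _) h5)).
have a2 := hd2 z'.1; rewrite enormB in a2; have {}a2 := a2 h3.
rewrite /vbar; set c' := cutoff _ z'.1 in a2 *; set c := cutoff _ z.1 in a2 *.
set b' := v (z'.1, _) in a1 *; set b := v (z.1, _) in a1 a2 V0 *.
have /andP[c0 c1] : 0 <= c' <= 1 := cutoff_bounds rad z'.1.
rewrite (_ : _ - _ = c' * (b' - b) + (c' - c) * b); last by ring.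
apply: le_lt_trans (ler_normD _ _) _; rewrite !normrM (ger0_norm c0) (splitr e) ltr_leD//.
  by apply: le_lt_trans a1; rewrite ler_piMl.
have {}a2 := ltW a2; rewrite ler_pdivlMr// in a2; rewrite (distrC c'); apply: le_trans a2.
by rewrite ler_wpM2l// lerDl.
Qed.

Lemma le_time_closure w (c : R) x : continuous w -> (forall d, 0 < d -> exists2 t, - d < t < 0 & w (x, t) <= c) -> w (x, 0) <= c.
Proof.
move=> cw h; apply/ler_addgt0Pr => e e0; have [d d0 hd] := (continuous_epsXP w (x, 0)).1 (cw _) e e0.
have [t /andP[t1 t2] wt] := h d d0.
have := hd (x, t); rewrite /cylinder /= subrr enorm0 subr0 ltr0_norm// ltrNl.
by move=> /(_ (conj d0 t1)); rewrite ltr_norml; move: wt; clrP => ? /andP[? ?]; lra.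
Qed.

Lemma gopN k r (f g : 'rV[R]_n -> R) x : intg (fun y => (if enorm y < r then dlt f x y else dlt g x y) * k y) ->
  gop k r (fun x => - f x) (fun x => - g x) x = - gop k r f g x.
Proof.
move=> i; rewrite /gop -mulrN -INTN//; congr (_ * INT _); apply/funext => y.
by rewrite -mulNr; congr (_ * _); case: ifP => _; rewrite dltN.
Qed.

(* Cutting off far away and freezing time outside a compact interval turns the two solutions into uniformly continuous, bounded functions satisfying the same inequalities up to a small error. *)
Lemma reduction (g C0 : R) : par n s lam Lam -> lam <= Lam -> 0 < g -> g < 2 * s -> 0 < C0 ->
  exists2 Cg, 0 < Cg & forall rad, 4 <= rad -> forall tb ta, 0 < ta -> ta < tb ->
  forall K, kernel_class s lam Lam K -> exists2 k, kern s lam Lam k & forall (A : set ('rV[R]_n * R)) e v, 0 <= e ->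
  (forall t, - tb < t < 0 -> lebesgue_measurable (fun x => v (x, t))) ->
  {within eball rad `*` `]- tb, 0]%classic, continuous v} ->
  visc_abs_le K e (~` A `&` (eball rad `*` `]- tb, 0[%classic)) v ->
  (forall z, (eball rad `*` `]- tb, 0[%classic) z -> - e <= v z) ->
  (forall x t, - tb < t < 0 -> `|v (x, t)| <= C0 * (1 + enorm x) `^ (2 * s - g)) ->
  let w := vbar rad ta v in
  [/\ UC w, (exists M, forall z, `|w z| <= M), (forall z, - e <= w z),
    (forall z, `|w z| <= C0 * (1 + enorm z.1) `^ (2 * s - g)) &
    vsub k (e + Cg * rad `^ (- g)) (~` A `&` (eball (rad / 4) `*` `]- ta, 0[%classic)) w /\
    vsub k (e + Cg * rad `^ (- g)) (~` A `&` (eball (rad / 4) `*` `]- ta, 0[%classic)) (fun z => - w z)].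
Proof.
move=> pp lL g0 gs C00; have [Cg Cg0 hCg] := nonlocal_red pp g0 gs C00; exists Cg => //.
move=> rad r4 tb ta ta0 tab K HK; have [k [N [kk mN N0 Kk]]] := kernel_rep pp HK lL; exists k => //.
move=> A e v e0 vm vc [vle vge] vlow vg w.
have rad0 : 0 < rad by move: r4; lr.
have cw : continuous w by apply: continuous_vbar vc => //; exact: ltW.
have wt x t : w (x, t) = w (x, clampt ta t) by rewrite /w /vbar /= clampt_idem// ltW.
have ct t : clampt ta t < 0 -> - tb < clampt ta t < 0.
  move=> h; rewrite h andbT; have /andP[h1 _] := clampt_bounds t (ltW ta0).
  by apply: lt_le_trans h1; rewrite ltrN2.
(* The bounds on [v] are given for negative times only; the clamped value [0] is reached by
   continuity from earlier times. *)
have wext (P : 'rV[R]_n -> set R) : (forall x t, - ta <= t < 0 -> P x (w (x, t))) ->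
    (forall x, P x (w (x, 0))) -> forall z, P z.1 (w z).
  move=> h1 h2 [x t]; rewrite wt /=; have /andP[a b] := clampt_bounds t (ltW ta0).
  move: b; rewrite le_eqVlt => /orP[/eqP->//|b]; apply: h1; exact/andP.
have w0 (x : 'rV[R]_n) (c : R) : (forall t, - ta <= t < 0 -> w (x, t) <= c) -> w (x, 0) <= c.
  move=> h; apply: (le_time_closure cw) => d d0; exists (- (Num.min d ta / 2)).
    have m0 : 0 < Num.min d ta by rewrite lt_min d0.
    have md : Num.min d ta <= d by rewrite ge_min lexx.
    by apply/andP; split; move: m0 md; lr.
  apply: h; have m0 : 0 < Num.min d ta by rewrite lt_min d0.
  have md : Num.min d ta <= ta by rewrite ge_min lexx orbT.
  by apply/andP; split; move: m0 md; lr.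
have cNw : continuous (fun z => - w z) by move=> z; apply: cvgN; exact: cw.
have w0' (x : 'rV[R]_n) (c : R) : (forall t, - ta <= t < 0 -> c <= w (x, t)) -> c <= w (x, 0).
  move=> h; rewrite -lerN2; apply: (le_time_closure cNw) => d d0; exists (- (Num.min d ta / 2)).
    have m0 : 0 < Num.min d ta by rewrite lt_min d0.
    have md : Num.min d ta <= d by rewrite ge_min lexx.
    by apply/andP; split; move: m0 md; lr.
  rewrite lerN2; apply: h; have m0 : 0 < Num.min d ta by rewrite lt_min d0.
  have md : Num.min d ta <= ta by rewrite ge_min lexx orbT.
  by apply/andP; split; move: m0 md; lr.
have tin t : - ta <= t < 0 -> - tb < t < 0.
  by move=> /andP[h1 h2]; rewrite h2 andbT (lt_le_trans _ h1)// ltrN2.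
have tcl t : - ta <= t < 0 -> clampt ta t = t.
  by move=> /andP[h1 h2]; rewrite clampt_id// h1 ltW.
have wlow z : - e <= w z.
  apply: (wext (fun _ q => - e <= q)) => [x t ht|x]; last (apply: w0' => t ht);
  (rewrite /w /vbar /= tcl//; have /andP[c0 c1] := cutoff_bounds rad x;
   have [xr|xr] := ltP (enorm x) rad; last (by rewrite cutoff_out ?mul0r ?oppr_le0//; move: xr rad0; lr);
   have : - e <= v (x, t) by apply: vlow; split => //=; rewrite in_itv/= tin//).
    by move: c0 c1 e0; clrP; set c := cutoff _ _; nra.
  by move: c0 c1 e0; clrP; set c := cutoff _ _; nra.
have wgrow z : `|w z| <= C0 * (1 + enorm z.1) `^ (2 * s - g).
  have h (x : 'rV[R]_n) (t : R) : - ta <= t < 0 -> `|w (x, t)| <= C0 * (1 + enorm x) `^ (2 * s - g).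
    move=> ht; rewrite /w /vbar /= tcl// normrM; have /andP[c0 c1] := cutoff_bounds rad x.
    by rewrite (ger0_norm c0) (le_trans _ (vg x t (tin _ ht)))// ler_piMl.
  apply: (wext (fun x q => `|q| <= C0 * (1 + enorm x) `^ (2 * s - g))) => // x.
  rewrite ler_norml; apply/andP; split; [apply: w0'|apply: w0] => t ht; have := h x t ht; rewrite ler_norml => /andP[]//.
have [ucw [M wM]] : UC w /\ exists M, forall z, `|w z| <= M.
  apply: (@UC_of_compact w ta (3 / 4 * rad)) => //; [exact: ltW|by rewrite mulr_ge0 ?divr_ge0// ltW|].
  by move=> x t xr; rewrite /w /vbar cutoff_out// mul0r.
(* Contact cylinders lie where the cut-off is 1 and time is not frozen, so [w] and [v] coincide
   there and one test function serves both; they differ only in the far part of the operator. *)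
have key z r phi : 0 < r -> cylinder r z `<=` ~` A `&` (eball (rad / 4) `*` `]- ta, 0[%classic) -> tst phi -> phi z = w z ->
    [/\ cylinder r z `<=` ~` A `&` (eball rad `*` `]- tb, 0[%classic), (forall z', cylinder r z z' -> w z' = v z'),
    intg (fun y => (if enorm y < r then dlt (fun x => phi (x, z.2)) z.1 y else dlt (fun x => w (x, z.2)) z.1 y) * k y) &
    `|nonlocal_op K (Defs.glue r z phi v) z.1 - gop k r (fun x => phi (x, z.2)) (fun x => w (x, z.2)) z.1| <= Cg * rad `^ (- g)].
  move=> r0 cyl tphi phiz.
  have zz : cylinder r z z by split; rewrite subrr ?enorm0 ?normr0.
  have wv z' : cylinder r z z' -> w z' = v z'.
    move=> /cyl[_ [/= h1]]; rewrite in_itv/= => /andP[h2 h3]; apply: vbar_id => //.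
      by move: h1; rewrite /eball /=; move: rad0; lr.
    by rewrite !ltW.
  have [_ [/= zr]] := cyl z zz; rewrite in_itv/= => /andP[zt1 zt2].
  have zt : - ta <= z.2 < 0 by rewrite ltW.
  have [C C0' hC] := tst_dlt_bound z tphi r0.
  have mw : measurable_fun setT (fun x => w (x, z.2)) by apply: continuous_measurable_rV; exact: UC_slice.
  have cphi := @tst_slice _ _ phi z.2 tphi.
  split => //.
  - move=> z' /cyl[h [/= h1]]; rewrite in_itv/= => /andP[h2 h3]; split => //; split => /=.
      by move: h1; rewrite /eball /=; move: rad0; lr.
    by rewrite in_itv/= h3 andbT (lt_trans _ h2)// ltrN2.
  - exact: (intg_gop pp kk r0 C0' (continuous_measurable_rV cphi) mw (fun x => wM _) hC).
  have cn : continuous (fun z => `|phi z|).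
    by move=> z'; apply: (@continuous_comp _ _ _ phi (fun u : R => `|u|)); [exact: tst_continuous|exact: norm_continuous].
  have ezz : enorm (z.1 - z.1) <= r by rewrite subrr enorm0 ltW.
  have ett : z.2 <= z.2 <= z.2 by rewrite lexx.
  have [zM [_ _ hM]] := cyl_max cn ezz ett.
  apply: (@hCg rad r4 K k N (fun x => v (x, z.2)) (fun x => w (x, z.2)) (fun x => phi (x, z.2)) z.1 r C (Num.max M `|phi zM|) kk mN N0 Kk) => //.
  - by apply: vm; exact: tin.
  - by move=> y; rewrite le_max wM.
  - by move=> y yr; rewrite /w vbar_id//= ltW//; move: zt => /andP[_ /ltW].
  - by move=> y; apply: vg; exact: tin.
  - by move=> y yr; rewrite le_max hM ?orbT//= (addrC z.1) addrK ltW.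
  - by rewrite -surjective_pairing phiz wv.
split => //; first by exists M.
split=> z r phi r0 cyl tphi phiz phile.
  have [cyl' wv _ h] := key z r phi r0 cyl tphi phiz.
  have zz : cylinder r z z by split; rewrite subrr ?enorm0 ?normr0.
  have := vle z r phi r0 cyl' (proj1 tphi).
  rewrite -wv// => /(_ phiz) H; have {}H : Dt phi z - nonlocal_op K (Defs.glue r z phi v) z.1 <= e.
    by apply: H => z' hz; rewrite -wv//; exact: phile.
  by move: h H; rewrite ler_norml; clrP => /andP[? ?] ?; lra.
have phiNz : - phi z = w z by rewrite phiz opprK.
have [cyl' wv i h] := key z r (fun z => - phi z) r0 cyl (tstN tphi) phiNz.
have zz : cylinder r z z by split; rewrite subrr ?enorm0 ?normr0.
have := vge z r (fun z => - phi z) r0 cyl' (C21N (proj1 tphi)).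
rewrite -wv// Dt_opp; last exact: (proj1 tphi).
move=> /(_ phiNz) H; have {}H : - e <= - Dt phi z - nonlocal_op K (Defs.glue r z (fun z => - phi z) v) z.1.
  by apply: H => z' hz; rewrite -wv// lerNl; exact: phile.
have := gopN i; under [X in gop k r X _ _]eq_fun do rewrite opprK.
by move: h H; rewrite ler_norml; clrP => /andP[? ?] ? ->; lra.
Qed.

End CutOff.

(** * Barriers: local maximum, local minimum and propagation of positivity *)

Section Weights.
Context (R : realType) (n : nat) (s lam Lam : R).
Implicit Types (x y p : 'rV[R]_n) (z v : 'rV[R]_n * R) (w : 'rV[R]_n * R -> R)
  (k u : 'rV[R]_n -> R) (t e r C M : R).

(** The model kernel regularised at scale [r]: comparable with [jker] beyond [r] and bounded inside,
    so that the mass also sees the values near its centre. *)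
Definition wgt r y : R := (r + enorm y) `^ (- n%:R - 2 * s).

Lemma wgt_ge0 r y : 0 <= wgt r y. Proof. exact: powR_ge0. Qed.

Lemma meas_wgt r : measurable_fun setT (wgt r).
Proof.
have m1 : measurable_fun setT (fun y : 'rV[R]_n => r + enorm y).
  by apply: measurable_funD; [exact: measurable_cst|exact: meas_enorm].
exact: (@measurableT_comp _ _ _ _ _ _ (@powR R ^~ (- n%:R - 2 * s)) _ (fun y : 'rV[R]_n => r + enorm y) (measurable_powR _) m1).
Qed.

Lemma ler_powP (a b : R) : 0 < s -> 0 < a -> a <= b -> b `^ (- n%:R - 2 * s) <= a `^ (- n%:R - 2 * s).
Proof. by move=> s0 a0 ab; rewrite -opprD; apply: ler_powRN => //; rewrite addr_ge0// mulr_ge0// ltW. Qed.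

Lemma powP_split r : 0 < r -> r `^ (- n%:R - 2 * s) = r ^- n / r `^ (2 * s).
Proof.
move=> r0; rewrite powRD; last by rewrite (gt_eqF r0) implybT.
by rewrite !powRN powR_mulrn// ltW.
Qed.

Lemma wgt_bounds : par n s lam Lam -> exists2 C, 0 < C & forall r, 0 < r ->
  intg (wgt r) /\ INT (wgt r) <= C / r `^ (2 * s).
Proof.
move=> [hn s0 s1 _ _]; have [C C0 h] := jker_far n s0; exists (C + 2 ^+ n); first by rewrite addr_gt0// exprn_gt0.
move=> r r0; have [i1 I1] := h r r0.
pose g y := ind (r <= enorm y) * jker s y + r `^ (- n%:R - 2 * s) * ind (enorm (y - 0) < r).
have ig : intg g by apply: intgD => //; apply: intgZ; exact: intg_ball.
have le y : `|wgt r y| <= g y.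
  rewrite ger0_norm ?wgt_ge0// /g subr0; case: (ltP (enorm y) r) => yr; rewrite /ind /= ?mul1r ?mul0r ?mulr1 ?mulr0 ?addr0 ?add0r.
    by apply: ler_powP; rewrite ?lerDl ?enorm_ge0.
  by apply: ler_powP; rewrite ?lerDr ?(ltW r0)// (lt_le_trans r0).
have iw := intg_le (meas_wgt r) le ig; split => //.
apply: (@le_trans _ _ (INT g)).
  by apply: INT_le => // y; rewrite (le_trans _ (le y))// ler_norm.
rewrite /g INTD//; last by apply: intgZ; exact: intg_ball.
rewrite INTZ; last exact: intg_ball.
rewrite [leRHS]mulrDl lerD//; first by rewrite -powRN.
rewrite powP_split// mulrAC ler_pM2r ?invr_gt0 ?powR_gt0// mulrC ler_pdivrMr ?exprn_gt0// -exprMn.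
by apply: INT_ball_le; exact: ltW.
Qed.

(** It has the dimension of [w / r^(2s)], that of a time derivative: integrated over a time of order
    [r^(2s)] it is comparable with values of [w]. *)
Definition Mt w r x t := INT (fun y => Num.max 0 (w (x + y, t)) * wgt r y).

Definition bdd w M := forall z, `|w z| <= M.

Lemma pos_le_norm (a : R) : `|Num.max 0 a| <= `|a|.
Proof. by case: (leP 0 a) => a0 //; rewrite normr0. Qed.

Lemma pos_lip (a b : R) : `|Num.max 0 a - Num.max 0 b| <= `|a - b|.
Proof.
have := ler_norm (a - b); have := ler_norm (b - a); rewrite (distrC b) => h1 h2.
by rewrite ler_norml; case: (leP 0 a) => a0; case: (leP 0 b) => b0; apply/andP; split; lra.
Qed.

Lemma meas_pos_slice w x t : UC w -> measurable_fun setT (fun y => Num.max 0 (w (x + y, t))).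
Proof.
move=> uw; apply: measurable_maxr; first exact: measurable_cst.
apply: (meas_shift (f := fun y => w (y, t))); apply: continuous_measurable_rV; exact: UC_slice.
Qed.

Lemma intg_Mt w M r x t : par n s lam Lam -> UC w -> bdd w M -> 0 < r ->
  intg (fun y => Num.max 0 (w (x + y, t)) * wgt r y).
Proof.
move=> pp uw bw r0; have [C C0 h] := wgt_bounds pp; have [iw _] := h r r0.
apply: (intg_le _ _ (intgZ M iw)).
  by apply: measurable_funM; [exact: meas_pos_slice|exact: meas_wgt].
move=> y; rewrite normrM (ger0_norm (wgt_ge0 _ _)) ler_wpM2r ?wgt_ge0//.
exact: le_trans (pos_le_norm _) (bw _).
Qed.

Lemma Mt_ge0 w r x t : 0 <= Mt w r x t.
Proof. by apply: INT_ge0 => y; rewrite mulr_ge0 ?wgt_ge0// le_max lexx. Qed.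

Lemma continuous_Mt w M r x : par n s lam Lam -> UC w -> bdd w M -> 0 < r -> continuous (Mt w r x).
Proof.
move=> pp uw bw r0 t; apply/cvgrPdist_le => e e0.
have [C C0 h] := wgt_bounds pp; have [iw _] := h r r0.
have I1 : 0 < INT (wgt r) + 1 by rewrite ltr_wpDl// INT_ge0// => y; exact: wgt_ge0.
have [d d0 hd] := uw _ (divr_gt0 e0 I1).
near=> t'.
have tt : `|t - t'| < d by near: t'; apply: cvgr_dist_lt.
rewrite /Mt -INTB; [|exact: intg_Mt bw r0|exact: intg_Mt bw r0].
have ib := intgB (intg_Mt x t pp uw bw r0) (intg_Mt x t' pp uw bw r0).
apply: le_trans (le_norm_INT ib) _.
apply: (@le_trans _ _ (INT (fun y => e / (INT (wgt r) + 1) * wgt r y))).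
  apply: INT_le; [exact: intg_norm ib|exact: intgZ|move=> y].
  rewrite -mulrBl normrM (ger0_norm (wgt_ge0 _ _)) ler_wpM2r ?wgt_ge0// (le_trans (pos_lip _ _))// ltW// hd//=.
  by rewrite subrr enorm0.
rewrite INTZ// mulrAC ler_pdivrMr// ler_wpM2l ?(ltW e0)// lerDl//.
Unshelve. all: by end_near. Qed.

End Weights.

(** * Upper bound by the mass: a barrier that blows up *)

Section BlowUp.
Context (R : realType).
Implicit Types (nu v D : R).

Lemma C1fun_inv (g dg : R -> R) : C1fun g dg -> (forall t, 0 < g t) ->
  C1fun (fun t => (g t)^-1) (fun t => - dg t * (g t)^-1 ^+ 2).
Proof.
move=> cg g0; split=> t.
  have gt : g t != 0 by rewrite gt_eqF.
  have := (proj1 cg) t => hg; have := is_deriveV gt hg => h.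
  by apply: is_derive_eq; rewrite /GRing.scale /= exprVn; ring.
have cg' := C1fun_continuous cg.
have cV : {for t, continuous (fun t => (g t)^-1)}.
  by apply: cvgV; [rewrite gt_eqF|exact: cg'].
apply: cvgM; first by apply: cvgN; exact: (proj2 cg).
by under [X in X @ _ --> _]eq_fun do rewrite expr2; rewrite expr2; apply: cvgM; exact: cV.
Qed.

(* [bf N nu] blows up like [max (1 - v) nu ^- (3 (N + 1))] as [v] tends to [1]; [nu > 0] regularises it. *)
Definition bg nu v : R := ppow 3 (1 - v) + nu ^+ 3.
Definition bf (N : nat) nu v : R := (bg nu v)^-1 ^+ N.+1.
Definition bf1 (N : nat) nu v : R := 3 * N.+1%:R * ((bg nu v)^-1 ^+ N.+2 * ppow 2 (1 - v)).
Definition bf2 (N : nat) nu v : R :=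
  3 * N.+1%:R * (3 * N.+2%:R * ((bg nu v)^-1 ^+ N.+3 * ppow 2 (1 - v) ^+ 2) - 2 * ((bg nu v)^-1 ^+ N.+2 * ppow 1 (1 - v))).

Lemma bg_gt0 nu v : 0 < nu -> 0 < bg nu v.
Proof. by move=> nu0; rewrite ltr_wpDl ?ppow_ge0 ?exprn_gt0. Qed.

Lemma C1fun_ppow_sub k : C1fun (fun v : R => ppow k.+2 (1 - v)) (fun v => - (k.+2%:R * ppow k.+1 (1 - v))).
Proof.
have h := C1fun_comp (C1fun_ppow R k) (C1fun_affine (-1) 1).
by apply: (eq_C1fun h) => v /=; rewrite ?mulN1r ?mulrN1 (addrC (- v)).
Qed.

Lemma C2fun_bf N nu : 0 < nu -> C2fun (bf N nu) (bf1 N nu) (bf2 N nu).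
Proof.
move=> nu0; have gi0 v := bg_gt0 v nu0.
have hg : C1fun (bg nu) (fun v => - (3 * ppow 2 (1 - v))).
  by apply: (eq_C1fun (C1funD (C1fun_ppow_sub 1) (C1fun_cst (nu ^+ 3)))) => v //; rewrite addr0.
have hgi := C1fun_inv hg gi0.
split.
  apply: (eq_C1fun (C1fun_comp (C1fun_exprn R N) hgi)) => v //=.
  by rewrite /bf1 !exprS; ring.
have h1 := C1fun_comp (C1fun_exprn R N.+1) hgi.
apply: (eq_C1fun (C1funM (C1fun_cst (3 * N.+1%:R)) (C1funM h1 (C1fun_ppow_sub 0)))) => v //=.
by rewrite /bf2 !exprS; ring.
Qed.

Lemma bf_gt0 N nu v : 0 < nu -> 0 < bf N nu v.
Proof. by move=> nu0; rewrite exprn_gt0// invr_gt0 bg_gt0. Qed.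

(** Numerical factor of the second-derivative bound below; the powers of 8 count the factors
    [(bg nu v)^-1]. *)
Definition bB (N : nat) : R := 54 * N.+1%:R * N.+2%:R * 8 ^+ N.+3 + 9 * N.+1%:R * 8 ^+ N.+2.

(** With [D = 1 - v], the product [(bg nu v)^-1 * D ^+ 3] is at most 1, so a derivative costs a
    factor of order [1 / D], as for a pure power, uniformly in [nu]. *)
Lemma bf1_bounds N nu v D : 0 < nu -> 0 < D -> v = 1 - D -> 0 <= bf1 N nu v <= 3 * N.+1%:R * bf N nu v / D.
Proof.
move=> nu0 D0 vD; have gi0 := bg_gt0 v nu0.
have gD : (bg nu v)^-1 * D ^+ 3 <= 1.
  rewrite mulrC ler_pdivrMr// mul1r /bg vD subKr ppow_pos ?(ltW D0)//.
  by rewrite lerDl exprn_ge0// ltW.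
have i0 : 0 <= (bg nu v)^-1 by rewrite invr_ge0 ltW.
have N0 : 0 <= 3 * N.+1%:R :> R by rewrite mulr_ge0.
apply/andP; split; first by apply: mulr_ge0 => //; apply: mulr_ge0; [exact: exprn_ge0|exact: ppow_ge0].
rewrite ler_pdivlMr// /bf1 -(mulrA (3 * _)) ler_wpM2l//.
rewrite /bf vD subKr ppow_pos ?(ltW D0)// -vD exprS.
have f0 : 0 <= (bg nu v)^-1 ^+ N.+1 by rewrite exprn_ge0.
rewrite [leLHS](_ : _ = (bg nu v)^-1 ^+ N.+1 * ((bg nu v)^-1 * D ^+ 3)); last by ring.
exact: ler_piMr.
Qed.

(** On the interval considered [1 - v] stays between [D / 2] and [3 / 2 * D], so [(bg nu v)^-1] is
    at most 8 times its value at [u]; two derivatives then cost [1 / D ^+ 2]. *)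
Lemma bf2_bound N nu u v D : 0 < nu -> 0 < D -> u = 1 - D -> `|v - u| <= D / 2 ->
  `|bf2 N nu v| <= bB N * bf N nu u / D ^+ 2.
Proof.
move=> nu0 D0 uD vu; have gu0 := bg_gt0 u nu0; have gv0 := bg_gt0 v nu0.
have [p1 p2] : D / 2 <= 1 - v /\ 1 - v <= 3 / 2 * D.
  by move: vu; rewrite ler_norml uD => /andP[? ?]; split; lra.
have p0 : 0 <= 1 - v by apply: le_trans p1; rewrite divr_ge0// ltW.
have eu : bg nu u = D ^+ 3 + nu ^+ 3 by rewrite /bg uD subKr ppow_pos ?(ltW D0).
have n30 : 0 < nu ^+ 3 by rewrite exprn_gt0.
have h8 : (bg nu v)^-1 <= 8 * (bg nu u)^-1.
  rewrite -[leRHS]invrK invf_ple ?posrE ?invr_gt0 ?mulr_gt0 ?invr_gt0// invfM invrK eu /bg ppow_pos//.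
  have : (D / 2) ^+ 3 <= (1 - v) ^+ 3 by rewrite lerXn2r// nnegrE// divr_ge0// ltW.
  rewrite exprMn; set a := D ^+ 3; rewrite (_ : 2^-1 ^+ 3 = 8^-1) => [|]; last by rewrite !exprS expr0; field.
  by move: n30; lr.
have giD : (bg nu u)^-1 * D ^+ 3 <= 1.
  by rewrite mulrC ler_pdivrMr// mul1r eu lerDl ltW.
set A := (bg nu u)^-1 in h8 giD *; set B := (bg nu v)^-1 in h8 *.
have A0 : 0 <= A by rewrite invr_ge0 ltW.
have B0 : 0 <= B by rewrite invr_ge0 ltW.
have D2 : 0 < D ^+ 2 by rewrite exprn_gt0.
have BX m : B ^+ m <= 8 ^+ m * A ^+ m by rewrite -exprMn lerXn2r// nnegrE// mulr_ge0.
have f0 : 0 <= A ^+ N.+1 by rewrite exprn_ge0.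
rewrite /bf2 /bf -/A -/B ppow_pos// ppow_pos// expr1.
have t1 : B ^+ N.+3 * ((1 - v) ^+ 2) ^+ 2 <= 8 ^+ N.+3 * (A ^+ N.+1 / D ^+ 2) * 6.
  apply: (@le_trans _ _ (8 ^+ N.+3 * A ^+ N.+3 * ((3 / 2 * D) ^+ 2) ^+ 2)).
    apply: ler_pM; rewrite ?exprn_ge0 ?BX//.
    by rewrite lerXn2r ?nnegrE ?exprn_ge0 ?mulr_ge0 ?divr_ge0 ?(ltW D0)// lerXn2r ?nnegrE ?mulr_ge0 ?divr_ge0 ?(ltW D0).
  rewrite -[leLHS]mulrA -[leRHS]mulrA ler_wpM2l ?exprn_ge0//.
  have -> : A ^+ N.+3 * ((3 / 2 * D) ^+ 2) ^+ 2 = A ^+ N.+1 / D ^+ 2 * (81 / 16 * (A * D ^+ 3) ^+ 2).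
    by rewrite !exprS; field; rewrite ?mulf_neq0 ?gt_eqF.
  rewrite ler_wpM2l ?divr_ge0 ?(ltW D2)//.
  have : (A * D ^+ 3) ^+ 2 <= 1 by rewrite expr_le1// mulr_ge0 ?exprn_ge0// ltW.
  by lr.
have t2 : B ^+ N.+2 * (1 - v) <= 8 ^+ N.+2 * (A ^+ N.+1 / D ^+ 2) * (3 / 2).
  apply: (@le_trans _ _ (8 ^+ N.+2 * A ^+ N.+2 * (3 / 2 * D))).
    by apply: ler_pM; rewrite ?exprn_ge0 ?BX.
  rewrite -[leLHS]mulrA -[leRHS]mulrA ler_wpM2l ?exprn_ge0//.
  have -> : A ^+ N.+2 * (3 / 2 * D) = A ^+ N.+1 / D ^+ 2 * (3 / 2 * (A * D ^+ 3)).
    by rewrite !exprS; field; rewrite ?mulf_neq0 ?gt_eqF.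
  rewrite ler_wpM2l ?divr_ge0 ?(ltW D2)//.
  by move: giD; lr.
have q1 : 0 <= B ^+ N.+3 * ((1 - v) ^+ 2) ^+ 2 by rewrite mulr_ge0 ?exprn_ge0.
have q2 : 0 <= B ^+ N.+2 * (1 - v) by rewrite mulr_ge0 ?exprn_ge0.
rewrite normrM ger0_norm ?mulr_ge0//.
apply: (@le_trans _ _ (3 * N.+1%:R * (3 * N.+2%:R * (B ^+ N.+3 * ((1 - v) ^+ 2) ^+ 2) + 2 * (B ^+ N.+2 * (1 - v))))).
  rewrite ler_wpM2l ?mulr_ge0// (le_trans (ler_normB _ _))// !ger0_norm// mulr_ge0//.
rewrite /bB (_ : (_ + _) * _ / _ = 3 * N.+1%:R * (3 * N.+2%:R * (8 ^+ N.+3 * (A ^+ N.+1 / D ^+ 2) * 6) + 2 * (8 ^+ N.+2 * (A ^+ N.+1 / D ^+ 2) * (3 / 2)))); last first.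
  by field; rewrite gt_eqF.
by rewrite ler_wpM2l ?mulr_ge0// lerD// ler_wpM2l// mulr_ge0.
Qed.

End BlowUp.

Ltac pos := repeat first [assumption | by apply: ltW | exact: ler0n | exact: ltr0Sn | exact: sqr_ge0 | exact: enorm_ge0
  | exact: powR_ge0 | exact: ind_ge0 | exact: ppow_ge0 | exact: tr_ge0 | apply: exprn_ge0 | apply: exprn_gt0
  | apply: mulr_ge0 | apply: mulr_gt0 | rewrite invr_ge0 | rewrite invr_gt0 | apply: powR_gt0 | apply: addr_ge0 | apply: addr_gt0 | by []].

Section LocalMaximum.
Context (R : realType) (n : nat) (s lam Lam : R).
Implicit Types (x y p : 'rV[R]_n) (z v : 'rV[R]_n * R) (w : 'rV[R]_n * R -> R)
  (k u : 'rV[R]_n -> R) (t e r C M : R).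

(** Displacements up to [kap * D * r] move the argument by at most [D / 2], so the derivative bounds
    at the centre apply. The factor [kap ^+ 2], gained by measuring at the scale [kap * D * r], is
    what lets absorption beat dispersion. *)
Lemma blowup_near (N : nat) nu r c kap D p x y : 0 < nu -> 0 < r -> 0 <= c -> 0 < kap -> kap <= 1 -> 0 < D ->
  let a := ((16 * r) ^+ 2)^-1 in
  1 - D = a * enorm (x - p) ^+ 2 + c -> enorm y <= kap * D * r ->
  `|dlt (fun x => bf N nu (a * enorm (x - p) ^+ 2 + c)) x y| <=
    (N.+1%:R + bB R N) * kap ^+ 2 * bf N nu (1 - D) * tr (kap * D * r) y.
Proof.
move=> nu0 r0 c0 kap0 kap1 D0 a eD yr.
have a16 : 0 < (16 * r) ^+ 2 by rewrite exprn_gt0// mulr_gt0.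
have a0 : 0 <= a by rewrite invr_ge0 ltW.
have D1 : D <= 1.
  by have := addr_ge0 (mulr_ge0 a0 (sqr_ge0 (enorm (x - p)))) c0; rewrite -eD; lr.
have f0 := bf_gt0 N (1 - D) nu0.
have xr : enorm (x - p) <= 16 * r.
  have h : a * enorm (x - p) ^+ 2 <= 1 by move: eD D0 c0; lr.
  have r16 : 0 <= 16 * r by rewrite mulr_ge0// ltW.
  rewrite -(@ler_pXn2r _ 2)// ?nnegrE ?enorm_ge0//.
  by move: h; rewrite /a mulrC ler_pdivrMr// mul1r.
have y0 := enorm_ge0 y; have x0 := enorm_ge0 (x - p).
have kD : kap * D <= 1 by rewrite mulr_ile1// ltW.
have yr1 : enorm y <= r by apply: le_trans yr _; rewrite ler_piMl// ltW.
pose eta := a * (2 * enorm (x - p) * enorm y + enorm y ^+ 2).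
have eta1 : eta <= enorm y / (7 * r).
  rewrite /eta /a mulrC ler_pdivrMr// expr2 -mulrDl mulrAC mulrC -[leRHS]mulrA ler_wpM2l//.
  rewrite mulrC ler_pdivlMr ?mulr_gt0//; move: xr yr1 r0 x0 y0; clrP; nra.
have etaD : eta <= D / 2.
  apply: le_trans eta1 _; rewrite ler_pdivrMr ?mulr_gt0//.
  have : kap * D * r <= D * r by rewrite -mulrA ler_piMl// mulr_ge0// ltW.
  by move: yr (mulr_gt0 D0 r0); lr.
have eta0 : 0 <= eta.
  by rewrite mulr_ge0// addr_ge0 ?sqr_ge0// !mulr_ge0.
have := @dlt_base _ _ (bf N nu) (bf1 N nu) (bf2 N nu) a c (bB R N * bf N nu (1 - D) / D ^+ 2) x p y a0 (C2fun_bf N nu0).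
rewrite /= -eD => /(_ _)/le_trans; apply.
  move=> v hv; apply: (@bf2_bound _ N nu (1 - D) v D) => //; exact: le_trans hv etaD.
have /andP[b0 b1] := bf1_bounds N nu0 D0 (erefl (1 - D)).
rewrite (ger0_norm b0) tr_near ?mulr_gt0//.
have kr0 : 0 < kap * r by rewrite mulr_gt0.
have q0 : 0 <= enorm y ^+ 2 by exact: sqr_ge0.
rewrite [leRHS](_ : _ = N.+1%:R * bf N nu (1 - D) * (enorm y ^+ 2 / (D ^+ 2 * r ^+ 2)) + bB R N * bf N nu (1 - D) * (enorm y ^+ 2 / (D ^+ 2 * r ^+ 2))); last first.
  by field; rewrite !gt_eqF.
apply: lerD.
  apply: (@le_trans _ _ (3 * N.+1%:R * bf N nu (1 - D) / D * (2 * a * enorm y ^+ 2))).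
    by rewrite ler_wpM2r// mulr_ge0// mulr_ge0.
  rewrite [leLHS](_ : _ = N.+1%:R * bf N nu (1 - D) * (3 / D * (2 * a * enorm y ^+ 2))); last by ring.
  rewrite ler_wpM2l ?mulr_ge0 ?(ltW f0)// /a.
  rewrite [leLHS](_ : _ = enorm y ^+ 2 / (D ^+ 2 * r ^+ 2) * (6 / 256 * D)); last by field; rewrite !gt_eqF.
  apply: ler_piMr; first by rewrite divr_ge0// mulr_ge0 ?sqr_ge0.
  by move: D1 D0; lr.
have e2 : eta ^+ 2 <= enorm y ^+ 2 / (49 * r ^+ 2).
  rewrite [leRHS](_ : _ = (enorm y / (7 * r)) ^+ 2); last by field; rewrite gt_eqF.
  by rewrite ler_pXn2r// nnegrE// divr_ge0// mulr_ge0// ltW.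
have bB0 : 0 <= bB R N by rewrite /bB addr_ge0// !mulr_ge0// exprn_ge0.
apply: (@le_trans _ _ (2 * (bB R N * bf N nu (1 - D) / D ^+ 2) * (enorm y ^+ 2 / (49 * r ^+ 2)))).
  by rewrite ler_wpM2l// mulr_ge0// divr_ge0 ?sqr_ge0// mulr_ge0// ltW.
rewrite [leLHS](_ : _ = bB R N * bf N nu (1 - D) * (enorm y ^+ 2 / (D ^+ 2 * r ^+ 2)) * (2 / 49)); last by field; rewrite !gt_eqF.
by apply: ler_piMr; [pos|lra].
Qed.

(** When [|y| >= b * r], the distance [r + enorm (y + (x - p))] is at most [17 * r + |y|], hence at
    most [18 / b * |y|]: the kernel seen from [x] lies below a multiple of the weight centred at
    [p]. *)
Lemma far_le_Mt k w M r p x t b : par n s lam Lam -> kern s lam Lam k -> UC w -> bdd w M -> 0 < r -> 0 < b -> b <= 1 ->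
  enorm (x - p) <= 16 * r ->
  intg (fun y => ind (b * r <= enorm y) * Num.max 0 (w (x + y, t)) * k y) /\
  INT (fun y => ind (b * r <= enorm y) * Num.max 0 (w (x + y, t)) * k y) <= Lam * (18 / b) `^ (n%:R + 2 * s) * Mt s w r p t.
Proof.
move=> pp kk uw bw r0 b0 b1 xr; have [hn s0 s1 lam0 Lam0] := pp; have [mk ke kb] := kk.
have br0 : 0 < b * r by rewrite mulr_gt0.
have i : intg (fun y => ind (b * r <= enorm y) * Num.max 0 (w (x + y, t)) * k y).
  apply: (intg_far_le pp kk br0 (meas_pos_slice _ _ uw) (C := M)) => y.
  exact: le_trans (pos_le_norm _) (bw _).
split => //; have i2 := intg_Mt p t pp uw bw r0.
rewrite /Mt -(INT_shift (x - p) i2) -INTZ; last exact: (intg_shift (x - p) i2).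
apply: INT_le => //; first by apply: intgZ; exact: (intg_shift (x - p) i2).
move=> y; rewrite (_ : p + (y + (x - p)) = x + y); last by rewrite addrCA (addrC p) subrK addrC.
set W := Num.max 0 _; have W0 : 0 <= W by rewrite /W le_max lexx.
case: (ltP (enorm y) (b * r)) => yr.
  by rewrite {1}/ind !mul0r !mulr_ge0 ?powR_ge0 ?wgt_ge0// ltW.
rewrite {1}/ind mul1r mulrCA ler_wpM2l//; have /andP[_ kL] := kb y; apply: le_trans kL _.
rewrite -mulrA ler_wpM2l ?(ltW Lam0)// /jker /wgt.
have y0 : 0 < enorm y := lt_le_trans br0 yr.
have h : r + enorm (y + (x - p)) <= 18 / b * enorm y.
  rewrite mulrAC ler_pdivlMr//; have := ler_enormD y (x - p) => h.
  have h1 : r + enorm (y + (x - p)) <= 17 * r + enorm y by move: h xr; lr.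
  apply: le_trans (ler_wpM2r (ltW b0) h1) _.
  have : b * enorm y <= enorm y by rewrite ler_piMl// ltW.
  by move: yr; rewrite mulrDl; clrP; rewrite -mulrA (mulrC r) (mulrC (enorm y) b); lra.
have rp : 0 < r + enorm (y + (x - p)) by rewrite ltr_wpDr ?enorm_ge0.
have b18 : 0 < 18 / b by rewrite divr_gt0.
apply: le_trans (_ : (18 / b) `^ (n%:R + 2 * s) * (18 / b * enorm y) `^ (- n%:R - 2 * s) <= _).
  rewrite [X in _ <= _ * X]powRM ?(ltW b18) ?(ltW y0)// mulrA -opprD (powRN (18 / b)) mulfV ?mul1r// gt_eqF// powR_gt0//.
by rewrite ler_wpM2l ?powR_ge0// ler_powP.
Qed.

Lemma rs_gt0 r : 0 < r -> 0 < r `^ (2 * s).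
Proof. exact: powR_gt0. Qed.

Lemma rs_le r : 2^-1 <= s -> 0 < r -> r <= 1 -> r `^ (2 * s) <= r.
Proof.
move=> s2 r0 r1; rewrite -[leRHS]powRr1; last exact: ltW.
by apply: ger_powR; [rewrite r0|move: s2; lr].
Qed.

Lemma bf_ge N (nu v : R) : 0 < nu -> nu <= 1 - v -> ((2 * (1 - v) ^+ 3)^-1) ^+ N.+1 <= bf N nu v.
Proof.
move=> nu0 h; have v0 : 0 < 1 - v := lt_le_trans nu0 h.
rewrite lerXn2r// ?nnegrE ?invr_ge0 ?mulr_ge0 ?exprn_ge0 ?(ltW v0) ?(ltW (bg_gt0 _ nu0))//.
rewrite lef_pV2 ?posrE ?mulr_gt0 ?exprn_gt0 ?bg_gt0// /bg ppow_pos ?(ltW v0)//.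
have : nu ^+ 3 <= (1 - v) ^+ 3 by rewrite lerXn2r// nnegrE ltW.
by lr.
Qed.

Lemma bf_edge N (nu v : R) : 0 < nu -> nu <= 1 -> 1 - v <= nu -> (2 ^+ N.+1)^-1 / nu <= bf N nu v.
Proof.
move=> nu0 nu1 h; have n30 : 0 < nu ^+ 3 by rewrite exprn_gt0.
have g2 : bg nu v <= 2 * nu.
  have p : ppow 3 (1 - v) <= nu ^+ 3.
    by rewrite /ppow lerXn2r ?nnegrE ?le_max ?lexx ?(ltW nu0)// ge_max (ltW nu0).
  have : nu ^+ 3 <= nu by rewrite -[leRHS]expr1 ler_wiXn2l// ltW.
  by move: p; rewrite /bg; lr.
apply: (@le_trans _ _ ((2 * nu)^-1 ^+ N.+1)).
  rewrite invfM exprMn (exprVn 2) ler_wpM2l ?invr_ge0 ?exprn_ge0//.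
  by rewrite -[leLHS]expr1 ler_weXn2l// invf_ge1.
rewrite lerXn2r// ?nnegrE ?invr_ge0 ?mulr_ge0 ?(ltW nu0) ?(ltW (bg_gt0 _ nu0))//.
by rewrite lef_pV2 ?posrE ?mulr_gt0 ?bg_gt0.
Qed.

(* [h = mu(t) g^-n] blows up on the parabolic boundary; where a solution touches it from below the nonlocal absorption [- h * int_(|y| > kap D r) k] dominates, and the remaining far contribution is paid for by [mu']. *)
Lemma local_max (taub : R) : par n s lam Lam -> 2^-1 <= s -> 0 < taub -> exists2 C, 0 < C &
  forall k Om w M e p r ta tb (mu : R -> R), kern s lam Lam k -> UC w -> bdd w M -> 0 <= e -> 0 < r ->
  vsub k e Om w -> C1fun mu (Mt s w r p) -> (forall t, ta <= t -> mu ta <= mu t) ->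
  (forall x t, enorm (x - p) < 16 * r -> ta < t < tb -> 0 < w (x, t) ->
    exists2 rho, 0 < rho & cylinder rho (x, t) `<=` Om) ->
  forall x t, enorm (x - p) <= 8 * r -> ta + taub * r `^ (2 * s) <= t -> t < tb ->
    w (x, t) <= C * (r `^ (2 * s) * e + (mu t - mu ta)).
Proof.
move=> pp s2 taub0; have [hn s0 s1 lam0 Lam0] := pp.
have [Cm [cf [Cm0 cf0 kbd]]] := kern_bounds pp.
have [N nN] : exists N, n = N.+1 by case: (n) hn => // N _; exists N.
pose Bn : R := N.+1%:R + bB R N.
have Bn0 : 0 < Bn by rewrite ltr_pwDl// /bB addr_ge0// !mulr_ge0// exprn_ge0.
(* The second entry keeps the dispersion near the contact point below a quarter of the absorption,
   the third does the same for the time derivative of the shift [q]. *)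
pose kap := Num.min 1 (Num.min (cf / (2 * (Bn * Cm))) (cf * taub / (24 * N.+1%:R))).
have kap0 : 0 < kap by rewrite !lt_min ltr01 !divr_gt0 ?mulr_gt0.
have : kap <= Num.min 1 (Num.min (cf / (2 * (Bn * Cm))) (cf * taub / (24 * N.+1%:R))) by [].
rewrite !le_min => /and3P[kap1 kapB kapt].
(* [C1] makes the derivative of [mm] pay for the far contribution; [C2] keeps the right-hand side
   [e] below a quarter of the absorption. *)
pose C1 : R := 2 ^+ N.+1 * (Lam * (18 / kap) `^ (n%:R + 2 * s)).
have C10 : 0 < C1 by rewrite !mulr_gt0 ?exprn_gt0 ?powR_gt0 ?divr_gt0.
pose C2 : R := 2 ^+ N.+1 * (4 / cf).
have C20 : 0 < C2 by rewrite mulr_gt0 ?exprn_gt0 ?divr_gt0.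
exists (3 ^+ N.+1 * (C1 + C2)); first by rewrite mulr_gt0 ?exprn_gt0 ?addr_gt0.
move=> k Om w M e p r ta tb mu kk uw bw e0 r0 vw hmu muinc hOm x0 t0 hx0 ht0 ht0b.
have rs0 := rs_gt0 r0; set rs := r `^ (2 * s) in rs0 ht0 *.
have mu0 : 0 <= mu t0 - mu ta.
  by rewrite subr_ge0 muinc// (le_trans _ ht0)// lerDl mulr_ge0// ltW.
suff key io : 0 < io -> io <= 1 -> w (x0, t0) <= 3 ^+ N.+1 * (C2 * rs * e + io + C1 * (mu t0 - mu ta)).
  apply/ler_addgt0Pr => d d0.
  have p3 : 0 < 3 ^+ N.+1 :> R by rewrite exprn_gt0.
  have := key (Num.min 1 (d / 3 ^+ N.+1)); rewrite lt_min ltr01 divr_gt0// ge_min lexx => /(_ isT isT)/le_trans; apply.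
  have h : 3 ^+ N.+1 * Num.min 1 (d / 3 ^+ N.+1) <= d.
    by rewrite mulrC -ler_pdivlMr// ge_min lexx orbT.
  have h1 : 0 <= 3 ^+ N.+1 * (C1 * (rs * e)) by pos.
  have h2 : 0 <= 3 ^+ N.+1 * (C2 * (mu t0 - mu ta)) by pos.
  by move: h h1 h2; clrP; move: (3 ^+ _) (Num.min _ _) (mu t0 - mu ta) C1 C2 => a1 a2 a3 a4 a5; lra.
move=> io0 io1.
have M0 : 0 <= M := le_trans (normr_ge0 _) (bw (0, 0)).
(* [io] keeps the height positive and is sent to zero at the end; [nu] is then so small that on its
   edge the barrier exceeds [M + 1], hence [w]. *)
pose nu := io / (2 ^+ N.+1 * (M + 1)).
have M1 : 0 < M + 1 by rewrite ltr_wpDl.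
have twoN : 1 <= 2 ^+ N.+1 :> R by rewrite exprn_ege1// ler1n.
have nu0 : 0 < nu by rewrite divr_gt0// mulr_gt0// exprn_gt0.
have nu1 : nu <= 1.
  rewrite ler_pdivrMr ?mulr_gt0 ?exprn_gt0// mul1r (le_trans io1)// mulr_ege1// lerDr//.
pose tau := taub * rs; have tau0 : 0 < tau by rewrite mulr_gt0.
pose a := ((16 * r) ^+ 2)^-1.
have a16 : 0 < (16 * r) ^+ 2 by rewrite exprn_gt0// mulr_gt0.
have a0 : 0 <= a by rewrite invr_ge0 ltW.
(* The shift is 1 at time [ta], so that the barrier starts on its edge everywhere, and 0 from
   [ta + tau] on, when the barrier is fully open. *)
pose q t := ppow 2 (- tau^-1 * t + (ta + tau) / tau).
pose dq t := 2 * ppow 1 (- tau^-1 * t + (ta + tau) / tau) * - tau^-1.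
have hq : C1fun q dq := C1fun_comp (C1fun_ppow R 0) (C1fun_affine (- tau^-1) ((ta + tau) / tau)).
have qarg t : - tau^-1 * t + (ta + tau) / tau = (ta + tau - t) / tau by field; rewrite gt_eqF.
pose mm t := C1 * mu t + (C2 * rs * e + io - C1 * mu ta).
pose dmm t := C1 * Mt s w r p t.
have hm : C1fun mm dmm.
  by apply: (eq_C1fun (C1funD (C1funM (C1fun_cst C1) hmu) (C1fun_cst (C2 * rs * e + io - C1 * mu ta)))) => t; rewrite ?mul0r ?add0r ?addr0.
have mm_ge t : ta <= t -> C2 * rs * e + io <= mm t.
  by move=> tta; have := muinc t tta; rewrite /mm -(ler_pM2l C10); lr.
have ce0 : 0 <= C2 * rs * e by pos.
have mmio t : ta <= t -> io <= mm t by move=> /mm_ge; move: ce0; lr.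
pose h := basefun mm (bf N nu) a p q.
have th : tst h := tst_base p a0 hm (C2fun_bf N nu0) hq.
have edge x t : ta <= t -> 1 - (a * enorm (x - p) ^+ 2 + q t) <= nu -> w (x, t) <= h (x, t).
  move=> tta hh; apply: (@le_trans _ _ (M + 1)).
    by rewrite (le_trans (ler_norm _))// (le_trans (bw _))// lerDl.
  have h1 := bf_edge N nu0 nu1 hh; rewrite /h /basefun /=.
  apply: (@le_trans _ _ (io * ((2 ^+ N.+1)^-1 / nu))).
    by rewrite /nu invfM invrK; rewrite le_eqVlt; apply/orP; left; apply/eqP; field; rewrite ?gt_eqF.
  by apply: ler_pM; [pos|pos|exact: mmio|].
have q0 t : 0 <= q t by exact: ppow_ge0.
have tmid : t0 < (t0 + tb) / 2 by move: ht0b; lr.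
have tmid2 : (t0 + tb) / 2 < tb by move: ht0b; lr.
have hx16 : enorm (x0 - p) <= 16 * r by move: hx0 r0; lr.
have tat0 : ta <= t0 by move: ht0 tau0; rewrite /tau; lr.
have := @barrier_le _ _ k e Om w h p (16 * r) ta ((t0 + tb) / 2) tb (UC_continuous uw) vw th tmid2 _ _ _ x0 t0 hx16.
rewrite tat0 (ltW tmid) => /(_ _ _ _ isT) H.
have {}H : w (x0, t0) <= h (x0, t0).
  apply: H.
  - move=> x t xr /andP[tta _]; apply: edge => //; rewrite xr /a mulVf ?gt_eqF//.
    by move: (q0 t) (ltW nu0); lr.
  - move=> x xr; apply: edge => //.
    have -> : q ta = 1.
      by rewrite /q qarg (addrC ta) addrK divff ?gt_eqF// ppow_pos// expr1n.
    by move: (mulr_ge0 a0 (sqr_ge0 (enorm (x - p)))) (ltW nu0); lr.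
  - move=> x t xr /andP[tta ttb] hw hmax.
    pose D := 1 - (a * enorm (x - p) ^+ 2 + q t).
    have Dnu : nu < D by rewrite ltNge; apply/negP => /(edge x t (ltW tta)); rewrite leNgt hw.
    have D0 : 0 < D := lt_trans nu0 Dnu.
    have D1 : D <= 1 by rewrite /D; move: (mulr_ge0 a0 (sqr_ge0 (enorm (x - p)))) (q0 t); lr.
    have eD : 1 - D = a * enorm (x - p) ^+ 2 + q t by rewrite /D subKr.
    have f0 := bf_gt0 N (1 - D) nu0.
    pose H := mm t * bf N nu (1 - D).
    have hH : h (x, t) = H by rewrite /h /basefun /= -eD.
    have mt0 : 0 < mm t := lt_le_trans io0 (mmio t (ltW tta)).
    have H0 : 0 < H by rewrite mulr_gt0.
    have wH : H < w (x, t) by rewrite -hH.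
    split; first by apply: hOm; rewrite ?tta ?ttb// (lt_trans H0).
    have b0 : 0 < kap * D by rewrite mulr_gt0.
    have b1 : kap * D <= 1 by rewrite mulr_ile1// ltW.
    have ar0 : 0 < kap * D * r by rewrite mulr_gt0.
    have [iM IM] := far_le_Mt t pp kk uw bw r0 b0 b1 (ltW xr).
    have [iT IT iF _ IF] := kbd k kk _ ar0.
    exists (kap * D * r) => // rg rg0 rga.
    pose S y := Bn * kap ^+ 2 * H * tr (kap * D * r) y.
    pose G y := ind (kap * D * r <= enorm y) * Num.max 0 (w (x + y, t)) - H * ind (kap * D * r <= enorm y).
    have dh y : enorm y <= kap * D * r -> `|dlt (fun x => h (x, t)) x y| <= S y.
      move=> yr; rewrite (dltZ (mm t) (fun x => bf N nu (a * enorm (x - p) ^+ 2 + q t))) normrM (gtr0_norm mt0).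
      rewrite /S /H [leRHS](_ : _ = mm t * (Bn * kap ^+ 2 * bf N nu (1 - D) * tr (kap * D * r) y)); last by ring.
      by rewrite ler_wpM2l ?(ltW mt0)//; exact: blowup_near.
    have iS : intg (fun y => S y * k y).
      by have := intgZ (Bn * kap ^+ 2 * H) iT; rewrite /S; under eq_fun do rewrite mulrA.
    have iG : intg (fun y => G y * k y).
      have := intgB iM (intgZ H iF); rewrite /intg; congr (_.-integrable _ _).
      by apply/funext => y /=; rewrite /G; congr EFin; ring.
    have mh : measurable_fun setT (fun x => h (x, t)) by apply: continuous_measurable_rV; exact: tst_slice.
    have mw : measurable_fun setT (fun x => w (x, t)) by apply: continuous_measurable_rV; exact: UC_slice.
    have [Ch Ch0 hCh] := tst_dlt_bound (x, t) th rg0.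
    have ball y : enorm y <= kap * D * r -> enorm (x + y - p) <= 16 * r.
      move=> yr; rewrite addrAC (le_trans (ler_enormD _ _))//.
      (* The definition of [D] gives [enorm (x - p) ^+ 2 <= (16 * r) ^+ 2 * (1 - D)], and
         [1 - D <= (1 - D / 2) ^+ 2]; the distance left to the boundary exceeds [kap * D * r]. *)
      have hx : enorm (x - p) <= 16 * r * (1 - D / 2).
        have r16 : 0 <= 16 * r * (1 - D / 2) by rewrite !mulr_ge0 ?(ltW r0)//; move: D1; lr.
        rewrite -(@ler_pXn2r _ 2)// ?nnegrE ?enorm_ge0//.
        have : enorm (x - p) ^+ 2 <= (16 * r) ^+ 2 * (1 - D).
          by rewrite eD mulrDr mulrA divff ?gt_eqF// mul1r lerDl mulr_ge0 ?q0// ltW.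
        move=> /le_trans; apply; rewrite [leRHS]exprMn ler_wpM2l ?(ltW a16)//; move: D0; clrP; nra.
      have : kap * D * r <= D * r by rewrite -mulrA ler_piMl// mulr_ge0// ltW.
      by move: hx yr (mulr_gt0 D0 r0); clrP; lra.
    have gle := @gop_le _ _ _ _ _ pp k (fun x => h (x, t)) (fun x => w (x, t)) x rg Ch M S G kk rg0 Ch0 mh mw (fun y => bw _) hCh iS iG.
    have {}gle : gop k rg (fun x => h (x, t)) (fun x => w (x, t)) x <= 2^-1 * INT (fun y => S y * k y) + INT (fun y => G y * k y).
      apply: gle => y; have S0 : 0 <= S y by pos.
      case: (ltP (enorm y) rg) => yrg.
        have ya : enorm y < kap * D * r := lt_trans yrg rga.
        rewrite /G enormN !indF -?ltNge// !mul0r mulr0 !subr0 !addr0.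
        exact: le_trans (ler_norm _) (dh y (ltW ya)).
      case: (ltP (enorm y) (kap * D * r)) => ya.
        rewrite /G enormN !indF -?ltNge// !mul0r mulr0 !subr0 !addr0.
        apply: le_trans (le_trans (ler_norm _) (dh y (ltW ya))).
        have h1 := hmax _ (ball y (ltW ya)).
        have yN : enorm (- y) <= kap * D * r by rewrite enormN ltW.
        have h2 := hmax _ (ball (- y) yN).
        by rewrite /dlt; move: h1 h2; lr.
      rewrite /G enormN !indT// !mul1r mulr1 /dlt.
      have p1 : w (x + y, t) <= Num.max 0 (w (x + y, t)) by rewrite le_max lexx orbT.
      have p2 : w (x - y, t) <= Num.max 0 (w (x - y, t)) by rewrite le_max lexx orbT.
      by move: p1 p2 S0 wH; lr.
    apply: le_lt_trans (lerD (lexx e) gle) _.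
    have eS : INT (fun y => S y * k y) = Bn * kap ^+ 2 * H * INT (fun y => tr (kap * D * r) y * k y).
      by rewrite -INTZ//; congr INT; apply/funext => y; rewrite /S mulrA.
    have eG : INT (fun y => G y * k y) = INT (fun y => ind (kap * D * r <= enorm y) * Num.max 0 (w (x + y, t)) * k y)
        - H * INT (fun y => ind (kap * D * r <= enorm y) * k y).
      by rewrite -INTZ// -INTB//; [congr INT; apply/funext => y; rewrite /G; ring|exact: intgZ].
    pose ra := (kap * D * r) `^ (2 * s).
    have ra0 : 0 < ra by exact: rs_gt0.
    pose Q := cf * H / ra.
    have Q0 : 0 < Q by rewrite divr_gt0 ?mulr_gt0.
    have bS : 2^-1 * INT (fun y => S y * k y) <= Q / 4.
      rewrite eS; apply: (@le_trans _ _ (2^-1 * (Bn * kap * H * (Cm / ra)))).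
        rewrite ler_wpM2l//; apply: ler_pM => //; first by pos.
          by apply: INT_ge0 => y; rewrite mulr_ge0 ?tr_ge0 ?(kern_ge0 pp y kk).
        by rewrite ler_wpM2r ?(ltW H0)// ler_wpM2l ?(ltW Bn0)// expr2 ler_piMl// ltW.
      rewrite (_ : 2^-1 * _ = (2 * (Bn * Cm) * kap) * (H / ra) / 4); last by field; rewrite gt_eqF.
      rewrite (_ : Q / 4 = cf * (H / ra) / 4); last by rewrite /Q; ring.
      rewrite ler_pM2r// ler_pM2r ?divr_gt0// mulrC.
      by move: kapB; rewrite ler_pdivlMr// ?mulr_gt0.
    have bG : INT (fun y => G y * k y) <= Lam * (18 / (kap * D)) `^ (n%:R + 2 * s) * Mt s w r p t - Q.
      have : Q <= H * INT (fun y => ind (kap * D * r <= enorm y) * k y).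
        rewrite (_ : Q = H * (cf / ra)); last by rewrite /Q; ring.
        by rewrite ler_wpM2l// ltW.
      by rewrite eG; move: IM; lr.
    have P0 : 0 <= n%:R + 2 * s by rewrite addr_ge0// mulr_ge0// ltW.
    have D30 : 0 < 2 * D ^+ 3 by rewrite mulr_gt0 ?exprn_gt0.
    have hbf : ((2 * D ^+ 3)^-1) ^+ N.+1 <= bf N nu (1 - D).
      by have := @bf_ge N nu (1 - D); rewrite subKr => /(_ nu0 (ltW Dnu)).
    have f2 : (2 ^+ N.+1)^-1 <= bf N nu (1 - D).
      apply: le_trans hbf; rewrite -exprVn lerXn2r ?nnegrE ?invr_ge0 ?(ltW D30)//.
      by rewrite lef_pV2 ?posrE// ler_piMr// exprn_ile1// ltW.
    (* The blow-up exponent is used here: [D^(-(n + 2 s))] is dominated by [D^(-3 n)] because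
       [n + 2 s <= 3 n] for [s < 1 <= n]. *)
    have t1 : Lam * (18 / (kap * D)) `^ (n%:R + 2 * s) * Mt s w r p t <= C1 * Mt s w r p t * bf N nu (1 - D).
      rewrite (mulrAC C1) ler_wpM2r ?Mt_ge0//.
      rewrite invfM (mulrA 18) powRM ?invr_ge0 ?(ltW D0)//; last by pos.
      rewrite (_ : C1 * _ = Lam * ((18 / kap) `^ (n%:R + 2 * s) * (2 ^+ N.+1 * bf N nu (1 - D)))); last by rewrite /C1; ring.
      rewrite ler_wpM2l ?(ltW Lam0)// ler_wpM2l ?powR_ge0//.
      apply: (@le_trans _ _ (2 ^+ N.+1 * ((2 * D ^+ 3)^-1) ^+ N.+1)); last by rewrite ler_wpM2l// exprn_ge0.
      rewrite -exprMn invfM mulrA divff// mul1r -exprVn -exprM.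
      rewrite -powR_inv1 ?(ltW D0)// -powRrM mulN1r -(powR_mulrn _ (powR_ge0 _ _)) -powRrM mulN1r.
      rewrite !powRN lef_pV2 ?posrE ?powR_gt0//.
      apply: ger_powR; first by rewrite D0.
      have N1 : 1 <= N.+1%:R :> R by rewrite ler1n.
      by rewrite nN natrM; move: s1 N1; lr.
    (* Here [2 * s >= 1] enters: the absorption, of order [1 / ra], dominates the time derivative of
       the shift, of order [1 / (D * tau)]. *)
    have rale : ra <= kap * D * rs.
      rewrite /ra powRM ?(ltW b0) ?(ltW r0)// ler_wpM2r ?(ltW rs0)//.
      exact: rs_le.
    have dqb : - (2 / tau) <= dq t.
      rewrite /dq qarg mulrN lerN2 ler_pM2r ?invr_gt0// ler_piMr// /ppow expr1.
      by rewrite ge_max ler01/= ler_pdivrMr// mul1r lerBlDr (addrC tau) lerD2r ltW.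
    have t2 : - (Q / 4) <= mm t * dq t * bf1 N nu (1 - D).
      have /andP[f10 f1D] := bf1_bounds N nu0 D0 (erefl (1 - D)).
      apply: (@le_trans _ _ (- (2 / tau) * (mm t * (3 * N.+1%:R * bf N nu (1 - D) / D)))).
        rewrite mulNr lerN2 (_ : _ * (mm t * _) = (6 * N.+1%:R) * (H / (D * tau))); last first.
          by rewrite /H; field; rewrite !gt_eqF.
        rewrite (_ : Q / 4 = (cf / 4) * (H / ra)); last by rewrite /Q; ring.
        apply: (@le_trans _ _ (cf / 4 * (H / (kap * D * rs)))).
          rewrite (_ : cf / 4 * _ = (cf * taub / (4 * kap)) * (H / (D * tau))); last first.
            by rewrite /tau; field; rewrite !gt_eqF.
          rewrite ler_pM2r ?divr_gt0 ?mulr_gt0// ler_pdivlMr ?mulr_gt0//.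
          by move: kapt; rewrite ler_pdivlMr ?mulr_gt0//; clrP; rewrite mulrC; lra.
        rewrite ler_wpM2l ?divr_ge0 ?(ltW cf0)// ler_pM2l// lef_pV2 ?posrE ?mulr_gt0//.
      rewrite (_ : mm t * dq t * _ = dq t * (mm t * bf1 N nu (1 - D))); last by ring.
      apply: (@le_trans _ _ (- (2 / tau) * (mm t * bf1 N nu (1 - D)))).
        by rewrite !mulNr lerN2 ler_wpM2l ?divr_ge0 ?(ltW tau0)// ler_wpM2l// ltW.
      by rewrite ler_wpM2r// mulr_ge0// ltW.
    have t3 : e <= Q / 4.
      apply: (@le_trans _ _ (cf / 4 * (C2 * rs * e * (2 ^+ N.+1)^-1 / rs))).
        rewrite /C2 le_eqVlt; apply/orP; left; apply/eqP; field.
        by rewrite !gt_eqF// exprn_gt0.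
      rewrite (_ : Q / 4 = (cf / 4) * (H / ra)); last by rewrite /Q; ring.
      rewrite ler_wpM2l ?divr_ge0 ?(ltW cf0)//.
      apply: ler_pM; [pos|pos| |].
        apply: ler_pM; [pos|pos| |by []].
        by have := mm_ge t (ltW tta); move: io0; lr.
      rewrite lef_pV2 ?posrE//; apply: le_trans rale _; rewrite ler_piMl// ltW//.
    have Dth : Dt h (x, t) = C1 * Mt s w r p t * bf N nu (1 - D) + mm t * dq t * bf1 N nu (1 - D).
      by rewrite /h (Dt_base _ _ hm (proj1 (proj1 (C2fun_bf N nu0))) hq) /basefun /= -eD.
    by rewrite Dth; move: bS bG t1 t2 t3 Q0; lr.
have q00 : q t0 = 0.
  rewrite /q ppow_neg// qarg pmulr_lle0 ?invr_gt0// subr_le0.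
  exact: ht0.
apply: le_trans H _; rewrite /h /basefun /= q00 addr0.
have ax : a * enorm (x0 - p) ^+ 2 <= 4^-1.
  rewrite /a mulrC ler_pdivrMr// [leRHS](_ : _ = (8 * r) ^+ 2); last by field.
  by rewrite ler_pXn2r ?nnegrE ?enorm_ge0 ?mulr_ge0 ?(ltW r0).
have fle : bf N nu (a * enorm (x0 - p) ^+ 2) <= 3 ^+ N.+1.
  rewrite /bf lerXn2r ?nnegrE ?invr_ge0 ?(ltW (bg_gt0 _ nu0))// -[leRHS]invrK lef_pV2 ?posrE ?bg_gt0 ?invr_gt0//.
  rewrite /bg ppow_pos; last by move: ax; lr.
  have n30 : 0 <= nu ^+ 3 by rewrite exprn_ge0// ltW.
  have : (3 / 4) ^+ 3 <= (1 - a * enorm (x0 - p) ^+ 2) ^+ 3.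
    by rewrite lerXn2r ?nnegrE//; [move: ax; lr|move: ax; lr].
  by rewrite !exprS expr0 => h3; move: h3 n30; lr.
rewrite mulrC (_ : C2 * rs * e + io + _ = mm t0); last by rewrite /mm; ring.
by rewrite ler_wpM2r//; exact: le_trans (ltW io0) (mmio t0 tat0).
Qed.

End LocalMaximum.

(** * Primitives of continuous functions *)

Section Primitive.
Context (R : realType).

Lemma C1fun_le (f df : R -> R) (a b : R) : C1fun f df -> (forall t, 0 <= df t) -> a <= b -> f a <= f b.
Proof.
move=> hf df0 ab; have [v _] := mean_value a (b - a) (proj1 hf).
by rewrite (addrC a) subrK => e; rewrite -subr_ge0 e mulr_ge0// subr_ge0.
Qed.

Definition itvint (g : R -> R) (N : nat) (x : R) : R :=
  \int[@lebesgue_measure R]_(t in [set` Interval (BLeft (- N%:R : R)) (BRight x)]) g t.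

Lemma intg_itv (g : R -> R) (a b : R) : continuous g ->
  (@lebesgue_measure R).-integrable [set` Interval (BLeft a) (BRight b)] (EFin \o g).
Proof.
move=> cg; apply: continuous_compact_integrable; first exact: segment_compact.
exact: continuous_subspaceT.
Qed.

Lemma is_derive_itvint (g : R -> R) (N : nat) (x : R) : continuous g -> - N%:R < x -> is_derive x 1 (itvint g N) (g x).
Proof.
move=> cg Nx.
have xx : x < x + 1 by rewrite ltrDl.
have [|d1 d2] := continuous_FTC1 xx (intg_itv (- N%:R) (x + 1) cg) _ (cg x); first by [].
by apply: DeriveDef; [exact: d1|rewrite -derive1E; exact: d2].
Qed.

Lemma itvintB (g : R -> R) (N : nat) (x y : R) : continuous g -> - N%:R <= x -> x <= y ->
  itvint g N y - itvint g N x = \int[@lebesgue_measure R]_(t in [set` Interval (BRight x) (BRight y)]) g t.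
Proof.
move=> cg Nx xy; rewrite /itvint Rintegral_itvB//; exact: intg_itv.
Qed.

(* Gluing the primitives [itvint g N - itvint g N 0] of [g] on the half-lines [x > - N]. *)
Lemma primitive (g : R -> R) : continuous g -> exists F, C1fun F g.
Proof.
move=> cg; pose P (N : nat) x := itvint g N x - itvint g N 0.
have dP N (x : R) : - N%:R < x -> is_derive x 1 (P N) (g x).
  move=> Nx; have h := is_derive_itvint cg Nx.
  by have := is_deriveB h (is_derive_cst (itvint g N 0) x (1:R)); rewrite subr0.
have N0 N : - N%:R <= 0 :> R by rewrite oppr_le0.
have eqP N M (x : R) : - N%:R < x -> - M%:R < x -> P N x = P M x.
  move=> /ltW Nx /ltW Mx; rewrite /P; case: (leP 0 x) => x0.
    by rewrite !itvintB.
  by apply: oppr_inj; rewrite !opprB !itvintB// ltW.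
pose F x := P (Num.bound x) x.
have hb (x : R) : - (Num.bound x)%:R < x by rewrite ltrNl unstable.ltrNbound.
exists F; split; [move=> x|exact: cg].
apply: (near_eq_is_derive _ (dP (Num.bound x) x (hb x))); near=> y.
by apply: eqP => //; near: y; apply: lt_nbhsr.
Unshelve. all: by end_near. Qed.

End Primitive.

(** * A smooth step and its second differences *)

Section SmoothStep.
Context (R : realType).
Implicit Types (v d c : R).

(* A nondecreasing function of class C^2, equal to [0] for [v <= 1/2] and to [1] for [v >= 1]. *)
Definition stf v : R := 1 - ppow 3 (1 - ppow 3 (2 * v - 1)).
Definition stf1 v : R := 18 * (ppow 2 (1 - ppow 3 (2 * v - 1)) * ppow 2 (2 * v - 1)).
Definition stf2 v : R :=
  18 * (- 12 * ppow 1 (1 - ppow 3 (2 * v - 1)) * ppow 2 (2 * v - 1) ^+ 2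
        + 4 * ppow 2 (1 - ppow 3 (2 * v - 1)) * ppow 1 (2 * v - 1)).

Lemma C1fun_ppow_step k : C1fun (fun v => ppow k.+2 (2 * v - 1)) (fun v => 2 * k.+2%:R * ppow k.+1 (2 * v - 1)).
Proof.
have h := C1fun_comp (C1fun_ppow R k) (C1fun_affine (2:R) (-1)).
by apply: (eq_C1fun h) => v //=; ring.
Qed.

Lemma C1fun_ppow_step2 k : C1fun (fun v => ppow k.+2 (1 - ppow 3 (2 * v - 1)))
  (fun v => - (6 * k.+2%:R) * (ppow k.+1 (1 - ppow 3 (2 * v - 1)) * ppow 2 (2 * v - 1))).
Proof.
have h := C1fun_comp (C1fun_ppow_sub R k) (C1fun_ppow_step 1).
by apply: (eq_C1fun h) => v //=; ring.
Qed.

Lemma C2fun_stf : C2fun stf stf1 stf2.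
Proof.
split.
  have h := C1funD (C1fun_cst (1:R)) (C1funM (C1fun_cst (-1:R)) (C1fun_ppow_step2 1)).
  by apply: (eq_C1fun h) => v /=; rewrite /stf /stf1; ring.
have h := C1funM (C1fun_cst (18:R)) (C1funM (C1fun_ppow_step2 0) (C1fun_ppow_step 0)).
by apply: (eq_C1fun h) => v /=; rewrite /stf1 /stf2; ring.
Qed.

Lemma stf_lo v : v <= 2^-1 -> stf v = 0.
Proof.
move=> v2; have h : 2 * v - 1 <= 0 by move: v2; lr.
by rewrite /stf (ppow_neg 2 h) subr0 ppow_pos// expr1n subrr.
Qed.

Lemma ppow_ge1 k v : 1 <= v -> 1 <= ppow k v.
Proof. by move=> v1; rewrite ppow_pos ?exprn_ege1// (le_trans ler01). Qed.

Lemma stf_hi v : 1 <= v -> stf v = 1.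
Proof.
move=> v1; have h : 1 - ppow 3 (2 * v - 1) <= 0 by rewrite subr_le0 ppow_ge1//; move: v1; lr.
by rewrite /stf (ppow_neg 2 h) subr0.
Qed.

Lemma stf_bounds v : 0 <= stf v <= 1.
Proof.
rewrite /stf subr_ge0 lerBlDr lerDl ppow_ge0 andbT.
rewrite /ppow exprn_ile1 ?le_max ?lexx// ge_max ler01/= gerBl exprn_ge0// le_max lexx//.
Qed.

Lemma stf1_ge0 v : 0 <= stf1 v.
Proof. by rewrite mulr_ge0// mulr_ge0 ?ppow_ge0. Qed.

Lemma stf12_out v : v <= 2^-1 \/ 1 <= v -> stf1 v = 0 /\ stf2 v = 0.
Proof.
rewrite /stf1 /stf2 => -[v2|v1].
  have h : 2 * v - 1 <= 0 by move: v2; lr.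
  by rewrite (ppow_neg 1 h) (ppow_neg 0 h) expr0n/= !mulr0 add0r mulr0.
have h : 1 - ppow 3 (2 * v - 1) <= 0.
  by rewrite subr_le0 ppow_ge1//; move: v1; lr.
by rewrite (ppow_neg 1 h) (ppow_neg 0 h) !(mulr0, mul0r) addr0 mulr0.
Qed.

Lemma stf12_bounded : exists2 B : R, 0 <= B & forall v, `|stf1 v| <= B /\ `|stf2 v| <= B.
Proof.
have [B1 B10 h1] := continuous_bounded_itv 1 (C1fun_continuous (proj2 C2fun_stf)).
have [B2 B20 h2] := continuous_bounded_itv 1 (proj2 (proj2 C2fun_stf)).
exists (B1 + B2) => [|v]; first by rewrite addr_ge0.
case: (leP v 2^-1) => v2.
  by have [-> ->] := stf12_out (or_introl v2); rewrite normr0 addr_ge0.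
case: (leP 1 v) => v1.
  by have [-> ->] := stf12_out (or_intror v1); rewrite normr0 addr_ge0.
have vn : `|v| <= 1 by rewrite ler_norml (ltW v1) andbT; move: v2; lr.
by rewrite (le_trans (h1 v vn)) ?lerDl// (le_trans (h2 v vn)) ?lerDr.
Qed.

(** For [|y| >= d] the bounds 0 and 1 suffice. For [|y| < d] and [|x - p| >= 3 * d] all three values
    are 1. In the remaining case the argument moves by at most [7 * |y| / d] and Taylor applies. *)
Lemma stf_dlt : exists2 C : R, 0 < C & forall n (p x y : 'rV[R]_n) d c, 0 < d -> 0 <= c ->
  `|dlt (fun x => stf ((d ^+ 2)^-1 * enorm (x - p) ^+ 2 + c)) x y| <= C * tr d y.
Proof.
have [B B0 hB] := stf12_bounded.
exists (2 + 100 * B); first by rewrite ltr_pwDl// mulr_ge0.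
move=> n p x y d c d0 c0; set a := (d ^+ 2)^-1.
have d2 : 0 < d ^+ 2 by rewrite exprn_gt0.
have a0 : 0 <= a by rewrite invr_ge0 ltW.
case: (leP d (enorm y)) => yd.
  rewrite tr_far// mulr1 /dlt.
  have /andP[s1 s2] := stf_bounds (a * enorm (x + y - p) ^+ 2 + c).
  have /andP[s3 s4] := stf_bounds (a * enorm (x - y - p) ^+ 2 + c).
  have /andP[s5 s6] := stf_bounds (a * enorm (x - p) ^+ 2 + c).
  apply: (@le_trans _ _ 2); last by rewrite lerDl mulr_ge0.
  by move: s1 s2 s3 s4 s5 s6; clrP; rewrite ler_norml => *; apply/andP; split; lra.
have tr0 := tr_ge0 d y.
have y0 := enorm_ge0 y; have x0 := enorm_ge0 (x - p).
case: (leP (3 * d) (enorm (x - p))) => xd.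
  have big z : 2 * d <= enorm z -> stf (a * enorm z ^+ 2 + c) = 1.
    move=> zd; apply: stf_hi.
    suff : 1 <= a * enorm z ^+ 2 by move: c0; lr.
    rewrite /a mulrC ler_pdivlMr// mul1r ler_pXn2r ?nnegrE ?enorm_ge0 ?(ltW d0)//.
    by move: zd d0; lr.
  have h1 : 2 * d <= enorm (x + y - p).
    have := ler_enormB (x + y - p) y; rewrite addrAC addrK => h.
    by move: h xd yd; lr.
  have h2 : 2 * d <= enorm (x - y - p).
    have := ler_enormD (x - y - p) y; rewrite addrAC subrK => h.
    by move: h xd yd; lr.
  have h3 : 2 * d <= enorm (x - p) by move: xd d0; lr.
  rewrite /dlt !big// mulr1 (_ : 1 + 1 - 2 = 0) ?normr0; last by lra.
  by rewrite mulr_ge0// addr_ge0// mulr_ge0.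
have := @dlt_base _ _ stf stf1 stf2 a c B x p y a0 C2fun_stf.
move=> /(_ (fun v _ => proj2 (hB v)))/le_trans; apply.
rewrite tr_near ?(ltW yd)//.
set eta := a * (_ + _).
have e0 : 0 <= eta by rewrite mulr_ge0// addr_ge0 ?sqr_ge0// !mulr_ge0.
have e1 : eta <= 7 * (enorm y / d).
  rewrite /eta /a mulrC ler_pdivrMr// (_ : 7 * (enorm y / d) * d ^+ 2 = 7 * (enorm y * d)); last by field; rewrite gt_eqF.
  move: xd yd d0 x0 y0; clrP; nra.
have e2 : eta ^+ 2 <= 49 * (enorm y ^+ 2 / d ^+ 2).
  rewrite (_ : 49 * _ = (7 * (enorm y / d)) ^+ 2); last by field; rewrite gt_eqF.
  by rewrite ler_pXn2r ?nnegrE// mulr_ge0// divr_ge0// ltW.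
have q0 : 0 <= enorm y ^+ 2 / d ^+ 2 by rewrite divr_ge0 ?sqr_ge0.
rewrite (_ : 2 * a * enorm y ^+ 2 = 2 * (enorm y ^+ 2 / d ^+ 2)); last by rewrite /a; ring.
have b1 := proj1 (hB (a * enorm (x - p) ^+ 2 + c)).
apply: (@le_trans _ _ (B * (2 * (enorm y ^+ 2 / d ^+ 2)) + 2 * B * (49 * (enorm y ^+ 2 / d ^+ 2)))).
  by apply: lerD; [apply: ler_wpM2r => //; exact: mulr_ge0|apply: ler_wpM2l => //; exact: mulr_ge0].
rewrite (_ : B * _ + _ = 100 * B * (enorm y ^+ 2 / d ^+ 2)); last by ring.
by rewrite ler_wpM2r// lerDr.
Qed.

End SmoothStep.

(** * Lower bound by the mass: a bump barrier *)

Section LocalMinimum.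
Context (R : realType) (n : nat) (s lam Lam : R).
Implicit Types (x y p : 'rV[R]_n) (w : 'rV[R]_n * R -> R) (k : 'rV[R]_n -> R).

Lemma max0_ge0 (a : R) : 0 <= Num.max 0 a. Proof. by rewrite le_max lexx. Qed.

Lemma max0_le (a b : R) : 0 <= b -> a <= b -> Num.max 0 a <= b.
Proof. by move=> b0 ab; rewrite ge_max b0. Qed.

Lemma bdd_max0 w (M : R) z : bdd w M -> Num.max 0 (w z) <= M.
Proof. by move=> bw; have h := bw z; apply: max0_le; [exact: le_trans h|exact: le_trans (ler_norm _) h]. Qed.

Lemma Mt_shift w (M r : R) x0 x (t : R) : par n s lam Lam -> UC w -> bdd w M -> 0 < r ->
  intg (fun y => Num.max 0 (w (x + y, t)) * wgt s r (y + (x - x0))) /\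
  INT (fun y => Num.max 0 (w (x + y, t)) * wgt s r (y + (x - x0))) = Mt s w r x0 t.
Proof.
move=> pp uw bw r0; have i0 := intg_Mt x0 t pp uw bw r0.
have e : (fun y => Num.max 0 (w (x + y, t)) * wgt s r (y + (x - x0))) =
  (fun y => (fun y => Num.max 0 (w (x0 + y, t)) * wgt s r y) (y + (x - x0))).
  by apply/funext => y /=; rewrite (_ : x0 + (y + (x - x0)) = x + y)//; rewrite addrC -addrA subrK addrC.
by rewrite e; split; [exact: intg_shift i0|exact: INT_shift i0].
Qed.

Lemma wgt_le_jker (r : R) (v y : 'rV[R]_n) : 0 < s -> 0 < r -> enorm v <= 3 * r -> 0 < enorm y ->
  3 `^ (- n%:R - 2 * s) * wgt s r (y + v) <= jker s y.
Proof.
move=> s0 r0 vr y0; rewrite /wgt -powRM//; last by rewrite addr_ge0 ?enorm_ge0// ltW.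
apply: ler_powP => //.
have := ler_enormB (y + v) v; rewrite addrK.
by move: (enorm_ge0 (y + v)) vr; lr.
Qed.

(** This inequality and the next are the integrand comparisons of [far_ge_Mt], inside and outside
    the small ball, stripped of the integrals. *)
Lemma near_alg (c q W Y M rP : R) : 0 <= c -> 0 <= q -> 0 <= W -> 0 <= Y -> q <= M -> W <= rP ->
  c * (q * W - Y * W - M * rP * 1) <= 0.
Proof.
move=> c0 q0 W0 Y0 qM Wr; rewrite mulr1; apply: mulr_ge0_le0 => //.
have h1 : q * W <= M * rP by exact: ler_pM.
have h2 : 0 <= Y * W by exact: mulr_ge0.
by move: h1 h2; lr.
Qed.

Lemma far_alg (c q W Y p kk a : R) : 0 <= c -> 0 <= W -> 0 <= p -> q - Y <= p -> c * W <= kk ->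
  c * (q * W - Y * W - a * 0) <= 1 * p * kk.
Proof.
move=> c0 W0 p0 qp ck; rewrite mulr0 subr0 mul1r -mulrBl.
apply: (@le_trans _ _ (p * (c * W))); last exact: ler_wpM2l.
by rewrite mulrCA; apply: ler_wpM2r => //; exact: mulr_ge0.
Qed.

(** Subtracting the height [Y] costs at most [Y] times the total weight, and removing a ball of
    radius [rg] at most the sup bound times the weight at its peak times the volume; what remains
    sees the kernel, which dominates a multiple of the weight. *)
Lemma far_ge_Mt k w (M r : R) x0 x (t rg Y : R) : par n s lam Lam -> kern s lam Lam k -> UC w -> bdd w M ->
  0 < r -> 0 < rg -> 0 <= Y -> enorm (x - x0) <= 3 * r ->
  intg (fun y => ind (rg <= enorm y) * Num.max 0 (w (x + y, t) - Y) * k y) /\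
  lam * 3 `^ (- n%:R - 2 * s) * (Mt s w r x0 t - Y * INT (@wgt _ n s r) - M * r `^ (- n%:R - 2 * s) * (2 * rg) ^+ n) <=
  INT (fun y => ind (rg <= enorm y) * Num.max 0 (w (x + y, t) - Y) * k y).
Proof.
move=> pp kk uw bw r0 rg0 Y0 xr; have [hn s0 s1 lam0 Lam0] := pp.
have ind1 : ind true = 1 :> R by [].
have ind0 : ind false = 0 :> R by [].
have hk y : rg <= enorm y -> lam * 3 `^ (- n%:R - 2 * s) * wgt s r (y + (x - x0)) <= k y.
  move=> yr; have [_ _ kb] := kk; have /andP[kl _] := kb y; apply: le_trans kl.
  rewrite -mulrA (ler_pM2l lam0); apply: (wgt_le_jker s0 r0 xr); exact: lt_le_trans yr.
have hr y : wgt s r y <= r `^ (- n%:R - 2 * s) by apply: (ler_powP n s0 r0); rewrite lerDl enorm_ge0.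
have c0 : 0 <= lam * 3 `^ (- n%:R - 2 * s) by apply: mulr_ge0; [exact: ltW|exact: powR_ge0].
have mw : measurable_fun setT (fun y => w (x + y, t) - Y).
  apply: measurable_funB; last exact: measurable_cst.
  apply: (meas_shift (f := fun y => w (y, t))); apply: continuous_measurable_rV; exact: UC_slice.
have mle y : Num.max 0 (w (x + y, t) - Y) <= Num.max 0 (w (x + y, t)).
  apply: max0_le; first exact: max0_ge0.
  by rewrite le_max; apply/orP; right; move: Y0; lr.
have mge y : Num.max 0 (w (x + y, t)) - Y <= Num.max 0 (w (x + y, t) - Y).
  by rewrite lerBlDr; apply: max0_le; [exact: addr_ge0 (max0_ge0 _) Y0|rewrite -lerBlDr le_max lexx orbT].
have mm : measurable_fun setT (fun y => Num.max 0 (w (x + y, t) - Y)).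
  by apply: measurable_maxr mw; exact: measurable_cst.
have mM y : `|Num.max 0 (w (x + y, t) - Y)| <= M.
  by rewrite (ger0_norm (max0_ge0 _)); apply: le_trans (mle y) _; exact: bdd_max0.
have iL := intg_far_le pp kk rg0 mm mM.
have [iM eM] := Mt_shift x0 x t pp uw bw r0.
have [Cw Cw0 hw] := wgt_bounds pp; have [iw _] := hw r r0.
have iw' := intg_shift (x - x0) iw.
have ib : intg (fun y : 'rV[R]_n => ind (enorm (y - 0) < rg)) := intg_ball 0 rg.
have M0 : 0 <= M := le_trans (normr_ge0 _) (bw (0, 0)).
split; first exact: iL.
move: hk hr c0; move: (lam * _) (r `^ _) => c rP hk hr c0.
have i1 := intgB iM (intgZ Y iw').
have i2 := intgB i1 (intgZ (M * rP) ib).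
have i3 := intgZ c i2.
have -> : c * (Mt s w r x0 t - Y * INT (@wgt R n s r) - M * rP * (2 * rg) ^+ n) =
  c * (Mt s w r x0 t - Y * INT (@wgt R n s r) - M * rP * INT (fun y => ind (enorm (y - 0) < rg))) - c * (M * rP * ((2 * rg) ^+ n - INT (fun y : 'rV[R]_n => ind (enorm (y - 0) < rg)))).
  by move: (Mt _ _ _ _ _) (INT _) (INT _) (_ ^+ n) => m1 m2 m3 m4; ring.
rewrite -eM -(INT_shift (x - x0) iw) -(INTZ Y iw') -(INTB iM (intgZ Y iw')) -(INTZ (M * rP) ib) -(INTB i1 (intgZ (M * rP) ib)) -(INTZ c i2).
rewrite lerBlDr -[leLHS]addr0; apply: lerD.
  apply: (INT_le i3 iL) => y /=; rewrite subr0.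
  case: (ltP (enorm y) rg) => yr.
    rewrite ind0 ind1 !mul0r.
    by apply: near_alg; [exact: c0|exact: max0_ge0|exact: wgt_ge0|exact: Y0|exact: bdd_max0|exact: hr].
  rewrite ind0 ind1.
  by apply: far_alg; [exact: c0|exact: wgt_ge0|exact: max0_ge0|exact: mge|exact: hk].
apply: mulr_ge0; first exact: c0.
apply: mulr_ge0.
  by apply: mulr_ge0; [exact: M0|exact: le_trans (wgt_ge0 _ _ _) (hr 0)].
by rewrite subr_ge0; apply: INT_ball_le; exact: ltW.
Qed.

(* The barrier is a bump around [p] of height [c (mu t - mu ta)]; for [tb - ta <= kap r^(2s)] the cost of its own dispersion is at most half of the gain. *)
Lemma local_min : par n s lam Lam -> exists2 c, 0 < c & forall b, 0 < b -> b <= 1 -> exists2 kap, 0 < kap &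
  forall k Om w M e e1 x0 p (r ta tb : R) mu, kern s lam Lam k -> UC w -> bdd w M -> 0 <= e -> 0 <= e1 -> 0 < r ->
  vsub k e Om (fun z => - w z) -> C1fun mu (Mt s w r x0) -> enorm (p - x0) <= 2 * r -> tb - ta <= kap * r `^ (2 * s) ->
  (forall x t, enorm (x - x0) < 16 * r -> ta <= t -> t < tb -> 0 <= w (x, t)) ->
  (forall x t, enorm (x - p) < b * r -> ta < t -> t < tb ->
    INT (fun y => ind (8 * r <= enorm y) * Num.max 0 (- w (x + y, t)) * k y) <= e1) ->
  (forall x t, enorm (x - p) < b * r -> ta < t -> t < tb -> exists2 rho, 0 < rho & cylinder rho (x, t) `<=` Om) ->
  forall x t, enorm (x - p) <= b * r / 2 -> ta <= t -> t < tb ->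
  c * (mu t - mu ta) - (e + e1) * (t - ta) <= w (x, t).
Proof.
move=> pp; have [hn s0 s1 lam0 Lam0] := pp.
have [Cm [cf [Cm0 cf0 kbd]]] := kern_bounds pp.
have [Cw Cw0 hw'] := wgt_bounds pp.
have [Cst Cst0 hst] := @stf_dlt R.
have [c [c0 ec]] : exists c, 0 < c /\ lam * 3 `^ (- n%:R - 2 * s) = c.
  by exists (lam * 3 `^ (- n%:R - 2 * s)); split => //; rewrite mulr_gt0// powR_gt0.
exists (c / 2); first by rewrite divr_gt0.
move=> b b0 b1.
have bs0 : 0 < b `^ (2 * s) by rewrite powR_gt0.
(* The first term is the dispersion of a bump of width [b * r], the second the mass lost by
   truncating at the height of the bump; over a time [r^(2s) / (2 * C)] both use up at most half of
   the gain. *)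
pose C := 2^-1 * Cst * Cm / b `^ (2 * s) + c * Cw.
have C0 : 0 < C by rewrite addr_gt0 ?divr_gt0 ?mulr_gt0.
exists (1 / (2 * C)); first by rewrite divr_gt0// mulr_gt0.
move=> k Om w M e e1 x0 p r ta tb mu kk uw bw e0 e10 r0 vw hmu pr tbta wpos htail hOm X T hX hT hTb.
have rs0 := rs_gt0 s r0; set rs := r `^ (2 * s) in rs0 tbta *.
have M0 : 0 <= M := le_trans (normr_ge0 _) (bw (0, 0)).
have muinc t : ta <= t -> mu ta <= mu t by apply: (C1fun_le hmu) => v; exact: Mt_ge0.
pose Y (t : R) : R := mu t - mu ta.
have Y0 t : ta <= t -> 0 <= Y t by move=> /muinc; rewrite subr_ge0.
pose d := b * r; have d0 : 0 < d by rewrite mulr_gt0.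
have dr : d <= r by rewrite ler_piMl// ltW.
(* The margin [zt] makes the barrier inequality strict and is sent to zero. *)
suff key zt : 0 < zt -> - w (X, T) <= - c * Y T + c * C / rs * (Y T * (T - ta)) + (e + e1 + zt) * (T - ta).
  have TY : c * C / rs * (Y T * (T - ta)) <= c / 2 * Y T.
    have h : C / rs * (T - ta) <= 2^-1.
      have : T - ta <= 1 / (2 * C) * rs by move: hTb tbta; lr.
      rewrite -(ler_pM2l (_ : 0 < C / rs)) ?divr_gt0// => /le_trans; apply.
      by rewrite le_eqVlt; apply/orP; left; apply/eqP; field; rewrite !gt_eqF.
    rewrite (_ : c * C / rs * _ = c * Y T * (C / rs * (T - ta))); last by ring.
    rewrite (_ : c / 2 * _ = c * Y T * 2^-1); last by ring.
    by rewrite ler_wpM2l// mulr_ge0 ?Y0// ltW.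
  apply/ler_addgt0Pr => zt zt0.
  have T1 : 0 < T - ta + 1 by move: hT; lr.
  have := key (zt / (T - ta + 1)) (divr_gt0 zt0 T1).
  have : zt / (T - ta + 1) * (T - ta) <= zt.
    by rewrite mulrAC ler_pdivrMr// ler_wpM2l ?(ltW zt0)//; lra.
  rewrite -/(Y T); move: TY; clrP; move: (zt / _) (Y T) (w (X, T)) (c * C / rs * _) => z1 YT wT q.
  by move=> *; nra.
move=> zt0.
pose E := e + e1 + zt.
have E0 : 0 < E by rewrite ltr_wpDl// addr_ge0.
pose a := (d ^+ 2)^-1.
have d2 : 0 < d ^+ 2 by rewrite exprn_gt0.
have a0 : 0 <= a by rewrite invr_ge0 ltW.
pose mm (t : R) : R := c * Y t.
have hY : C1fun Y (Mt s w r x0).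
  by apply: (eq_C1fun (C1funD hmu (C1fun_cst (- mu ta)))) => t //; rewrite addr0.
have hm : C1fun mm (fun t => c * Mt s w r x0 t).
  by apply: (eq_C1fun (C1funM (C1fun_cst c) hY)) => t //; rewrite mul0r add0r.
(* As a barrier for [- w], the sum of [mm * stf] and [g] is [- mm] inside the bump and nonnegative
   outside. Differentiating [- c * Y] produces exactly the mass that the operator gives back; the
   other two terms pay for dispersion and for the right-hand sides. *)
pose g (t : R) : R := - c * Y t + c * C / rs * (Y t * (t - ta)) + E * (t - ta).
pose dg (t : R) : R := - c * Mt s w r x0 t + c * C / rs * (Mt s w r x0 t * (t - ta) + Y t) + E.
have hl : C1fun (fun t => t - ta) (fun=> 1).
  by apply: (eq_C1fun (C1fun_affine 1 (- ta))) => t //; rewrite mul1r.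
have hg : C1fun g dg.
  apply: (eq_C1fun (C1funD (C1funD (C1funM (C1fun_cst (- c)) hY) (C1funM (C1fun_cst (c * C / rs)) (C1funM hY hl))) (C1funM (C1fun_cst E) hl))) => t //.
  by rewrite /dg /=; ring.
pose h1 := basefun mm (@stf R) a p (fun=> 0).
pose h z := h1 z + g z.2.
have th1 : tst h1 := tst_base p a0 hm (C2fun_stf R) (C1fun_cst 0).
have tg : tst (fun z : 'rV[R]_n * R => g z.2) := tst_time n hg.
have th : tst h := tstD th1 tg.
have Dth z : Dt h z = c * Mt s w r x0 z.2 * stf (a * enorm (z.1 - p) ^+ 2 + 0) + dg z.2.
  rewrite /h (tst_DtD z th1 tg) (Dt_time _ hg) /h1 (Dt_base _ _ hm (proj1 (proj1 (C2fun_stf R))) (C1fun_cst 0)) /basefun /=.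
  by rewrite mulr0 mul0r addr0.
have g_ge t : ta <= t -> - mm t <= g t.
  move=> tta; rewrite /g /mm mulNr -addrA lerDl //.
  have t1 : 0 <= t - ta by rewrite subr_ge0.
  by have t2 := Y0 t tta; pos.
have mm0 u : ta <= u -> 0 <= mm u by move=> tu; exact: mulr_ge0 (ltW c0) (Y0 u tu).
have hE x t : h (x, t) = mm t * stf (a * enorm (x - p) ^+ 2 + 0) + g t by [].
have h_ge x t : ta <= t -> - mm t <= h (x, t).
  move=> tta; rewrite hE -[leLHS]add0r lerD ?g_ge// mulr_ge0 ?mm0//.
  by have /andP[] := stf_bounds (a * enorm (x - p) ^+ 2 + 0).
have h_out x t : ta <= t -> d <= enorm (x - p) -> 0 <= h (x, t).
  move=> tta xd; rewrite hE stf_hi; first by rewrite mulr1; move: (g_ge t tta); lr.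
  rewrite addr0 /a mulrC ler_pdivlMr// mul1r ler_pXn2r ?nnegrE ?enorm_ge0 ?(ltW d0)//.
have inb x : enorm (x - p) <= d -> enorm (x - x0) <= 3 * r.
  move=> xd; rewrite -(subrK p x) -addrA (le_trans (ler_enormD _ _))//.
  by move: xd pr dr; lr.
have wposb x t : enorm (x - x0) <= 11 * r -> ta <= t -> t < tb -> 0 <= w (x, t).
  by move=> xr; apply: wpos; apply: le_lt_trans xr _; rewrite ltr_pM2r//; lra.
have Tmid : T < (T + tb) / 2 by move: hTb; lr.
have Tmid2 : (T + tb) / 2 < tb by move: hTb; lr.
have hXd : enorm (X - p) <= d by move: hX d0; rewrite -/d; lr.
have := @barrier_le _ _ k e Om (fun z => - w z) h p d ta T ((T + tb) / 2) _ vw th Tmid _ _ _ X T hXd.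
rewrite hT lexx => /(_ _ _ _ _ isT) H.
have hX2 : stf (a * enorm (X - p) ^+ 2 + 0) = 0.
  apply: stf_lo; rewrite addr0 /a mulrC ler_pdivrMr//.
  apply: (@le_trans _ _ ((d / 2) ^+ 2)); first by rewrite ler_pXn2r ?nnegrE ?enorm_ge0// divr_ge0// ltW.
  by rewrite (_ : (d / 2) ^+ 2 = 4^-1 * d ^+ 2); [move: d2; lr|field].
have -> : - c * Y T + c * C / rs * (Y T * (T - ta)) + (e + e1 + zt) * (T - ta) = h (X, T).
  by rewrite hE hX2 mulr0 add0r.
apply: H => {hX2}.
- by move=> z; apply: cvgN; exact: UC_continuous.
- move=> x t xr /andP[tta ttb].
  have ttb' : t < tb := le_lt_trans ttb Tmid2.
  apply: (@le_trans _ _ 0); last by apply: h_out => //; rewrite xr.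
  rewrite oppr_le0; apply: wposb => //.
  have xd : enorm (x - p) <= d by rewrite xr.
  by move: (inb x xd) r0; lr.
- move=> x xr; have tta : ta < tb := le_lt_trans hT hTb.
  have -> : h (x, ta) = 0 by rewrite hE /g /mm /Y !subrr !(mulr0, mul0r) !addr0.
  rewrite oppr_le0; apply: wposb => //.
  by move: (inb x xr) r0; lr.
move=> x t xr /andP[tta ttb] hw hmax.
have ttb' : t < tb := lt_trans ttb Tmid2.
split; first exact: hOm.
have tta' := ltW tta.
have xx0 := inb x (ltW xr).
have mt0 := mm0 t tta'.
have M1 : 0 < 4 * (c * (M * r `^ (- n%:R - 2 * s)) + 1).
  by apply: mulr_gt0 => //; apply: ltr_wpDl => //; pos.
exists (Num.min (8 * r) (Num.min (1 / 2) (zt / (4 * (c * (M * r `^ (- n%:R - 2 * s)) + 1))))).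
  by rewrite !lt_min (divr_gt0 zt0 M1) andbT divr_gt0// andbT mulr_gt0.
move=> rg rg0; rewrite !lt_min => /and3P[rgr rg1 rgz].
have [iG1 IG1] := far_ge_Mt t pp kk uw bw r0 rg0 mt0 xx0.
have [iT IT _ _ _] := kbd k kk _ d0.
have mwx : measurable_fun setT (fun x => w (x, t)) by apply: continuous_measurable_rV; exact: UC_slice.
have iG2 : intg (fun y => ind (8 * r <= enorm y) * Num.max 0 (- w (x + y, t)) * k y).
  apply: (intg_far_le pp kk _ _ (C := M)); first by rewrite mulr_gt0.
    apply: measurable_maxr; first exact: measurable_cst.
    by apply: measurable_funN; exact: (meas_shift (f := fun y => w (y, t))).
  by move=> y; rewrite (le_trans (pos_le_norm _))// normrN; exact: bw.
pose S y := mm t * Cst * tr d y.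
pose G y := ind (8 * r <= enorm y) * Num.max 0 (- w (x + y, t)) - ind (rg <= enorm y) * Num.max 0 (w (x + y, t) - mm t).
have dh y : `|dlt (fun x => h (x, t)) x y| <= S y.
  have -> : dlt (fun x => h (x, t)) x y = mm t * dlt (fun x => stf (a * enorm (x - p) ^+ 2 + 0)) x y.
    by rewrite /dlt !hE; ring.
  rewrite normrM (ger0_norm mt0) /S -mulrA ler_wpM2l//.
  by apply: hst.
have iS : intg (fun y => S y * k y).
  by have := intgZ (mm t * Cst) iT; rewrite /S; under eq_fun do rewrite mulrA.
have iG : intg (fun y => G y * k y).
  have := intgB iG2 iG1; rewrite /intg; congr (_.-integrable _ _).
  by apply/funext => y /=; rewrite /G; congr EFin; ring.
have mh : measurable_fun setT (fun x => h (x, t)) by apply: continuous_measurable_rV; exact: tst_slice.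
have mw : measurable_fun setT (fun x => - w (x, t)) by exact: measurable_funN.
have [Ch Ch0 hCh] := tst_dlt_bound (x, t) th rg0.
have bnw y : `|- w (y, t)| <= M by rewrite normrN; exact: bw.
(* Where [w] is negative the point is at distance at least [8 * r] and is charged to the tail. Where
   [w] exceeds the height [mm t] the excess is the gain. Elsewhere maximality or the sign of [h]
   suffices. *)
have one y : rg <= enorm y -> - w (x + y, t) <= h (x + y, t) - h (x, t) - w (x, t) + G y.
  move=> yrg; rewrite /G (indT _ yrg) mul1r.
  case: (ltP (w (x + y, t)) 0) => wz.
    have y8 : 8 * r <= enorm y.
      rewrite leNgt; apply/negP => y8; move: wz; apply/negP; rewrite -leNgt; apply: wposb => //.
      rewrite addrAC (le_trans (ler_enormD _ _))//.
      by move: xx0 (ltW y8); lr.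
    rewrite (indT _ y8) mul1r max_r; last by move: wz; lr.
    rewrite (@max_l _ _ 0); last by move: wz mt0; lr.
    have zd : d <= enorm (x + y - p).
      rewrite leNgt; apply/negP => zd; move: wz; apply/negP; rewrite -leNgt; apply: wposb => //.
      by move: (inb _ (ltW zd)) r0; lr.
    by move: (h_out _ _ tta' zd) hw; lr.
  rewrite (@max_l _ _ 0 (- _)) ?oppr_le0// mulr0 add0r.
  case: (leP 0 (w (x + y, t) - mm t)) => wm.
    by move: (h_ge (x + y) t tta') hw; lr.
  rewrite subr0; case: (leP (enorm (x + y - p)) d) => zd.
    by move: (hmax _ zd); lr.
  by move: (h_out _ _ tta' (ltW zd)) hw wz; lr.
have gle := @gop_le _ _ _ _ _ pp k (fun x => h (x, t)) (fun x => - w (x, t)) x rg Ch M S G kk rg0 Ch0 mh mw bnw hCh iS iG.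
have {}gle : gop k rg (fun x => h (x, t)) (fun x => - w (x, t)) x <= 2^-1 * INT (fun y => S y * k y) + INT (fun y => G y * k y).
  apply: gle => y; case: (ltP (enorm y) rg) => yrg.
    rewrite /G enormN !indF -?ltNge//; last exact: lt_trans yrg rgr.
    by rewrite !mul0r !subr0 !addr0; exact: le_trans (ler_norm _) (dh y).
  have o1 := one y yrg; have o2 := one (- y); rewrite enormN in o2; have {}o2 := o2 yrg.
  have := le_trans (ler_norm _) (dh y); rewrite /dlt.
  by move: o1 o2; lr.
have eS : INT (fun y => S y * k y) = mm t * Cst * INT (fun y => tr d y * k y).
  by rewrite -INTZ//; congr INT; apply/funext => y; rewrite /S mulrA.
have eG : INT (fun y => G y * k y) = INT (fun y => ind (8 * r <= enorm y) * Num.max 0 (- w (x + y, t)) * k y)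
   - INT (fun y => ind (rg <= enorm y) * Num.max 0 (w (x + y, t) - mm t) * k y).
  by rewrite -INTB//; congr INT; apply/funext => y; rewrite /G; ring.
have tl := htail x t xr tta ttb'.
have [iw Iw] := hw' r r0.
have bS : 2^-1 * INT (fun y => S y * k y) <= 2^-1 * (mm t * Cst * (Cm / (b `^ (2 * s) * rs))).
  rewrite eS; apply: ler_wpM2l => //; apply: ler_wpM2l; first exact: mulr_ge0 mt0 (ltW Cst0).
  by rewrite /rs -powRM ?(ltW b0) ?(ltW r0).
have bW : mm t * INT (@wgt R n s r) <= mm t * (Cw / rs) by exact: ler_wpM2l.
(* The sup bound [M] is not uniform, but it is multiplied by the volume of a ball whose radius [rg]
   may depend on it. *)
have bM : c * (M * r `^ (- n%:R - 2 * s) * (2 * rg) ^+ n) <= zt / 2.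
  have rgn : (2 * rg) ^+ n <= 2 * rg.
    case: (n) hn => // N _; rewrite exprS ler_piMr ?mulr_ge0 ?(ltW rg0)// exprn_ile1 ?mulr_ge0 ?(ltW rg0)//.
    by move: rg1; lr.
  move: rgz; rewrite ltr_pdivlMr// => rgz.
  apply: (@le_trans _ _ (c * (M * r `^ (- n%:R - 2 * s) * (2 * rg)))).
    by rewrite ler_wpM2l ?(ltW c0)// ler_wpM2l// mulr_ge0 ?powR_ge0.
  by move: rgz rg0; clrP; move: (M * _) => q; nra.
rewrite Dth /=.
have st0 : 0 <= c * Mt s w r x0 t * stf (a * enorm (x - p) ^+ 2 + 0).
  by rewrite mulr_ge0 ?mulr_ge0 ?Mt_ge0 ?(ltW c0)//; have /andP[] := stf_bounds (a * enorm (x - p) ^+ 2 + 0).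
apply: (@lt_le_trans _ _ (dg t)); last by rewrite lerDr.
apply: le_lt_trans (lerD (lexx e) gle) _.
rewrite eG.
have IG1' := IG1; rewrite ec in IG1'.
have dge : - c * Mt s w r x0 t + c * C / rs * Y t + E <= dg t.
  rewrite /dg lerD2r lerD2l ler_wpM2l//; first by rewrite divr_ge0 ?mulr_ge0 ?(ltW c0) ?(ltW C0) ?(ltW rs0).
  by rewrite lerDr mulr_ge0 ?Mt_ge0 ?subr_ge0.
apply: lt_le_trans dge.
have eC : c * C / rs * Y t = 2^-1 * (mm t * Cst * (Cm / (b `^ (2 * s) * rs))) + c * (mm t * (Cw / rs)).
  by rewrite /C /mm; field; rewrite !gt_eqF.
rewrite eC /E.
have bW' : c * (mm t * INT (@wgt R n s r)) <= c * (mm t * (Cw / rs)) by rewrite ler_wpM2l ?(ltW c0).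
rewrite !mulrBr in IG1'.
by move: bS bW' bM IG1' tl zt0; lr.
Qed.

End LocalMinimum.

Ltac vec := apply/rowP => ?; rewrite !mxE; ring.

(** * Propagation of positivity *)

Section PositivityPropagation.
Context (R : realType) (n : nat) (s lam Lam : R).
Implicit Types (x y p : 'rV[R]_n) (w : 'rV[R]_n * R -> R) (k : 'rV[R]_n -> R).

(** Seen from [x], the ball of radius [d / 2] around [p] lies between the distances [d / 2] and
    [ra], where the kernel is integrable and bounded below. *)
Lemma ball_INT_ge k x p (d ra : R) : par n s lam Lam -> kern s lam Lam k -> 0 < d -> d <= enorm (x - p) ->
  enorm (x - p) + d / 2 <= ra ->
  intg (fun y => ind (enorm (x + y - p) < d / 2) * k y) /\
  lam * ra `^ (- n%:R - 2 * s) * (d / 2 / n%:R) ^+ n <= INT (fun y => ind (enorm (x + y - p) < d / 2) * k y).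
Proof.
move=> pp kk d0 dx xra; have [hn s0 s1 lam0 Lam0] := pp; have [mk ke kb] := kk.
have d20 : 0 < d / 2 by rewrite divr_gt0.
have e y : enorm (y - (p - x)) = enorm (x + y - p) by congr enorm; vec.
have ib := intg_ball (p - x) (d / 2).
have eb : (fun y : 'rV[R]_n => ind (enorm (y - (p - x)) < d / 2)) = (fun y => ind (enorm (x + y - p) < d / 2) : R).
  by apply/funext => y; rewrite e.
have Ib := INT_ball_ge (p - x) hn d20; rewrite eb in ib Ib.
have far y : enorm (x + y - p) < d / 2 -> d / 2 <= enorm y /\ enorm y <= ra.
  move=> yd; have h1 := ler_enormB (x + y - p) y; have h2 := ler_enormB (x + y - p) (x - p).
  rewrite (_ : x + y - p - y = x - p) in h1; last by vec.
  rewrite (_ : x + y - p - (x - p) = y) in h2; last by vec.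
  by split; [move: h1 yd dx; lr|move: h2 yd xra; lr].
have mb : measurable_fun setT (fun y : 'rV[R]_n => ind (enorm (x + y - p) < d / 2) : R) := intg_meas ib.
have ik : intg (fun y => ind (enorm (x + y - p) < d / 2) * k y).
  have := intg_far_le (C := 1) pp kk d20 mb.
  rewrite (_ : (fun y => _ * _ * k y) = (fun y => ind (enorm (x + y - p) < d / 2) * k y)).
    by apply => y; rewrite ger0_norm ?ind_le1 ?ind_ge0.
  apply/funext => y; congr (_ * _).
  case: (ltP (enorm (x + y - p)) (d / 2)) => yd; last by rewrite mulr0.
  by rewrite indT ?mul1r//; have [] := far y yd.
split; first exact: ik.
have c0 : 0 <= lam * ra `^ (- n%:R - 2 * s) by apply: mulr_ge0; [exact: ltW|exact: powR_ge0].
apply: (@le_trans _ _ (lam * ra `^ (- n%:R - 2 * s) * INT (fun y => ind (enorm (x + y - p) < d / 2)))).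
  exact: ler_wpM2l.
rewrite -(INTZ _ ib); apply: (INT_le (intgZ _ ib) ik) => y.
case: (boolP (enorm (x + y - p) < d / 2)) => yd; last by rewrite (indF _ (_ : ~~ false))// mulr0 mul0r.
rewrite (indT _ (_ : true))// mulr1 mul1r.
have [y1 y2] := far y yd; have /andP[kl _] := kb y; apply: le_trans kl.
rewrite (ler_pM2l lam0); apply: (ler_powP n s0) y2; exact: lt_le_trans y1.
Qed.

(* The barrier is [- a Z], where [Z] equals [1] near the initial time and outside [B_8r]: the mass [V] on the small ball pays for [Z]. *)
Lemma positivity (taub b : R) : par n s lam Lam -> 0 < taub -> 0 < b -> b <= 1 -> exists C c, [/\ 0 < C, 0 < c &
  forall k Om w M e e1 x0 p (r ta tb a V : R), kern s lam Lam k -> UC w -> bdd w M -> 0 <= e -> 0 <= e1 -> 0 < r ->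
  vsub k e Om (fun z => - w z) -> enorm (p - x0) <= 2 * r -> 0 <= a -> 0 < V ->
  (forall x t, enorm (x - x0) < 16 * r -> ta <= t -> t < tb -> - a <= w (x, t)) ->
  (forall x t, enorm (x - p) < b * r -> ta <= t -> t < tb -> V <= w (x, t)) ->
  (forall x t, enorm (x - x0) < 8 * r -> ta < t -> t < tb ->
    INT (fun y => ind (8 * r <= enorm y) * Num.max 0 (- w (x + y, t)) * k y) <= e1) ->
  (forall x t, enorm (x - x0) < 8 * r -> ta < t -> t < tb -> w (x, t) < 0 -> exists2 rho, 0 < rho & cylinder rho (x, t) `<=` Om) ->
  C * a + r `^ (2 * s) * (e + e1) < c * V ->
  forall x t, enorm (x - x0) <= 4 * r -> ta + taub * r `^ (2 * s) <= t -> t < tb -> 0 <= w (x, t)].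
Proof.
move=> pp taub0 b0 b1; have [hn s0 s1 lam0 Lam0] := pp.
have [Cm [cf [Cm0 cf0 kbd]]] := kern_bounds pp.
have [Cst Cst0 hst] := @stf_dlt R.
have [B B0 hB] := @stf12_bounded R.
have n0 : 0 < n%:R :> R by rewrite ltr0n.
(* The radius [11 * r] covers [8 * r] for [x], [2 * r] for [p] and half of [b * r <= r]. *)
pose c : R := lam * (11 `^ (- n%:R - 2 * s) * (b / 2 / n%:R) ^+ n).
have c0 : 0 < c.
  by apply: mulr_gt0 => //; apply: mulr_gt0; [exact: powR_gt0|apply: exprn_gt0; rewrite !divr_gt0].
(* Cost of the barrier per unit of height, multiplied by [r^(2s)]: its second differences at scale
   [8 * r] and its time derivative over the duration [taub * r^(2s)]. *)
pose C := 2^-1 * Cst * Cm + 2 * B / taub.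
have C0 : 0 < C by rewrite ltr_wpDr ?mulr_gt0// divr_ge0 ?mulr_ge0// ltW.
exists C, c; split => //.
move=> k Om w M e e1 x0 p r ta tb a V kk uw bw e0 e10 r0 vw pr a0 V0 wa wV htail hOm hC X T hX hT hTb.
have rs0 := rs_gt0 s r0; set rs := r `^ (2 * s) in rs0 hC hT *.
pose d := b * r; have d0 : 0 < d by rewrite mulr_gt0.
have dr : d <= r by rewrite ler_piMl// ltW.
pose tau := taub * rs; have tau0 : 0 < tau by rewrite mulr_gt0.
pose A := ((8 * r) ^+ 2)^-1.
have r80 : 0 < 8 * r by rewrite mulr_gt0.
have A8 : 0 < (8 * r) ^+ 2 by rewrite exprn_gt0.
have A0 : 0 <= A by rewrite invr_ge0 ltW.
pose q (t : R) : R := ppow 2 (- tau^-1 * t + (ta + tau) / tau).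
pose dq (t : R) : R := 2 * ppow 1 (- tau^-1 * t + (ta + tau) / tau) * - tau^-1.
have hq : C1fun q dq := C1fun_comp (C1fun_ppow R 0) (C1fun_affine (- tau^-1) ((ta + tau) / tau)).
have qarg t : - tau^-1 * t + (ta + tau) / tau = (ta + tau - t) / tau by field; rewrite gt_eqF.
have q0 t : 0 <= q t by exact: ppow_ge0.
pose h := basefun (fun=> a) (@stf R) A x0 q.
have th : tst h := tst_base x0 A0 (C1fun_cst a) (C2fun_stf R) hq.
have hE x t : h (x, t) = a * stf (A * enorm (x - x0) ^+ 2 + q t) by [].
have Dth z : Dt h z = a * dq z.2 * stf1 (A * enorm (z.1 - x0) ^+ 2 + q z.2).
  by rewrite /h (Dt_base _ _ (C1fun_cst a) (proj1 (proj1 (C2fun_stf R))) hq) /basefun /= mul0r add0r.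
have h0 x t : 0 <= h (x, t).
  by rewrite hE mulr_ge0//; have /andP[] := stf_bounds (A * enorm (x - x0) ^+ 2 + q t).
have h_out x t : 8 * r <= enorm (x - x0) -> h (x, t) = a.
  move=> xr; rewrite hE stf_hi ?mulr1// ler_wpDr//.
  by rewrite /A mulrC ler_pdivlMr// mul1r ler_pXn2r ?nnegrE ?enorm_ge0 ?(ltW r80).
have Tmid : T < (T + tb) / 2 by move: hTb; lr.
have Tmid2 : (T + tb) / 2 < tb by move: hTb; lr.
have taT : ta <= T by move: hT tau0; rewrite /tau; lr.
have hX8 : enorm (X - x0) <= 8 * r by move: hX r0; lr.
have ballp x : enorm (x - p) <= d -> enorm (x - x0) < 8 * r.
  move=> xd; have := ler_enormD (x - p) (p - x0); rewrite (_ : x - p + (p - x0) = x - x0); last by vec.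
  by move: xd pr dr r0; lr.
have hXT : h (X, T) = 0.
  have qT : q T = 0.
    by rewrite /q ppow_neg// qarg pmulr_lle0 ?invr_gt0// subr_le0.
  rewrite hE qT addr0 stf_lo ?mulr0// /A mulrC ler_pdivrMr//.
  apply: (@le_trans _ _ ((4 * r) ^+ 2)); first by rewrite ler_pXn2r ?nnegrE ?enorm_ge0 ?mulr_ge0 ?(ltW r0).
  by rewrite (_ : (4 * r) ^+ 2 = 4^-1 * (8 * r) ^+ 2); [move: A8; lr|field].
rewrite -oppr_le0 -hXT.
have := @barrier_le _ _ k e Om (fun z => - w z) h x0 (8 * r) ta T ((T + tb) / 2) _ vw th Tmid _ _ _ X T hX8.
rewrite taT lexx => /(_ _ _ _ _ isT); apply => {hXT}.
- by move=> z; apply: cvgN; exact: UC_continuous.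
- move=> x t xr /andP[tta ttb].
  rewrite h_out ?xr// lerNl; apply: wa => //; last exact: le_lt_trans ttb Tmid2.
  by rewrite xr; move: r0; lr.
- move=> x xr.
  have -> : h (x, ta) = a.
    rewrite hE stf_hi ?mulr1//.
    have -> : q ta = 1.
      by rewrite /q qarg (addrC ta) addrK divff ?gt_eqF// ppow_pos// expr1n.
    by rewrite lerDr mulr_ge0 ?sqr_ge0.
  rewrite lerNl; apply: wa => //; last exact: le_lt_trans taT hTb.
  by move: xr r0; lr.
move=> x t xr /andP[tta ttb] hw hmax.
have ttb' : t < tb := lt_trans ttb Tmid2.
have tta' := ltW tta.
have wneg : w (x, t) < 0 by move: (h0 x t) hw; lr.
split; first exact: hOm.
have xp : d <= enorm (x - p).
  rewrite leNgt; apply/negP => xp; have := wV x t xp tta' ttb'.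
  by move: wneg V0; lr.
have xp11 : enorm (x - p) + d / 2 <= 11 * r.
  have := ler_enormB (x - x0) (p - x0); rewrite (_ : x - x0 - (p - x0) = x - p); last by vec.
  by move: xr pr dr r0 d0; lr.
have [iB IB] := ball_INT_ge pp kk d0 xp xp11.
have [iT IT _ _ _] := kbd k kk _ r80.
have mwx : measurable_fun setT (fun x => w (x, t)) by apply: continuous_measurable_rV; exact: UC_slice.
have mw : measurable_fun setT (fun x => - w (x, t)) by exact: measurable_funN.
have iG2 : intg (fun y => ind (8 * r <= enorm y) * Num.max 0 (- w (x + y, t)) * k y).
  apply: (intg_far_le pp kk r80 _ (C := M)).
    apply: measurable_maxr; first exact: measurable_cst.
    exact: (meas_shift (f := fun y => - w (y, t))).
  by move=> y; rewrite (le_trans (pos_le_norm _))// normrN; exact: bw.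
exists (d / 2); first by rewrite divr_gt0.
move=> rg rg0 rgd.
pose S y := a * Cst * tr (8 * r) y.
pose G y := ind (8 * r <= enorm y) * Num.max 0 (- w (x + y, t)) - V * ind (enorm (x + y - p) < d / 2).
have dh y : `|dlt (fun x => h (x, t)) x y| <= S y.
  have -> : dlt (fun x => h (x, t)) x y = a * dlt (fun x => stf (A * enorm (x - x0) ^+ 2 + q t)) x y.
    by rewrite /dlt !hE; ring.
  rewrite normrM (ger0_norm a0) /S -mulrA ler_wpM2l//.
  exact: hst.
have iS : intg (fun y => S y * k y).
  by have := intgZ (a * Cst) iT; rewrite /S; under eq_fun do rewrite mulrA.
have iG : intg (fun y => G y * k y).
  have := intgB iG2 (intgZ V iB); rewrite /intg; congr (_.-integrable _ _).
  by apply/funext => y /=; rewrite /G; congr EFin; ring.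
have mh : measurable_fun setT (fun x => h (x, t)) by apply: continuous_measurable_rV; exact: tst_slice.
have [Ch Ch0 hCh] := tst_dlt_bound (x, t) th rg0.
have bnw y : `|- w (y, t)| <= M by rewrite normrN; exact: bw.
have ind1 : ind true = 1 :> R by [].
have ind0 : ind false = 0 :> R by [].
have near_p y : enorm (x + y - p) < d / 2 -> d / 2 < enorm y.
  move=> yd; have := ler_enormB (x + y - p) y; rewrite (_ : x + y - p - y = x - p); last by vec.
  by move: yd xp; lr.
(* By position of [x + y]: in the small ball [w >= V] gives the gain; in [B_8r] maximality applies;
   up to [16 * r] the barrier equals [a], which bounds [- w]; beyond, the tail takes over. *)
have one y : - w (x + y, t) <= h (x + y, t) - h (x, t) - w (x, t) + G y.
  rewrite /G; have hz := h0 (x + y) t.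
  have m0 := max0_ge0 (- w (x + y, t)).
  have i0 : 0 <= ind (8 * r <= enorm y) * Num.max 0 (- w (x + y, t)) by exact: mulr_ge0 (ind_ge0 _ _) m0.
  case: (ltP (enorm (x + y - p)) (d / 2)) => yd.
    rewrite ind1 mulr1.
    have yd' : enorm (x + y - p) < d by move: yd d0; lr.
    by have := wV (x + y) t yd' tta' ttb'; move: hw hz i0; lr.
  rewrite ind0 mulr0 subr0.
  case: (leP (enorm (x + y - x0)) (8 * r)) => y8.
    by move: (hmax _ y8) i0; lr.
  case: (ltP (enorm (x + y - x0)) (16 * r)) => y16.
    have := h_out (x + y) t (ltW y8); have := wa (x + y) t y16 tta' ttb'.
    by move: hw i0; lr.
  have yr : 8 * r <= enorm y.
    have := ler_enormB (x + y - x0) (x - x0); rewrite (_ : x + y - x0 - (x - x0) = y); last by vec.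
    have := ler_enormD (x - x0) y; rewrite (_ : x - x0 + y = x + y - x0); last by vec.
    by move: y16 xr; lr.
  rewrite yr ind1 mul1r.
  have : - w (x + y, t) <= Num.max 0 (- w (x + y, t)) by rewrite le_max lexx orbT.
  by move: hz hw; lr.
have gle := @gop_le _ _ _ _ _ pp k (fun x => h (x, t)) (fun x => - w (x, t)) x rg Ch M S G kk rg0 Ch0 mh mw bnw hCh iS iG.
have {}gle : gop k rg (fun x => h (x, t)) (fun x => - w (x, t)) x <= 2^-1 * INT (fun y => S y * k y) + INT (fun y => G y * k y).
  apply: gle => y; case: (ltP (enorm y) rg) => yrg.
    have G0 v : enorm v < rg -> 0 <= G v.
      move=> vr; rewrite /G (indF _ (_ : ~~ (enorm (x + v - p) < d / 2))).
        by rewrite mulr0 subr0; exact: mulr_ge0 (ind_ge0 _ _) (max0_ge0 _).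
      by apply/negP => /near_p; move: vr rgd; lr.
    have g1 := G0 y yrg; have g2 := G0 (- y); rewrite enormN in g2; have {}g2 := g2 yrg.
    by have := le_trans (ler_norm _) (dh y); move: g1 g2; lr.
  have o1 := one y; have o2 := one (- y).
  have := le_trans (ler_norm _) (dh y); rewrite /dlt.
  by move: o1 o2; lr.
have eS : INT (fun y => S y * k y) = a * Cst * INT (fun y => tr (8 * r) y * k y).
  by rewrite -INTZ//; congr INT; apply/funext => y; rewrite /S mulrA.
have eG : INT (fun y => G y * k y) = INT (fun y => ind (8 * r <= enorm y) * Num.max 0 (- w (x + y, t)) * k y)
   - V * INT (fun y => ind (enorm (x + y - p) < d / 2) * k y).
  by rewrite -(INTZ V iB) -(INTB iG2 (intgZ V iB)); congr INT; apply/funext => y; rewrite /G; ring.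
have tl := htail x t xr tta ttb'.
apply: le_lt_trans (lerD (lexx e) gle) _.
rewrite Dth /= eG.
have bS : 2^-1 * INT (fun y => S y * k y) <= 2^-1 * Cst * Cm * a / rs.
  rewrite eS (_ : 2^-1 * Cst * Cm * a / rs = 2^-1 * (a * Cst * (Cm / rs))); last by ring.
  apply: ler_wpM2l => //; apply: ler_wpM2l; first exact: mulr_ge0 a0 (ltW Cst0).
  apply: le_trans IT _; rewrite (ler_pM2l Cm0) lef_pV2 ?posrE ?powR_gt0//.
  apply: ge0_ler_powR; rewrite ?nnegrE ?mulr_ge0 ?(ltW s0) ?(ltW r0) ?(ltW r80)//.
  by move: r0; lr.
have bB' : c * V / rs <= V * INT (fun y => ind (enorm (x + y - p) < d / 2) * k y).
  rewrite (_ : c * V / rs = V * (c / rs)); last by ring.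
  apply: (ler_wpM2l (ltW V0)); apply: le_trans IB.
  rewrite powRM ?(ltW r0)// (powP_split n s r0) le_eqVlt; apply/orP; left; apply/eqP.
  rewrite /c /d (_ : b * r / 2 / n%:R = (b / 2 / n%:R) * r); last by field; rewrite gt_eqF.
  rewrite [X in _ = _ * X]exprMn -/rs; have rn0 := exprn_gt0 n r0.
  move: (_ ^+ n) (r ^+ n) rn0 (11 `^ _) => q1 q2 q20 q3.
  by field; rewrite !gt_eqF.
have bD : - (2 * B * a / tau) <= a * dq t * stf1 (A * enorm (x - x0) ^+ 2 + q t).
  have sB := le_trans (ler_norm _) (proj1 (hB (A * enorm (x - x0) ^+ 2 + q t))).
  have s10 := stf1_ge0 (A * enorm (x - x0) ^+ 2 + q t).
  have p1 : ppow 1 (- tau^-1 * t + (ta + tau) / tau) <= 1.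
    rewrite qarg /ppow expr1 ge_max ler01/= ler_pdivrMr// mul1r.
    by move: tta'; lr.
  have p0 := ppow_ge0 1 (- tau^-1 * t + (ta + tau) / tau).
  rewrite /dq (_ : a * _ * _ = - (2 * a / tau * (ppow 1 (- tau^-1 * t + (ta + tau) / tau) * stf1 (A * enorm (x - x0) ^+ 2 + q t)))); last by ring.
  rewrite lerN2 (_ : 2 * B * a / tau = 2 * a / tau * (1 * B)); last by ring.
  apply: ler_wpM2l; first by rewrite divr_ge0 ?mulr_ge0// ltW.
  exact: ler_pM.
have hC' : e + e1 + 2^-1 * Cst * Cm * a / rs + 2 * B * a / tau < c * V / rs.
  rewrite ltr_pdivlMr//; apply: le_lt_trans hC.
  rewrite /C /tau le_eqVlt; apply/orP; left; apply/eqP; field.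
  by rewrite !gt_eqF.
by move: hC' bD bB' bS tl; lr.
Qed.

End PositivityPropagation.

(** * Mass forced by the normalisation *)

Section MassLowerBound.
Context (R : realType) (n : nat) (s lam Lam : R).
Implicit Types (x y p : 'rV[R]_n) (w : 'rV[R]_n * R -> R) (k : 'rV[R]_n -> R).

Lemma kern_far_growth (g : R) : par n s lam Lam -> 0 < g -> exists2 C, 0 < C & forall k, kern s lam Lam k ->
  forall r, 0 < r -> intg (fun y => ind (r <= enorm y) * enorm y `^ (2 * s - g) * k y) /\
  INT (fun y => ind (r <= enorm y) * enorm y `^ (2 * s - g) * k y) <= C * r `^ (- g).
Proof.
move=> pp g0; have [hn s0 s1 lam0 Lam0] := pp.
have [C C0 hC] := jker_far_growth n s g0.
exists (Lam * C); first exact: mulr_gt0.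
move=> k kk r r0; have [ig Ig] := hC r r0.
have mf : measurable_fun setT (fun y : 'rV[R]_n => ind (r <= enorm y) * enorm y `^ (2 * s - g)).
  by apply: measurable_funM; [exact: meas_ind_far|exact: meas_powenorm].
have e : (fun y : 'rV[R]_n => ind (r <= enorm y) * (enorm y `^ (2 * s - g) * jker s y)) =
  (fun y => ind (r <= enorm y) * enorm y `^ (2 * s - g) * jker s y) by apply/funext => y; rewrite mulrA.
rewrite e in ig Ig.
have g_ge0 y : 0 <= ind (r <= enorm y) * enorm y `^ (2 * s - g) :> R by exact: mulr_ge0 (ind_ge0 _ _) (powR_ge0 _ _).
split.
  by apply: (kern_intg pp kk mf _ ig) => y; rewrite ger0_norm.
apply: le_trans (kern_INT_le pp kk mf g_ge0 ig) _.
by rewrite -mulrA (ler_pM2l Lam0).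
Qed.

(** Change of centre and scale: [r0 + enorm (y + (x1 - x0))] is at most [K * (r1 + enorm y)], so the
    weights compare. *)
Lemma Mt_le_Mt w (M r1 r0 K : R) x1 x0 (t : R) : par n s lam Lam -> UC w -> bdd w M -> 0 < r1 -> 0 < r0 ->
  0 < K -> r0 <= K * r1 -> r0 + enorm (x1 - x0) <= K * r1 -> 1 <= K ->
  Mt s w r1 x1 t <= K `^ (n%:R + 2 * s) * Mt s w r0 x0 t.
Proof.
move=> pp uw bw r10 r00 K0 rK xK K1; have [hn s0 s1 lam0 Lam0] := pp.
have [iM <-] := Mt_shift x0 x1 t pp uw bw r00.
rewrite -(INTZ _ iM); apply: (INT_le (intg_Mt x1 t pp uw bw r10) (intgZ _ iM)) => y.
rewrite mulrCA; apply: (ler_wpM2l (max0_ge0 _)).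
have y0 := enorm_ge0 y.
have e : K `^ (n%:R + 2 * s) = K^-1 `^ (- n%:R - 2 * s).
  by rewrite -opprD powRN -[K^-1]powR_inv1 ?(ltW K0)// -powRrM mulN1r powRN invrK.
rewrite e /wgt -powRM ?invr_ge0 ?(ltW K0) ?addr_ge0 ?enorm_ge0 ?(ltW r00)//.
apply: (ler_powP n s0); first by rewrite mulr_gt0 ?invr_gt0// ltr_pwDl// enorm_ge0.
rewrite mulrC ler_pdivrMr// mulrC mulrDr.
have := ler_enormD y (x1 - x0); have : 1 * enorm y <= K * enorm y by exact: ler_wpM2r.
by move: xK; lr.
Qed.

Lemma C1fun_diff_le (f g df dg : R -> R) (K a b : R) : C1fun f df -> C1fun g dg -> (forall t, df t <= K * dg t) ->
  a <= b -> f b - f a <= K * (g b - g a).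
Proof.
move=> hf hg h ab.
have hk := C1funD (C1funM (C1fun_cst K) hg) (C1funM (C1fun_cst (-1 : R)) hf).
have := C1fun_le hk _ ab; rewrite -subr_ge0 => /(_ _) H.
rewrite -subr_ge0; rewrite [leRHS](_ : _ = K * g b + -1 * f b - (K * g a + -1 * f a)); last by ring.
by apply: H => t; have := h t; lr.
Qed.

(** By contradiction: a small mass during the initial interval gives [w <= 1/4] on a large ball at
    its end, through [local_max]. From then on a barrier that starts at [1/4], equals a large
    constant at infinity and rises by at most [1/4] until time 0 keeps [w (en, t)] below [1/2],
    against the value 1 at time 0. *)
Lemma mass_ge (g C0 T Tm : R) : par n s lam Lam -> 2^-1 <= s -> 0 < g -> g < 2 * s -> 0 < C0 -> 0 < T -> 0 < Tm ->
  exists m0 R1 eN, [/\ 0 < m0, 0 < R1, 0 < eN & forall k Om w M e x0 en (r0 ta : R) mu, kern s lam Lam k -> UC w -> bdd w M ->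
  0 <= e -> e <= eN -> vsub k e Om w -> (forall z, `|w z| <= C0 * (1 + enorm z.1) `^ (2 * s - g)) ->
  0 < r0 -> r0 <= 1 -> enorm x0 <= 1 -> enorm en <= 1 -> C1fun mu (Mt s w r0 x0) -> - Tm <= ta -> ta + T < 0 ->
  (forall x t, enorm x < R1 -> ta < t -> t < 0 -> 0 < w (x, t) -> exists2 rho, 0 < rho & cylinder rho (x, t) `<=` Om) ->
  w (en, 0) = 1 -> m0 <= mu (ta + T) - mu ta].
Proof.
move=> pp s2 g0 gs C00 T0 Tm0; have [hn s0 s1 lam0 Lam0] := pp.
have [Cm [cf [Cm0 cf0 kbd]]] := kern_bounds pp.
have [Cst Cst0 hst] := @stf_dlt R.
have [CU CU0 hU] := local_max pp s2 T0.
have [Cg Cg0 hCg] := kern_far_growth pp g0.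
pose c3 : R := C0 * 3 `^ (2 * s - g).
have c30 : 0 < c3 by rewrite mulr_gt0// powR_gt0.
pose CE := c3 * Cg + 2^-1 * c3 * Cst * Cm + 1.
have CE0 : 0 < CE by rewrite addr_gt0// addr_gt0 ?mulr_gt0.
have e80 : 0 < 8^-1 :> R by rewrite invr_gt0.
have [ri ri0 hri] := powR_small (CE * Tm) g0 e80.
(* So large that the influence of the growth at infinity, at rate [CE * rho0^(-g)], adds at most
   [1/8] over the whole time [Tm]. *)
pose rho0 := Num.max 2 ri^-1.
have rho2 : 2 <= rho0 by rewrite le_max lexx.
have rho00 : 0 < rho0 by move: rho2; lr.
have hrho : CE * Tm * rho0 `^ (- g) <= 8^-1.
  have h := hri rho0^-1; rewrite invr_gt0 in h.
  have e : rho0 `^ (- g) = rho0^-1 `^ g by rewrite -powR_inv1 ?(ltW rho00)// -powRrM mulN1r.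
  rewrite e; apply: h => //; rewrite -[leRHS]invrK lef_pV2 ?posrE ?invr_gt0// le_max lexx orbT//.
pose K := (rho0 + 3) `^ (n%:R + 2 * s).
have K0 : 0 < K by apply: powR_gt0; apply: addr_gt0.
(* Mass and error each put at most [1/16] into the bound of [local_max], and the error adds at most
   [1/8] until time 0. The radius [rho0 + 20] leaves room for cylinders of radius 16 around points
   of [B_rho0]. *)
exists (8^-1 / (2 * (CU * K))), (rho0 + 20), (Num.min (8^-1 / (2 * CU)) (8^-1 / Tm)); split.
- by rewrite divr_gt0 ?mulr_gt0.
- by rewrite ltr_wpDr// ltW.
- by rewrite lt_min !divr_gt0 ?mulr_gt0.
move=> k Om w M e x0 en r0 ta mu kk uw bw e0; rewrite le_min => /andP[eN1 eN2] vw hgr r00 r01 hx0 hen hmu hta haT hOm hw1.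
rewrite leNgt; apply/negP => hmass.
set b := ta + T in haT hmass.
pose V := C0 * (1 + 2 * rho0) `^ (2 * s - g).
have V0 : 0 < V by rewrite mulr_gt0// powR_gt0// addr_gt0// mulr_gt0.
have gs0 : 0 <= 2 * s - g by move: gs; lr.
have hb x : enorm x <= rho0 -> w (x, b) <= 4^-1.
  move=> xr; have [nu hnu] := primitive (continuous_Mt (x := x) pp uw bw ltr01).
  have := hU k Om w M e x 1 ta 0 nu kk uw bw e0 ltr01 vw hnu _ _ x b.
  rewrite subrr enorm0 powR1 !mulr1 !mul1r => H0; have H := fun h1 h2 h3 h4 => H0 h1 h2 h3 h4 haT.
  have {}H : w (x, b) <= CU * (e + (nu b - nu ta)).
    apply: H => //.
    - by move=> t; apply: (C1fun_le hnu) => v; exact: Mt_ge0.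
    - move=> y t yx /andP[tta t0]; apply: hOm => //.
      rewrite -(subrK x y); apply: le_lt_trans (ler_enormD _ _) _.
      by move: yx xr; lr.
  apply: le_trans H _.
  have nb : nu b - nu ta <= K * (mu b - mu ta).
    apply: (C1fun_diff_le hnu hmu) => [t|]; last by rewrite /b lerDl ltW.
    apply: (Mt_le_Mt _ pp uw bw ltr01 r00); rewrite ?mulr1.
    - by move: rho00; lr.
    - by move: rho00 r01; lr.
    - have := ler_enormB x x0; move: xr hx0 r01 rho00; lr.
    - by move: rho00; lr.
  have h1 : CU * e <= 8^-1 / 2.
    by move: eN1; rewrite ler_pdivlMr ?mulr_gt0// => h; rewrite ler_pdivlMr//; move: h; lr.
  have h2 : CU * (K * (mu b - mu ta)) <= 8^-1 / 2.
    move: (ltW hmass); rewrite ler_pdivlMr ?mulr_gt0// => h; rewrite ler_pdivlMr//; move: h; lr.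
  have h3 : CU * (nu b - nu ta) <= CU * (K * (mu b - mu ta)) by rewrite (ler_pM2l CU0).
  by rewrite mulrDr; move: h1 h2 h3; lr.
pose A := (rho0 ^+ 2)^-1.
have A8 : 0 < rho0 ^+ 2 by rewrite exprn_gt0.
have A0 : 0 <= A by rewrite invr_ge0 ltW.
pose E := e + CE * rho0 `^ (- g).
have rg_gt0 : 0 < rho0 `^ (- g) by exact: powR_gt0.
have E0 : 0 <= E by rewrite addr_ge0// mulr_ge0// ltW.
have Eb t : b <= t -> t < 0 -> E * (t - b) <= 4^-1.
  move=> bt t0; apply: (@le_trans _ _ (E * Tm)).
    by apply: ler_wpM2l => //; rewrite /b; move: hta t0 T0 bt; rewrite /b; lr.
  rewrite /E mulrDl; move: eN2; rewrite ler_pdivlMr// => eN2.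
  by move: hrho eN2; rewrite mulrAC; lr.
pose q t := E * (t - b) + 4^-1.
have hq : C1fun q (fun=> E).
  apply: (eq_C1fun (C1fun_affine E (- (E * b) + 4^-1))) => t //.
  by rewrite /q; ring.
pose h1 := basefun (fun=> V) (@stf R) A (0 : 'rV[R]_n) (fun=> 0).
pose h z := h1 z + q z.2.
have th1 : tst h1 := tst_base 0 A0 (C1fun_cst V) (C2fun_stf R) (C1fun_cst 0).
have tg : tst (fun z : 'rV[R]_n * R => q z.2) := tst_time n hq.
have th : tst h := tstD th1 tg.
have hE x t : h (x, t) = V * stf (A * enorm (x - 0) ^+ 2 + 0) + q t by [].
have Dth z : Dt h z = E.
  rewrite /h (tst_DtD z th1 tg) (Dt_time _ hq) /h1 (Dt_base _ _ (C1fun_cst V) (proj1 (proj1 (C2fun_stf R))) (C1fun_cst 0)) /basefun /=.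
  by rewrite mulr0 !mul0r !add0r.
have q_ge t : b <= t -> 4^-1 <= q t.
  by move=> bt; rewrite /q lerDr mulr_ge0// subr_ge0.
have st0 x : 0 <= stf (A * enorm (x - 0) ^+ 2 + 0) by have /andP[] := stf_bounds (A * enorm (x - 0) ^+ 2 + 0).
have h_ge x t : b <= t -> 4^-1 <= h (x, t).
  by move=> /q_ge qt; rewrite hE; have := mulr_ge0 (ltW V0) (st0 x); move: qt; lr.
have h_out x t : b <= t -> rho0 <= enorm x -> V <= h (x, t).
  move=> bt xr; rewrite hE stf_hi; first by rewrite mulr1; have := q_ge t bt; lr.
  by rewrite addr0 subr0 /A mulrC ler_pdivlMr// mul1r ler_pXn2r ?nnegrE ?enorm_ge0 ?(ltW rho00).
have wV x t : enorm x <= 2 * rho0 -> w (x, t) <= V.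
  move=> xr; apply: le_trans (ler_norm _) (le_trans (hgr (x, t)) _).
  rewrite /V (ler_pM2l C00); apply: (ge0_ler_powR gs0); rewrite ?nnegrE ?addr_ge0 ?enorm_ge0 ?mulr_ge0 ?(ltW rho00)//=.
  by move: xr; lr.
have CEe : e + (2^-1 * (V * Cst * (Cm / rho0 `^ (2 * s))) + c3 * (Cg * rho0 `^ (- g))) < E.
  have Vl : V <= c3 * rho0 `^ (2 * s) * rho0 `^ (- g).
    rewrite -mulrA -powRD; last by rewrite (gt_eqF rho00) implybT.
    rewrite /c3 -mulrA -powRM ?(ltW rho00)//.
    rewrite /V (ler_pM2l C00); apply: (ge0_ler_powR gs0); rewrite ?nnegrE ?addr_ge0 ?mulr_ge0 ?(ltW rho00)//=.
    by move: rho2; lr.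
  have rs0 : 0 < rho0 `^ (2 * s) by exact: powR_gt0.
  have : 2^-1 * (V * Cst * (Cm / rho0 `^ (2 * s))) <= 2^-1 * (c3 * rho0 `^ (2 * s) * rho0 `^ (- g) * Cst * (Cm / rho0 `^ (2 * s))).
    apply: ler_wpM2l => //; apply: ler_wpM2r; first by rewrite divr_ge0 ?(ltW Cm0) ?(ltW rs0).
    by apply: ler_wpM2r => //; exact: ltW.
  rewrite [leRHS](_ : _ = 2^-1 * c3 * Cst * Cm * rho0 `^ (- g)); last by field; rewrite gt_eqF.
  by rewrite /E /CE; move: rg_gt0; lr.
have main t : b < t -> t < 0 -> w (en, t) <= 2^-1.
  move=> bt t0.
  have tt2 : t < t / 2 by move: t0; lr.
  have en0 : enorm (en - 0) <= rho0 by rewrite subr0; move: hen rho2; lr.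
  have := @barrier_le _ _ k e Om w h 0 rho0 b t (t / 2) (UC_continuous uw) vw th tt2 _ _ _ en t en0.
  rewrite (ltW bt) lexx => /(_ _ _ _ isT) H.
  have {}H : w (en, t) <= h (en, t).
    apply: H.
    - move=> x u xr /andP[bu ut]; rewrite subr0 in xr.
      apply: le_trans (h_out x u bu _); last by rewrite xr.
      by apply: wV; rewrite xr; move: rho00; lr.
    - move=> x xr; rewrite subr0 in xr.
      exact: le_trans (hb x xr) (h_ge x b (lexx _)).
    move=> x u xr /andP[bu ut] hw hmax; rewrite subr0 in xr.
    have u0 : u < 0 by move: ut t0; lr.
    have bu' := ltW bu.
    split.
      apply: hOm => //; first by move: xr; lr.
        by move: bu T0; rewrite /b; lr.
      by have := h_ge x u bu'; move: hw; lr.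
    have [iT IT _ _ _] := kbd k kk _ rho00.
    have [iG0 IG0] := hCg k kk _ rho00.
    have mw : measurable_fun setT (fun x => w (x, u)) by apply: continuous_measurable_rV; exact: UC_slice.
    exists rho0 => // rg rg0 rgd.
    pose S y := V * Cst * tr rho0 y.
    pose G y := c3 * (ind (rho0 <= enorm y) * enorm y `^ (2 * s - g)).
    have dh y : `|dlt (fun x => h (x, u)) x y| <= S y.
      have -> : dlt (fun x => h (x, u)) x y = V * dlt (fun x => stf (A * enorm (x - 0) ^+ 2 + 0)) x y.
        by rewrite /dlt !hE; ring.
      rewrite normrM (gtr0_norm V0) /S -mulrA (ler_pM2l V0).
      exact: hst.
    have iS : intg (fun y => S y * k y).
      by have := intgZ (V * Cst) iT; rewrite /S; under eq_fun do rewrite mulrA.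
    have eG y : G y * k y = c3 * (ind (rho0 <= enorm y) * enorm y `^ (2 * s - g) * k y) by rewrite /G; ring.
    have iG : intg (fun y => G y * k y).
      by under [X in intg X]eq_fun do rewrite eG; exact: intgZ iG0.
    have mh : measurable_fun setT (fun x => h (x, u)) by apply: continuous_measurable_rV; exact: tst_slice.
    have [Ch Ch0 hCh] := tst_dlt_bound (x, u) th rg0.
    have G0 y : 0 <= G y.
      by apply: mulr_ge0; [exact: ltW|exact: mulr_ge0 (ind_ge0 _ _) (powR_ge0 _ _)].
    have one y : w (x + y, u) <= h (x + y, u) - h (x, u) + w (x, u) + G y.
      have Gy := G0 y; have hz := h_ge (x + y) u bu'.
      case: (leP (enorm (x + y)) rho0) => y1.
        have := hmax (x + y); rewrite subr0 => /(_ y1).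
        by move: Gy; lr.
      case: (leP (enorm (x + y)) (2 * rho0)) => y2.
        have := wV _ u y2; have := h_out _ u bu' (ltW y1).
        by move: Gy hw; lr.
      have yr : rho0 <= enorm y by have := ler_enormD x y; move: y2 xr; lr.
      have rr4 : 4 <= 4 * rho0 by move: rho2; lr.
      have er4 : 4 * rho0 / 4 = rho0 by field.
      have gf := @growth_far _ _ s C0 g (4 * rho0) x y C00 g0 gs rr4; rewrite er4 in gf.
      have {}gf := gf xr yr.
      have wz := le_trans (ler_norm _) (le_trans (hgr (x + y, u)) gf).
      rewrite /G (indT _ yr) mul1r /c3.
      by move: wz hw hz; lr.
    have bnw y : `|w (y, u)| <= M by exact: bw.
    have gle := @gop_le _ _ _ _ _ pp k (fun x => h (x, u)) (fun x => w (x, u)) x rg Ch M S G kk rg0 Ch0 mh mw bnw hCh iS iG.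
    have {}gle : gop k rg (fun x => h (x, u)) (fun x => w (x, u)) x <= 2^-1 * INT (fun y => S y * k y) + INT (fun y => G y * k y).
      apply: gle => y; have d1 := le_trans (ler_norm _) (dh y); have g1 := G0 y; have g2 := G0 (- y).
      case: (ltP (enorm y) rg) => yrg; first by apply: le_trans d1 _; rewrite lerDl; exact: addr_ge0.
      have o1 := one y; have o2 := one (- y); move: d1; rewrite /dlt.
      by move: o1 o2; lr.
    have eS : INT (fun y => S y * k y) = V * Cst * INT (fun y => tr rho0 y * k y).
      by rewrite -INTZ//; congr INT; apply/funext => y; rewrite /S mulrA.
    have eG' : INT (fun y => G y * k y) = c3 * INT (fun y => ind (rho0 <= enorm y) * enorm y `^ (2 * s - g) * k y).
      by rewrite -(INTZ _ iG0); congr INT; apply/funext => y; rewrite eG.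
    apply: le_lt_trans (lerD (lexx e) gle) _.
    rewrite Dth; apply: le_lt_trans CEe; rewrite lerD2l; apply: lerD.
      rewrite eS; apply: ler_wpM2l => //; apply: ler_wpM2l => //; exact: mulr_ge0 (ltW V0) (ltW Cst0).
    by rewrite eG' (ler_pM2l c30).
  apply: le_trans H _; rewrite hE stf_lo ?mulr0 ?add0r.
    by rewrite /q; have := Eb t (ltW bt) t0; lr.
  rewrite addr0 subr0 /A mulrC ler_pdivrMr//.
  have h2 : enorm en ^+ 2 <= 1 by rewrite expr_le1// enorm_ge0.
  have h3 : 2 ^+ 2 <= rho0 ^+ 2 by rewrite ler_pXn2r ?nnegrE// ltW.
  by rewrite (_ : 2 ^+ 2 = 4) in h3; [move: h2 h3; lr|ring].
have : w (en, 0) <= 2^-1.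
  apply: le_time_closure; first exact: UC_continuous.
  move=> d d0; pose t := Num.max (b / 2) (- (d / 2)).
  have t0 : t < 0 by rewrite gt_max; apply/andP; split; [move: haT; lr|move: d0; lr].
  exists t.
    rewrite t0 andbT (lt_le_trans (y := - (d / 2)))//; first by move: d0; lr.
    by rewrite le_max lexx orbT.
  apply: main => //; apply: (lt_le_trans (y := b / 2)); first by move: haT; lr.
  by rewrite le_max lexx.
by rewrite hw1; lr.
Qed.

End MassLowerBound.

(** * Pairs of solutions at a fixed scale *)

Section Subsolutions.
Context (R : realType) (n : nat) (s lam Lam : R).
Implicit Types (x y p : 'rV[R]_n) (z : 'rV[R]_n * R) (phi w : 'rV[R]_n * R -> R) (k : 'rV[R]_n -> R) (Om : set ('rV[R]_n * R)).

Lemma C21Z (a : R) phi : C21 phi -> C21 (fun z => a * phi z).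
Proof.
move=> [c1 [d1 e1] f1 g1].
have DtZ : Dt (fun z => a * phi z) = (fun z => a * Dt phi z).
  by apply/funext => z; rewrite /Dt !derive1E; have := deriveZ a (d1 z).
have DxZ h : Dx h (fun z => a * phi z) = (fun z => a * Dx h phi z).
  by apply/funext => z; rewrite /Dx; have := deriveZ a ((f1 h).1 z).
have cZ (f : 'rV[R]_n * R -> R) : continuous f -> continuous (fun z => a * f z).
  by move=> cf z; apply: cvgM; [exact: cvg_cst|exact: cf].
split.
- exact: cZ.
- by split; [move=> z; have := derivableZ (k := a) (d1 z)|rewrite DtZ; exact: cZ].
- by move=> h; split; [move=> z; have := derivableZ (k := a) ((f1 h).1 z)|rewrite DxZ; apply: cZ; exact: (f1 h).2].
- move=> h k; rewrite DxZ; split; first by move=> z; have := derivableZ (k := a) ((g1 h k).1 z).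
  rewrite (_ : Dx k _ = (fun z => a * Dx k (Dx h phi) z)); first by apply: cZ; exact: (g1 h k).2.
  by apply/funext => z; rewrite {1}/Dx; have := deriveZ a ((g1 h k).1 z).
Qed.

Lemma Dt_scale (a : R) phi z : C21 phi -> Dt (fun z => a * phi z) z = a * Dt phi z.
Proof. by move=> [_ [d1 _] _ _]; rewrite /Dt !derive1E; have := deriveZ a (d1 z). Qed.

Lemma tstZ (a : R) phi : tst phi -> tst (fun z => a * phi z).
Proof.
move=> [h1 h2]; split; first exact: C21Z.
move=> z; have [r [C [r0 C0 h]]] := h2 z; exists r, (`|a| * C); split => //; first exact: mulr_ge0.
move=> w y cw yr; rewrite (dltZ a (fun x => phi (x, w.2))) normrM -mulrA ler_wpM2l//; exact: h.
Qed.

Lemma gop_scale k (r a : R) (f g : 'rV[R]_n -> R) x :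
  intg (fun y => (if enorm y < r then dlt f x y else dlt g x y) * k y) ->
  gop k r (fun x => a * f x) (fun x => a * g x) x = a * gop k r f g x.
Proof.
move=> ig; rewrite /gop mulrCA -(INTZ a ig); congr (_ * INT _).
by apply/funext => y; rewrite !dltZ; case: ifP => _; rewrite mulrA.
Qed.

Definition ssub k (e : R) Om w := [/\ UC w, exists M, bdd w M & vsub k e Om w].

Lemma ssubD k (c1 c2 : R) Om w1 w2 : par n s lam Lam -> kern s lam Lam k ->
  ssub k c1 Om w1 -> ssub k c2 Om w2 -> ssub k (c1 + c2) Om (fun z => w1 z + w2 z).
Proof.
move=> pp kk [u1 [M1 b1] v1] [u2 [M2 b2] v2]; split; last exact: vsubD pp kk u1 u2 b1 b2 v1 v2.
- move=> e e0; have e2 : 0 < e / 2 by rewrite divr_gt0.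
  have [d1 d10 h1] := u1 _ e2; have [d2 d20 h2] := u2 _ e2.
  exists (Num.min d1 d2); first by rewrite lt_min d10.
  move=> z v; rewrite !lt_min => /andP[a1 a2] /andP[a3 a4].
  have := h1 z v a1 a3; have := h2 z v a2 a4; rewrite !ltr_norml; clrP.
  by move=> /andP[? ?] /andP[? ?]; apply/andP; split; lra.
- by exists (M1 + M2) => z; rewrite (le_trans (ler_normD _ _))// lerD ?b1 ?b2.
Qed.

Lemma ssub_cst k (e a : R) Om w : ssub k e Om w -> ssub k e Om (fun z => w z + a).
Proof.
move=> [uw [M bw] vw]; split.
- move=> d d0; have [d1 d10 h1] := uw d d0; exists d1 => // z v a1 a2.
  by rewrite (_ : _ - _ = w z - w v); [exact: h1|ring].
- by exists (M + `|a|) => z; rewrite (le_trans (ler_normD _ _))// lerD2r bw.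
move=> z r phi r0 cz tp pz h.
have tc : tst (fun v : 'rV[R]_n * R => (fun=> - a) v.2) := tst_time n (C1fun_cst (- a)).
have := vw z r (fun z => phi z + - a) r0 cz (tstD tp tc).
rewrite (tst_DtD z tp tc) (Dt_time _ (C1fun_cst (- a))) addr0 pz addrK => /(_ erefl) H.
apply: le_trans (H _) _; first by move=> v cv; rewrite lerBrDr; exact: h.
rewrite (_ : gop k r _ _ _ = gop k r (fun x => phi (x, z.2)) (fun x => w (x, z.2)) z.1); last first.
  rewrite /gop; congr (_ * INT _); apply/funext => y; congr (_ * _); case: ifP => _ //.
  by rewrite /dlt; ring.
rewrite lerD2l le_eqVlt; apply/orP; left; apply/eqP; rewrite /gop; congr (_ * INT _); apply/funext => y; congr (_ * _).
by case: ifP => _ //; rewrite /dlt; ring.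
Qed.

Lemma ssubZ k (e a : R) Om w : par n s lam Lam -> kern s lam Lam k -> 0 < a -> ssub k e Om w -> ssub k (a * e) Om (fun z => a * w z).
Proof.
move=> pp kk a0 [uw [M bw] vw]; split.
- move=> d d0; have [d1 d10 h1] := uw (d / a) (divr_gt0 d0 a0); exists d1 => // z v a1 a2.
  by rewrite -mulrBr normrM (gtr0_norm a0) mulrC -ltr_pdivlMr//; exact: h1.
- by exists (a * M) => z; rewrite normrM (gtr0_norm a0) ler_pM2l.
move=> z r phi r0 cz tp pz h.
have tp' := tstZ a^-1 tp.
have h1 : a^-1 * phi z = w z by rewrite pz mulKf// gt_eqF.
have h2 v : cylinder r z v -> w v <= a^-1 * phi v.
  by move=> cv; rewrite mulrC ler_pdivlMr// mulrC; exact: h.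
have := vw z r (fun z => a^-1 * phi z) r0 cz tp' h1 h2.
rewrite (Dt_scale _ _ (proj1 tp)) -(ler_pM2l a0) mulVKf ?gt_eqF// => /le_trans; apply.
rewrite mulrDr lerD2l.
have [Ch Ch0 hCh] := tst_dlt_bound z tp' r0.
have ig := @intg_gop _ _ _ _ _ pp k (fun x => a^-1 * phi (x, z.2)) (fun x => w (x, z.2)) z.1 r Ch M kk r0 Ch0
  (continuous_measurable_rV (@tst_slice R n (fun z => a^-1 * phi z) z.2 tp')) (continuous_measurable_rV (@UC_slice R n w z.2 uw)) (fun y => bw _) hCh.
rewrite -(gop_scale a ig) le_eqVlt; apply/orP; left; apply/eqP; congr gop.
by apply/funext => x; rewrite mulVKf ?gt_eqF.
Qed.

(* The last clause encodes that [w] vanishes outside the open set [Om]. *)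
Definition sol k (g C0 Rb T0 e : R) Om w := [/\ ssub k e Om w, ssub k e Om (fun z => - w z),
  (forall z, - e <= w z), (forall z, `|w z| <= C0 * (1 + enorm z.1) `^ (2 * s - g)) &
  forall x t, enorm x < Rb -> - T0 < t -> t < 0 -> w (x, t) != 0 -> exists2 rho, 0 < rho & cylinder rho (x, t) `<=` Om].

(* What is used of the moving cone: the balls of radius [b r] around [x0 + r ev] stay in the domain during a time of order [r^(2s)]. *)
Definition access Om x0 (T : R) (ev : 'rV[R]_n) (b tb r1 : R) := forall r, 0 < r -> r <= r1 ->
  forall x t, enorm (x - (x0 + r *: ev)) < b * r -> T - 4 * (tb * r `^ (2 * s)) < t -> t < T ->
  exists2 rho, 0 < rho & cylinder rho (x, t) `<=` Om.

End Subsolutions.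

Section BaseEstimates.
Context (R : realType) (n : nat) (s lam Lam : R).
Implicit Types (x y p ev en : 'rV[R]_n) (z : 'rV[R]_n * R) (w v : 'rV[R]_n * R -> R) (k : 'rV[R]_n -> R) (Om : set ('rV[R]_n * R)).

(** Coarsest scale: balls of radius [16 * rb] around points of the unit ball stay in the ball of
    radius 2, where the growth bound is a constant. *)
Definition rb : R := 64^-1.

Lemma rbE : rb = 64^-1. Proof. by []. Qed.

Lemma rb_gt0 : 0 < rb. Proof. by rewrite invr_gt0. Qed.

(** The conclusion of [local_min] for a chosen width and duration, so that later statements can take
    it as a hypothesis on the constants [c], [b] and [kap]. *)
Definition lmin (c b kap : R) := forall k Om w M e e1 x0 p (r ta tb : R) mu, kern s lam Lam k -> UC w -> bdd w M -> 0 <= e -> 0 <= e1 -> 0 < r ->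
  vsub k e Om (fun z => - w z) -> C1fun mu (Mt s w r x0) -> enorm (p - x0) <= 2 * r -> tb - ta <= kap * r `^ (2 * s) ->
  (forall x t, enorm (x - x0) < 16 * r -> ta <= t -> t < tb -> 0 <= w (x, t)) ->
  (forall x t, enorm (x - p) < b * r -> ta < t -> t < tb ->
    INT (fun y => ind (8 * r <= enorm y) * Num.max 0 (- w (x + y, t)) * k y) <= e1) ->
  (forall x t, enorm (x - p) < b * r -> ta < t -> t < tb -> exists2 rho, 0 < rho & cylinder rho (x, t) `<=` Om) ->
  forall x t, enorm (x - p) <= b * r / 2 -> ta <= t -> t < tb ->
  c * (mu t - mu ta) - (e + e1) * (t - ta) <= w (x, t).

Lemma tail_growth (g C0 r : R) : par n s lam Lam -> 0 < r -> 0 < g -> g < 2 * s -> 0 < C0 -> exists2 Ct, 0 < Ct &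
  forall k, kern s lam Lam k -> forall x, enorm x <= 2 ->
  intg (fun y => ind (r <= enorm y) * (C0 * (1 + enorm (x + y)) `^ (2 * s - g)) * k y) /\
  INT (fun y => ind (r <= enorm y) * (C0 * (1 + enorm (x + y)) `^ (2 * s - g)) * k y) <= Ct.
Proof.
move=> pp r0 g0 gs C00; have [hn s0 s1 lam0 Lam0] := pp.
have [Cg Cg0 hCg] := kern_far_growth pp g0.
have gs0 : 0 <= 2 * s - g by move: gs; lr.
(* For [|x| <= 2] and [|y| >= r], [1 + |x + y|] is at most [3 + |y|], hence at most
   [(1 + 3 / r) * |y|]. *)
pose c3 : R := C0 * (1 + 3 / r) `^ (2 * s - g).
have c30 : 0 < c3 by rewrite mulr_gt0// powR_gt0// addr_gt0// divr_gt0.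
exists (c3 * (Cg * r `^ (- g))); first by rewrite mulr_gt0// mulr_gt0// powR_gt0.
move=> k kk x x2; have [iG IG] := hCg k kk _ r0.
have kG := intgZ c3 iG.
have le y : ind (r <= enorm y) * (C0 * (1 + enorm (x + y)) `^ (2 * s - g)) * k y <=
    c3 * (ind (r <= enorm y) * enorm y `^ (2 * s - g) * k y).
  rewrite [leRHS](_ : _ = ind (r <= enorm y) * (c3 * enorm y `^ (2 * s - g)) * k y); last by ring.
  apply: ler_wpM2r; first exact: (kern_ge0 pp y kk).
  case: (leP r (enorm y)) => yr; rewrite /ind/= ?mul0r// !mul1r.
  rewrite /c3 -mulrA (ler_pM2l C00) -powRM ?enorm_ge0 ?addr_ge0 ?divr_ge0 ?(ltW r0)//.
  apply: (ge0_ler_powR gs0); rewrite ?nnegrE ?addr_ge0 ?enorm_ge0 ?mulr_ge0 ?enorm_ge0 ?addr_ge0 ?divr_ge0 ?(ltW r0)//.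
  have h3 : 3 <= 3 / r * enorm y by rewrite mulrAC ler_pdivlMr// ler_pM2l.
  by have := ler_enormD x y; move: x2 h3; lr.
have mf : measurable_fun setT (fun y => ind (r <= enorm y) * (C0 * (1 + enorm (x + y)) `^ (2 * s - g)) * k y).
  apply: measurable_funM; last by have [mk _ _] := kk.
  apply: measurable_funM; first exact: meas_ind_far.
  apply: measurable_funM; first exact: measurable_cst.
  have m1 : measurable_fun setT (fun y : 'rV[R]_n => 1 + enorm (x + y)).
    by apply: measurable_funD; [exact: measurable_cst|exact: (meas_shift (f := @enorm R n) x (@meas_enorm R n))].
  exact: (@measurableT_comp _ _ _ _ _ _ (@powR R ^~ (2 * s - g)) _ (fun y => 1 + enorm (x + y)) (measurable_powR _) m1).
have ge0 y : 0 <= ind (r <= enorm y) * (C0 * (1 + enorm (x + y)) `^ (2 * s - g)) * k y.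
  apply: mulr_ge0; last exact: (kern_ge0 pp y kk).
  by apply: mulr_ge0; [exact: ind_ge0|apply: mulr_ge0; [exact: ltW|exact: powR_ge0]].
have iF := intg_le mf (fun y => _ : `|_| <= _) kG.
have {}iF := iF (fun y => eq_rect_r (fun q => q <= _) (le y) (ger0_norm (ge0 y))).
split; first exact: iF.
apply: le_trans (INT_le iF kG le) _.
by rewrite (INTZ c3 iG) (ler_pM2l c30).
Qed.

Lemma intg_tail k w (M r : R) x (t : R) : par n s lam Lam -> kern s lam Lam k -> UC w -> bdd w M -> 0 < r ->
  intg (fun y => ind (r <= enorm y) * Num.max 0 (- w (x + y, t)) * k y).
Proof.
move=> pp kk uw bw r0; apply: (intg_far_le pp kk r0 _ (C := M)).
  apply: measurable_maxr; first exact: measurable_cst.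
  apply: (meas_shift (f := fun y => - w (y, t))); apply: measurable_funN.
  by apply: continuous_measurable_rV; exact: UC_slice.
by move=> y; rewrite (le_trans (pos_le_norm _))// normrN; exact: bw.
Qed.

Lemma Mt_mono w1 w2 (M1 M2 r : R) x (t : R) : par n s lam Lam -> UC w1 -> UC w2 -> bdd w1 M1 -> bdd w2 M2 -> 0 < r ->
  (forall z, w1 z <= w2 z) -> Mt s w1 r x t <= Mt s w2 r x t.
Proof.
move=> pp u1 u2 b1 b2 r0 h; apply: (INT_le (intg_Mt x t pp u1 b1 r0) (intg_Mt x t pp u2 b2 r0)) => y.
apply: ler_wpM2r; first exact: wgt_ge0.
by apply: max0_le; [exact: max0_ge0|rewrite le_max h orbT].
Qed.

Lemma rb_pow_le1 : 0 < s -> rb `^ (2 * s) <= 1.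
Proof.
move=> s0; have e1 : 1 `^ (2 * s) = 1 :> R by rewrite powR1.
rewrite -[leRHS]e1; apply: ge0_ler_powR; rewrite ?nnegrE ?mulr_ge0 ?(ltW s0) ?(ltW rb_gt0)//.
by rewrite invf_le1// ler1n.
Qed.

(** At the coarsest scale the normalisation provides mass on every time window of length [tau],
    [local_min] converts it into a lower bound on the ball inside the cone, and [positivity] turns
    that into a sign on a ball that may meet the complement of the domain. *)
Lemma base_lower (g C0 b c kap taub t1 : R) : par n s lam Lam -> 2^-1 <= s -> 0 < g -> g < 2 * s -> 0 < C0 ->
  0 < b -> b <= 1 -> 0 < c -> lmin c b kap -> 0 < taub -> 4 * taub <= kap -> 8 * taub <= t1 -> exists c0 eJ R1, [/\ 0 < c0, 0 < eJ, 2 <= R1 &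
  forall k Om (e T Rb : R) v x0 ev en, kern s lam Lam k -> sol s k g C0 Rb (7 / 4 * t1) e Om v -> R1 <= Rb -> 0 <= e -> e <= eJ ->
  enorm x0 < 1 -> - t1 < T -> T < 0 -> enorm ev = 1 -> access s Om x0 T ev b taub rb -> enorm en <= 1 -> v (en, 0) = 1 ->
  (forall x t, enorm (x - (x0 + rb *: ev)) < b / 2 * rb -> T - 2 * (taub * rb `^ (2 * s)) <= t -> t < T -> c0 <= v (x, t)) /\
  (forall x t, enorm (x - x0) <= 4 * rb -> T - taub * rb `^ (2 * s) <= t -> t < T -> 0 <= v (x, t))].
Proof.
move=> pp s2 g0 gs C00 b0 b1 c_gt0 HL taub0 tkap tt1; have [hn s0 s1 lam0 Lam0] := pp.
have [Cm [cf [Cm0 cf0 kbd]]] := kern_bounds pp.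
have rs0 := rs_gt0 s rb_gt0; set rs := rb `^ (2 * s) in rs0 *.
have rs1 : rs <= 1 := rb_pow_le1 s0.
pose tau := taub * rs.
have tau0 : 0 < tau by rewrite mulr_gt0.
have taut : tau <= taub by rewrite ler_piMr// ltW.
have Tm0 : 0 < 7 / 4 * t1 by move: taub0 tt1; lr.
have [m0 [R1 [eN [m00 R10 eN0 hmass]]]] := mass_ge pp s2 g0 gs C00 tau0 Tm0.
have b20 : 0 < b / 2 by rewrite divr_gt0.
have b21 : b / 2 <= 1 by move: b0 b1; lr.
have [CP [cP [CP0 cP0 hP]]] := positivity pp taub0 b20 b21.
pose c0 := c * m0 / 2; have c00 : 0 < c0 by rewrite divr_gt0// mulr_gt0.
pose D := CP + rs + rs * (Cm / (8 * rb) `^ (2 * s)) + 1.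
have r80 : 0 < 8 * rb by rewrite mulr_gt0 ?rb_gt0.
have r8s : 0 < (8 * rb) `^ (2 * s) by exact: powR_gt0.
have D0 : 0 < D by rewrite /D; apply: addr_gt0 => //; apply: addr_gt0; [exact: addr_gt0|apply: mulr_gt0 => //; exact: divr_gt0].
have t20 : 0 < tau + 1 by apply: addr_gt0.
exists c0, (Num.min eN (Num.min (c0 / (tau + 1)) (cP * c0 / (2 * D)))), (Num.max 2 R1); split => //.
- by rewrite !lt_min eN0 !divr_gt0 ?mulr_gt0.
- by rewrite le_max lexx.
move=> k Om e T Rb v x0 ev en kk [sv snv vlo vgr vint]; have [uv [M bv] vv] := sv; have [_ _ vnv] := snv; rewrite ge_max => /andP[R1b R2b] e0.
rewrite !le_min => /and3P[eN1 eN2 eN3] hx0 T1 T0 hev hacc hen hv1.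
have pev : x0 + rb *: ev - x0 = rb *: ev by rewrite addrC addKr.
have npev : enorm (x0 + rb *: ev - x0) <= 2 * rb.
  by rewrite pev enormZ hev mulr1 ger0_norm ?(ltW rb_gt0)//; have := rb_gt0; lr.
have rb1 : rb <= 1 by rewrite invf_le1// ler1n.
have int16 x t : enorm (x - x0) < 8 * rb -> - (7 / 4 * t1) < t -> t < 0 -> v (x, t) != 0 -> exists2 rho, 0 < rho & cylinder rho (x, t) `<=` Om.
  move=> xr; apply: vint; apply: lt_le_trans R1b.
  have := ler_enormD (x - x0) x0; rewrite subrK.
  by move: xr hx0; rewrite /rb; lr.
have part1 x t : enorm (x - (x0 + rb *: ev)) < b / 2 * rb -> T - 2 * tau <= t -> t < T -> c0 <= v (x, t).
  move=> xr tT tT'.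
  have [mu hmu] := primitive (continuous_Mt (x := x0) pp uv bv rb_gt0).
  (* [v + e] is nonnegative everywhere, so the bump argument has no tail to control; its mass
     dominates that of [v]. *)
  have ssw := ssub_cst e sv.
  have ssn : ssub k e Om (fun z => - (v z + e)).
    by rewrite (_ : (fun z => _) = (fun z => - v z + - e)); [exact: ssub_cst snv|apply/funext => z; rewrite opprD].
  have [uw [M' bw] _] := ssw; have [_ _ vnw] := ssn.
  have [nu hnu] := primitive (continuous_Mt (x := x0) pp uw bw rb_gt0).
  have tta : - (7 / 4 * t1) <= t - tau by move: tT T1 taut tt1 taub0; lr.
  have := hmass k Om v M e x0 en rb (t - tau) mu kk uv bv e0 eN1 vv vgr rb_gt0 rb1 (ltW hx0) hen hmu tta.
  rewrite subrK => /(_ (lt_trans tT' T0) _ hv1) Hm.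
  have {}Hm : m0 <= mu t - mu (t - tau).
    apply: Hm => y u yR tu u0 vy; apply: vint => //; [exact: lt_le_trans R2b|exact: le_lt_trans tu|by rewrite gt_eqF].
  have Hn : mu t - mu (t - tau) <= 1 * (nu t - nu (t - tau)).
    apply: (C1fun_diff_le hmu hnu) => [u|]; last by rewrite gerBl ltW.
    by rewrite mul1r; apply: (Mt_mono x0 u pp uv uw bv bw rb_gt0) => z; rewrite lerDl.
  have := HL k Om (fun z => v z + e) M' e 0 x0 (x0 + rb *: ev) rb (t - tau) T nu kk uw bw e0 (lexx _) rb_gt0 vnw hnu npev.
  have hw : T - (t - tau) <= kap * rb `^ (2 * s).
    apply: (@le_trans _ _ (3 * tau)); first by move: tT; lr.
    rewrite /tau mulrA ler_pM2r//; by move: tkap taub0; lr.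
  have pos0 y u : 0 <= v (y, u) + e by have := vlo (y, u); lr.
  move=> /(_ hw (fun y u _ _ _ => pos0 y u)) H1.
  have {}H1 := H1 _ _ x t.
  have : c * (nu t - nu (t - tau)) - (e + 0) * (t - (t - tau)) <= v (x, t) + e.
    apply: H1 => //.
    - move=> y u _ _ _; rewrite (_ : (fun y0 => _) = (fun=> 0)) ?INT0//.
      by apply/funext => y0; rewrite max_l ?mulr0 ?mul0r// oppr_le0.
    - move=> y u yr ut uT; apply: (hacc rb rb_gt0 (lexx _)) => //.
      by move: ut tT tau0; rewrite -/rs -/tau; lr.
    - by apply: ltW; apply: lt_le_trans xr _; rewrite le_eqVlt; apply/orP; left; apply/eqP; ring.
    - by rewrite gerBl ltW.
  have h2 : e * (tau + 1) <= c0 by rewrite -ler_pdivlMr.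
  have h3 : c * m0 <= c * (nu t - nu (t - tau)).
    by rewrite (ler_pM2l c_gt0); move: Hm Hn; lr.
  rewrite addr0 subKr /c0; move: h2 h3; rewrite /c0; lr.
split; first exact: part1.
move=> x t xr tT tT'.
pose e1 := e * (Cm / (8 * rb) `^ (2 * s)).
have e10 : 0 <= e1 by apply: mulr_ge0 => //; apply: divr_ge0; exact: ltW.
have := hP k Om v M e e1 x0 (x0 + rb *: ev) rb (T - 2 * tau) T e c0 kk uv bv e0 e10 rb_gt0 vnv npev e0 c00.
move=> /(_ (fun y u _ _ _ => vlo (y, u)) part1 _ _ _ x t xr) H.
apply: H => //; rewrite -/rs -/tau.
- move=> y u yr uT uT'.
  have [_ _ iF IF _] := kbd k kk _ r80.
  apply: le_trans (_ : INT (fun y0 => e * (ind (8 * rb <= enorm y0) * k y0)) <= _).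
    apply: (INT_le (intg_tail y u pp kk uv bv r80) (intgZ e iF)) => y0.
    rewrite mulrA; apply: ler_wpM2r; first exact: (kern_ge0 pp y0 kk).
    rewrite mulrC; apply: ler_wpM2r; first exact: ind_ge0.
    by apply: max0_le => //; rewrite lerNl; exact: vlo.
  by rewrite (INTZ e iF); apply: ler_wpM2l.
- move=> y u yr uT uT' vy; apply: int16 => //.
  + by move: uT T1 taut tt1 taub0; lr.
  + exact: lt_trans uT' T0.
  + by rewrite lt_eqF.
- have h : e * (2 * D) <= cP * c0 by rewrite -ler_pdivlMr// mulr_gt0.
  have h2 : 0 < cP * c0 by exact: mulr_gt0.
  apply: (@le_lt_trans _ _ (e * D)); last by move: h h2; lr.
  have h3 : 0 <= e by [].
  by rewrite /D /e1; move: h3; lr.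
by move: tT; rewrite -/tau; lr.
Qed.

End BaseEstimates.

(** * Comparability of the two solutions at the coarsest scale *)

Section BaseComparison.
Context (R : realType) (n : nat) (s lam Lam : R).
Implicit Types (x y p ev en : 'rV[R]_n) (z : 'rV[R]_n * R) (w v : 'rV[R]_n * R -> R) (k : 'rV[R]_n -> R) (Om : set ('rV[R]_n * R)).
Local Notation rb := (@rb R).

Lemma ssub_comb k (e1 e2 a1 a2 : R) Om v1 v2 : par n s lam Lam -> kern s lam Lam k -> 0 < a1 -> 0 < a2 ->
  ssub k e1 Om v1 -> ssub k e2 Om (fun z => - v2 z) -> ssub k (a1 * e1 + a2 * e2) Om (fun z => a1 * v1 z - a2 * v2 z).
Proof.
move=> pp kk a10 a20 s1 s2.
rewrite (_ : (fun z => _) = (fun z => a1 * v1 z + a2 * - v2 z)); last by apply/funext => z; rewrite mulrN.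
by apply: ssubD pp kk (ssubZ pp kk a10 s1) (ssubZ pp kk a20 s2).
Qed.

Lemma ssub_combN k (e1 e2 a1 a2 : R) Om v1 v2 : par n s lam Lam -> kern s lam Lam k -> 0 < a1 -> 0 < a2 ->
  ssub k e1 Om (fun z => - v1 z) -> ssub k e2 Om v2 -> ssub k (a1 * e1 + a2 * e2) Om (fun z => - (a1 * v1 z - a2 * v2 z)).
Proof.
move=> pp kk a10 a20 s1 s2.
rewrite (_ : (fun z => _) = (fun z => a1 * - v1 z + a2 * v2 z)); last by apply/funext => z; rewrite opprB mulrN addrC.
by apply: ssubD pp kk (ssubZ pp kk a10 s1) (ssubZ pp kk a20 s2).
Qed.

(** [positivity] applied to [C4 * v2 - v1]. On the ball in the cone it is at least [C4 * c0 - G],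
    with [G] a bound for [v1] near the unit ball; its negative part and tail are bounded
    independently of [C4] as long as [C4 * e <= 1]. Hence a large [C4] and the threshold [C4^-1] for
    the error. *)
Lemma base_comparable (g C0 b taub t1 c0 : R) : par n s lam Lam -> 0 < g -> g < 2 * s -> 0 < C0 ->
  0 < b -> b <= 1 -> 0 < taub -> 8 * taub <= t1 -> 0 < c0 -> exists C4 eJ, [/\ 1 <= C4, 0 < eJ &
  forall k Om (e T Rb : R) v1 v2 x0 ev, kern s lam Lam k -> sol s k g C0 Rb (7 / 4 * t1) e Om v1 -> sol s k g C0 Rb (7 / 4 * t1) e Om v2 ->
  2 <= Rb -> 0 <= e -> e <= eJ -> enorm x0 < 1 -> - t1 < T -> T < 0 -> enorm ev = 1 ->
  (forall x t, enorm (x - (x0 + rb *: ev)) < b / 2 * rb -> T - 2 * (taub * rb `^ (2 * s)) <= t -> t < T -> c0 <= v2 (x, t)) ->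
  forall x t, enorm (x - x0) <= 4 * rb -> T - taub * rb `^ (2 * s) <= t -> t < T -> v1 (x, t) <= C4 * v2 (x, t)].
Proof.
move=> pp g0 gs C00 b0 b1 taub0 tt1 c00; have [hn s0 s1 lam0 Lam0] := pp.
have [Cm [cf [Cm0 cf0 kbd]]] := kern_bounds pp.
have rb0 := rb_gt0 R.
have rs0 := rs_gt0 s rb0; have rs1 := rb_pow_le1 s0; set rs := rb `^ (2 * s) in rs0 rs1 *.
pose tau := taub * rs.
have tau0 : 0 < tau by rewrite mulr_gt0.
have taut : tau <= taub by rewrite ler_piMr// ltW.
have b20 : 0 < b / 2 by rewrite divr_gt0.
have b21 : b / 2 <= 1 by move: b0 b1; lr.
have [CP [cP [CP0 cP0 hP]]] := positivity pp taub0 b20 b21.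
have [Ct Ct0 hCt] := tail_growth pp rb0 g0 gs C00.
have r80 : 0 < 8 * rb by rewrite mulr_gt0.
have r8s : 0 < (8 * rb) `^ (2 * s) by exact: powR_gt0.
pose Cr := Cm / (8 * rb) `^ (2 * s).
have Cr0 : 0 < Cr by exact: divr_gt0.
have gs0 : 0 <= 2 * s - g by move: gs; lr.
pose G : R := C0 * 3 `^ (2 * s - g).
have G0 : 0 < G by rewrite mulr_gt0// powR_gt0.
(* Everything that [cP * V] has to exceed in [positivity], under [C4 * e <= 1]; it does not involve
   [C4]. *)
pose N := CP * (G + 1) + rs * (2 + (Cr + Ct)) + 1.
have N0 : 0 < N by rewrite /N; apply: addr_gt0 => //; apply: addr_gt0; apply: mulr_gt0 => //; rewrite ?addr_gt0.
pose C4 := 1 + (G + N / cP) / c0.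
have C41 : 1 <= C4 by rewrite lerDl divr_ge0 ?(ltW c00)// addr_ge0 ?(ltW G0)// divr_ge0 ?(ltW N0) ?(ltW cP0).
have C40 : 0 < C4 by move: C41; lr.
pose V := C4 * c0 - G.
have VN : N <= cP * V.
  rewrite /V /C4 (_ : (1 + _) * c0 - G = c0 + N / cP); last by field; rewrite !gt_eqF.
  rewrite mulrDr mulrC mulrCA divff ?gt_eqF// mulr1 lerDr mulr_ge0 ?(ltW c00) ?(ltW cP0)//.
have V0 : 0 < V by rewrite -(pmulr_rgt0 _ cP0) (lt_le_trans N0).
exists C4, C4^-1; split; rewrite ?invr_gt0//.
move=> k Om e T Rb v1 v2 x0 ev kk sl1 sl2 Rb2 e0 eC hx0 T1 T0 hev low x t xr tT tT'.
have [sv1 snv1 lo1 gr1 int1] := sl1; have [sv2 snv2 lo2 gr2 int2] := sl2.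
have C4e : C4 * e <= 1 by rewrite mulrC -ler_pdivlMr// div1r.
have e1 : e <= 1 by apply: le_trans C4e; rewrite ler_peMl.
pose w z := C4 * v2 z - 1 * v1 z.
have [uw [M bw] _] : ssub k (C4 * e + 1 * e) Om w := ssub_comb pp kk C40 ltr01 sv2 snv1.
have [_ _ vnw] : ssub k (C4 * e + 1 * e) Om (fun z => - w z) := ssub_combN pp kk C40 ltr01 snv2 sv1.
pose a := G + C4 * e.
have a0 : 0 <= a by rewrite addr_ge0 ?(ltW G0)// mulr_ge0// ltW.
have ee0 : 0 <= C4 * e + 1 * e by rewrite mul1r addr_ge0// mulr_ge0// ltW.
pose e1' := C4 * e * Cr + Ct.
have e1'0 : 0 <= e1' by rewrite addr_ge0 ?(ltW Ct0)// mulr_ge0 ?(ltW Cr0)// mulr_ge0// ltW.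
have pev : x0 + rb *: ev - x0 = rb *: ev by rewrite addrC addKr.
have npev : enorm (x0 + rb *: ev - x0) <= 2 * rb.
  by rewrite pev enormZ hev mulr1 ger0_norm ?(ltW rb0)//; move: rb0; lr.
have v1G y u : enorm y <= 2 -> v1 (y, u) <= G.
  move=> y2; apply: le_trans (ler_norm _) (le_trans (gr1 (y, u)) _).
  rewrite /G (ler_pM2l C00); apply: (ge0_ler_powR gs0); rewrite ?nnegrE ?addr_ge0 ?enorm_ge0//=.
  by move: y2; lr.
have near y (q : R) : enorm (y - x0) <= q -> q <= 1 -> enorm y <= 2.
  by move=> yq q1; have := ler_enormD (y - x0) x0; rewrite subrK; move: yq q1 hx0; lr.
have C4v2 y u : - (C4 * e) <= C4 * v2 (y, u).
  by rewrite -mulrN (ler_pM2l C40); exact: lo2.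
have := hP k Om w M (C4 * e + 1 * e) e1' x0 (x0 + rb *: ev) rb (T - 2 * tau) T a V kk uw bw ee0 e1'0 rb0 vnw npev a0 V0.
move=> H; suff : 0 <= w (x, t) by rewrite /w mul1r subr_ge0.
apply: (H _ _ _ _ _ x t xr) => //.
- move=> y u yr _ _; have y2 : enorm y <= 2 by apply: (near y _ (ltW yr)); rewrite /rb; lr.
  by rewrite /w mul1r /a; move: (v1G y u y2) (C4v2 y u); lr.
- move=> y u yr uT uT'; have := low y u yr uT uT'; rewrite -(ler_pM2l C40) => h.
  have y2 : enorm y <= 2.
    apply: (near y (3 * rb)); last by rewrite /rb; lr.
    have := ler_enormD (y - (x0 + rb *: ev)) (x0 + rb *: ev - x0).
    rewrite (_ : y - _ + _ = y - x0); last by vec.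
    have : b / 2 * rb <= 1 * rb by rewrite ler_pM2r.
    by move: npev yr; lr.
  by rewrite /w mul1r /V; move: (v1G y u y2) h; lr.
- move=> y u yr uT uT'.
  have y2 : enorm y <= 2 by apply: (near y _ (ltW yr)); rewrite /rb; lr.
  have [_ _ iF IF _] := kbd k kk _ r80.
  have [iT IT] := hCt k kk y y2.
  have ce0 : 0 <= C4 * e by rewrite mulr_ge0// ltW.
  apply: le_trans (_ : INT (fun q => C4 * e * (ind (8 * rb <= enorm q) * k q) + ind (rb <= enorm q) * (C0 * (1 + enorm (y + q)) `^ (2 * s - g)) * k q) <= _).
    apply: (INT_le (intg_tail y u pp kk uw bw r80) (intgD (intgZ (C4 * e) iF) iT)) => q.
    rewrite mulrA -mulrDl; apply: ler_wpM2r; first exact: (kern_ge0 pp q kk).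
    have p0 : 0 <= C0 * (1 + enorm (y + q)) `^ (2 * s - g) by apply: mulr_ge0; [exact: ltW|exact: powR_ge0].
    case: (leP (8 * rb) (enorm q)) => qr; last first.
      by rewrite [ind false]/ind/= mul0r mulr0 add0r; exact: mulr_ge0 (ind_ge0 _ _) p0.
    rewrite (indT _ (_ : rb <= enorm q)); last by move: qr rb0; lr.
    rewrite /ind/= mul1r mulr1 mul1r; apply: max0_le; first exact: addr_ge0.
    have := le_trans (ler_norm _) (gr1 (y + q, u)); have := C4v2 (y + q) u.
    by rewrite /w mul1r /=; lr.
  rewrite (INTD (intgZ (C4 * e) iF) iT) (INTZ _ iF); apply: lerD => //.
  exact: ler_wpM2l.
- move=> y u yr uT uT' wy.
  have yR : enorm y < Rb.
    apply: lt_le_trans Rb2; have := ler_enormD (y - x0) x0; rewrite subrK.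
    by move: yr hx0; rewrite /rb; lr.
  have uT1 : - (7 / 4 * t1) < u by move: uT T1 taut tt1 taub0; lr.
  have u0 := lt_trans uT' T0.
  case: (eqVneq (v2 (y, u)) 0) => v20; last exact: int2.
  apply: int1 => //; apply/eqP => v10; move: wy; rewrite /w v10 v20 !mulr0 subr0 ltxx//.
- rewrite -/rs /a /e1'; apply: lt_le_trans VN; rewrite /N.
  have h1 : CP * (G + C4 * e) <= CP * (G + 1) by rewrite (ler_pM2l CP0) lerD2l.
  have h2 : rs * (C4 * e + 1 * e + (C4 * e * Cr + Ct)) <= rs * (2 + (Cr + Ct)).
    rewrite (ler_pM2l rs0).
    have h3 : C4 * e * Cr <= 1 * Cr by rewrite ler_pM2r.
    by move: h3 C4e e1; lr.
  by move: h1 h2; lr.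
by move: tT; rewrite -/rs -/tau; lr.
Qed.

End BaseComparison.

(** * Decay along the dyadic scales *)

Section ChainDecay.
Context (R : realType).

Lemma mvt_itv (f df : R -> R) (a b : R) : C1fun f df -> a <= b -> exists2 c, a <= c <= b & f b - f a = df c * (b - a).
Proof.
move=> hf ab; have [c|c hc e] := @MVT_segment R f df a b ab (fun c _ => (proj1 hf) c).
  by apply: continuous_subspaceT; exact: C1fun_continuous hf.
by exists c => //; move: hc; rewrite in_itv.
Qed.

Lemma gronwall (f df : R -> R) (L a b : R) : C1fun f df -> a <= b -> (forall t, a <= t -> t <= b -> df t <= L * f t) ->
  f b <= expR (L * (b - a)) * f a.
Proof.
move=> hf ab h.
have he : C1fun (@expR R) (@expR R) by split; [move=> t; exact: is_derive_expR|exact: continuous_expR].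
have hg := C1funM hf (C1fun_comp he (C1fun_affine (- L) 0)).
have [c /andP[c1 c2] /= e] := mvt_itv hg ab.
have d0 : df c * expR (- L * c + 0) + f c * (expR (- L * c + 0) * - L) <= 0.
  have := h c c1 c2; rewrite -(ler_pM2r (expR_gt0 (- L * c + 0))).
  by move: (expR _) => q; lr.
have e0 : f b * expR (- L * b + 0) <= f a * expR (- L * a + 0).
  by rewrite -subr_le0 e; apply: mulr_le0_ge0 => //; rewrite subr_ge0.
have eb : expR (- L * b + 0) * expR (L * b) = 1 by rewrite -expRD addr0 mulNr addNr expR0.
rewrite -[leLHS]mulr1 -eb mulrA.
apply: (@le_trans _ _ (f a * expR (- L * a + 0) * expR (L * b))); first by rewrite ler_wpM2r// expR_ge0.
by rewrite -mulrA -expRD mulrC le_eqVlt; apply/orP; left; apply/eqP; congr (expR _ * _); ring.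
Qed.

(** When [mu] is a primitive of the mass, this is the mean of the mass over the window of length
    [tau] that ends at [t]. *)
Definition avg (mu : R -> R) (tau t : R) : R := (mu t - mu (t - tau)) / tau.

Lemma C1fun_avg (mu Phi : R -> R) (tau : R) : C1fun mu Phi -> C1fun (avg mu tau) (fun t => (Phi t - Phi (t - tau)) / tau).
Proof.
move=> hm; have h2 := C1fun_comp hm (C1fun_affine 1 (- tau)).
have h3 := C1funM (C1fun_cst tau^-1) (C1funD hm (C1funM (C1fun_cst (-1)) h2)).
by apply: (eq_C1fun h3) => t /=; rewrite /avg !mul1r; ring.
Qed.

Lemma avg_mvt (mu Phi : R -> R) (tau t : R) : C1fun mu Phi -> 0 < tau -> exists2 c, t - tau <= c <= t & avg mu tau t = Phi c.
Proof.
move=> hm tau0; have tt : t - tau <= t by rewrite gerBl ltW.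
by have [c hc e] := mvt_itv hm tt; exists c => //; rewrite /avg e subKr mulfK// gt_eqF.
Qed.

Lemma C1fun_sum (f df : nat -> R -> R) (k : nat) : (forall j, C1fun (f j) (df j)) ->
  C1fun (fun t => \sum_(j < k) f j t) (fun t => \sum_(j < k) df j t).
Proof.
move=> h; elim: k => [|k IH].
  by apply: (eq_C1fun (C1fun_cst 0)) => t; rewrite big_ord0.
by apply: (eq_C1fun (C1funD IH (h k))) => t; rewrite big_ord_recr.
Qed.

Lemma sum_inv_geo (tau : nat -> R) (k : nat) : (forall j, 0 < tau j) -> (forall j, 8 * tau j.+1 <= tau j) ->
  \sum_(j < k.+1) (tau j)^-1 <= 2 / tau k.
Proof.
move=> t0 t8; elim: k => [|k IH].
  rewrite big_ord_recr big_ord0 /= add0r.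
  by have : 0 < (tau 0%N)^-1; [rewrite invr_gt0|lr].
rewrite big_ord_recr /=; apply: (@le_trans _ _ (2 / tau k + (tau k.+1)^-1)); first by rewrite lerD2r.
have h : (tau k)^-1 <= (8 * tau k.+1)^-1 by rewrite lef_pV2 ?posrE ?mulr_gt0.
have i0 : 0 < (tau k.+1)^-1 by rewrite invr_gt0.
by move: h i0; rewrite invfM; lr.
Qed.

(** [Phi k] stands for the mass at scale [k], [a k] for its mean over [tau k], [B k] for the sum of
    the means up to scale [k]. The bound [Phi <= C1 * B] gives [B k] a logarithmic growth rate of
    order [1 / tau k], so by Gronwall its growth over that time is a bounded factor. Summing the
    gains [c2 * a] over the scales gives [c2 * B k <= Phi k]; averaging in time, [a k], which is
    [B k] minus the previous sum, is a fixed fraction of [B k]. This is the strict decay from fine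
    to coarse scales. *)
Lemma chain_decay (C1 c2 c00 : R) : 0 < C1 -> 0 < c2 -> 0 < c00 -> exists CG q c4, [/\ 0 < CG, 0 < q, q < 1, 0 < c4 &
  forall (mu Phi : nat -> R -> R) (tau : nat -> R) (T ts : R), (forall j, C1fun (mu j) (Phi j)) -> (forall j t, 0 <= Phi j t) ->
  (forall j, 0 < tau j) -> (forall j, 8 * tau j.+1 <= tau j) -> 4 * tau 0%N <= ts ->
  let a j t := avg (mu j) (tau j) t in let B k t := \sum_(j < k.+1) a j t in
  (forall k t, T - ts <= t -> t < T -> Phi k t <= C1 * B k t) ->
  (forall t, T - 2 * tau 0%N <= t -> t < T -> c2 * a 0%N t <= Phi 0%N t) ->
  (forall k t, T - 2 * tau k.+1 <= t -> t < T -> Phi k t + c2 * a k.+1 t <= Phi k.+1 t) ->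
  (forall k t, T - ts <= t -> t < T -> c00 <= Phi k t) ->
  [/\ forall k u t, T - 2 * tau k <= u -> u <= t -> t < T -> B k t <= CG * B k u,
    forall k j t, (j <= k)%N -> T - tau k <= t -> t < T -> a j t <= q ^+ (k - j) * B k t,
    forall k, c00 <= q ^+ k * B k (T - tau k / 2) &
    forall k, c4 * B k (T - tau k / 2) <= a k (T - 3 / 8 * tau k)]].
Proof.
move=> C10 c20 c000.
pose CG : R := expR (4 * C1); have CG0 : 0 < CG by exact: expR_gt0.
(* The bound by 1/2 keeps the ratio [1 - c3] positive. *)
pose c3 := Num.min (c2 / CG) 2^-1.
have c30 : 0 < c3 by rewrite lt_min invr_gt0 ltr0n andbT divr_gt0.
have c3h : c3 <= 2^-1 by rewrite ge_min lexx orbT.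
have c32 : c3 <= c2 / CG by rewrite ge_min lexx.
exists CG, (1 - c3), (7 / 8 * (c2 / CG)); split => //.
- by move: c3h; lr.
- by move: c30; lr.
- by rewrite mulr_gt0// divr_gt0.
move=> mu Phi tau T ts hmu Phi0 tau0 tau8 tts a B H1 H20 H2 H3.
have tauS j : tau j.+1 <= tau j by have := tau8 j; have := tau0 j.+1; lr.
have taum j k : (j <= k)%N -> tau k <= tau j.
  elim: k => [|k IH]; first by rewrite leqn0 => /eqP ->.
  by rewrite leq_eqVlt => /orP[/eqP -> //|]; rewrite ltnS => /IH; exact: le_trans (tauS k).
have tau0k k : 4 * tau k <= ts by apply: le_trans tts; rewrite ler_pM2l// taum.
have a0 j t : 0 <= a j t.
  by rewrite /a; have [c _ ->] := avg_mvt t (hmu j) (tau0 j); exact: Phi0.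
have BS k t : B k.+1 t = B k t + a k.+1 t by rewrite /B big_ord_recr.
have BSle k t : B k t <= B k.+1 t by rewrite BS lerDl.
have Bmono j k t : (j <= k)%N -> B j t <= B k t.
  elim: k => [|k IH]; first by rewrite leqn0 => /eqP ->.
  by rewrite leq_eqVlt => /orP[/eqP -> //|]; rewrite ltnS => /IH /le_trans; apply.
have aB j t : a j t <= B j t.
  case: j => [|j]; first by rewrite /B big_ord_recr big_ord0 /= add0r.
  by rewrite BS lerDr; apply: sumr_ge0 => i _.
have B0 k t : 0 <= B k t by exact: le_trans (a0 k t) (aB k t).
have win k t : T - 2 * tau k <= t -> T - ts <= t.
  by move=> h; have := tau0k k; have := tau0 k; move: h; lr.
have G1 k u t : T - 2 * tau k <= u -> u <= t -> t < T -> B k t <= CG * B k u.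
  move=> Tu ut tT.
  have hB := C1fun_sum k.+1 (fun j => C1fun_avg (tau j) (hmu j)).
  have := @gronwall _ _ (2 * C1 / tau k) u t hB ut _.
  move=> /(_ _)/le_trans; apply.
    move=> v uv vt.
    have vT : v < T by exact: le_lt_trans tT.
    have vw : T - ts <= v by apply: (win k); exact: le_trans uv.
    apply: (@le_trans _ _ (\sum_(j < k.+1) (C1 * B k v) * (tau j)^-1)).
      apply: ler_sum => j _; rewrite ler_pM2r ?invr_gt0//.
      have h1 := H1 j v vw vT; have h2 := Phi0 j (v - tau j).
      have h3 : C1 * B j v <= C1 * B k v by rewrite (ler_pM2l C10); apply: Bmono; rewrite -ltnS.
      by move: h1 h2 h3; lr.
    rewrite -mulr_sumr (_ : 2 * C1 / tau k * _ = C1 * B k v * (2 / tau k)); last by rewrite /B /a; ring.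
    by apply: ler_wpM2l; [rewrite mulr_ge0// ltW|exact: sum_inv_geo].
  apply: ler_wpM2r; first exact: B0.
  rewrite /CG ler_expR mulrAC ler_pdivrMr// .
  have : t - u <= 2 * tau k by move: Tu tT; lr.
  by rewrite -(ler_pM2l C10); lr.
have F5 k t : T - 2 * tau k <= t -> t < T -> c2 * B k t <= Phi k t.
  elim: k => [|k IH] h tT.
    by rewrite /B big_ord_recr big_ord0 /= add0r; exact: H20.
  have hk : T - 2 * tau k <= t by have := tauS k; move: h; lr.
  by have := IH hk tT; have := H2 k t h tT; rewrite BS mulrDr; lr.
have F6' k u t : T - 2 * tau k <= u -> u <= t -> t < T -> c2 / CG * B k t <= Phi k u.
  move=> Tu ut tT; apply: (@le_trans _ _ (c2 * B k u)); last by apply: F5 => //; exact: le_lt_trans tT.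
  rewrite -mulrA (ler_pM2l c20) mulrC ler_pdivrMr// mulrC; exact: G1.
have F6 k t : T - tau k <= t -> t < T -> c3 * B k t <= a k t.
  move=> Tt tT; rewrite /a; have [c /andP[c1 c2'] ->] := avg_mvt t (hmu k) (tau0 k).
  apply: le_trans (F6' k c t _ c2' tT); first by rewrite ler_wpM2r.
  by move: c1 Tt; lr.
have Bq k j t : (j <= k)%N -> T - tau k <= t -> t < T -> B j t <= (1 - c3) ^+ (k - j) * B k t.
  elim: k => [|k IH] jk Tt tT; first by move: jk; rewrite leqn0 => /eqP ->; rewrite mul1r.
  move: jk; rewrite leq_eqVlt => /orP[/eqP ->|]; first by rewrite subnn mul1r.
  rewrite ltnS => jk; rewrite subSn// exprSr -mulrA.
  have Tt' : T - tau k <= t by have := tauS k; move: Tt; lr.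
  apply: le_trans (IH jk Tt' tT) _.
  apply: ler_wpM2l; first by rewrite exprn_ge0//; move: c3h; lr.
  by have := F6 k.+1 t Tt tT; have := BS k t; move: (B k.+1 t) (B k t) (a k.+1 t) => b1 b2 b3; lr.
split.
- exact: G1.
- by move=> k j t jk Tt tT; exact: le_trans (aB j t) (Bq k j t jk Tt tT).
- move=> k; have tk := tau0 k.
  have h1 : T - tau k <= T - tau k / 2 by move: tk; lr.
  have h2 : T - tau k / 2 < T by move: tk; lr.
  have := Bq k 0%N _ (leq0n k) h1 h2; rewrite subn0; apply: le_trans.
  apply: le_trans (aB 0%N _); rewrite /a; have [c /andP[c1 c2'] ->] := avg_mvt (T - tau k / 2) (hmu 0%N) (tau0 0%N).
  apply: H3; last exact: le_lt_trans h2.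
  by have := taum 0%N k (leq0n k); move: c1 tts (tau0 0%N) tk; lr.
(* Of the averaging window that ends at [T - 3 / 8 * tau k], the fraction [7 / 8] lies before
   [T - tau k / 2]. On that part the mass takes its mean value at some [c], where it is bounded
   below by the later value of [B k]. *)
move=> k; have tk := tau0 k.
have sT : T - tau k / 2 <= T - 3 / 8 * tau k by move: tk; lr.
have lo : T - 3 / 8 * tau k - tau k <= T - tau k / 2 by move: tk; lr.
have [c /andP[c1 c2'] e] := mvt_itv (hmu k) lo.
have up := C1fun_le (hmu k) (Phi0 k) sT.
have key := F6' k c (T - tau k / 2) _ c2' _.
have {}key : c2 / CG * B k (T - tau k / 2) <= Phi k c by apply: key; move: c1 tk; lr.
rewrite /a /avg ler_pdivlMr//.
apply: (@le_trans _ _ (Phi k c * (7 / 8 * tau k))).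
  by move: key; rewrite -(ler_pM2r (_ : 0 < 7 / 8 * tau k)) ?mulr_gt0//; move: (c2 / CG) => z; lr.
by move: e up; rewrite (_ : T - tau k / 2 - (T - 3 / 8 * tau k - tau k) = 7 / 8 * tau k); [lr|field].
Qed.

End ChainDecay.

(** * Mass and solution on dyadic annuli *)

Section Profile.
Context (R : realType) (n : nat) (s lam Lam : R).
Implicit Types (x y p ev en : 'rV[R]_n) (z : 'rV[R]_n * R) (w v : 'rV[R]_n * R -> R) (k : 'rV[R]_n -> R) (Om : set ('rV[R]_n * R)).
Local Notation rb := (@rb R).

(** Index 0 is already one step below [rb], so that [8 * rr j] is the preceding scale for every
    [j]. *)
Definition rr (j : nat) : R := rb * 8^-1 ^+ j.+1.
Definition tauk (taub : R) (j : nat) : R := taub * rr j `^ (2 * s).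

Lemma rr_gt0 j : 0 < rr j.
Proof. by rewrite mulr_gt0 ?rb_gt0// exprn_gt0// invr_gt0. Qed.

Lemma rr0 : 8 * rr 0 = rb.
Proof. by rewrite /rr expr1; field. Qed.

Lemma rrS j : 8 * rr j.+1 = rr j.
Proof. by rewrite /rr [_ ^+ j.+2]exprS; field. Qed.

Lemma rr_antitone i j : (i <= j)%N -> rr j <= rr i.
Proof.
move=> ij; rewrite /rr ler_pM2l ?rb_gt0//; apply: ler_wiXn2l => //; rewrite ?invr_ge0//.
by rewrite invf_le1// ler1n.
Qed.

Lemma rr_le j : rr j <= rb / 8.
Proof. by rewrite -rr0 mulrC mulKf//; exact: rr_antitone. Qed.

(** By [2 * s >= 1] time scales shrink at least as fast as lengths, which makes the sum of the
    inverse time scales geometric. *)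
Lemma pow8 (a : R) : 2^-1 <= s -> 0 < a -> 8 * a `^ (2 * s) <= (8 * a) `^ (2 * s).
Proof.
move=> s2 a0; rewrite powRM ?(ltW a0)// ler_pM2r ?powR_gt0//.
by rewrite -[leLHS]powRr1//; apply: ler_powR; [rewrite ler1n|move: s2; lr].
Qed.

Lemma tauk_gt0 taub j : 0 < taub -> 0 < tauk taub j.
Proof. by move=> t0; rewrite mulr_gt0// powR_gt0 ?rr_gt0. Qed.

Lemma taukS taub j : 2^-1 <= s -> 0 < taub -> 8 * tauk taub j.+1 <= tauk taub j.
Proof.
move=> s2 t0; rewrite /tauk mulrCA ler_pM2l// -[in leRHS]rrS; exact: pow8 (rr_gt0 _).
Qed.

Lemma tauk0 taub : 2^-1 <= s -> 0 < taub -> 8 * tauk taub 0 <= taub * rb `^ (2 * s).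
Proof.
move=> s2 t0; rewrite /tauk mulrCA ler_pM2l// -[in leRHS]rr0; exact: pow8 (rr_gt0 _).
Qed.

Lemma tauk_antitone taub i j : 2^-1 <= s -> 0 < taub -> (i <= j)%N -> tauk taub j <= tauk taub i.
Proof.
move=> s2 t0 ij; rewrite ler_pM2l//; apply: ge0_ler_powR; rewrite ?nnegrE ?(ltW (rr_gt0 _)) ?rr_antitone//.
by move: s2; lr.
Qed.

Lemma wgt_le_jker1 (r : R) y : 0 < s -> 0 <= r -> 0 < enorm y -> wgt s r y <= jker s y.
Proof. by move=> s0 r0 y0; apply: (ler_powP n s0) => //; rewrite lerDr. Qed.

Lemma jker_le_wgt (r : R) y : 0 < s -> 0 < r -> r <= enorm y -> jker s y <= 2 `^ (n%:R + 2 * s) * wgt s r y.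
Proof.
move=> s0 r0 ry; have y0 : 0 < enorm y by exact: lt_le_trans ry.
have e2 : 2 `^ (n%:R + 2 * s) = 2^-1 `^ (- n%:R - 2 * s) :> R.
  by rewrite -opprD powRN -[2^-1]powR_inv1// -powRrM mulN1r powRN invrK.
rewrite e2 /wgt -powRM ?invr_ge0 ?addr_ge0 ?(ltW r0) ?enorm_ge0//.
apply: (ler_powP n s0); first by rewrite mulr_gt0 ?invr_gt0 ?addr_gt0.
by move: ry; lr.
Qed.

(* Splits the space into the annuli between the radii [rr j]. *)
Lemma Mt_upper (g C0 : R) : par n s lam Lam -> 0 < g -> g < 2 * s -> 0 < C0 -> exists C Ct, [/\ 0 < C, 0 < Ct &
  forall w (M : R) x0 (t : R) (V : nat -> R) (m : nat), UC w -> bdd w M -> enorm x0 <= 1 ->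
  (forall z, `|w z| <= C0 * (1 + enorm z.1) `^ (2 * s - g)) -> (forall j, 0 <= V j) ->
  (forall j x, (j <= m)%N -> enorm (x - x0) < 8 * rr j -> w (x, t) <= V j) ->
  Mt s w (rr m) x0 t <= C * (\sum_(j < m.+1) V j / rr j `^ (2 * s)) + Ct].
Proof.
move=> pp g0 gs C00; have [hn s0 s1 lam0 Lam0] := pp.
have pp1 : par n s 1 1 by split.
(* The model kernel belongs to the class with both constants 1, so the tail estimate applies to the
   weight as well. *)
have kj : kern s 1 1 (@jker R n s).
  split; [exact: meas_jker|by move=> y; rewrite /jker enormN|by move=> y; rewrite mul1r lexx].
have [Ct Ct0 hCt] := tail_growth pp1 (rb_gt0 R) g0 gs C00.
have [Cw Cw0 hw] := wgt_bounds pp.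
pose P2 : R := 2 `^ (n%:R + 2 * s).
have P21 : 1 <= P2 by rewrite /P2 -[leLHS](powRr0 2); apply: ler_powR; rewrite ?ler1n// addr_ge0// mulr_ge0// ltW.
have P20 : 0 < P2 by move: P21; lr.
exists (P2 * Cw), Ct; split => //; first exact: mulr_gt0.
move=> w M x0 t V m uw bw hx0 hgr V0 hV.
have x02 : enorm x0 <= 2 by move: hx0; lr.
have [iT IT] := hCt _ kj x0 x02.
have iw j : intg (@wgt R n s (rr j)) := proj1 (hw _ (rr_gt0 j)).
pose S m y := \sum_(j < m.+1) V j * P2 * wgt s (rr j) y.
have iS l : intg (S l).
  rewrite /S; elim: l.+1 => [|l' IH].
    by under [X in intg X]eq_fun do rewrite big_ord0; exact: intg0.
  by under [X in intg X]eq_fun do rewrite big_ord_recr /=; apply: intgD IH _; exact: intgZ (iw l').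
have eS l : INT (S l) = \sum_(j < l.+1) V j * P2 * INT (@wgt R n s (rr j)).
  have : intg (fun y => \sum_(j < l.+1) V j * P2 * wgt s (rr j) y) /\ INT (fun y => \sum_(j < l.+1) V j * P2 * wgt s (rr j) y) = \sum_(j < l.+1) V j * P2 * INT (@wgt R n s (rr j)).
    elim: l.+1 => [|l' [IHi IH]].
      rewrite (_ : (fun y => _) = (fun=> 0)); last by apply/funext => y; rewrite big_ord0.
      by rewrite big_ord0 INT0; split => //; exact: intg0.
    rewrite (_ : (fun y => _) = (fun y => (\sum_(j < l') V j * P2 * wgt s (rr j) y) + V l' * P2 * wgt s (rr l') y)); last first.
      by apply/funext => y; rewrite big_ord_recr.
    by rewrite (INTD IHi (intgZ _ (iw l'))) IH (INTZ _ (iw l')) big_ord_recr; split => //; apply: intgD IHi _; exact: intgZ (iw l').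
  by case.
have S0 l y : 0 <= S l y by apply: sumr_ge0 => i _; apply: mulr_ge0; [apply: mulr_ge0 => //; exact: ltW|exact: wgt_ge0].
have SS l y : S l.+1 y = S l y + V l.+1 * P2 * wgt s (rr l.+1) y by rewrite /S big_ord_recr.
have term l y : 0 <= V l * P2 * wgt s (rr l) y by apply: mulr_ge0; [apply: mulr_ge0 => //; exact: ltW|exact: wgt_ge0].
have lastS l y : V l * P2 * wgt s (rr l) y <= S l y.
  case: l => [|l]; first by rewrite /S big_ord_recr big_ord0 /= add0r.
  by rewrite SS lerDr.
pose wp y := Num.max 0 (w (x0 + y, t)).
have wp0 y : 0 <= wp y by exact: max0_ge0.
have wpV j y : (j <= m)%N -> enorm y < 8 * rr j -> wp y <= V j.
  by move=> jm yj; apply: max0_le => //; apply: hV jm _; rewrite addrC addKr.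
(* Induction from the coarse scales down: a point between [rr l.+1] and [rr l] lies in the ball of
   radius [8 * rr l.+1], where [V l.+1] is the bound and the weight at that scale is comparable with
   the kernel. *)
have Q l y : (l <= m)%N -> rr l <= enorm y -> enorm y < rb -> wp y * jker s y <= S l y.
  elim: l => [|l IH] lm yl yb.
    apply: le_trans (lastS 0%N y); rewrite -mulrA; apply: ler_pM => //; first exact: powR_ge0.
      by apply: wpV => //; rewrite rr0.
    exact: jker_le_wgt (rr_gt0 _) yl.
  rewrite SS; case: (ltP (enorm y) (rr l)) => yl'.
    apply: (@le_trans _ _ (V l.+1 * P2 * wgt s (rr l.+1) y)); last by rewrite lerDr.
    rewrite -mulrA; apply: ler_pM => //; first exact: powR_ge0.
      by apply: wpV => //; rewrite rrS.
    exact: jker_le_wgt (rr_gt0 _) yl.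
  by apply: (le_trans (IH (ltnW lm) yl' yb)); rewrite lerDl.
pose F y := ind (rb <= enorm y) * (C0 * (1 + enorm (x0 + y)) `^ (2 * s - g)) * jker s y.
have F0 y : 0 <= F y.
  apply: mulr_ge0; last exact: powR_ge0.
  by apply: mulr_ge0; [exact: ind_ge0|apply: mulr_ge0; [exact: ltW|exact: powR_ge0]].
have main y : wp y * wgt s (rr m) y <= S m y + F y.
  case: (ltP (enorm y) rb) => yb.
    apply: (@le_trans _ _ (S m y)); last by rewrite lerDl.
    case: (ltP (enorm y) (rr m)) => ym; last first.
      apply: le_trans (Q m y (leqnn m) ym yb); apply: ler_wpM2l => //.
      by apply: wgt_le_jker1; rewrite ?(ltW (rr_gt0 m))//; exact: lt_le_trans (rr_gt0 m) ym.
    apply: le_trans (lastS m y); rewrite mulrAC -[leLHS]mulr1; apply: ler_pM => //.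
    - by apply: mulr_ge0 => //; exact: wgt_ge0.
    - apply: ler_wpM2r; first exact: wgt_ge0.
      by apply: wpV => //; apply: lt_trans ym _; have := rr_gt0 m; lr.
  apply: (@le_trans _ _ (F y)); last by rewrite lerDr.
  have y0 : 0 < enorm y by exact: lt_le_trans (rb_gt0 R) yb.
  rewrite /F (indT _ yb) mul1r; apply: ler_pM => //; first exact: wgt_ge0.
    by rewrite (le_trans (ler_norm _))// (le_trans (pos_le_norm _))//; exact: hgr.
  by apply: wgt_le_jker1 => //; exact: ltW (rr_gt0 m).
apply: le_trans (INT_le (intg_Mt x0 t pp uw bw (rr_gt0 m)) (intgD (iS m) iT) main) _.
rewrite (INTD (iS m) iT) eS; apply: lerD => //.
rewrite mulr_sumr; apply: ler_sum => j _.
rewrite (_ : P2 * Cw * (V j / rr j `^ (2 * s)) = V j * P2 * (Cw / rr j `^ (2 * s))); last by ring.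
apply: ler_wpM2l; first by apply: mulr_ge0 => //; exact: ltW.
exact: proj2 (hw _ (rr_gt0 j)).
Qed.

(** Refining the weight from [8 * r] to [r] increases it everywhere, and by a definite amount on the
    ball inside the cone, where [|y| <= 2 * r]. This is the gain per scale in the chain. *)
Lemma Mt_lower (b : R) : par n s lam Lam -> 0 < b -> b <= 1 -> exists2 c, 0 < c &
  forall w (M : R) x0 ev (t r V : R), UC w -> bdd w M -> 0 < r -> enorm ev = 1 -> 0 <= V ->
  (forall x, enorm (x - (x0 + r *: ev)) < b / 2 * r -> V <= w (x, t)) ->
  Mt s w (8 * r) x0 t + c * (V / r `^ (2 * s)) <= Mt s w r x0 t.
Proof.
move=> pp b0 b1; have [hn s0 s1 lam0 Lam0] := pp.
pose D : R := 3 `^ (- n%:R - 2 * s) - 8 `^ (- n%:R - 2 * s).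
have n0 : 0 < n%:R :> R by rewrite ltr0n.
have D0 : 0 < D.
  rewrite subr_gt0 -opprD !powRN ltf_pV2 ?posrE ?powR_gt0//.
  by apply: gt0_ltr_powR; rewrite ?nnegrE ?addr_gt0 ?mulr_gt0// ltr_nat.
exists (D * (b / 2 / n%:R) ^+ n); first by rewrite mulr_gt0// exprn_gt0// !divr_gt0.
move=> w M x0 ev t r V uw bw r0 hev V0 hV.
have d0 : 0 < b / 2 * r by rewrite mulr_gt0// divr_gt0.
have dr : b / 2 * r <= r / 2 by rewrite mulrAC ler_pM2r// ler_piMl// ltW.
have r80 : 0 < 8 * r by rewrite mulr_gt0.
have ib := intg_ball (r *: ev) (b / 2 * r).
have Ib := INT_ball_ge (r *: ev) hn d0.
have i1 := intg_Mt x0 t pp uw bw r0; have i8 := intg_Mt x0 t pp uw bw r80.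
pose A := V * (D * r `^ (- n%:R - 2 * s)).
have A0 : 0 <= A by rewrite mulr_ge0// mulr_ge0 ?powR_ge0// ltW.
apply: (@le_trans _ _ (Mt s w (8 * r) x0 t + A * INT (fun y => ind (enorm (y - r *: ev) < b / 2 * r)))).
  rewrite lerD2l; apply: le_trans (_ : A * (b / 2 * r / n%:R) ^+ n <= _); last exact: ler_wpM2l.
  rewrite /A (powP_split n s r0) (_ : b / 2 * r / n%:R = b / 2 / n%:R * r); last by field; rewrite gt_eqF.
  rewrite [X in _ <= _ * X]exprMn; have rn0 := exprn_gt0 n r0; have rs0 := rs_gt0 s r0.
  move: (_ ^+ n) (r ^+ n) rn0 (r `^ _) rs0 => q1 q2 q20 q3 q30.
  by rewrite le_eqVlt; apply/orP; left; apply/eqP; field; rewrite !gt_eqF.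
rewrite /Mt -(INTZ A ib) -(INTD i8 (intgZ A ib)).
apply: (INT_le (intgD i8 (intgZ A ib)) i1) => y.
have wp0 := max0_ge0 (w (x0 + y, t)).
have w8 : wgt s (8 * r) y <= wgt s r y.
  apply: (ler_powP n s0); first by rewrite ltr_pwDl// enorm_ge0.
  by rewrite lerD2r; move: r0; lr.
case: (ltP (enorm (y - r *: ev)) (b / 2 * r)) => yb; last first.
  by rewrite /ind/= mulr0 addr0; exact: ler_wpM2l.
rewrite /ind/= mulr1.
have Vw : V <= Num.max 0 (w (x0 + y, t)).
  rewrite le_max; apply/orP; right; apply: hV.
  by rewrite (_ : x0 + y - (x0 + r *: ev) = y - r *: ev)//; vec.
have yr : enorm y <= 2 * r.
  have := ler_enormD (y - r *: ev) (r *: ev); rewrite subrK enormZ hev mulr1 ger0_norm ?(ltW r0)//.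
  by move: yb dr r0; lr.
have g3 : 3 `^ (- n%:R - 2 * s) * r `^ (- n%:R - 2 * s) <= wgt s r y.
  rewrite -powRM ?(ltW r0)//; apply: (ler_powP n s0); first by rewrite ltr_pwDl// enorm_ge0.
  by move: yr; lr.
have g8 : wgt s (8 * r) y <= 8 `^ (- n%:R - 2 * s) * r `^ (- n%:R - 2 * s).
  by rewrite -powRM ?(ltW r0)//; apply: (ler_powP n s0) => //; rewrite lerDl enorm_ge0.
have gD : D * r `^ (- n%:R - 2 * s) <= wgt s r y - wgt s (8 * r) y.
  by rewrite /D mulrBl; exact: lerB.
have : A <= Num.max 0 (w (x0 + y, t)) * (wgt s r y - wgt s (8 * r) y).
  by apply: ler_pM => //; rewrite mulr_ge0 ?powR_ge0// ltW.
by rewrite mulrBr; lr.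
Qed.

End Profile.

Section ProfileExistence.
Context (R : realType) (n : nat) (s lam Lam : R).
Implicit Types (x y p ev en : 'rV[R]_n) (z : 'rV[R]_n * R) (w v : 'rV[R]_n * R -> R) (k : 'rV[R]_n -> R) (Om : set ('rV[R]_n * R)).
Local Notation rb := (@rb R).
Local Notation rr := (@rr R).
Local Notation tauk := (@tauk R s).

Lemma Mt_anti w (M r1 r2 : R) x (t : R) : par n s lam Lam -> UC w -> bdd w M -> 0 < r1 -> r1 <= r2 -> Mt s w r2 x t <= Mt s w r1 x t.
Proof.
move=> pp uw bw r10 r12; have [hn s0 s1 lam0 Lam0] := pp; have r20 := lt_le_trans r10 r12.
apply: (INT_le (intg_Mt x t pp uw bw r20) (intg_Mt x t pp uw bw r10)) => y.
apply: ler_wpM2l; first exact: max0_ge0.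
by apply: (ler_powP n s0); [rewrite ltr_pwDl// enorm_ge0|rewrite lerD2r].
Qed.

(* [Th m] is the size of [v / r^(2s)] at scale [rr m]; since [q < 1], on the coarser scales [j < m] this ratio is smaller by a geometric factor. *)
Definition profile_bounds (Cp cp q taub T : R) v x0 ev (Th : nat -> R) (m : nat) := [/\ cp <= q ^+ m * Th m,
  (forall j x t, (j <= m)%N -> enorm (x - x0) < 8 * rr j -> T - tauk taub m / 2 <= t -> t < T ->
    v (x, t) <= Cp * tauk taub j * (q ^+ (m - j) * Th m)) &
  cp * tauk taub m * Th m <= v (x0 + rr m *: ev, T - 3 / 8 * tauk taub m)].

(** The hypotheses of [chain_decay] are checked scale by scale: [local_max] bounds [v] above by
    [tauk taub j] times the mean mass, which [Mt_upper] turns into the bound on the mass;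
    [local_min] bounds it below on the ball in the cone, which [Mt_lower] turns into the gain. The
    mean mass at each scale is at least [c00], so a small right-hand side is absorbed at all scales
    at once. *)
Lemma profile (g C0 b c kap taub t1 c0 : R) : par n s lam Lam -> 2^-1 <= s -> 0 < g -> g < 2 * s -> 0 < C0 ->
  0 < b -> b <= 1 -> 0 < c -> @lmin R n s lam Lam c b kap -> 0 < taub -> 4 * taub <= kap -> 8 * taub <= t1 -> 0 < c0 ->
  exists Cp cp q eJ, [/\ 0 < Cp, 0 < cp, 0 < q /\ q < 1, 0 < eJ &
  forall k Om (e T Rb : R) v x0 ev, kern s lam Lam k -> sol s k g C0 Rb (7 / 4 * t1) e Om v -> 2 <= Rb -> 0 <= e -> e <= eJ ->
  enorm x0 < 1 -> - t1 < T -> T < 0 -> enorm ev = 1 -> access s Om x0 T ev b taub rb ->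
  (forall x t, enorm (x - (x0 + rb *: ev)) < b / 2 * rb -> T - 2 * (taub * rb `^ (2 * s)) <= t -> t < T -> c0 <= v (x, t)) ->
  (forall x t, enorm (x - x0) <= 4 * rb -> T - taub * rb `^ (2 * s) <= t -> t < T -> 0 <= v (x, t)) ->
  exists Th, forall m, profile_bounds Cp cp q taub T v x0 ev Th m].
Proof.
move=> pp s2 g0 gs C00 b0 b1 c_gt0 HL taub0 tkap tt1 c00_gt0; have [hn s0 s1 lam0 Lam0] := pp.
have [Cm [cf [Cm0 cf0 kbd]]] := kern_bounds pp.
have rb0 := rb_gt0 R.
have rs0 := rs_gt0 s rb0; have rs1 := rb_pow_le1 s0.
pose taub_b := taub * rb `^ (2 * s).
have tb0 : 0 < taub_b by rewrite mulr_gt0.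
have tbt : taub_b <= taub by rewrite ler_piMr// ltW.
have [CU CU0 hU] := local_max pp s2 taub0.
have [C [Ct [C_gt0 Ct0 hup]]] := Mt_upper pp g0 gs C00.
have [cB cB0 hlow] := Mt_lower pp b0 b1.
pose c00 := cB * (c0 / rb `^ (2 * s)).
have c000 : 0 < c00 by rewrite mulr_gt0// divr_gt0.
pose C1 := C * (2 * CU * taub) + Ct / c00.
have C10 : 0 < C1 by rewrite addr_gt0 ?divr_gt0// !mulr_gt0.
pose c2 := cB * (c / 2 * taub).
have c20 : 0 < c2 by rewrite !mulr_gt0.
have [CG [q [c4 [CG0 q0 q1 c40 hchain]]]] := chain_decay C10 c20 c000.
pose Cr := Cm / rb `^ (2 * s).
have Cr0 : 0 < Cr by rewrite divr_gt0.
(* The first threshold absorbs the error in the upper bounds, the second the error and the negative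
   tail in the lower bounds. *)
exists (2 * CU * CG), (Num.min c00 (c / 2 * c4)), q, (Num.min (taub * c00) (c * c00 / (2 * (1 + Cr)))).
have Cr1 : 0 < 2 * (1 + Cr) by rewrite mulr_gt0// addr_gt0.
split => //.
- by rewrite !mulr_gt0.
- by rewrite lt_min c000 !mulr_gt0.
- by rewrite lt_min; apply/andP; split; [exact: mulr_gt0|apply: divr_gt0 => //; exact: mulr_gt0].
move=> k Om e T Rb v x0 ev kk [sv snv vlo vgr vint] Rb2 e0; rewrite le_min => /andP[eJ1 eJ2] hx0 T1 T0 hev hacc low nneg.
have [uv [M bv] vv] := sv; have [_ _ vnv] := snv.
have [mu hmu] := choice (P := fun j m => C1fun m (Mt s v (rr j) x0))
  (fun j => primitive (@continuous_Mt R n s lam Lam v M (rr j) x0 pp uv bv (rr_gt0 R j))).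
have Phi0 j t : 0 <= Mt s v (rr j) x0 t by exact: Mt_ge0.
have tk0 j : 0 < tauk taub j := tauk_gt0 s j taub0.
have tk8 j : 8 * tauk taub j.+1 <= tauk taub j := taukS j s2 taub0.
have tkb : 8 * tauk taub 0%N <= taub_b := tauk0 s2 taub0.
have tkm j : tauk taub j <= tauk taub 0%N := tauk_antitone s2 taub0 (leq0n j).
have tkr j : tauk taub j = taub * rr j `^ (2 * s) by [].
pose a j t := avg (mu j) (tauk taub j) t.
have J_eq j t : mu j t - mu j (t - tauk taub j) = tauk taub j * a j t.
  by rewrite /a /avg mulrC divfK// gt_eqF.
have Phi_lo j t : T - taub_b <= t -> t < T -> c00 <= Mt s v (rr j) x0 t.
  move=> Tt tT; apply: (@le_trans _ _ (Mt s v rb x0 t)); last first.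
    apply: (Mt_anti _ _ pp uv bv (rr_gt0 R j)).
    by have := rr_le R j; move: rb0; lr.
  have := hlow v M x0 ev t rb c0 uv bv rb0 hev (ltW c00_gt0).
  move=> /(_ (fun x xr => low x t xr _ tT)) H.
  have {}H := H (_ : T - 2 * (taub * rb `^ (2 * s)) <= t).
  apply: le_trans (H _); first by rewrite lerDr; exact: Mt_ge0.
  by move: Tt tb0; rewrite /taub_b; lr.
have a_lo j t : T - taub_b / 2 <= t -> t < T -> c00 <= a j t.
  move=> Tt tT; rewrite /a; have [d /andP[d1 d2] ->] := avg_mvt t (hmu j) (tk0 j).
  apply: Phi_lo; last exact: le_lt_trans d2 tT.
  by have := tkm j; move: d1 Tt tkb tb0; lr.
have xb x (r : R) : enorm (x - x0) < r -> r <= 2 * rb -> enorm x < Rb.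
  move=> xr r2; have := ler_enormD (x - x0) x0; rewrite subrK.
  by move: xr r2 hx0 Rb2; rewrite rbE; lr.
have rr16 j : 16 * rr j <= 2 * rb by have := rr_le R j; lr.
have upper j x t : enorm (x - x0) <= 8 * rr j -> T - taub_b / 2 <= t -> t < T -> v (x, t) <= 2 * CU * (tauk taub j * a j t).
  move=> xr Tt tT.
  have := hU k Om v M e x0 (rr j) (t - tauk taub j) T (mu j) kk uv bv e0 (rr_gt0 R j) vv (hmu j).
  have mono u : t - tauk taub j <= u -> mu j (t - tauk taub j) <= mu j u by apply: (C1fun_le (hmu j)).
  move=> /(_ mono) H.
  have {}H := H _ x t xr _ tT.
  apply: le_trans (H _ _) _.
  - move=> y u yr /andP[tu uT] vy; apply: vint; last by rewrite gt_eqF.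
    + exact: xb yr (rr16 j).
    + by have := tkm j; move: tu Tt T1 tkb tb0 tbt tt1; lr.
    + exact: lt_trans uT T0.
  - by rewrite -tkr subrK.
  rewrite J_eq -mulrA [leRHS]mulrCA ler_pM2l//.
  have aj := a_lo j t Tt tT.
  have : rr j `^ (2 * s) * e <= tauk taub j * a j t.
    rewrite tkr mulrAC [leRHS]mulrC ler_pM2l ?rs_gt0 ?rr_gt0//.
    by apply: (le_trans eJ1); rewrite ler_pM2l.
  by lr.
have lower j x t : enorm (x - (x0 + rr j *: ev)) <= b * rr j / 2 -> T - 2 * tauk taub j <= t -> t < T ->
    c / 2 * (tauk taub j * a j t) <= v (x, t).
  move=> xr Tt tT.
  have ejt := tkm j.
  have pev : enorm (x0 + rr j *: ev - x0) = rr j.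
    by rewrite addrC addKr enormZ hev mulr1 ger0_norm ?(ltW (rr_gt0 R j)).
  have npev : enorm (x0 + rr j *: ev - x0) <= 2 * rr j by rewrite pev; have := rr_gt0 R j; lr.
  have e10 : 0 <= e * Cr by rewrite mulr_ge0// ltW.
  have win : T - (t - tauk taub j) <= kap * rr j `^ (2 * s).
    apply: (@le_trans _ _ (4 * taub * rr j `^ (2 * s))); last by rewrite ler_pM2r// rs_gt0// rr_gt0.
    by rewrite -mulrA -tkr; move: Tt (tk0 j); lr.
  have := HL k Om v M e (e * Cr) x0 (x0 + rr j *: ev) (rr j) (t - tauk taub j) T (mu j) kk uv bv e0 e10 (rr_gt0 R j) vnv (hmu j) npev win.
  move=> H; have {}H := H _ _ _ x t xr _ tT.
  have aj : c00 <= a j t by apply: a_lo => //; move: Tt ejt tkb tb0; lr.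
  apply: le_trans (_ : c * (mu j t - mu j (t - tauk taub j)) - (e + e * Cr) * (t - (t - tauk taub j)) <= _).
    rewrite J_eq subKr.
    have h1 : (e + e * Cr) * tauk taub j <= c / 2 * (tauk taub j * a j t).
      rewrite [leRHS](_ : _ = c / 2 * a j t * tauk taub j); last by ring.
      rewrite ler_pM2r//; apply: (@le_trans _ _ (c / 2 * c00)).
        by move: eJ2; rewrite ler_pdivlMr//; lr.
      by rewrite ler_pM2l// divr_gt0.
    by move: h1; lr.
  have inn u : t - tauk taub j <= u -> T - taub_b <= u by move: Tt ejt tkb (tk0 j); lr.
  apply: H.
  - move=> y u yr tu uT; apply: nneg => //; last exact: inn.
    by apply: ltW; apply: lt_le_trans yr _; have := rr16 j; move: rb0; lr.
  - move=> y u yr tu uT.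
    have [_ _ iF IF _] := kbd k kk _ rb0.
    have r80 : 0 < 8 * rr j by rewrite mulr_gt0// rr_gt0.
    apply: le_trans (_ : INT (fun h => e * (ind (rb <= enorm h) * k h)) <= _); last first.
      by rewrite (INTZ e iF); exact: ler_wpM2l.
    apply: (INT_le (intg_tail y u pp kk uv bv r80) (intgZ e iF)) => h.
    rewrite mulrA; apply: ler_wpM2r; first exact: (kern_ge0 pp h kk).
    case: (ltP (enorm h) rb) => hb.
      rewrite max_l; first by rewrite !mulr0.
      rewrite oppr_le0; apply: nneg => //; last exact: inn (ltW tu).
      have := ler_enormD (y - (x0 + rr j *: ev)) (x0 + rr j *: ev - x0 + h).
      rewrite (_ : y - (x0 + rr j *: ev) + (x0 + rr j *: ev - x0 + h) = y + h - x0); last by vec.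
      have := ler_enormD (x0 + rr j *: ev - x0) h; rewrite pev.
      have : b * rr j <= 1 * rr j by rewrite ler_pM2r ?rr_gt0.
      have := rr_le R j; move: yr hb rb0; lr.
    rewrite mulr1 -[leRHS]mul1r; apply: ler_pM; [exact: ind_ge0|exact: max0_ge0|exact: ind_le1|].
    by apply: max0_le => //; rewrite lerNl; exact: vlo.
  - move=> y u yr tu uT; apply: (hacc (rr j) (rr_gt0 R j)) => //.
      by have := rr_le R j; move: rb0; lr.
    by rewrite -tkr; move: tu Tt (tk0 j); lr.
  by rewrite gerBl ltW.
have sumB (m : nat) t : \sum_(j < m.+1) (2 * CU * (tauk taub j * a j t)) / rr j `^ (2 * s) = 2 * CU * taub * \sum_(j < m.+1) a j t.
  rewrite mulr_sumr; apply: eq_bigr => j _; rewrite tkr.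
  by have := rs_gt0 s (rr_gt0 R j) => r2; field; rewrite gt_eqF.
have a_ge0 j t : 0 <= a j t.
  by rewrite /a; have [d _ ->] := avg_mvt t (hmu j) (tk0 j); exact: Phi0.
have JJ0 j t : 0 <= tauk taub j * a j t by apply: mulr_ge0 (a_ge0 j t); exact: ltW.
have step j t : T - 2 * tauk taub j <= t -> t < T -> Mt s v (8 * rr j) x0 t + c2 * a j t <= Mt s v (rr j) x0 t.
  move=> Tt tT; have V0 : 0 <= c / 2 * (tauk taub j * a j t) by apply: mulr_ge0 (JJ0 j t); rewrite divr_ge0// ltW.
  apply: le_trans (hlow v M x0 ev t (rr j) _ uv bv (rr_gt0 R j) hev V0 _).
    rewrite lerD2l le_eqVlt; apply/orP; left; apply/eqP; rewrite /c2 tkr.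
    by have := rs_gt0 s (rr_gt0 R j) => r2; field; rewrite gt_eqF.
  move=> x xr; apply: lower => //; apply: ltW; apply: lt_le_trans xr _.
  by rewrite le_eqVlt mulrAC eqxx.
have tts : 4 * tauk taub 0%N <= taub_b / 2 by move: tkb; lr.
have x01 := ltW hx0.
have := hchain mu (fun j => Mt s v (rr j) x0) (tauk taub) T (taub_b / 2) hmu Phi0 tk0 tk8 tts.
move=> [].
- move=> m t Tt tT.
  have := hup v M x0 t (fun j => 2 * CU * (tauk taub j * a j t)) m uv bv x01 vgr.
  move=> /(_ _ _)/le_trans; apply.
  + by move=> j; apply: mulr_ge0 (JJ0 j t); rewrite mulr_ge0// ltW.
  + by move=> j x jm xr; apply: upper => //; exact: ltW.
  rewrite sumB /C1 [leRHS]mulrDl; apply: lerD; first by rewrite mulrA.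
  rewrite mulrAC ler_pdivlMr//; apply: (ler_wpM2l (ltW Ct0)).
  apply: (le_trans (a_lo 0%N t Tt tT)); rewrite big_ord_recl lerDl.
  by apply: sumr_ge0 => i _; exact: a_ge0.
- move=> t Tt tT; apply: le_trans (step 0%N t Tt tT).
  by rewrite lerDr; exact: Mt_ge0.
- by move=> m t Tt tT; have := step m.+1 t Tt tT; rewrite rrS.
- move=> m t Tt tT; apply: Phi_lo => //; move: Tt tb0; lr.
move=> G1 G2 G3 G4.
exists (fun m => \sum_(j < m.+1) a j (T - tauk taub m / 2)) => m; split.
- by apply: (le_trans _ (G3 m)); rewrite ge_min lexx.
- move=> j x t jm xr Tt tT.
  have tm := tk0 m.
  have Tb : T - taub_b / 2 <= t by have := tkm m; move: Tt tkb tb0 tm; lr.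
  apply: (le_trans (upper j x t (ltW xr) Tb tT)).
  have h1 : T - tauk taub m <= t by move: Tt tm; lr.
  have h2 : T - 2 * tauk taub m <= T - tauk taub m / 2 by move: tm; lr.
  have g2 := G2 m j t jm h1 tT.
  have g1 := G1 m _ t h2 Tt tT.
  rewrite [leRHS](_ : _ = 2 * CU * (tauk taub j * (q ^+ (m - j) * (CG * \sum_(j0 < m.+1) a j0 (T - tauk taub m / 2))))); last by ring.
  rewrite ler_pM2l ?mulr_gt0// ler_pM2l//.
  apply: (le_trans g2); apply: ler_wpM2l => //; exact: exprn_ge0 (ltW q0).
have tm := tk0 m.
have g4 := G4 m.
apply: le_trans (lower m _ _ _ _ _).
- rewrite mulrAC [leRHS]mulrA [leRHS]mulrAC ler_pM2r//.
  apply: (@le_trans _ _ (c / 2 * c4 * \sum_(j < m.+1) a j (T - tauk taub m / 2))).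
    apply: ler_wpM2r; last by rewrite ge_min lexx orbT.
    by apply: sumr_ge0 => i _; exact: a_ge0.
  by rewrite -mulrA ler_pM2l// divr_gt0.
- by rewrite subrr enorm0 divr_ge0// mulr_ge0 ?(ltW b0) ?(ltW (rr_gt0 R m)).
- by move: tm; lr.
by move: tm; lr.
Qed.

End ProfileExistence.

Ltac pgt := repeat first [assumption | apply: divr_gt0 | apply: mulr_gt0 | by []].

(** * Oscillation of the ratio *)

Section Improvement.
Context (R : realType) (n : nat) (s lam Lam : R).
Implicit Types (x y p ev en : 'rV[R]_n) (z : 'rV[R]_n * R) (w v u : 'rV[R]_n * R -> R) (k : 'rV[R]_n -> R) (Om : set ('rV[R]_n * R)).
Local Notation rb := (@rb R).
Local Notation rr := (@rr R).
Local Notation tauk := (@tauk R s).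

(** Since [2 * s < 2], one step changes the time scale by at most [8 ^+ 2]. *)
Lemma tauk_pred taub (m : nat) : s < 1 -> 0 < taub -> tauk taub m <= 64 * tauk taub m.+1.
Proof.
move=> s1 t0; rewrite /tauk -(rrS R m) powRM ?(ltW (rr_gt0 R _))// (mulrCA 64) (ler_pM2l t0).
rewrite ler_pM2r ?rs_gt0 ?rr_gt0//.
have -> : 64 = 8 `^ 2%:R :> R by rewrite powR_mulrn//; ring.
by apply: ler_powR; [rewrite ler1n|move: s1; lr].
Qed.

(** [u] stands for [v1 - lo * v2] or [hi * v2 - v1], and [osc] for the width [hi - lo]. Being large
    at one point of the cone, [u] must have had mass before ([local_max]); this mass bounds [u]
    below on a ball of the cone afterwards ([local_min]); [positivity] applied to [u - th * osc * v]
    reaches the larger ball. Tails are needed for [u] and for this difference, hence the two values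
    of [th']. *)
Lemma improvement (b c kap taub Cp cp q : R) : par n s lam Lam -> 2^-1 <= s -> 0 < b -> b <= 1 -> 0 < c ->
  @lmin R n s lam Lam c b kap -> 0 < taub -> 4 * taub <= kap -> 0 < Cp -> 0 < cp -> 0 < q -> q < 1 ->
  exists th0 kt, [/\ 0 < th0, 0 < kt & forall k Om (e eu T osc th : R) v u x0 ev (Th : nat -> R) (m : nat), kern s lam Lam k ->
  ssub k e Om v -> ssub k e Om (fun z => - v z) -> ssub k eu Om u -> ssub k eu Om (fun z => - u z) -> 0 <= e -> 0 <= eu -> enorm ev = 1 ->
  access s Om x0 T ev b taub rb -> profile_bounds s Cp cp q taub T v x0 ev Th m.+1 -> 0 < osc -> 0 < th -> th <= th0 ->
  eu + th * osc * e <= kt * (osc * Th m.+1) ->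
  (forall x t, enorm (x - x0) < 16 * rr m.+1 -> T - tauk taub m.+1 / 2 < t -> t < T -> u (x, t) != 0 \/ v (x, t) != 0 ->
     exists2 rho, 0 < rho & cylinder rho (x, t) `<=` Om) ->
  (forall x t, enorm (x - x0) < 16 * rr m.+1 -> T - tauk taub m.+1 / 2 <= t -> t < T -> 0 <= u (x, t)) ->
  osc / 2 * v (x0 + rr m.+1 *: ev, T - 3 / 8 * tauk taub m.+1) <= u (x0 + rr m.+1 *: ev, T - 3 / 8 * tauk taub m.+1) ->
  (forall th' x t, th' = 0 \/ th' = th -> enorm (x - x0) < 8 * rr m.+1 -> T - tauk taub m.+1 / 2 < t -> t < T ->
     INT (fun y => ind (8 * rr m.+1 <= enorm y) * Num.max 0 (- (u (x + y, t) - th' * osc * v (x + y, t))) * k y) <= kt * (osc * Th m.+1)) ->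
  forall x t, enorm (x - x0) <= 4 * rr m.+1 -> T - tauk taub m.+1 / 4 <= t -> t < T -> th * osc * v (x, t) <= u (x, t)].
Proof.
move=> pp s2 b0 b1 c0 HL taub0 tkap Cp0 cp0 q0 q1; have [hn s0 s1 lam0 Lam0] := pp.
have tau8 : 0 < taub / 8 by rewrite divr_gt0.
have [CU CU0 hU] := local_max pp s2 tau8.
have b20 : 0 < b / 2 by rewrite divr_gt0.
have b21 : b / 2 <= 1 by move: b0 b1; lr.
have [CP [cP [CP0 cP0 hP]]] := positivity pp tau8 b20 b21.
(* Half of what [local_min] extracts from the mass [cp / (4 * CU) * (tk * A)]; the other half
   absorbs the right-hand side and the tail. *)
pose g1 := c * cp / (8 * CU).
have g10 : 0 < g1 by rewrite divr_gt0 ?mulr_gt0.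
exists (Num.min (g1 / (2 * Cp)) (cP * g1 / (8 * (CP * 64 * Cp)))), (Num.min (taub * cp / (4 * CU)) (Num.min g1 (taub * cP * g1 / 16))).
split.
- by rewrite lt_min; apply/andP; split; pgt.
- by rewrite !lt_min; apply/and3P; split; pgt.
move=> k Om e eu T osc th v u x0 ev Th m kk sv snv su snu e0 eu0 hev hacc [pb1 pb2 pb3] osc0 th_gt0.
rewrite le_min => /andP[th1 th2].
set kt := Num.min _ _.
have [kt1 kt2 kt3] : [/\ kt <= taub * cp / (4 * CU), kt <= g1 & kt <= taub * cP * g1 / 16].
  by rewrite /kt; split; rewrite !ge_min ?lexx ?orbT.
have kt0 : 0 < kt by rewrite /kt !lt_min; apply/and3P; split; pgt.
move: kt kt1 kt2 kt3 kt0 => kt kt1 kt2 kt3 kt0.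
move=> hkt hint hu hpt htail.
have [uu [Mu bu] vu] := su; have [_ _ vnu] := snu.
have r0 : 0 < rr m.+1 := rr_gt0 R _.
have rs0 := rs_gt0 s r0.
have tk0 : 0 < tauk taub m.+1 := tauk_gt0 s _ taub0.
have tkr : tauk taub m.+1 = taub * rr m.+1 `^ (2 * s) by [].
have tkp := tauk_pred m s1 taub0.
have rS : 8 * rr m.+1 = rr m := rrS R m.
set tk := tauk taub m.+1 in hint hu hpt htail pb2 pb3 tk0 tkr tkp *.
set r := rr m.+1 in hint hu hpt htail pb2 pb3 r0 rs0 tkr rS *.
pose A := osc * Th m.+1.
have Th0 : 0 < Th m.+1.
  by rewrite -(pmulr_rgt0 _ (exprn_gt0 m.+1 q0)) (lt_le_trans cp0).
have A0 : 0 < A by rewrite mulr_gt0.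
have eu_le : eu <= kt * A by apply: le_trans hkt; rewrite lerDl !mulr_ge0// ltW.
pose rs := r `^ (2 * s).
(* Mass is collected between [sA] and [s1'], the bound in the cone holds from [s1'] on, and
   [positivity] takes another [tk / 8], ending at [T - tk / 4]. *)
pose sA := T - tk / 2; pose s1' := T - 3 / 8 * tk.
pose p := x0 + r *: ev.
have pev : enorm (p - x0) = r by rewrite /p addrC addKr enormZ hev mulr1 ger0_norm ?(ltW r0).
have [mu hmu] := primitive (continuous_Mt (x := x0) pp uu bu r0).
have mass : cp / (4 * CU) * (tk * A) <= mu s1' - mu sA.
  have := hU k Om u Mu eu x0 r sA T mu kk uu bu eu0 r0 vu hmu.
  have mono t : sA <= t -> mu sA <= mu t by apply: (C1fun_le hmu) => ?; exact: Mt_ge0.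
  move=> /(_ mono) H; have {}H := H _ p s1' _ _ _.
  have : u (p, s1') <= CU * (r `^ (2 * s) * eu + (mu s1' - mu sA)).
    apply: H.
    - by move=> y t yr /andP[t1 t2] uy; apply: hint => //; left; rewrite gt_eqF.
    - by rewrite pev; move: r0; lr.
    - rewrite mulrAC -tkr /sA /s1'; move: tk0; lr.
    - by rewrite /s1'; move: tk0; lr.
  have h1 : osc / 2 * (cp * tk * Th m.+1) <= u (p, s1').
    by apply: le_trans hpt; rewrite ler_wpM2l// divr_ge0// ltW.
  have h2 : CU * (r `^ (2 * s) * eu) <= cp / 4 * (tk * A).
    apply: (@le_trans _ _ (CU * (r `^ (2 * s) * (taub * cp / (4 * CU) * A)))).
      rewrite (ler_pM2l CU0) ler_pM2l//; apply: (le_trans eu_le); by rewrite ler_pM2r.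
    by rewrite tkr le_eqVlt; apply/orP; left; apply/eqP; field; rewrite gt_eqF.
  rewrite (_ : osc / 2 * _ = 2 * (cp / 4 * (tk * A))) in h1; last by rewrite /A; field.
  move=> h3.
  have : cp / 4 * (tk * A) <= CU * (mu s1' - mu sA) by move: h1 h2 h3; lr.
  move=> h4; rewrite -(ler_pM2l CU0); apply: le_trans h4.
  by rewrite le_eqVlt; apply/orP; left; apply/eqP; field; rewrite gt_eqF.
have part1 x t : enorm (x - p) <= b * r / 2 -> s1' <= t -> t < T -> g1 * (tk * A) <= u (x, t).
  move=> xr st tT.
  have kA0 : 0 <= kt * A by rewrite mulr_ge0// ltW.
  have npev : enorm (p - x0) <= 2 * r by rewrite pev; move: r0; lr.
  have win : T - sA <= kap * r `^ (2 * s).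
    apply: (@le_trans _ _ (4 * taub * r `^ (2 * s))); last by rewrite ler_pM2r.
    by rewrite -mulrA -tkr /sA; move: tk0; lr.
  have := HL k Om u Mu eu (kt * A) x0 p r sA T mu kk uu bu eu0 kA0 r0 vnu hmu npev win.
  move=> H; have {}H := H _ _ _ x t xr _ tT.
  have key : c * (mu t - mu sA) - (eu + kt * A) * (t - sA) <= u (x, t).
    apply: H.
    - by move=> y v' yr h1 h2; exact: hu.
    - move=> y t' yr h1 h2.
      have yr8 : enorm (y - x0) < 8 * r.
        have := ler_enormD (y - p) (p - x0); rewrite (_ : y - p + (p - x0) = y - x0); last by vec.
        have : b * r <= 1 * r by rewrite ler_pM2r.
        by rewrite pev; move: yr r0; lr.
      have := htail 0 y t' (or_introl erefl) yr8 h1 h2.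
      rewrite (_ : (fun y0 => _) = (fun y0 => ind (8 * r <= enorm y0) * Num.max 0 (- u (y + y0, t')) * k y0))//.
      by apply/funext => y0; rewrite !mul0r subr0.
    - move=> y t' yr h1 h2; apply: (hacc r r0) => //.
        by rewrite /r; have := rr_le R m.+1; have := rb_gt0 R; lr.
      by rewrite -tkr; move: h1 tk0; rewrite /sA; lr.
    - by move: st tk0; rewrite /s1' /sA; lr.
  have up : mu s1' <= mu t by apply: (C1fun_le hmu) st => ?; exact: Mt_ge0.
  have h1 : c * (cp / (4 * CU) * (tk * A)) <= c * (mu t - mu sA).
    by rewrite (ler_pM2l c0); move: mass up; lr.
  have h2 : (eu + kt * A) * (t - sA) <= 2 * (g1 * A) * (tk / 2).
    apply: ler_pM; [exact: addr_ge0|by move: st tk0; rewrite /s1' /sA; lr| |].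
      have : kt * A <= g1 * A by rewrite ler_pM2r.
      by move: eu_le; lr.
    by move: tT; rewrite /sA; lr.
  have h3 : c * (cp / (4 * CU) * (tk * A)) = 2 * (g1 * (tk * A)) by rewrite /g1; field; rewrite gt_eqF.
  by move: key h1 h2; rewrite h3; lr.
pose eu' := eu + th * osc * e.
have tho : 0 < th * osc by rewrite mulr_gt0.
pose u' z := 1 * u z - th * osc * v z.
have [uu' [Mu' bu'] _] : ssub k (1 * eu + th * osc * e) Om u' := ssub_comb pp kk ltr01 tho su snv.
have [_ _ vnu'] : ssub k (1 * eu + th * osc * e) Om (fun z => - u' z) := ssub_combN pp kk ltr01 tho snu sv.
move=> x t xr tT tT'.
pose a := th * osc * (Cp * (64 * tk) * (q * Th m.+1)).
have a0 : 0 <= a by rewrite /a !mulr_ge0// ltW.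
have eu'0 : 0 <= 1 * eu + th * osc * e by rewrite mul1r addr_ge0// mulr_ge0// ltW.
have kA0 : 0 <= kt * A by rewrite mulr_ge0// ltW.
have npev : enorm (p - x0) <= 2 * r by rewrite pev; move: r0; lr.
have V0 : 0 < g1 * (tk * A) / 2 by rewrite divr_gt0// mulr_gt0// mulr_gt0.
have := hP k Om u' Mu' (1 * eu + th * osc * e) (kt * A) x0 p r s1' T a (g1 * (tk * A) / 2) kk uu' bu' eu'0 kA0 r0 vnu' npev a0 V0.
move=> H; suff : 0 <= u' (x, t) by rewrite /u' mul1r subr_ge0.
have sA1 : sA < s1' by rewrite /sA /s1'; move: tk0; lr.
apply: (H _ _ _ _ _ x t xr _ tT').
- move=> y t' yr h1 h2.
  have h1' : sA <= t' by move: h1 sA1; lr.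
  have ym : enorm (y - x0) < 8 * rr m by move: yr; rewrite -rS; move: r0; lr.
  have v_le := pb2 m y t' (leqnSn m) ym h1' h2.
  rewrite subSnn expr1 in v_le.
  have v_le2 : v (y, t') <= Cp * (64 * tk) * (q * Th m.+1).
    apply: (le_trans v_le); apply: ler_wpM2r; first by rewrite mulr_ge0// ltW.
    by rewrite ler_pM2l.
  have := hu y t' yr h1' h2.
  have : th * osc * v (y, t') <= a by rewrite /a ler_pM2l.
  by rewrite /u' mul1r; lr.
- move=> y t' yr h1 h2.
  have h1' : sA <= t' by move: h1 sA1; lr.
  have yr' : enorm (y - p) <= b * r / 2 by rewrite mulrAC; exact: ltW.
  have uy := part1 y t' yr' h1 h2.
  have ym : enorm (y - x0) < 8 * r.
    have := ler_enormD (y - p) (p - x0); rewrite (_ : y - p + (p - x0) = y - x0); last by vec.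
    have : b * r <= 1 * r by rewrite ler_pM2r.
    by rewrite pev; move: yr' r0; lr.
  have v_le := pb2 m.+1 y t' (leqnn _) ym h1' h2.
  rewrite subnn expr0 mul1r in v_le.
  have : th * osc * v (y, t') <= g1 * (tk * A) / 2.
    apply: (@le_trans _ _ (g1 / (2 * Cp) * osc * (Cp * tk * Th m.+1))).
      apply: (@le_trans _ _ (th * osc * (Cp * tk * Th m.+1))); first by rewrite ler_pM2l.
      by apply: ler_wpM2r; [rewrite !mulr_ge0// ltW|rewrite ler_pM2r].
    by rewrite /A le_eqVlt; apply/orP; left; apply/eqP; field; rewrite gt_eqF.
  by rewrite /u' mul1r; move: uy; lr.
- move=> y t' yr h1 h2.
  have h1' : sA < t' by move: h1 sA1; lr.
  have := htail th y t' (or_intror erefl) yr h1' h2.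
  rewrite (_ : (fun y0 => _) = (fun y0 => ind (8 * r <= enorm y0) * Num.max 0 (- u' (y + y0, t')) * k y0))//.
  by apply/funext => y0; rewrite /u' mul1r.
- move=> y t' yr h1 h2 uy; apply: hint => //.
  + by move: yr r0; lr.
  + by move: h1 sA1; rewrite /sA; lr.
  + case: (eqVneq (v (y, t')) 0) => v0; last by right.
    by left; move: uy; rewrite /u' v0 mulr0 subr0 mul1r => uy; rewrite lt_eqF.
- have h1 : CP * a <= cP * g1 / 8 * (tk * A).
    apply: (@le_trans _ _ (CP * (th * osc * (Cp * (64 * tk) * (1 * Th m.+1))))).
      rewrite (ler_pM2l CP0) /a ler_pM2l// ler_wpM2l//; first by rewrite !mulr_ge0// ltW.
      by rewrite ler_pM2r// ltW.
    rewrite (_ : CP * _ = th * (CP * 64 * Cp * (tk * A))); last by rewrite /A; ring.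
    apply: (@le_trans _ _ (cP * g1 / (8 * (CP * 64 * Cp)) * (CP * 64 * Cp * (tk * A)))).
      by apply: ler_wpM2r => //; rewrite !mulr_ge0// ltW.
    by rewrite le_eqVlt; apply/orP; left; apply/eqP; field; rewrite !gt_eqF.
  have h2 : r `^ (2 * s) * (1 * eu + th * osc * e + kt * A) <= cP * g1 / 8 * (tk * A).
    apply: (@le_trans _ _ (r `^ (2 * s) * (2 * (taub * cP * g1 / 16 * A)))).
      rewrite ler_pM2l// mul1r.
      have : kt * A <= taub * cP * g1 / 16 * A by rewrite ler_pM2r.
      by move: hkt; rewrite -/A; lr.
    by rewrite tkr le_eqVlt; apply/orP; left; apply/eqP; field.
  apply: (@le_lt_trans _ _ (2 * (cP * g1 / 8 * (tk * A)))); first by move: h1 h2; lr.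
  have : 0 < cP * g1 * (tk * A) by pgt.
  by lr.
by rewrite mulrAC -tkr /s1'; move: tT; lr.
Qed.

End Improvement.

(** * Geometric sums *)

Section GeometricSums.
Context (R : realType).

Lemma geo_sum_le (y : R) (m : nat) : 0 <= y -> y < 1 -> \sum_(i < m) y ^+ i <= (1 - y)^-1.
Proof.
move=> y0 y1; have y10 : 0 < 1 - y by rewrite subr_gt0.
rewrite -[leRHS]mul1r ler_pdivlMr// mulrC -[X in X * _]opprB mulNr -subrX1 opprB gerBl.
exact: exprn_ge0.
Qed.

(** Writing [s1] and [s2] for the two sums, the difference at the next index is
    [q * (s1 - s2) + (y - q) * s1]; the bound is the fixed point of this recursion. *)
Lemma geo_sum_diff (q y : R) (m : nat) : 0 <= q -> q <= y -> y < 1 ->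
  \sum_(i < m) y ^+ i - \sum_(i < m) q ^+ i <= (y - q) / ((1 - y) * (1 - q)).
Proof.
move=> q0 qy y1; have y10 : 0 < 1 - y by rewrite subr_gt0.
have q10 : 0 < 1 - q by move: qy y1; lr.
have S (z : R) l : \sum_(i < l.+1) z ^+ i = 1 + z * \sum_(i < l) z ^+ i.
  by rewrite big_ord_recl mulr_sumr; congr (_ + _); apply: eq_bigr => i _; rewrite exprS.
elim: m => [|m IH]; first by rewrite !big_ord0 subr0 divr_ge0 ?subr_ge0// mulr_ge0 ?(ltW q10) ?(ltW y10).
rewrite !S; have y0 := le_trans q0 qy; have := geo_sum_le m y0 y1.
move: (\sum_(_ < _) _) (\sum_(_ < _) _) IH => s2 s1 IH h.
rewrite (_ : 1 + y * s1 - _ = q * (s1 - s2) + (y - q) * s1); last by ring.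
have h1 : q * (s1 - s2) <= q * ((y - q) / ((1 - y) * (1 - q))) by exact: ler_wpM2l.
have h2 : (y - q) * s1 <= (y - q) * (1 - y)^-1 by apply: ler_wpM2l => //; rewrite subr_ge0.
apply: (le_trans (lerD h1 h2)); rewrite le_eqVlt; apply/orP; left; apply/eqP; field.
by rewrite !gt_eqF.
Qed.

Lemma rev_sum (F : nat -> R) (m : nat) : \sum_(j < m) F (m - j)%N = \sum_(i < m) F i.+1.
Proof.
elim: m => [|m IH]; first by rewrite !big_ord0.
by rewrite big_ord_recl big_ord_recr /= subn0 addrC -IH; congr (_ + _); apply: eq_bigr.
Qed.

(** The bracket measures by how much a coarser oscillation exceeds the current one. It grows like a
    power of [(1 - th)^-1], but [q / (1 - th)] stays below 1, and it is of first order in [th]; so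
    the whole sum is of order [th], with a constant that depends on [q] alone. *)
Lemma decay_sum (q th : R) (m : nat) : 0 < q -> q < 1 -> 0 < th -> th <= (1 - q) / 2 ->
  \sum_(j < m) q ^+ (m - j) * ((1 - th)^-1 ^+ (m - j).-1 - 1 + th) <= 9 / (1 - q) ^+ 2 * th.
Proof.
move=> q0 q1 th0 thq.
rewrite (rev_sum (fun i => q ^+ i * ((1 - th)^-1 ^+ i.-1 - 1 + th))) /=.
have v0 : 2^-1 <= 1 - th by move: thq q0; lr.
have v00 : 0 < 1 - th by move: v0; lr.
(* The effective ratio; [th <= (1 - q) / 2] leaves it at distance at least [(1 - q) / 2] from 1. *)
pose y := q / (1 - th).
have qy : q <= y by rewrite ler_pdivlMr// ler_piMr ?(ltW q0)//; move: th0; lr.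
have y2 : (1 - q) / 2 <= 1 - y.
  rewrite lerBrDr -lerBrDl ler_pdivrMr//; move: thq q0 q1; clrP; nra.
have y1 : y < 1 by move: y2 q1; lr.
have -> : \sum_(i < m) q ^+ i.+1 * ((1 - th)^-1 ^+ i - 1 + th) =
  q * ((\sum_(i < m) y ^+ i - \sum_(i < m) q ^+ i) + th * \sum_(i < m) q ^+ i).
  rewrite -sumrB mulr_sumr -big_split mulr_sumr; apply: eq_bigr => i _ /=.
  by rewrite /y exprMn exprS; ring.
have d1 := geo_sum_diff m (ltW q0) qy y1.
have d2 := geo_sum_le m (ltW q0) q1.
have q10 : 0 < 1 - q by move: q1; lr.
have yq : y - q <= 2 * th.
  have e : y * (1 - th) = q by rewrite /y divfK// gt_eqF.
  by move: e y1 th0; clrP; nra.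
have d3 : (y - q) / ((1 - y) * (1 - q)) <= 2 * th * (2 / (1 - q) ^+ 2).
  apply: ler_pM => //; first by rewrite subr_ge0.
    by rewrite invr_ge0 mulr_ge0 ?(ltW q10)// subr_ge0 ltW.
  rewrite (_ : 2 / (1 - q) ^+ 2 = ((1 - q) / 2 * (1 - q))^-1); last by field; rewrite gt_eqF.
  by rewrite lef_pV2 ?posrE ?mulr_gt0 ?subr_gt0 ?ler_pM2r ?divr_gt0.
have d4 : th * \sum_(i < m) q ^+ i <= th * (1 - q)^-1 by rewrite ler_pM2l.
have d5 : (1 - q)^-1 <= ((1 - q) ^+ 2)^-1.
  by rewrite lef_pV2 ?posrE ?exprn_gt0// expr2 ler_piMr ?(ltW q10)//; move: q0; lr.
have d6 : th * (1 - q)^-1 <= th * ((1 - q) ^+ 2)^-1 by rewrite ler_pM2l.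
have i0 : 0 < ((1 - q) ^+ 2)^-1 by rewrite invr_gt0 exprn_gt0.
have key : (\sum_(i < m) y ^+ i - \sum_(i < m) q ^+ i) + th * \sum_(i < m) q ^+ i <= 5 * (th * ((1 - q) ^+ 2)^-1).
  by move: d1 d3 d4 d6; lr.
have t0 : 0 < th * ((1 - q) ^+ 2)^-1 by rewrite mulr_gt0.
rewrite (_ : 9 / _ * th = 9 * (th * ((1 - q) ^+ 2)^-1)); last by ring.
apply: (@le_trans _ _ (q * (5 * (th * ((1 - q) ^+ 2)^-1)))); first by rewrite ler_pM2l.
by move: t0 q1 q0; clrP; nra.
Qed.

End GeometricSums.

(** * Tails of the negative part over the scales *)

Section TailChain.
Context (R : realType) (n : nat) (s lam Lam : R).
Implicit Types (x y p ev en : 'rV[R]_n) (z : 'rV[R]_n * R) (w v u : 'rV[R]_n * R -> R) (k : 'rV[R]_n -> R) (Om : set ('rV[R]_n * R)).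
Local Notation rb := (@rb R).
Local Notation rr := (@rr R).

Lemma intg_sum (l : nat) (f : nat -> 'rV[R]_n -> R) : (forall j, intg (f j)) ->
  intg (fun y => \sum_(j < l) f j y) /\ INT (fun y => \sum_(j < l) f j y) = \sum_(j < l) INT (f j).
Proof.
move=> h; elim: l => [|l [IHi IH]].
  rewrite (_ : (fun y => _) = (fun=> 0)); last by apply/funext => y; rewrite big_ord0.
  by rewrite big_ord0 INT0; split => //; exact: intg0.
rewrite (_ : (fun y => _) = (fun y => (\sum_(j < l) f j y) + f l y)); last first.
  by apply/funext => y; rewrite big_ord_recr.
by rewrite (INTD IHi (h l)) IH big_ord_recr; split => //; apply: intgD IHi (h l).
Qed.

(** Dyadic summation as for the mass, but around a point [x] that is not the common centre: bounds
    are assumed on balls of radius [16 * rr j.+1] about [x0], and a point outside such a ball is at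
    distance at least [8 * rr j.+1] from [x]. Beyond the coarsest ball the growth bound takes
    over. *)
Lemma tail_chain (g C0 : R) : par n s lam Lam -> 0 < g -> g < 2 * s -> 0 < C0 -> exists Cm Ct, [/\ 0 < Cm, 0 < Ct &
  forall k w (M : R) x0 x (t K : R) (W : nat -> R) (m : nat), kern s lam Lam k -> UC w -> bdd w M -> enorm x0 <= 1 ->
  enorm (x - x0) < 8 * rr m.+1 -> 0 <= K -> (forall j, 0 <= W j) ->
  (forall j x', (j <= m)%N -> enorm (x' - x0) < 16 * rr j.+1 -> - w (x', t) <= W j) ->
  (forall z, - w z <= K * (C0 * (1 + enorm z.1) `^ (2 * s - g))) ->
  INT (fun y => ind (8 * rr m.+1 <= enorm y) * Num.max 0 (- w (x + y, t)) * k y) <=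
  \sum_(j < m.+1) W j * (Cm / rr j.+1 `^ (2 * s)) + K * Ct].
Proof.
move=> pp g0 gs C00; have [hn s0 s1 lam0 Lam0] := pp.
have [Cm [cf [Cm0 cf0 kbd]]] := kern_bounds pp.
have r10 := rr_gt0 R 1.
have r80 : 0 < 8 * rr 1 by rewrite mulr_gt0.
have [Ct Ct0 hCt] := tail_growth pp r80 g0 gs C00.
exists Cm, Ct; split => // k w M x0 x t K W m kk uw bw hx0 hx K0 W0 hW hK.
have rm0 : 0 < 8 * rr m.+1 by rewrite mulr_gt0// rr_gt0.
have rr1m : rr m.+1 <= rr 1 by exact: rr_antitone.
have x2 : enorm x <= 2.
  have := ler_enormD (x - x0) x0; rewrite subrK.
  by have := rr_le R m.+1; move: hx hx0; rewrite rbE; lr.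
have [iT IT] := hCt k kk x x2.
have rS2 j : 8 * rr j.+2 = rr j.+1 := rrS R j.+1.
have kb j : intg (fun y => ind (8 * rr j.+2 <= enorm y) * k y) /\
  INT (fun y => ind (8 * rr j.+2 <= enorm y) * k y) <= Cm / rr j.+1 `^ (2 * s).
  by rewrite rS2; have [_ _ h1 h2 _] := kbd k kk _ (rr_gt0 R j.+1).
have [iS eS] := intg_sum m.+1 (fun j => intgZ (W j) (proj1 (kb j))).
pose f y := Num.max 0 (- w (x + y, t)).
have f0 y : 0 <= f y by exact: max0_ge0.
pose far y := K * (ind (8 * rr 1 <= enorm y) * (C0 * (1 + enorm (x + y)) `^ (2 * s - g))).
have gr0 y : 0 <= C0 * (1 + enorm (x + y)) `^ (2 * s - g) by apply: mulr_ge0; [exact: ltW|exact: powR_ge0].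
have far0 y : 0 <= far y by apply: mulr_ge0 => //; exact: mulr_ge0 (ind_ge0 _ _) (gr0 y).
pose T l y := \sum_(j < l) W j * ind (8 * rr j.+2 <= enorm y).
have Tt j y : 0 <= W j * ind (8 * rr j.+2 <= enorm y) by exact: mulr_ge0 (W0 j) (ind_ge0 _ _).
have T0 l y : 0 <= T l y by apply: sumr_ge0 => j _.
have TS l y : T l.+1 y = T l y + W l * ind (8 * rr l.+2 <= enorm y) by rewrite /T big_ord_recr.
have shift y : enorm (x + y - x0) <= enorm (x - x0) + enorm y by rewrite addrAC ler_enormD.
have Q l y : (l <= m)%N -> 8 * rr m.+1 <= enorm y -> 16 * rr l.+1 <= enorm (x + y - x0) -> f y <= T l y + far y.
  elim: l => [|l IH] lm ym zl.
    have y1 : 8 * rr 1 <= enorm y by have := shift y; move: zl hx rr1m; lr.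
    rewrite /far (indT _ y1) mul1r ler_wpDl//.
    by apply: max0_le; [exact: mulr_ge0|exact: hK].
  case: (ltP (enorm (x + y - x0)) (16 * rr l.+1)) => zl'.
    have y1 : 8 * rr l.+2 <= enorm y.
      have : rr m.+1 <= rr l.+2 by apply: rr_antitone.
      by have := shift y; move: zl hx; lr.
    rewrite TS (indT _ y1) mulr1 -addrA [X in _ <= _ + X]addrC addrA ler_wpDl ?addr_ge0//.
    by apply: max0_le => //; apply: hW zl'; exact: ltnW.
  by apply: (le_trans (IH (ltnW lm) ym zl')); rewrite lerD2r TS lerDl.
have main y : 8 * rr m.+1 <= enorm y -> f y <= T m.+1 y + far y.
  move=> ym; case: (ltP (enorm (x + y - x0)) (16 * rr m.+1)) => zm; last first.
    by apply: (le_trans (Q m y (leqnn m) ym zm)); rewrite lerD2r TS lerDl.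
  have y1 : 8 * rr m.+2 <= enorm y by have := rr_antitone R (leqnSn m.+1); move: ym; lr.
  rewrite TS (indT _ y1) mulr1 -addrA [X in _ <= _ + X]addrC addrA ler_wpDl ?addr_ge0//.
  by apply: max0_le => //; exact: hW zm.
apply: le_trans (_ : INT (fun y => (\sum_(j < m.+1) W j * (ind (8 * rr j.+2 <= enorm y) * k y)) + K * (ind (8 * rr 1 <= enorm y) * (C0 * (1 + enorm (x + y)) `^ (2 * s - g)) * k y)) <= _).
  apply: (INT_le (intg_tail x t pp kk uw bw rm0) (intgD iS (intgZ K iT))) => y.
  rewrite (_ : \sum_(j < m.+1) _ + _ = (T m.+1 y + far y) * k y); last first.
    rewrite [RHS]mulrDl.
    have -> : far y * k y = K * (ind (8 * rr 1 <= enorm y) * (C0 * (1 + enorm (x + y)) `^ (2 * s - g)) * k y) by rewrite /far; ring.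
    by have -> : T m.+1 y * k y = \sum_(j < m.+1) W j * (ind (8 * rr j.+2 <= enorm y) * k y) by rewrite /T mulr_suml; apply: eq_bigr => j _; rewrite mulrA.
  apply: ler_wpM2r; first exact: (kern_ge0 pp y kk).
  case: (leP (8 * rr m.+1) (enorm y)) => ym; last by rewrite /ind/= mul0r addr_ge0.
  by rewrite /ind/= mul1r; exact: main.
rewrite (INTD iS (intgZ K iT)) eS (INTZ K iT); apply: lerD; last exact: ler_wpM2l.
apply: ler_sum => j _; rewrite (INTZ _ (proj1 (kb j))); apply: ler_wpM2l => //.
exact: (proj2 (kb j)).
Qed.

End TailChain.

Section Oscillation.
Context (R : realType) (n : nat) (s lam Lam : R).
Implicit Types (x y p ev en : 'rV[R]_n) (z : 'rV[R]_n * R) (w v u : 'rV[R]_n * R -> R) (k : 'rV[R]_n -> R) (Om : set ('rV[R]_n * R)).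
Local Notation rb := (@rb R).
Local Notation rr := (@rr R).
Local Notation tauk := (@tauk R s).

(** The last term is the smallest, so [N * q ^+ N] is at most the geometric sum and hence at most
    [(1 - q)^-1]. *)
Lemma small_power (q d : R) : 0 < q -> q < 1 -> 0 < d -> exists k0 : nat, q ^+ k0.+1 <= d.
Proof.
move=> q0 q1 d0; have q10 : 0 < 1 - q by rewrite subr_gt0.
pose N := Num.bound ((1 - q)^-1 / d); exists N.
have h : (1 - q)^-1 / d < N%:R by apply: Num.Theory.archi_boundP; rewrite divr_ge0 ?invr_ge0 ?(ltW d0) ?(ltW q10).
have q0' := ltW q0; have q1' := ltW q1.
have h2 : N%:R * q ^+ N <= (1 - q)^-1.
  apply: le_trans (geo_sum_le N q0' q1).
  have -> : N%:R * q ^+ N = \sum_(i < N) q ^+ N by rewrite sumr_const card_ord mulr_natl.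
  by apply: ler_sum => i _; apply: ler_wiXn2l => //; exact: ltnW.
have qN : 0 < q ^+ N by rewrite exprn_gt0.
apply: (@le_trans _ _ (q ^+ N)); first by rewrite exprS ler_piMl// ltW.
rewrite -(ler_pM2l (_ : 0 < N%:R)); last by apply: le_lt_trans h; rewrite divr_ge0 ?invr_ge0 ?(ltW d0) ?(ltW q10).
by apply: (le_trans h2); move: (ltW h); rewrite ler_pdivrMr.
Qed.

(** Nested intervals for the ratio, with comparability as the start. At a new scale one of
    [v1 - lo * v2] and [hi * v2 - v1] is at least half the width times [v2] at the reference point
    in the cone, and [improvement] moves that end inward. On a coarser ball the negative part of
    this function is at most the excess of the coarser width times [v2], where the profile of [v2]
    brings in a power of [q]; [decay_sum] adds these contributions. *)
Lemma oscillation (g C0 b c kap taub t1 Cp cp q C4 : R) : par n s lam Lam -> 2^-1 <= s -> 0 < g -> g < 2 * s -> 0 < C0 ->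
  0 < b -> b <= 1 -> 0 < c -> @lmin R n s lam Lam c b kap -> 0 < taub -> 4 * taub <= kap -> 8 * taub <= t1 ->
  0 < Cp -> 0 < cp -> 0 < q -> q < 1 -> 1 <= C4 ->
  exists (th : R) (j0 : nat) (eJ : R), [/\ 0 < th, th <= 2^-1, 0 < eJ &
  forall k Om (e T Rb : R) v1 v2 x0 ev Th, kern s lam Lam k -> sol s k g C0 Rb (7 / 4 * t1) e Om v1 ->
  sol s k g C0 Rb (7 / 4 * t1) e Om v2 -> 2 <= Rb -> 0 <= e -> e <= eJ -> enorm x0 < 1 -> - t1 < T -> T < 0 ->
  enorm ev = 1 -> access s Om x0 T ev b taub rb -> (forall m, profile_bounds s Cp cp q taub T v2 x0 ev Th m) ->
  (forall x t, enorm (x - x0) <= 4 * rb -> T - taub * rb `^ (2 * s) <= t -> t < T -> 0 <= v2 (x, t)) ->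
  (forall x t, enorm (x - x0) <= 4 * rb -> T - taub * rb `^ (2 * s) <= t -> t < T -> v1 (x, t) <= C4 * v2 (x, t)) ->
  (forall x t, enorm (x - x0) <= 4 * rb -> T - taub * rb `^ (2 * s) <= t -> t < T -> v2 (x, t) <= C4 * v1 (x, t)) ->
  forall m : nat, exists lo, forall x t, enorm (x - x0) < 16 * rr m -> T - tauk taub m / 2 <= t -> t < T ->
    lo * v2 (x, t) <= v1 (x, t) /\ v1 (x, t) <= (lo + C4 * (1 - th) ^+ (m - j0)) * v2 (x, t)].
Proof.
move=> pp s2 g0 gs C00 b0 b1 c_gt0 HL taub0 tkap tt1 Cp0 cp0 q0 q1 C41; have [hn s0 s1 lam0 Lam0] := pp.
have [th0 [kt [th00 kt0 himp]]] := improvement pp s2 b0 b1 c_gt0 HL taub0 tkap Cp0 cp0 q0 q1.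
have [Cm [Ct [Cm0 Ct0 htail]]] := tail_chain pp g0 gs C00.
have C40 : 0 < C4 by move: C41; lr.
have q10 : 0 < 1 - q by rewrite subr_gt0.
pose C5 := 64 * taub * Cp * Cm.
have C50 : 0 < C5 by rewrite !mulr_gt0.
pose Kc := 1 + 3 * C4.
have Kc0 : 0 < Kc by rewrite addr_gt0// mulr_gt0.
(* In order: the range of [improvement], convergence in [decay_sum], and a sum over the annuli of at
   most half the tolerance [kt * A]. *)
pose th := Num.min th0 (Num.min ((1 - q) / 2) (kt * (1 - q) ^+ 2 / (18 * C5))).
have th_gt0 : 0 < th.
  rewrite !lt_min th00 !divr_gt0// ?mulr_gt0// exprn_gt0//.
have [th1 th2 th3] : [/\ th <= th0, th <= (1 - q) / 2 & th <= kt * (1 - q) ^+ 2 / (18 * C5)].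
  by rewrite /th; split; rewrite !ge_min ?lexx ?orbT.
have d0 : 0 < kt * C4 * cp / (2 * (Kc * Ct)) by rewrite divr_gt0 ?mulr_gt0.
(* Up to scale [k1.+1] no decay is claimed. From there on the profile, at least [cp / q ^+ m], is so
   large that the contribution [Kc * Ct] of the growth at infinity uses at most the other half of
   the tolerance. *)
have [k1 hk1] := small_power q0 q1 d0.
move: th th_gt0 th1 th2 th3 => th th_gt0 th1 th2 th3.
have th12 : th <= 2^-1 by move: th2 q0; lr.
have vt0 : 0 < 1 - th by move: th12; lr.
have vt1 : 1 - th <= 1 by move: th_gt0; lr.
have vtq : q <= 1 - th by move: th2 q1; lr.
exists th, k1.+1, (kt * C4 * cp / Kc); split => //; first by rewrite divr_gt0 ?mulr_gt0.
move=> k Om e T Rb v1 v2 x0 ev Th kk sl1 sl2 Rb2 e0 eJ hx0 T1 T0 hev hacc hprof nneg c12 c21.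
have [sv1 snv1 lo1 gr1 int1] := sl1; have [sv2 snv2 lo2 gr2 int2] := sl2.
have rb0 := rb_gt0 R.
pose osc j := C4 * (1 - th) ^+ (j - k1.+1).
have osc0 j : 0 < osc j by rewrite mulr_gt0// exprn_gt0.
have oscC j : osc j <= C4 by rewrite ler_piMr ?(ltW C40)// exprn_ile1// ltW.
have rr16 j : 16 * rr j <= 4 * rb by have := rr_le R j; move: rb0; lr.
have tk0 j : 0 < tauk taub j := tauk_gt0 s j taub0.
have tkb j : 8 * tauk taub j <= taub * rb `^ (2 * s).
  by apply: le_trans (tauk0 s2 taub0); rewrite ler_pM2l// tauk_antitone.
have tkt j : tauk taub j <= taub.
  have := tkb j; have := rb_pow_le1 s0 (R := R); rewrite -(ler_pM2l taub0) mulr1.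
  by move: (tk0 j); lr.
have winb j t : T - tauk taub j / 2 <= t -> T - taub * rb `^ (2 * s) <= t.
  by move=> h; have := tkb j; have := tk0 j; move: h; lr.
have x01 := ltW hx0.
pose Bd j l := forall x t, enorm (x - x0) < 16 * rr j -> T - tauk taub j / 2 <= t -> t < T ->
    l * v2 (x, t) <= v1 (x, t) /\ v1 (x, t) <= (l + osc j) * v2 (x, t).
have base j l : l = C4^-1 -> (j <= k1.+1)%N -> Bd j l.
  move=> -> jk x t xr Tt tT; have x4 : enorm (x - x0) <= 4 * rb by apply: ltW; exact: lt_le_trans (rr16 j).
  have Tb := winb j t Tt; have n2 := nneg x t x4 Tb tT.
  split; first by rewrite mulrC ler_pdivrMr// mulrC; exact: c21.
  have -> : osc j = C4 by rewrite /osc (_ : (j - k1.+1 = 0)%N) ?expr0 ?mulr1//; apply/eqP; rewrite subn_eq0.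
  apply: (le_trans (c12 x t x4 Tb tT)); rewrite mulrDl lerDr mulr_ge0// invr_ge0 ltW//.
(* The whole nested sequence is carried along, because the tail at a new scale uses the bounds at
   all coarser scales. *)
suff key d : exists lo : nat -> R, [/\ lo 0%N = C4^-1,
    (forall i j, (i <= j)%N -> (j <= k1 + d.+1)%N -> lo i <= lo j /\ lo j + osc j <= lo i + osc i) &
    forall j, (j <= k1 + d.+1)%N -> Bd j (lo j)].
  move=> m; have [lo [_ _ H]] := key m; exists (lo m); apply: H.
  by rewrite addnS -addSn leq_addl.
elim: d => [|d [lo [lo0 nest bd]]].
  exists (fun=> C4^-1); split => // [i j ij jk|j jk]; last by apply: base => //; rewrite -addn1.
  split => //; rewrite lerD2l /osc ler_pM2l//; apply: ler_wiXn2l => //; [exact: ltW|exact: leq_sub2r].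
rewrite !addnS in nest bd *; set m := (k1 + d)%N in nest bd *.
have Nk : (k1.+1 <= m.+1)%N by rewrite ltnS leq_addr.
have oscS : osc m.+2 = (1 - th) * osc m.+1.
  by rewrite /osc subSn// exprS mulrCA.
have [pb1 pb2 pb3] := hprof m.+1.
have Th0 : 0 < Th m.+1 by rewrite -(pmulr_rgt0 _ (exprn_gt0 m.+1 q0)) (lt_le_trans cp0).
pose A := osc m.+1 * Th m.+1.
(* The width decreases by [1 - th >= q] per scale and the profile is at least [cp] times the inverse
   power of [q], so their product does not decay. *)
have A_lo : C4 * cp / q ^+ k1.+1 <= A.
  have qk := exprn_gt0 k1.+1 q0.
  rewrite ler_pdivrMr//; apply: (@le_trans _ _ (C4 * (q ^+ m.+1 * Th m.+1))); first by rewrite ler_pM2l.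
  have e1 : q ^+ m.+1 = q ^+ (m.+1 - k1.+1) * q ^+ k1.+1 by rewrite -exprD subnK.
  have h1 : q ^+ (m.+1 - k1.+1) <= (1 - th) ^+ (m.+1 - k1.+1) by apply: lerXn2r => //; rewrite ?nnegrE ltW.
  have TT : 0 <= C4 * (Th m.+1 * q ^+ k1.+1) by apply: ltW; pgt.
  rewrite e1 /A /osc; move: h1 TT; move: (_ ^+ (m.+1 - k1.+1)) (_ ^+ (m.+1 - k1.+1)) => a2 a1 h1 TT.
  rewrite [leLHS](_ : _ = a1 * (C4 * (Th m.+1 * q ^+ k1.+1))); last by ring.
  rewrite [leRHS](_ : _ = a2 * (C4 * (Th m.+1 * q ^+ k1.+1))); last by ring.
  exact: ler_wpM2r.
have A_lo1 : C4 * cp <= A.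
  apply: le_trans A_lo; rewrite ler_pdivlMr ?exprn_gt0// ler_piMr// ?mulr_ge0 ?(ltW C40) ?(ltW cp0)//.
  by apply: exprn_ile1; exact: ltW.
have A_lo2 : Kc * Ct <= kt * A / 2.
  have h : q ^+ k1.+1 * (2 * (Kc * Ct)) <= kt * (C4 * cp).
    have D : 0 < 2 * (Kc * Ct) by pgt.
    have -> : kt * (C4 * cp) = kt * C4 * cp by ring.
    by move: hk1; rewrite (ler_pdivlMr _ _ D).
  have qk := exprn_gt0 k1.+1 q0.
  have h2 : C4 * cp <= A * q ^+ k1.+1 by rewrite -ler_pdivrMr.
  have h3 : kt * (C4 * cp) <= kt * (A * q ^+ k1.+1) by rewrite ler_pM2l.
  have h4 : q ^+ k1.+1 * (2 * (Kc * Ct)) <= q ^+ k1.+1 * (kt * A).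
    by apply: (le_trans h); apply: (le_trans h3); rewrite le_eqVlt; apply/orP; left; apply/eqP; ring.
  by move: h4; rewrite ler_pM2l//; lr.
have lo_ge j : (j <= m.+1)%N -> C4^-1 <= lo j.
  by move=> jm; rewrite -lo0; exact: (proj1 (nest 0%N j (leq0n j) jm)).
have hi_le j : (j <= m.+1)%N -> lo j + osc j <= 2 * C4.
  move=> jm; apply: (le_trans (proj2 (nest 0%N j (leq0n j) jm))); rewrite lo0.
  have C4i : C4^-1 <= 1 by rewrite (invf_le1 C40).
  by have := oscC 0%N; move: C4i C41; lr.
have Ci0 : 0 < C4^-1 by rewrite invr_gt0.
have lo_gt0 : 0 < lo m.+1 by apply: lt_le_trans Ci0 (lo_ge _ (leqnn _)).
have loC : lo m.+1 <= 2 * C4 by have := hi_le m.+1 (leqnn _); have := osc0 m.+1; lr.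
have hi_gt0 : 0 < lo m.+1 + osc m.+1 by rewrite addr_gt0.
have eeA : Kc * e <= kt * A.
  apply: (@le_trans _ _ (kt * (C4 * cp))); last by rewrite ler_pM2l.
  by rewrite mulrC mulrA -ler_pdivlMr.
have imp u eu : ssub k eu Om u -> ssub k eu Om (fun z => - u z) -> 0 <= eu -> eu <= (1 + 2 * C4) * e ->
  (forall z, - u z <= (1 + 2 * C4) * (C0 * (1 + enorm z.1) `^ (2 * s - g))) ->
  (forall j x t, (j <= m)%N -> enorm (x - x0) < 16 * rr j.+1 -> T - tauk taub m.+1 / 2 <= t -> t < T -> - u (x, t) <= (osc j.+1 - osc m.+1) * v2 (x, t)) ->
  (forall x t, enorm x < Rb -> - (7 / 4 * t1) < t -> t < 0 -> u (x, t) != 0 -> exists2 rho, 0 < rho & cylinder rho (x, t) `<=` Om) ->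
  osc m.+1 / 2 * v2 (x0 + rr m.+1 *: ev, T - 3 / 8 * tauk taub m.+1) <= u (x0 + rr m.+1 *: ev, T - 3 / 8 * tauk taub m.+1) ->
  forall x t, enorm (x - x0) <= 4 * rr m.+1 -> T - tauk taub m.+1 / 4 <= t -> t < T -> th * osc m.+1 * v2 (x, t) <= u (x, t).
  move=> su snu eu0 eue ugr ulow uint upt.
  have n2 j x t : enorm (x - x0) < 16 * rr j -> T - tauk taub m.+1 / 2 <= t -> t < T -> 0 <= v2 (x, t).
    move=> xr Tt tT; apply: nneg => //; last exact: winb Tt.
    by apply: ltW; exact: lt_le_trans (rr16 j).
  have ths : th * osc m.+1 <= C4.
    by apply: (@le_trans _ _ (1 * C4)); [apply: ler_pM => //; rewrite ?(ltW th_gt0) ?(ltW (osc0 _))//; move: th12; lr|rewrite mul1r].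
  apply: (himp k Om e eu T (osc m.+1) th v2 u x0 ev Th m kk sv2 snv2 su snu e0 eu0 hev hacc (hprof m.+1) (osc0 _) th_gt0 th1).
  - apply: le_trans eeA; rewrite -/A /Kc.
    have : th * osc m.+1 * e <= C4 * e by apply: ler_wpM2r.
    by move: eue; lr.
  - move=> x t xr Tt tT [ux|vx].
    + apply: uint => //; last exact: lt_trans T0.
        have := ler_enormD (x - x0) x0; rewrite subrK; have := rr16 m.+1.
        by move: xr hx0 Rb2; rewrite rbE; lr.
      by have := tkt m.+1; move: Tt T1 tt1 taub0; lr.
    + apply: int2 => //; last exact: lt_trans T0.
        have := ler_enormD (x - x0) x0; rewrite subrK; have := rr16 m.+1.
        by move: xr hx0 Rb2; rewrite rbE; lr.
      by have := tkt m.+1; move: Tt T1 tt1 taub0; lr.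
  - move=> x t xr Tt tT; have := ulow m x t (leqnn m) xr Tt tT.
    by rewrite subrr mul0r oppr_le0.
  - exact: upt.
  move=> th' x t hth' xr Tt tT.
  have Tt' := ltW Tt.
  have th'0 : 0 <= th' by case: hth' => ->; rewrite ?lexx ?(ltW th_gt0).
  have th'1 : th' <= th by case: hth' => ->; rewrite ?lexx ?(ltW th_gt0).
  pose u' z := u z - th' * osc m.+1 * v2 z.
  have [uu' [M' bu']] : UC u' /\ exists M', bdd u' M'.
    case: hth' => th'e.
      have -> : u' = u by apply/funext => z; rewrite /u' th'e !mul0r subr0.
      by have [h1 h2 _] := su; split.
    have tho : 0 < th' * osc m.+1 by rewrite th'e mulr_gt0.
    have [h1 h2 _] := ssub_comb pp kk ltr01 tho su snv2.
    have -> : u' = (fun z => 1 * u z - th' * osc m.+1 * v2 z) by apply/funext => z; rewrite mul1r.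
    by split.
  pose Dl j := osc j.+1 - osc m.+1 + th * osc m.+1.
  have osc_le j : (j <= m)%N -> osc m.+1 <= osc j.+1.
    move=> jm; rewrite /osc ler_pM2l//; apply: ler_wiXn2l => //; first exact: ltW.
    by apply: leq_sub2r.
  pose W j := (if (j <= m)%N then Dl j else 0) * (Cp * tauk taub j * (q ^+ (m.+1 - j) * Th m.+1)).
  have Cpj j : 0 <= Cp * tauk taub j * (q ^+ (m.+1 - j) * Th m.+1).
    have qj := exprn_gt0 (m.+1 - j) q0; have tj := tk0 j.
    by apply: ltW; pgt.
  have Dl0 j : (j <= m)%N -> 0 <= Dl j.
    by move=> jm; rewrite addr_ge0// ?subr_ge0 ?osc_le// mulr_ge0// ltW.
  have W0 j : 0 <= W j by rewrite /W; apply: mulr_ge0 => //; case: ifP => // jm; exact: Dl0.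
  have hW j x' : (j <= m)%N -> enorm (x' - x0) < 16 * rr j.+1 -> - u' (x', t) <= W j.
    move=> jm xr'; have v0 := n2 j.+1 x' t xr' Tt' tT.
    apply: (@le_trans _ _ (Dl j * v2 (x', t))).
      have h1 := ulow j x' t jm xr' Tt' tT.
      have h2 : th' * osc m.+1 * v2 (x', t) <= th * osc m.+1 * v2 (x', t).
        by apply: ler_wpM2r => //; apply: ler_wpM2r => //; exact: ltW.
      by rewrite /u' /Dl opprB mulrDl; move: h1 h2; lr.
    rewrite /W jm; apply: ler_wpM2l; first exact: Dl0.
    apply: pb2 => //; first exact: leqW.
    by apply: (lt_trans xr'); have := rrS R j; have := rr_gt0 R j; lr.
  have hK z : - u' z <= Kc * (C0 * (1 + enorm z.1) `^ (2 * s - g)).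
    have h1 := ugr z; have h2 := le_trans (ler_norm _) (gr2 z).
    have G0 : 0 <= C0 * (1 + enorm z.1) `^ (2 * s - g) by apply: mulr_ge0; [exact: ltW|exact: powR_ge0].
    have h3 : th' * osc m.+1 * v2 z <= C4 * (C0 * (1 + enorm z.1) `^ (2 * s - g)).
      apply: (@le_trans _ _ (th' * osc m.+1 * (C0 * (1 + enorm z.1) `^ (2 * s - g)))).
        by apply: ler_wpM2l => //; rewrite mulr_ge0// ltW.
      apply: ler_wpM2r => //; apply: le_trans ths; apply: ler_wpM2r => //; exact: ltW.
    by rewrite /u' /Kc opprB; move: h1 h3; move: (C0 * _) => G; lr.
  have := htail k u' M' x0 x t Kc W m kk uu' bu' x01 xr (ltW Kc0) W0 hW hK.
  move=> /le_trans; apply; rewrite -/A.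
  have sumW : \sum_(j < m.+1) W j * (Cm / rr j.+1 `^ (2 * s)) <= kt * A / 2.
    apply: (@le_trans _ _ (\sum_(j < m.+1) C5 * A * (q ^+ (m.+1 - j) * ((1 - th)^-1 ^+ (m.+1 - j).-1 - 1 + th)))).
      apply: ler_sum => j _; have jm : (j <= m)%N by rewrite -ltnS.
      rewrite /W jm.
      (* A coarser width is at most the current one divided by [1 - th] for each scale in between;
         the truncated exponents up to [k1.+1] only make it smaller. Here [(m.+1 - j).-1] is
         [m - j]. *)
      have DlA : Dl j <= osc m.+1 * ((1 - th)^-1 ^+ (m.+1 - j).-1 - 1 + th).
        rewrite /Dl mulrDr mulrBr mulr1 [osc m.+1 * th]mulrC lerD2r lerD2r.
        rewrite subSn//= exprVn ler_pdivlMr ?exprn_gt0//.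
        rewrite /osc -mulrA ler_pM2l// -exprD; apply: ler_wiXn2l; [exact: ltW|exact: vt1|].
        by rewrite leq_subLR addnA (addnC k1.+1) -leq_subLR; move: Nk jm; clear; lia.
      have rj := rs_gt0 s (rr_gt0 R j.+1).
      have tj : tauk taub j <= 64 * taub * rr j.+1 `^ (2 * s).
        by rewrite -mulrA; exact: tauk_pred.
      have e1 : (Cp * tauk taub j * (q ^+ (m.+1 - j) * Th m.+1)) * (Cm / rr j.+1 `^ (2 * s)) <= C5 * (q ^+ (m.+1 - j) * Th m.+1).
        rewrite [leLHS](_ : _ = Cp * Cm * (q ^+ (m.+1 - j) * Th m.+1) * (tauk taub j / rr j.+1 `^ (2 * s))); last by ring.
        rewrite [leRHS](_ : _ = Cp * Cm * (q ^+ (m.+1 - j) * Th m.+1) * (64 * taub)); last by rewrite /C5; ring.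
        apply: ler_wpM2l; last by rewrite ler_pdivrMr.
        by apply: ltW; rewrite !mulr_gt0// exprn_gt0.
      rewrite -mulrA [leRHS](_ : _ = osc m.+1 * ((1 - th)^-1 ^+ (m.+1 - j).-1 - 1 + th) * (C5 * (q ^+ (m.+1 - j) * Th m.+1))); last by rewrite /A; ring.
      apply: ler_pM => //; first exact: Dl0.
      by apply: mulr_ge0 => //; rewrite divr_ge0 ?(ltW Cm0) ?(ltW rj).
    rewrite -mulr_sumr; have ds := decay_sum m.+1 q0 q1 th_gt0 th2.
    have A0 : 0 < A by rewrite mulr_gt0.
    have CA : 0 < C5 * A by rewrite mulr_gt0.
    apply: (@le_trans _ _ (C5 * A * (9 / (1 - q) ^+ 2 * th))); first by rewrite ler_pM2l.
    apply: (@le_trans _ _ (C5 * A * (9 / (1 - q) ^+ 2 * (kt * (1 - q) ^+ 2 / (18 * C5))))).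
      by rewrite ler_pM2l// ler_wpM2l// divr_ge0// exprn_ge0// ltW.
    by rewrite le_eqVlt; apply/orP; left; apply/eqP; field; rewrite !gt_eqF.
  by move: sumW A_lo2; lr.
have win2 t : T - tauk taub m.+2 / 2 <= t -> T - tauk taub m.+1 / 4 <= t.
  by move=> h; have := taukS m.+1 s2 taub0; have := tk0 m.+2; move: h; lr.
have win3 t : T - tauk taub m.+2 / 2 <= t -> T - tauk taub m.+1 / 2 <= t.
  by move=> h; have := taukS m.+1 s2 taub0; have := tk0 m.+2; move: h; lr.
have r2 x : enorm (x - x0) < 16 * rr m.+2 -> enorm (x - x0) <= 4 * rr m.+1.
  by move=> h; have := rrS R m.+1; have := rr_gt0 R m.+2; move: h; lr.
have r3 x : enorm (x - x0) < 16 * rr m.+2 -> enorm (x - x0) < 16 * rr m.+1.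
  by move=> /r2 h; apply: le_lt_trans h _; rewrite ltr_pM2r ?rr_gt0// ltr_nat.
have finish l : lo m.+1 <= l -> l + osc m.+2 <= lo m.+1 + osc m.+1 -> Bd m.+2 l ->
  exists lo0 : nat -> R, [/\ lo0 0%N = C4^-1,
    forall i j, (i <= j)%N -> (j <= m.+2)%N -> lo0 i <= lo0 j /\ lo0 j + osc j <= lo0 i + osc i
    & forall j, (j <= m.+2)%N -> Bd j (lo0 j)].
  move=> l1 l2 bl; exists (fun j => if (j <= m.+1)%N then lo j else l); split => //.
  - move=> i j ij jm; case: (leqP j m.+1) => jm1.
      by rewrite (leq_trans ij jm1); exact: nest.
    have -> : j = m.+2 by apply/eqP; rewrite eqn_leq jm jm1.
    case: (leqP i m.+1) => im1; last first.
      by have -> : i = m.+2 by apply/eqP; rewrite eqn_leq im1 (leq_trans ij jm).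
    have [n1 n3] := nest i m.+1 im1 (leqnn _); split; first exact: le_trans n1 l1.
    exact: le_trans l2 n3.
  - move=> j jm; case: (leqP j m.+1) => jm1; first exact: bd.
    by have -> : j = m.+2 by apply/eqP; rewrite eqn_leq jm jm1.
pose P := (x0 + rr m.+1 *: ev, T - 3 / 8 * tauk taub m.+1).
have gr_u a1 a2 z : 0 <= a1 -> 0 <= a2 -> a1 + a2 <= 1 + 2 * C4 ->
    `|v1 z| <= C0 * (1 + enorm z.1) `^ (2 * s - g) -> `|v2 z| <= C0 * (1 + enorm z.1) `^ (2 * s - g) ->
    a1 * `|v1 z| + a2 * `|v2 z| <= (1 + 2 * C4) * (C0 * (1 + enorm z.1) `^ (2 * s - g)).
  move=> a10 a20 aC h1 h2; have G0 := le_trans (normr_ge0 _) h1.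
  apply: (@le_trans _ _ ((a1 + a2) * (C0 * (1 + enorm z.1) `^ (2 * s - g)))); last exact: ler_wpM2r.
  by rewrite mulrDl; apply: lerD; exact: ler_wpM2l.
(* The two functions add up to [osc m.+1 * v2] at [P], so one of them is at least half of it: the
   first case raises the lower end, the second lowers the upper end. *)
case: (leP (osc m.+1 / 2 * v2 P) (1 * v1 P - lo m.+1 * v2 P)) => hP.
- have su := ssub_comb pp kk ltr01 lo_gt0 sv1 snv2.
  have snu := ssub_combN pp kk ltr01 lo_gt0 snv1 sv2.
  have eu0 : 0 <= 1 * e + lo m.+1 * e by rewrite mul1r addr_ge0// mulr_ge0// ltW.
  have H := imp _ _ su snu eu0 _ _ _ _ hP.
  apply: (finish (lo m.+1 + th * osc m.+1)).
  + by rewrite lerDl mulr_ge0// ltW.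
  + by rewrite oscS; lr.
  move=> x t xr Tt tT.
  have [b1' b2'] := bd m.+1 (leqnn _) x t (r3 x xr) (win3 t Tt) tT.
  split; last by rewrite oscS (_ : _ + _ + _ = lo m.+1 + osc m.+1)//; ring.
  have : th * osc m.+1 * v2 (x, t) <= 1 * v1 (x, t) - lo m.+1 * v2 (x, t).
    apply: H (r2 x xr) (win2 t Tt) tT.
    * by rewrite mul1r [leRHS]mulrDl mul1r lerD2l; exact: ler_wpM2r.
    * move=> z; apply: le_trans (gr_u 1 (lo m.+1) z ler01 (ltW lo_gt0) _ (gr1 z) (gr2 z)); last by rewrite lerD2l.
      rewrite opprB mul1r.
      have := ler_norm (- v1 z); rewrite normrN.
      have : lo m.+1 * v2 z <= lo m.+1 * `|v2 z| by rewrite ler_pM2l// ler_norm.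
      by lr.
    * move=> j y u jm yr Tu uT.
      have yT : T - tauk taub j.+1 / 2 <= u.
        by have := tauk_antitone s2 taub0 (_ : j.+1 <= m.+1)%N; move=> /(_ jm); move: Tu; lr.
      have [q1' _] := bd j.+1 jm y u yr yT uT.
      have v0 : 0 <= v2 (y, u).
        by apply: nneg => //; [apply: ltW; exact: lt_le_trans (rr16 j.+1)|exact: winb Tu].
      have [n1 n3] := nest j.+1 m.+1 jm (leqnn _).
      have : (lo m.+1 - lo j.+1) * v2 (y, u) <= (osc j.+1 - osc m.+1) * v2 (y, u).
        by apply: ler_wpM2r => //; move: n3; lr.
      by rewrite mul1r; move: q1'; lr.
    * move=> y u yR Tu u0 uy.
      case: (eqVneq (v1 (y, u)) 0) => v10; last exact: int1.
      apply: int2 => //; apply/eqP => v20; move: uy.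
      by rewrite v10 v20 !mulr0 subr0 eqxx.
  by rewrite mul1r; lr.
have hP2 : osc m.+1 / 2 * v2 P <= (lo m.+1 + osc m.+1) * v2 P - 1 * v1 P.
  by move: hP; lr.
have su := ssub_comb pp kk hi_gt0 ltr01 sv2 snv1.
have snu := ssub_combN pp kk hi_gt0 ltr01 snv2 sv1.
have eu0 : 0 <= (lo m.+1 + osc m.+1) * e + 1 * e by rewrite mul1r addr_ge0// mulr_ge0// ltW.
have H := imp _ _ su snu eu0 _ _ _ _ hP2.
apply: (finish (lo m.+1)) => //.
  by rewrite lerD2l oscS ler_piMl// ltW.
move=> x t xr Tt tT.
have [b1' b2'] := bd m.+1 (leqnn _) x t (r3 x xr) (win3 t Tt) tT.
split; first exact: b1'.
have : th * osc m.+1 * v2 (x, t) <= (lo m.+1 + osc m.+1) * v2 (x, t) - 1 * v1 (x, t).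
  apply: H (r2 x xr) (win2 t Tt) tT.
  * by rewrite mul1r addrC [leRHS]mulrDl mul1r lerD2l; apply: ler_wpM2r => //; exact: hi_le.
  * move=> z; apply: le_trans (gr_u 1 (lo m.+1 + osc m.+1) z ler01 (ltW hi_gt0) _ (gr1 z) (gr2 z)); last by rewrite lerD2l; exact: hi_le.
    rewrite opprB mul1r.
    have := ler_norm (v1 z).
    have : - ((lo m.+1 + osc m.+1) * v2 z) <= (lo m.+1 + osc m.+1) * `|v2 z|.
      by rewrite -mulrN ler_pM2l// -normrN ler_norm.
    by lr.
  * move=> j y u jm yr Tu uT.
    have yT : T - tauk taub j.+1 / 2 <= u.
      by have := tauk_antitone s2 taub0 (_ : j.+1 <= m.+1)%N; move=> /(_ jm); move: Tu; lr.
    have [_ q2'] := bd j.+1 jm y u yr yT uT.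
    have v0 : 0 <= v2 (y, u).
      by apply: nneg => //; [apply: ltW; exact: lt_le_trans (rr16 j.+1)|exact: winb Tu].
    have [n1 n3] := nest j.+1 m.+1 jm (leqnn _).
    have : (lo j.+1 - lo m.+1) * v2 (y, u) <= 0 by apply: mulr_le0_ge0 => //; rewrite subr_le0.
    by rewrite mul1r; move: q2'; lr.
  * move=> y u yR Tu u0 uy.
    case: (eqVneq (v1 (y, u)) 0) => v10; last exact: int1.
    apply: int2 => //; apply/eqP => v20; move: uy.
    by rewrite v10 v20 !mulr0 subr0 eqxx.
by rewrite oscS; lr.
Qed.

End Oscillation.

(** * Positivity and oscillation at an interior point *)

Section LocalRatio.
Context (R : realType) (n : nat) (s lam Lam : R).
Implicit Types (x y p ev en : 'rV[R]_n) (z : 'rV[R]_n * R) (w v u : 'rV[R]_n * R -> R) (k : 'rV[R]_n -> R) (Om : set ('rV[R]_n * R)).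
Local Notation rb := (@rb R).
Local Notation rr := (@rr R).
Local Notation tauk := (@tauk R s).

Lemma UC_time w x : UC w -> continuous (fun t => w (x, t)).
Proof.
move=> uw t; apply/cvgrPdist_lt => e e0; have [d d0 h] := uw e e0.
near=> t'; apply: h => /=; first by rewrite subrr enorm0.
by near: t'; apply: cvgr_dist_lt.
Unshelve. all: by end_near. Qed.

(** Estimates around a base point hold strictly before its time; this carries them to that time. *)
Lemma left_limit_ge0 (f : R -> R) (ta T : R) : continuous f -> ta < T -> (forall t, ta <= t -> t < T -> 0 <= f t) -> 0 <= f T.
Proof.
move=> cf taT h; rewrite leNgt; apply/negP => fT.
have fT' : 0 < - f T by rewrite oppr_gt0.
have [d d0 hd] := continuous_epsR (cf T) fT'.
pose t := Num.max ta (T - d / 2).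
have tT : t < T by rewrite gt_max taT/=; move: d0; lr.
have tta : ta <= t by rewrite le_max lexx.
have td : T - d / 2 <= t by rewrite le_max lexx orbT.
have tt : `|t - T| < d by rewrite ltr_norml; apply/andP; split; move: tT td d0; lr.
have := hd t tt; rewrite ltr_norml => /andP[h1 h2].
by have := h t tta tT; move: h1 h2; lr.
Qed.

Lemma tail_small k v (M e : R) x0 x (r t Cm : R) : par n s lam Lam -> kern s lam Lam k -> UC v -> bdd v M -> 0 <= e -> 0 < r ->
  intg (fun y => ind (rb <= enorm y) * k y) /\ INT (fun y => ind (rb <= enorm y) * k y) <= Cm / rb `^ (2 * s) ->
  (forall z, - e <= v z) -> (forall x, enorm (x - x0) <= 4 * rb -> 0 <= v (x, t)) -> enorm (x - x0) <= 3 * rb ->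
  INT (fun y => ind (8 * r <= enorm y) * Num.max 0 (- v (x + y, t)) * k y) <= e * (Cm / rb `^ (2 * s)).
Proof.
move=> pp kk uv bv e0 r0 [iF IF] vlo nneg xr.
have r80 : 0 < 8 * r by rewrite mulr_gt0.
apply: le_trans (_ : INT (fun h => e * (ind (rb <= enorm h) * k h)) <= _); last first.
  by rewrite (INTZ e iF); exact: ler_wpM2l.
apply: (INT_le (intg_tail x t pp kk uv bv r80) (intgZ e iF)) => h.
rewrite mulrA; apply: ler_wpM2r; first exact: (kern_ge0 pp h kk).
case: (ltP (enorm h) rb) => hb.
  rewrite max_l; first by rewrite !mulr0.
  rewrite oppr_le0; apply: nneg.
  have := ler_enormD (x - x0) h; rewrite addrAC.
  by move: xr hb; rewrite (addrAC x); lr.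
rewrite mulr1 -[leRHS]mul1r; apply: ler_pM; [exact: ind_ge0|exact: max0_ge0|exact: ind_le1|].
by apply: max0_le => //; rewrite lerNl; exact: vlo.
Qed.

(** The earlier estimates give only a sign near [x0] before time [T]. Strict positivity at [(x0, T)]
    comes from one more bump centred at [x0], whose width depends on the distance to the complement;
    this is why [lmin] is assumed for every width with the same [c], so that the threshold on [e]
    does not depend on the point. *)
Lemma local_ratio (g C0 b c kap taub t1 : R) : par n s lam Lam -> 2^-1 <= s -> 0 < g -> g < 2 * s -> 0 < C0 ->
  0 < b -> b <= 1 -> 0 < c -> (forall b', 0 < b' -> b' <= 1 -> exists2 kap', 0 < kap' & @lmin R n s lam Lam c b' kap') ->
  @lmin R n s lam Lam c b kap -> 0 < taub -> 4 * taub <= kap -> 8 * taub <= t1 ->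
  exists (C4 th : R) (j0 : nat) (eJ R1 : R), [/\ 1 <= C4, 0 < th, th <= 2^-1, 0 < eJ & 2 <= R1 /\
  forall k Om (e Rb : R) v1 v2 en, kern s lam Lam k -> sol s k g C0 Rb (7 / 4 * t1) e Om v1 -> sol s k g C0 Rb (7 / 4 * t1) e Om v2 ->
  R1 <= Rb -> 0 <= e -> e <= eJ -> enorm en <= 1 -> v1 (en, 0) = 1 -> v2 (en, 0) = 1 ->
  forall x0 (T : R) ev, enorm x0 < 1 -> - t1 < T -> T < 0 -> enorm ev = 1 -> access s Om x0 T ev b taub rb ->
  (exists2 rho, 0 < rho & cylinder rho (x0, T) `<=` Om) ->
  [/\ 0 < v1 (x0, T), 0 < v2 (x0, T), v1 (x0, T) <= C4 * v2 (x0, T), v2 (x0, T) <= C4 * v1 (x0, T) &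
    forall m : nat, exists lo, forall x t, enorm (x - x0) < 16 * rr m -> T - tauk taub m / 2 <= t -> t <= T ->
      lo * v2 (x, t) <= v1 (x, t) /\ v1 (x, t) <= (lo + C4 * (1 - th) ^+ (m - j0)) * v2 (x, t)]].
Proof.
move=> pp s2 g0 gs C00 b0 b1 c_gt0 HLall HL taub0 tkap tt1; have [hn s0 s1 lam0 Lam0] := pp.
have [Cm [cf [Cm0 cf0 kbd]]] := kern_bounds pp.
have rb0 := rb_gt0 R; have rs0 := rs_gt0 s rb0.
have [c0 [eJ1 [R1 [c00 eJ10 R12 hbase]]]] := base_lower pp s2 g0 gs C00 b0 b1 c_gt0 HL taub0 tkap tt1.
have [C4 [eJ2 [C41 eJ20 hcmp]]] := base_comparable pp g0 gs C00 b0 b1 taub0 tt1 c00.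
have [Cp [cp [q [eJ3 [Cp0 cp0 [q0 q1] eJ30 hprof]]]]] := profile pp s2 g0 gs C00 b0 b1 c_gt0 HL taub0 tkap tt1 c00.
have [th [j0 [eJ4 [th0 th1 eJ40 hosc]]]] := oscillation pp s2 g0 gs C00 b0 b1 c_gt0 HL taub0 tkap tt1 Cp0 cp0 q0 q1 C41.
have [cB cB0 hlow] := Mt_lower pp b0 b1.
pose c1 := cB * (c0 / rb `^ (2 * s)).
have c10 : 0 < c1 by pgt.
pose Cr := Cm / rb `^ (2 * s).
have Cr0 : 0 < Cr by exact: divr_gt0.
pose eJ5 := c * c1 / (2 * (1 + Cr)).
have c1C : 0 < 1 + Cr by exact: addr_gt0.
have eJ50 : 0 < eJ5 by pgt.
exists C4, th, j0, (Num.min eJ1 (Num.min eJ2 (Num.min eJ3 (Num.min eJ4 eJ5)))), R1; split => //.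
  by rewrite !lt_min eJ10 eJ20 eJ30 eJ40.
split => // k Om e Rb v1 v2 en kk sl1 sl2 R1b e0.
rewrite !le_min => /and5P[e1 e2 e3 e4 e5] hen h1 h2 x0 T ev hx0 T1 T0 hev hacc [rho rho0 hrho].
have Rb2 := le_trans R12 R1b.
have [low1 nn1] := hbase k Om e T Rb v1 x0 ev en kk sl1 R1b e0 e1 hx0 T1 T0 hev hacc hen h1.
have [low2 nn2] := hbase k Om e T Rb v2 x0 ev en kk sl2 R1b e0 e1 hx0 T1 T0 hev hacc hen h2.
have cmp12 := hcmp k Om e T Rb v1 v2 x0 ev kk sl1 sl2 Rb2 e0 e2 hx0 T1 T0 hev low2.
have cmp21 := hcmp k Om e T Rb v2 v1 x0 ev kk sl2 sl1 Rb2 e0 e2 hx0 T1 T0 hev low1.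
have [Th prof] := hprof k Om e T Rb v2 x0 ev kk sl2 Rb2 e0 e3 hx0 T1 T0 hev hacc low2 nn2.
have osc := hosc k Om e T Rb v1 v2 x0 ev Th kk sl1 sl2 Rb2 e0 e4 hx0 T1 T0 hev hacc prof nn2 cmp12 cmp21.
pose tb := taub * rb `^ (2 * s).
have tb0 : 0 < tb by exact: mulr_gt0.
have posv v : sol s k g C0 Rb (7 / 4 * t1) e Om v ->
  (forall x t, enorm (x - (x0 + rb *: ev)) < b / 2 * rb -> T - 2 * tb <= t -> t < T -> c0 <= v (x, t)) ->
  (forall x t, enorm (x - x0) <= 4 * rb -> T - tb <= t -> t < T -> 0 <= v (x, t)) -> 0 < v (x0, T).
  move=> [[uv [M bv] vv] [_ _ vnv] vlo vgr vint] low nn.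
  have r0 := rr_gt0 R 0; have rle := rr_le R 0.
  (* The bump fits into the cylinder of radius [rho] contained in the domain. *)
  pose b' := Num.min 1 (rho / rr 0).
  have b'0 : 0 < b' by rewrite lt_min ltr01 divr_gt0.
  have b'1 : b' <= 1 by rewrite ge_min lexx.
  have b'r : b' * rr 0 <= rho by rewrite -ler_pdivlMr// ge_min lexx orbT.
  have [kap' kap'0 HL'] := HLall b' b'0 b'1.
  pose dt := Num.min rho (Num.min tb (kap' * rr 0 `^ (2 * s))).
  have dt0 : 0 < dt by rewrite !lt_min rho0 tb0 mulr_gt0// rs_gt0.
  have [dt1 dt2 dt3] : [/\ dt <= rho, dt <= tb & dt <= kap' * rr 0 `^ (2 * s)].
    by rewrite /dt; split; rewrite !ge_min ?lexx ?orbT.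
  have [mu hmu] := primitive (continuous_Mt (x := x0) pp uv bv r0).
  have e10 : 0 <= e * Cr by rewrite mulr_ge0// ltW.
  have npev : enorm (x0 - x0) <= 2 * rr 0 by rewrite subrr enorm0 mulr_ge0// ltW.
  have win : T - (T - dt) <= kap' * rr 0 `^ (2 * s) by rewrite subKr.
  have := HL' k Om v M e (e * Cr) x0 x0 (rr 0) (T - dt) T mu kk uv bv e0 e10 r0 vnv hmu npev win.
  move=> H; have {}H := H _ _ _ x0.
  have L t : T - dt <= t -> t < T -> c * (mu t - mu (T - dt)) - (e + e * Cr) * (t - (T - dt)) <= v (x0, t).
    move=> h3 h4; apply: H h3 h4.
    - move=> y u yr ty tT; apply: nn => //; last by move: ty dt2; lr.
      by apply: ltW; move: yr rle rb0; lr.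
    - move=> y u yr ty tT; rewrite /Cr; refine (@tail_small k v M e x0 y (rr 0) u Cm pp kk uv bv e0 r0 _ vlo _ _).
      + by have [_ _ i1 i2 _] := kbd k kk _ rb0.
      + by move=> y' y'r; apply: nn => //; move: ty dt2; lr.
      + have : b' * rr 0 <= 1 * rr 0 by rewrite ler_pM2r.
        by move: yr rle rb0; lr.
    - move=> y u yr ty tT; exists (Num.min (rho - enorm (y - x0)) (rho - `|u - T|)).
        rewrite lt_min !subr_gt0; apply/andP; split; first exact: lt_le_trans b'r.
        by rewrite ltr_norml; apply/andP; split; move: ty tT dt1 rho0; lr.
      move=> [y' t'] [/=]; rewrite !lt_min => /andP[a1 a2] /andP[a3 a4]; apply: hrho; split => /=.
        have := ler_enormD (y' - y) (y - x0); rewrite (_ : y' - y + (y - x0) = y' - x0); last by vec.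
        by move: a1; lr.
      have := ler_normD (t' - u) (u - T); rewrite (_ : t' - u + (u - T) = t' - T); last by ring.
      by move: a4; lr.
    by rewrite subrr enorm0 divr_ge0// mulr_ge0 ?(ltW b'0) ?(ltW r0).
  have Phi t : T - dt <= t -> t < T -> c1 <= Mt s v (rr 0) x0 t.
    move=> tt tT; apply: (@le_trans _ _ (Mt s v rb x0 t)); last first.
      by apply: (Mt_anti _ _ pp uv bv r0); move: rle rb0; lr.
    apply: le_trans (hlow v M x0 ev t rb c0 uv bv rb0 hev (ltW c00) _); first by rewrite lerDr; exact: Mt_ge0.
    by move=> y yr; apply: low => //; move: tt dt2 tb0; lr.
  pose K := c * c1 / 2.
  have K0 : 0 < K by pgt.
  have eK : e + e * Cr <= K.
    have c1C2 : 0 < 2 * (1 + Cr) by pgt.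
    by move: e5; rewrite /eJ5 (ler_pdivlMr _ _ c1C2) /K; lr.
  (* The mass is at least [c1] throughout the window, so the lower bound grows linearly in time even
     after the errors are subtracted; half a window later it is a positive constant. *)
  have L2 t : T - dt <= t -> t < T -> K * (t - (T - dt)) <= v (x0, t).
    move=> tt tT; apply: le_trans (L t tt tT).
    have [d /andP[d1 d2] ->] := mvt_itv hmu tt.
    have h3 := Phi d d1 (le_lt_trans d2 tT).
    have h4 : 0 <= t - (T - dt) by rewrite subr_ge0.
    have h5 : c * (c1 * (t - (T - dt))) <= c * (Mt s v (rr 0) x0 d * (t - (T - dt))).
      by rewrite (ler_pM2l c_gt0); exact: ler_wpM2r.
    have h6 : (e + e * Cr) * (t - (T - dt)) <= K * (t - (T - dt)) by exact: ler_wpM2r.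
    by move: h5 h6; rewrite /K; lr.
  have : 0 <= v (x0, T) - K * (dt / 2).
    apply: (left_limit_ge0 (f := fun t => v (x0, t) - K * (dt / 2)) (ta := T - dt / 2)).
    - by move=> t; apply: cvgB; [exact: UC_time uv t|exact: cvg_cst].
    - by move: dt0; lr.
    move=> t tt tT; rewrite subr_ge0.
    have tt' : T - dt <= t by move: tt dt0; lr.
    apply: le_trans (L2 t tt' tT); rewrite ler_pM2l//; move: tt; lr.
  by have : 0 < K * (dt / 2); [pgt|lr].
have [[uv1 _ _] _ _ _ _] := sl1; have [[uv2 _ _] _ _ _ _] := sl2.
have lim (a1 a2 : R) x (ta : R) : ta < T -> (forall t, ta <= t -> t < T -> a1 * v1 (x, t) <= a2 * v2 (x, t)) -> a1 * v1 (x, T) <= a2 * v2 (x, T).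
  move=> taT h; rewrite -subr_ge0.
  apply: (left_limit_ge0 (f := fun t => a2 * v2 (x, t) - a1 * v1 (x, t)) _ taT).
    by move=> t; apply: cvgB; apply: cvgM; try exact: cvg_cst; [exact: UC_time uv2 t|exact: UC_time uv1 t].
  by move=> t tt tT; rewrite subr_ge0; exact: h.
have x00 : enorm (x0 - x0) <= 4 * rb by rewrite subrr enorm0 mulr_ge0// ltW.
have tbT : T - tb < T by rewrite gtrBl.
split.
- exact: posv sl1 low1 nn1.
- exact: posv sl2 low2 nn2.
- rewrite -[leLHS]mul1r; apply: (lim 1 C4 x0 (T - tb) tbT) => t tt tT; rewrite mul1r; exact: cmp12.
- have := lim (- C4) (- 1) x0 (T - tb) tbT; rewrite !mulN1r !mulNr lerN2; apply => t tt tT.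
  by rewrite mulN1r mulNr lerN2; exact: cmp21.
move=> m; have [lo H] := osc m; exists lo => x t xr Tt; rewrite le_eqVlt => /orP[/eqP ->|tT]; last exact: H.
have tkm : T - tauk taub m / 2 < T by have := tauk_gt0 s m taub0; lr.
split.
  have := lim (- 1) (- lo) x _ tkm; rewrite !mulN1r !mulNr lerN2; apply => u uu uT.
  by rewrite mulN1r mulNr lerN2; exact: (proj1 (H x u xr uu uT)).
rewrite -[leLHS]mul1r; apply: (lim 1 _ x _ tkm) => u uu uT; rewrite mul1r.
exact: (proj2 (H x u xr uu uT)).
Qed.

End LocalRatio.

(** * Geometry of the cone and the Hölder seminorm *)

Section HolderRatio.
Context (R : realType) (n : nat).
Implicit Types (x y ev : 'rV[R]_n) (z w : 'rV[R]_n * R) (A : set ('rV[R]_n * R)).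

Lemma enorm_last_vec : enorm (last_vec R n.+1) = 1.
Proof.
rewrite /enorm /dotv big_ord_recr /= big1 ?add0r; first by rewrite !mxE /= eqxx mulr1 sqrtr1.
move=> i _; rewrite !mxE /= eqSS; case: eqVneq => [h|_]; last by rewrite mulr0.
by have := ltn_ord i; rewrite h ltnn.
Qed.

Lemma closed_cylinder A z : closed A -> ~ A z -> exists2 rho, 0 < rho & cylinder rho z `<=` ~` A.
Proof.
move=> /closed_openC oA nA; have /nbhs_ballP[d /= d0 hd] : nbhs z (~` A) by exact: open_nbhs_nbhs.
exists d => // -[x t] [/= h1 h2]; apply: hd; split; rewrite /= -ball_normE /= distrC //.
exact: le_lt_trans (le_norm_enorm _) h1.
Qed.

Lemma cylinder_in_domain A (Rb T0 t : R) x : closed A -> ~ A (x, t) -> enorm x < Rb -> - T0 < t -> t < 0 ->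
  exists2 rho, 0 < rho & cylinder rho (x, t) `<=` ~` A `&` (eball Rb `*` `]- T0, 0[%classic).
Proof.
move=> cA nA xR tT t0; have [d d0 hd] := closed_cylinder cA nA.
exists (Num.min d (Num.min (Rb - enorm x) (Num.min (t + T0) (- t)))).
  rewrite !lt_min d0 subr_gt0 xR oppr_gt0 t0 andbT /=; by move: tT; lr.
move=> [y u] [/=]; rewrite !lt_min => /and4P[y1 y2 y3 y4] /and4P[u1 u2 u3 u4]; split; first exact: hd.
move: u3 u4; rewrite !ltr_norml => /andP[u3 u5] /andP[u4 u6]; split => /=.
  have := ler_enormD (y - x) x; rewrite subrK /eball /=; by move: y2; lr.
by rewrite in_itv /=; apply/andP; split; move: u3 u6; lr.
Qed.

(** During the time [4 * taub * r^(2s) <= 4 * taub * r] the vertex moves along the axis by at most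
    [r / 4], since [16 * taub * omega <= 1]. The point [x0 + r ev] therefore stays at least
    [3 / 4 * r] ahead of the vertex, and the ball of radius [(1 - cos theta) / 4 * r] around it
    stays in the cone. *)
Lemma cone_access A (s theta omega taub t0 Rb T : R) x0 : 2^-1 <= s -> 0 < cos theta -> cos theta < 1 -> 0 < omega ->
  0 < taub -> 16 * taub * omega <= 1 -> 8 * taub <= t0 -> 2 <= Rb -> closed A -> enorm x0 < 1 -> - t0 < T -> T < 0 ->
  interior_cone_at0 theta omega [set w | (~` A) (w + (x0, T))] ->
  exists2 ev : 'rV[R]_n, enorm ev = 1 &
    access s (~` A `&` (eball Rb `*` `]- (7 / 4 * t0), 0[%classic)) x0 T ev ((1 - cos theta) / 4) taub (rb R).
Proof.
move=> s2 c0 c1 om0 taub0 tauom tau8 Rb2 cA x01 T1 T0 [ev ev1 hcone]; exists ev => // r r0 rr x t.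
have rb64 : r <= 64^-1 := rr.
have cc : 0 < 1 - cos theta by rewrite subr_gt0.
have t00 : 0 < t0 by move: taub0 tau8; lr.
have rs : r `^ (2 * s) <= r.
  rewrite -[leRHS]powRr1 ?(ltW r0)//; apply: ger_powR; last by move: s2; lr.
  by apply/andP; split; move: r0 rb64; lr.
have trs : 4 * (taub * r `^ (2 * s)) <= 4 * taub * r by rewrite -mulrA ler_pM2l// ler_pM2l.
set y := x - (x0 + r *: ev) => yb tT tT0.
have sg0 : 0 < T - t by rewrite subr_gt0.
have sg1 : T - t < 4 * taub * r by move: tT trs; lr.
have osg : omega * (T - t) <= r / 4.
  apply: le_trans (_ : omega * (4 * taub * r) <= _); first by rewrite ler_pM2l// ltW.
  have := ler_wpM2r (ltW r0) tauom; lra.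
have osg0 : 0 < omega * (T - t) by exact: mulr_gt0.
have taur : taub * r <= taub * 64^-1 by rewrite ler_pM2l.
(* Position relative to the vertex, which at time [t < T] has advanced by [omega * (T - t)] along
   [ev]. *)
pose xi : 'rV[R]_n := (r - omega * (T - t)) *: ev + y.
have xx0 : x - x0 = xi - (omega * (t - T)) *: ev by rewrite /xi /y; vec.
have dote : dotv ev ev = 1 by rewrite -sqr_enorm ev1 expr1n.
have xn : enorm (x - x0) <= r + enorm y.
  have -> : x - x0 = r *: ev + y by rewrite /y; vec.
  by apply: le_trans (ler_enormD _ _) _; rewrite enormZ ev1 mulr1 ger0_norm// ltW.
have y0 := enorm_ge0 y.
have yr : enorm y < r / 4.
  apply: lt_le_trans yb _; have := mulr_gt0 c0 r0; lra.
have notA : ~ A (x, t).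
  have h := hcone (t - T); rewrite subr_lt0 in h; have {}h := h tT0 (x - x0, t - T).
  have pt : (x - x0, t - T) + (x0, T) = (x, t) :> 'rV[R]_n * R by congr pair; rewrite /= subrK.
  move: h; rewrite /= pt => h Axt; apply: h => //.
  split => //; split; last by rewrite /eball /=; move: xn yr rb64 r0; lr.
  exists xi => //=.
  have e1 : dotv xi ev = (r - omega * (T - t)) + dotv y ev by rewrite dotvDl dotvZl dote mulr1.
  have e2 : - enorm y <= dotv y ev.
    by have := CauchySchwarz y ev; rewrite ev1 mulr1 ler_norml => /andP[].
  have rho0 : 0 <= r - omega * (T - t) by move: osg r0; lr.
  have e3 : enorm xi <= (r - omega * (T - t)) + enorm y.
    by apply: le_trans (ler_enormD _ _) _; rewrite enormZ ev1 mulr1 ger0_norm.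
  rewrite e1; apply: le_lt_trans (ler_wpM2l (ltW c0) e3) _.
  have h1 : (1 - cos theta) * (3 / 4 * r) <= (1 - cos theta) * (r - omega * (T - t)).
    by apply: ler_wpM2l; [rewrite subr_ge0 ltW|move: osg; lr].
  have h2 : cos theta * enorm y <= 1 * enorm y by apply: ler_wpM2r => //; exact: ltW.
  by move: h1 h2 e2 yb; have := mulr_gt0 r0 cc; lra.
apply: cylinder_in_domain => //; first by have := ler_enormD (x - x0) x0; rewrite subrK; move: xn yr rb64 x01 Rb2 r0; lr.
  by move: sg1 taur T1 tau8 taub0; lr.
exact: lt_trans T0.
Qed.

Lemma st_dist_sym z w : st_dist z w = st_dist w z.
Proof. by rewrite /st_dist enormB -(sqrrN (z.2 - w.2)) opprB. Qed.

Lemma st_dist_space z w : enorm (z.1 - w.1) <= st_dist z w.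
Proof.
rewrite /st_dist -[leLHS]ger0_norm ?enorm_ge0// -sqrtr_sqr ler_sqrt ?lerDl ?sqr_ge0//.
by rewrite addr_ge0// sqr_ge0.
Qed.

Lemma st_dist_time z w : `|z.2 - w.2| <= st_dist z w.
Proof. by rewrite /st_dist -sqrtr_sqr ler_sqrt ?lerDr ?addr_ge0 ?sqr_ge0. Qed.

Lemma st_dist_gt0 z w : z != w -> 0 < st_dist z w.
Proof.
move=> zw; rewrite ltNge; apply: contra_neqN zw; case: z w => [x t] [y u] d0; congr pair.
  by apply/eqP; rewrite -subr_eq0 -enorm_eq0 eq_le enorm_ge0 andbT (le_trans (st_dist_space (x, t) (y, u)) d0).
by apply/eqP; rewrite -subr_eq0 -normr_le0 (le_trans (st_dist_time (x, t) (y, u)) d0).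
Qed.

Lemma geometric_scale (c d : R) : 0 < c -> 0 < d -> exists N : nat, c * 64^-1 ^+ N <= d.
Proof.
move=> c0 d0; exists (Num.truncn (c / d)).+1; set N := _.+1.
rewrite exprVn ler_pdivrMr ?exprn_gt0// mulrC -ler_pdivrMr//.
apply: le_trans (ltW (truncnS_gt (c / d))) _; rewrite -natrX ler_nat; apply: ltnW; exact: ltn_expl.
Qed.

(** The exponent is the logarithm of [1 - th] in base [1/64]; it is below 1 because [1 - th] is at
    least [1/2]. *)
Lemma holder_exponent (th : R) : 0 < th -> th <= 2^-1 ->
  exists al : R, [/\ 0 < al, al < 1 & 64^-1 `^ al = 1 - th].
Proof.
move=> th0 th1; have h0 : 0 < 1 - th by move: th1; lr.
have l64 : ln 64^-1 < 0 :> R by rewrite ln_lt0// invr_gt0 ltr0n invf_lt1 ?ltr1n.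
have lth : ln (1 - th) < 0 by rewrite ln_lt0// h0/= gtrBl.
exists (ln (1 - th) / ln 64^-1); split.
- by rewrite -mulrNN -invrN divr_gt0// oppr_gt0.
- by rewrite ltr_ndivrMr// mul1r ltr_ln ?posrE ?invr_gt0//; move: th1; lr.
by rewrite /powR gt_eqF ?invr_gt0// -mulrA mulVf ?mulr1 ?lnK ?posrE// lt_eqF.
Qed.

(** The distance of two points is placed between two consecutive scales [c * 64^-1 ^+ m]; decay at
    the coarser one is compared with the power of the distance, and the shift by [j0.+1] goes into
    the constant. *)
Lemma holder_of_decay (D : set ('rV[R]_n * R)) (f : 'rV[R]_n * R -> R) (C c th al : R) (j0 : nat) :
  0 < C -> 0 < c -> 0 < th -> th <= 2^-1 -> 0 < al -> 64^-1 `^ al = 1 - th ->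
  (forall z, D z -> 0 <= f z <= C) ->
  (forall z w (m : nat), D z -> D w -> w.2 <= z.2 -> enorm (w.1 - z.1) < c * 64^-1 ^+ m -> z.2 - w.2 <= c * 64^-1 ^+ m ->
     `|f z - f w| <= C * (1 - th) ^+ (m - j0)) ->
  (holder_seminorm al D f <= (C / (1 - th) ^+ j0.+1 / c `^ al)%:E)%E.
Proof.
move=> C0 c0 th0 th1 al0 hal fb hf; have h0 : 0 < 1 - th by move: th1; lr.
have h1 : 1 - th <= 1 by move: th0; lr.
have ca0 : 0 < c `^ al by exact: powR_gt0.
have pj : 0 < (1 - th) ^+ j0.+1 by exact: exprn_gt0.
rewrite /holder_seminorm ge_max lee_fin !divr_ge0 ?(ltW C0) ?(ltW pj) ?(ltW ca0)//=.
apply: ge_ereal_sup => _ [z [w [Dz Dw zw ->]]]; rewrite lee_fin.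
have d0 := st_dist_gt0 zw.
wlog wz : z w zw Dz Dw d0 / w.2 <= z.2.
  move=> H; case: (leP w.2 z.2) => [|h]; first exact: H.
  by rewrite distrC st_dist_sym; apply: H => //; [rewrite eq_sym|rewrite st_dist_sym|exact: ltW].
rewrite ler_pdivrMr ?powR_gt0//.
(* The first scale not exceeding the distance: if it is 0 the bound by [C] suffices, otherwise the
   points lie within the preceding scale. *)
have [N hN hmin] := ex_minnP (geometric_scale c0 d0).
have dN : c `^ al * (1 - th) ^+ N <= st_dist z w `^ al.
  have -> : c `^ al * (1 - th) ^+ N = (c * 64^-1 ^+ N) `^ al.
    have i0 : 0 <= 64^-1 :> R by rewrite invr_ge0.
    rewrite (powRM _ (ltW c0) (exprn_ge0 N i0)) -hal -(powR_mulrn N (powR_ge0 _ _)) -(powR_mulrn N i0).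
    by rewrite -!powRrM (mulrC al).
  by rewrite ge0_ler_powR ?nnegrE ?mulr_ge0 ?exprn_ge0 ?invr_ge0 ?(ltW c0) ?(ltW al0) ?(ltW d0).
apply: le_trans (_ : C / (1 - th) ^+ j0.+1 / c `^ al * (c `^ al * (1 - th) ^+ N) <= _); last first.
  by apply: ler_wpM2l dN; rewrite !divr_ge0 ?(ltW C0) ?(ltW pj) ?(ltW ca0).
have -> : C / (1 - th) ^+ j0.+1 / c `^ al * (c `^ al * (1 - th) ^+ N) = C * ((1 - th) ^+ N / (1 - th) ^+ j0.+1).
  by field; rewrite !gt_eqF.
case: N hN hmin dN => [|m] hN hmin dN.
  apply: (@le_trans _ _ (C * 1)); last by rewrite ler_pM2l// expr0 ler_pdivlMr// mul1r exprn_ile1// ltW.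
  have /andP[a1 a2] := fb z Dz; have /andP[b1 b2] := fb w Dw.
  by rewrite mulr1 ler_norml; apply/andP; split; move: a1 a2 b1 b2; lr.
have dm : st_dist z w < c * 64^-1 ^+ m.
  by rewrite ltNge; apply/negP => /hmin; rewrite ltnn.
apply: le_trans (hf z w m Dz Dw wz _ _) _.
- by rewrite enormB; exact: le_lt_trans (st_dist_space z w) dm.
- by apply: le_trans (ltW dm); apply: le_trans (st_dist_time z w); exact: ler_norm.
rewrite ler_pM2l// ler_pdivlMr// -exprD; apply: ler_wiXn2l => //; first exact: ltW.
by clear; lia.
Qed.

(** Lengths shrink by 8 and times by at most 64 per step, so the single ratio 64 serves for both in
    the Hölder estimate. *)
Lemma rr_ge_geometric (m : nat) : rr R 0 * 64^-1 ^+ m <= rr R m.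
Proof.
elim: m => [|m IH]; first by rewrite mulr1.
have r0 := rr_gt0 R m.+1; rewrite exprSr mulrA; have := rrS R m => hr.
by move: IH r0; rewrite -hr; lr.
Qed.

Lemma tauk_ge_geometric (s taub : R) (m : nat) : s < 1 -> 0 < taub -> tauk s taub 0 * 64^-1 ^+ m <= tauk s taub m.
Proof.
move=> s1 t0; elim: m => [|m IH]; first by rewrite mulr1.
have := tauk_pred m s1 t0; move: IH; rewrite exprSr (mulrA (tauk s taub 0)).
by move: (tauk s taub 0 * _) (tauk s taub m) (tauk s taub m.+1) => a a1 a2; lra.
Qed.

End HolderRatio.

Theorem theorem3p2 (R : realType) (n : nat) (hn : (1 <= n)%N)
    (s lam Lam theta omega t0 gamma0 C0 : R)
    (hs : 2^-1 <= s /\ s < 1) (hlam : 0 < lam) (hLam : lam <= Lam)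
    (htheta : 0 < theta /\ theta < pi / 2) (homega : 0 < omega) (ht0 : 0 < t0)
    (hgamma0 : 0 < gamma0 /\ gamma0 < 2 * s) (hC0 : 0 < C0) :
  exists rad eps alpha C : R,
    [/\ 0 < rad, 0 < eps, 0 < alpha, alpha < 1 & 0 < C] /\
    forall (K : 'rV[R]_n -> R) (A : set ('rV[R]_n * R))
           (v : 'I_2 -> 'rV[R]_n * R -> R),
      let Q1 := eball 1 `*` `]- t0, 0[%classic in
      let QR := eball rad `*` `]- (2 * t0), 0[%classic in
      kernel_class s lam Lam K ->
      closed A ->
      A `<=` [set: 'rV[R]_n] `*` `[- (2 * t0), 0]%classic ->
      interior_cone theta omega (~` A) Q1 ->
      (forall i t, - (2 * t0) < t < 0 ->
         lebesgue_measurable (fun x => v i (x, t))) ->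
      (forall i, {within eball rad `*` `]- (2 * t0), 0]%classic, continuous (v i)}) ->
      (forall i, visc_abs_le K eps (~` A `&` QR) (v i)) ->
      (forall i z, (A `&` QR) z -> v i z = 0) ->
      (forall i z, QR z -> - eps <= v i z) ->
      (forall i x t, - (2 * t0) < t < 0 ->
         `|v i (x, t)| <= C0 * (1 + enorm x) `^ (2 * s - gamma0)) ->
      (forall i, v i (last_vec R n, 0) = 1) ->
      (forall i z, (~` A `&` Q1) z -> 0 < v i z) /\
      (holder_seminorm alpha (~` A `&` Q1) (fun z => (v ord0 z / v ord_max z)%R) +
       holder_seminorm alpha (~` A `&` Q1) (fun z => (v ord_max z / v ord0 z)%R)
         <= C%:E)%E.
Proof.
have [s2 s1] := hs; have [th0 thpi] := htheta; have [g0 g2] := hgamma0.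
have s0 : 0 < s by move: s2; lr.
have Lam0 : 0 < Lam by exact: lt_le_trans hLam.
have pp : par n s lam Lam by split.
have cos0 : 0 < cos theta.
  by apply: cos_gt0_pihalf; rewrite thpi andbT (lt_trans _ th0)// oppr_lt0 divr_gt0// pi_gt0.
have sin0 : 0 < sin theta.
  by apply: sin_gt0_pi; rewrite th0 /=; move: thpi th0; lr.
have cos1 : cos theta < 1.
  have := cos2Dsin2 theta; have : 0 < sin theta ^+ 2 by exact: exprn_gt0.
  move: cos0; move: (cos theta) (sin theta ^+ 2) => c q c0 q0 cq.
  by rewrite ltNge; apply/negP => c1; nra.
pose b := (1 - cos theta) / 4.
have b0 : 0 < b by rewrite divr_gt0// subr_gt0.
have b1 : b <= 1 by rewrite /b; move: cos0; lr.
have [c c0 hmin] := local_min pp.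
have [kap kap0 HL] := hmin b b0 b1.
(* The entries control the displacement of the cone, the duration allowed by the bump barrier, and
   the room left before time [- t0]. *)
pose taub := Num.min (16 * omega)^-1 (Num.min (kap / 4) (t0 / 8)).
have taub0 : 0 < taub by rewrite !lt_min invr_gt0 mulr_gt0// divr_gt0//= divr_gt0.
have [taub1 taub2 taub3] : [/\ taub <= (16 * omega)^-1, taub <= kap / 4 & taub <= t0 / 8].
  by rewrite /taub; split; rewrite !ge_min ?lexx ?orbT.
have tauom : 16 * taub * omega <= 1.
  by move: taub1; rewrite -[(16 * omega)^-1]mul1r ler_pdivlMr ?mulr_gt0// mulrCA mulrA.
move: (taub) taub0 tauom taub2 taub3 => {taub1}{}taub taub0 tauom taub2 taub3.
have tkap : 4 * taub <= kap by move: taub2; lr.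
have tt1 : 8 * taub <= t0 by move: taub3; lr.
have [C4 [th [j0 [eJ [R1 [C41 thp th1 eJ0 [R12 hloc]]]]]]] :=
  local_ratio pp s2 g0 g2 hC0 b0 b1 c0 hmin HL taub0 tkap tt1.
have [Cg Cg0 hred] := reduction pp hLam g0 g2 hC0.
have eJ2 : 0 < eJ / 2 by rewrite divr_gt0.
have [r0 r00 hr0] := powR_small Cg g0 eJ2.
have [al [al0 al1 hal]] := holder_exponent thp th1.
(* The first term makes the reduced domain of radius [rad / 4] large enough, the second makes the
   truncation error at most [eJ / 2]. *)
pose rad := 4 * R1 + r0^-1.
have R10 : 0 < R1 by move: R12; lr.
have rad4 : 4 * R1 <= rad by rewrite lerDl invr_ge0 ltW.
have rad0 : 0 < rad by move: rad4 R10; lr.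
have radr : Cg * rad `^ (- gamma0) <= eJ / 2.
  have -> : rad `^ (- gamma0) = rad^-1 `^ gamma0.
    by rewrite -[rad^-1]powR_inv1 ?(ltW rad0)// -powRrM mulN1r.
  apply: hr0; first by rewrite invr_gt0.
  by rewrite -[leRHS]invrK lef_pV2 ?posrE ?invr_gt0// lerDr mulr_ge0// ltW.
(* Every pair at parabolic scale [cr * 64^-1 ^+ m] falls into the space and time windows of scale
   [m]. *)
pose cr := Num.min (rr R 0) (tauk s taub 0 / 2).
have cr0 : 0 < cr by rewrite lt_min rr_gt0 divr_gt0// tauk_gt0.
pose C := C4 / (1 - th) ^+ j0.+1 / cr `^ al.
have C40 : 0 < C4 by exact: lt_le_trans C41.
have C00 : 0 < C by rewrite !divr_gt0 ?exprn_gt0 ?powR_gt0//; move: th1; lr.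
(* Half of the admissible error is left to the truncation at radius [rad]. *)
exists rad, (eJ / 2), al, (C + C); split; first by split => //; exact: addr_gt0.
move=> K A v Q1 QR HK cA _ hcone vm vc vv v0 vlow vgr v1.
(* Strictly between [t0] and [2 * t0]: room for the backward windows of points of [Q1], while time
   is frozen inside the interval of continuity. *)
have t74 : 0 < 7 / 4 * t0 by rewrite mulr_gt0.
have t742 : 7 / 4 * t0 < 2 * t0 by move: ht0; lr.
have rad4' : 4 <= rad by move: rad4 R12; lr.
have [k kk hk] := hred rad rad4' (2 * t0) (7 / 4 * t0) t74 t742 K HK.
pose et := eJ / 2 + Cg * rad `^ (- gamma0).
have et0 : 0 <= et by rewrite addr_ge0 ?mulr_ge0 ?powR_ge0// ltW.
have et1 : et <= eJ by rewrite /et; move: radr; lr.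
pose w i := vbar rad (7 / 4 * t0) (v i).
pose Om := ~` A `&` (eball (rad / 4) `*` `]- (7 / 4 * t0), 0[%classic).
have wv i z : enorm z.1 <= rad / 2 -> - (7 / 4 * t0) <= z.2 <= 0 -> w i z = v i z by exact: vbar_id.
have wsol i : sol s k gamma0 C0 (rad / 4) (7 / 4 * t0) et Om (w i).
  have [uw bw lw gw [vw vnw]] := hk A (eJ / 2) (v i) (ltW eJ2) (vm i) (vc i) (vv i) (vlow i) (vgr i).
  split => //.
  - split => //; first by move=> e e0; have [d d0 hd] := uw e e0; exists d => // z y zy1 zy2; rewrite -opprD normrN; exact: hd.
    by have [M hM] := bw; exists M => z; rewrite normrN; exact: hM.
  - move=> z; apply: le_trans (lw z); by rewrite lerN2 lerDl mulr_ge0 ?powR_ge0// ltW.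
  move=> x t xr tT t00 wn; apply: cylinder_in_domain => // Axt; move: wn.
  rewrite wv /= ?(v0 i) ?eqxx//.
  - split => //; split; rewrite /= /eball ?in_itv/=; first by move: xr rad0; lr.
    by rewrite t00 andbT; move: tT t742; lr.
  - by move: xr rad0; lr.
  - by rewrite !ltW.
have R1rad : R1 <= rad / 4 by move: rad4; lr.
have en1 : enorm (last_vec R n) <= 1 by case: (n) hn => // n' _; rewrite enorm_last_vec.
have w1 i : w i (last_vec R n, 0) = 1.
  by rewrite wv//= ?lexx ?andbT ?oppr_le0 ?(ltW t74)//; move: en1 R12 rad4; lr.
have Q1P z : Q1 z -> [/\ enorm z.1 < 1, - t0 < z.2 & z.2 < 0].
  by move=> [/= h]; rewrite in_itv /= => /andP[].
have wvQ i z : Q1 z -> w i z = v i z.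
  move=> /Q1P[h1 h2 h3]; apply: wv; first by move: h1 R12 rad4; lr.
  by apply/andP; split; move: h2 h3 ht0; lr.
have loc i j z : (~` A `&` Q1) z -> [/\ 0 < v i z, 0 < v j z, v i z <= C4 * v j z, v j z <= C4 * v i z &
    forall m : nat, exists lo, forall x t, enorm (x - z.1) < 16 * rr R m -> z.2 - tauk s taub m / 2 <= t -> t <= z.2 ->
      lo * w j (x, t) <= w i (x, t) /\ w i (x, t) <= (lo + C4 * (1 - th) ^+ (m - j0)) * w j (x, t)].
  move=> Dz; have [nA Qz] := Dz; have [h1 h2 h3] := Q1P z Qz; rewrite -!wvQ//.
  case: z Dz nA Qz h1 h2 h3 => x0 T Dz nA Qz h1 h2 h3.
  have [ev ev1 acc] := cone_access s2 cos0 cos1 homega taub0 tauom tt1 (le_trans R12 R1rad) cA h1 h2 h3 (hcone _ Dz).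
  apply: (hloc k Om et (rad / 4) (w i) (w j) (last_vec R n) kk (wsol i) (wsol j) R1rad et0 et1 en1 (w1 i) (w1 j) x0 T ev h1 h2 h3 ev1 acc).
  apply: cylinder_in_domain => //=; first by move: h1 R12 R1rad; lr.
  by move: h2 ht0 => /=; lr.
have vpos i z : (~` A `&` Q1) z -> 0 < v i z by move=> /(loc i i)[].
split => //.
(* All local estimates are symmetric in the two solutions, so one bound serves both quotients. *)
have main i j : (holder_seminorm al (~` A `&` Q1) (fun z => (v i z / v j z)%R) <= C%:E)%E.
  apply: holder_of_decay => //.
    move=> z Dz; have [vi vj h1 h2 _] := loc i j z Dz.
    by rewrite divr_ge0 ?(ltW vi) ?(ltW vj)// ler_pdivrMr.
  move=> z y m Dz Dy yz yx yt; have [_ vjz _ _ osc] := loc i j z Dz; have [lo hlo] := osc m.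
  have vjy := vpos j y Dy.
  have crm : cr * 64^-1 ^+ m <= rr R m.
    by apply: le_trans (rr_ge_geometric R m); rewrite ler_wpM2r ?exprn_ge0 ?invr_ge0// ge_min lexx.
  have crt : cr * 64^-1 ^+ m <= tauk s taub m / 2.
    have h : cr <= tauk s taub 0 / 2 by rewrite ge_min lexx orbT.
    have i0 : 0 <= 64^-1 :> R by rewrite invr_ge0.
    have := ler_wpM2r (exprn_ge0 m i0) h.
    have := tauk_ge_geometric m s1 taub0.
    by move: (tauk s taub 0) (tauk s taub m) => a1 a2; lr.
  have rm := rr_gt0 R m; have tm := tauk_gt0 s m taub0.
  have itv u : (~` A `&` Q1) u -> enorm (u.1 - z.1) < 16 * rr R m -> z.2 - tauk s taub m / 2 <= u.2 -> u.2 <= z.2 ->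
      lo <= v i u / v j u <= lo + C4 * (1 - th) ^+ (m - j0).
    move=> Du h1 h2 h3; have [hl hu] := hlo u.1 u.2 h1 h2 h3; have vju := vpos j u Du.
    move: hl hu; rewrite -surjective_pairing (wvQ i u (proj2 Du)) (wvQ j u (proj2 Du)) => hl hu.
    by rewrite ler_pdivlMr// ler_pdivrMr// hl hu.
  have /andP[z1 z2] : lo <= v i z / v j z <= lo + C4 * (1 - th) ^+ (m - j0).
    apply: itv => //; first by rewrite subrr enorm0 mulr_gt0.
    by rewrite gerBl divr_ge0// ltW.
  have /andP[y1 y2] : lo <= v i y / v j y <= lo + C4 * (1 - th) ^+ (m - j0).
    apply: itv => //; first by move: yx crm rm; lr.
    by move: yt crt; lr.
  by rewrite ler_norml; apply/andP; split; move: z1 z2 y1 y2; lr.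
by rewrite EFinD; apply: leeD; exact: main.
Qed.
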